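(* Let $d\ge 1$ and assume the standing setting described in the context (stationarity, uniform ellipticity and boundedness, Lipschitz continuity, finite range dependence). There is a constant $c_1>1$, depending only on $d,\nu,\beta,K,R$, such that for every $\ell\in S^{d-1}$ the inequality $$\mathbb{E}[(b(0,\omega)\cdot \ell)_+] > c_1\,\mathbb{E}[(b(0,\omega)\cdot\ell)_-]$$ implies that condition $(T)|\ell$ holds.
   Context: Random environment: a probability space $(\Omega,\mathcal A,\mathbb P)$ with a group $\{t_x:x\in\mathbb R^d\}$ of transformations of $\Omega$, jointly measurable in $(x,\omega)$, with $t_x\mathbb P=\mathbb P$ for all $x$. On $\Omega$ there are random variables $a(\cdot)$ (values in symmetric $d\times d$ matrices) and $b(\cdot)$ (values in $\mathbb R^d$); set $a(x,\omega)=a(t_x\omega)$, $b(x,\omega)=b(t_x\omega)$. Assume there are constants $\nu\ge 1$, $\beta>0$, $K>0$, $R>0$ such that for all $\omega$, $x,y$: $\frac1\nu|y|^2\le y^t a(x,\omega)y\le \nu|y|^2$, $|b(x,\omega)|\le\beta$; $|a(x,\omega)-a(y,\omega)|+|b(x,\omega)-b(y,\omega)|\le K|x-y|$; and, with $\mathcal H_F=\sigma\{a(x,\cdot),b(x,\cdot):x\in F\}$, the $\sigma$-fields $\mathcal H_A,\mathcal H_B$ are $\mathbb P$-independent whenever $d(A,B)=\inf\{|x-y|:x\in A,y\in B\}>R$. Let $\mathcal L_\omega=\frac12\sum_{i,j}a_{ij}(x,\omega)\partial^2_{ij}+\sum_i b_i(x,\omega)\partial_i$ and let $P_{x,\omega}$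 be the unique solution of the martingale problem for $\mathcal L_\omega$ started at $x$, on $C(\mathbb R_+,\mathbb R^d)$ with canonical process $X$ (quenched law). The annealed law is $P_x=\mathbb P\times P_{x,\omega}$ (semi-direct product), i.e. $P_x[\cdot]=\mathbb E[P_{x,\omega}[\cdot]]$. For $\ell\in S^{d-1}$, $b,L>0$, let $U_{\ell,b,L}=\{x:-bL<x\cdot\ell<L\}$ and $T_U=\inf\{t\ge0:X_t\notin U\}$. Condition $(T)|\ell$ holds if for all $\ell'\in S^{d-1}$ in a neighborhood of $\ell$ and all $b>0$, $\limsup_{L\to\infty}L^{-1}\log P_0[X_{T_{U_{\ell',b,L}}}\cdot\ell'<0]<0$. Here $z_+=\max(z,0)$, $z_-=\max(-z,0)$. *)

(* Defs.v *)
From HB Require Import structures.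
From mathcomp Require Import all_boot all_order all_algebra.
From mathcomp Require Import all_classical all_reals all_analysis measurable_realfun.
Set Implicit Arguments. Unset Strict Implicit. Unset Printing Implicit Defensive.
Import Order.TTheory GRing.Theory Num.Theory.
Import numFieldNormedType.Exports.
Local Open Scope classical_set_scope.
Local Open Scope ring_scope.

Section Defs.
Variable R : realType.
Variable d : nat.

Definition dotv (u v : 'rV[R]_d) : R := \sum_(i < d) u 0 i * v 0 i.
Definition enorm (u : 'rV[R]_d) : R := Num.sqrt (dotv u u).
Definition mxnorm (A : 'M[R]_d) : R := Num.sqrt (\sum_(i < d) \sum_(j < d) A i j ^+ 2).
Definition quadf (y : 'rV[R]_d) (A : 'M[R]_d) : R :=
  \sum_(i < d) \sum_(j < d) y 0 i * A i j * y 0 j.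

Definition evec (i : 'I_d) : 'rV[R]_d := delta_mx 0 i.

Definition borel_rV : set (set 'rV[R]_d) := <<s [set U | open U] >>.

(* d(A,B) := inf {|x-y| : x in A, y in B} > r *)
Definition dist_gt (A B : set 'rV[R]_d) (r : R) : Prop :=
  exists r', r < r' /\ forall x y, A x -> B y -> r' <= enorm (x - y).

Section Env.
Context (dO : measure_display) (Omega : measurableType dO).
Variables (P : probability Omega R) (t : 'rV[R]_d -> Omega -> Omega)
  (a : Omega -> 'M[R]_d) (b : Omega -> 'rV[R]_d).

Definition Hsig (F : set 'rV[R]_d) : set (set Omega) :=
  <<s [set C | exists x, F x /\
        ((exists (i j : 'I_d) (B : set R), measurable B /\
            C = (fun w => a (t x w) i j) @^-1` B) \/
         (exists (i : 'I_d) (B : set R), measurable B /\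
            C = (fun w => b (t x w) 0 i) @^-1` B))] >>.

Definition indep_sigma (F1 F2 : set (set Omega)) : Prop :=
  forall A B, F1 A -> F2 B -> P (A `&` B) = (P A * P B)%E.

Definition env_assumptions (nu beta K Rr : R) : Prop :=
  (forall w, t 0 w = w) /\
  (forall x y w, t (x + y) w = t x (t y w)) /\
  (forall A : set Omega, measurable A ->
     <<s [set E | exists (B : set 'rV[R]_d) (C : set Omega),
                    borel_rV B /\ measurable C /\ E = B `*` C] >>
       [set p : 'rV[R]_d * Omega | A (t p.1 p.2)]) /\
  (forall x (A : set Omega), measurable A -> P (t x @^-1` A) = P A) /\
  (forall i j, measurable_fun setT (fun w => a w i j)) /\
  (forall i, measurable_fun setT (fun w => b w 0 i)) /\
  (forall w, (a w)^T = a w) /\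
  (forall x w y, nu^-1 * enorm y ^+ 2 <= quadf y (a (t x w)) <= nu * enorm y ^+ 2) /\
  (forall x w, enorm (b (t x w)) <= beta) /\
  (forall x y w, mxnorm (a (t x w) - a (t y w)) + enorm (b (t x w) - b (t y w))
                   <= K * enorm (x - y)) /\
  (forall A B : set 'rV[R]_d, dist_gt A B Rr -> indep_sigma (Hsig A) (Hsig B)).

End Env.

Definition Lgen (aa : 'rV[R]_d -> 'M[R]_d) (bb : 'rV[R]_d -> 'rV[R]_d)
  (f : 'rV[R]_d -> R) (y : 'rV[R]_d) : R :=
  2^-1 * (\sum_(i < d) \sum_(j < d) aa y i j * ('D_(evec i) ('D_(evec j) f)) y)
  + \sum_(i < d) bb y 0 i * ('D_(evec i) f) y.

Definition C2c (f : 'rV[R]_d -> R) : Prop :=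
  (forall y, differentiable f y) /\
  (forall j y, differentiable ('D_(evec j) f) y) /\
  (forall i j, continuous ('D_(evec i) ('D_(evec j) f))) /\
  (exists M : R, forall y, M < enorm y -> f y = 0).

Section Paths.
Context (dW : measure_display) (W : measurableType dW).
Variable X : W -> R -> 'rV[R]_d.

Definition Ffilt (s : R) : set (set W) :=
  <<s [set C | exists u (i : 'I_d) (B : set R), 0 <= u <= s /\ measurable B /\
                 C = (fun w => X w u 0 i) @^-1` B] >>.

Definition Mf (aa : 'rV[R]_d -> 'M[R]_d) (bb : 'rV[R]_d -> 'rV[R]_d)
  (f : 'rV[R]_d -> R) (s : R) (w : W) : R :=
  f (X w s) - f (X w 0) -
  Rintegral lebesgue_measure [set u | 0 <= u <= s] (fun u => Lgen aa bb f (X w u)).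

Definition solves_MP (aa : 'rV[R]_d -> 'M[R]_d) (bb : 'rV[R]_d -> 'rV[R]_d)
  (x : 'rV[R]_d) (Q : probability W R) : Prop :=
  Q [set w | X w 0 = x] = 1%E /\
  forall f, C2c f -> forall s u, 0 <= s <= u ->
    forall A, Ffilt s A ->
      (\int[Q]_(w in A) (Mf aa bb f u w - Mf aa bb f s w)%:E = 0)%E.

Definition slab (l : 'rV[R]_d) (bb L : R) : set 'rV[R]_d :=
  [set y | - (bb * L) < dotv y l < L].

(* the event { X_{T_U} . l < 0 } (T_U finite) *)
Definition exit_neg (l : 'rV[R]_d) (bb L : R) : set W :=
  [set w | (exists s, 0 <= s /\ ~ slab l bb L (X w s)) /\
           dotv (X w (inf [set s | 0 <= s /\ ~ slab l bb L (X w s)])) l < 0].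

Section Anneal.
Context (dO : measure_display) (Omega : measurableType dO).
Variables (P : probability Omega R) (Q : 'rV[R]_d -> Omega -> probability W R).

Definition Pann (A : set W) : \bar R := (\int[P]_(w in setT) Q 0 w A)%E.

Definition condT (l : 'rV[R]_d) : Prop :=
  exists delta : R, 0 < delta /\
  forall l', enorm l' = 1 -> enorm (l' - l) < delta ->
  forall bb : R, 0 < bb ->
    exists c : R, 0 < c /\
      \forall L \near +oo, (Pann (exit_neg l' bb L) <= (expR (- (c * L)))%:E)%E.

End Anneal.

Definition diffusion_assumptions (dO : measure_display) (Omega : measurableType dO)
  (t : 'rV[R]_d -> Omega -> Omega) (a : Omega -> 'M[R]_d) (b : Omega -> 'rV[R]_d)
  (Q : 'rV[R]_d -> Omega -> probability W R) : Prop :=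
  (forall s (i : 'I_d), measurable_fun setT (fun w => X w s 0 i)) /\
  (forall w, {within [set s | 0 <= s], continuous (X w)}) /\
  (forall x (A : set W), measurable A -> measurable_fun [set: Omega] (fun o => (Q x o A : \bar R))) /\
  (forall x o, solves_MP (fun y => a (t y o)) (fun y => b (t y o)) x (Q x o)).

End Paths.
End Defs.

(* Main.v *)
(** The resolvent at 0, [U f = inf {phi 0 + e / kap : f <= (kap - L) phi + e}], is linear on Lipschitz compactly
supported [f] because a parametrix solves [(kap - L) phi = f] up to any error. Barriers and equilibrium potentials
compare [U] of a small tent with its value for coefficients modified near the tent, which is independent of the
drift there; so [E (U (b.l g))] is, up to constants, [E (b.l)_+ - c E (b.l)_-] times [E (U g)]. Testing with a
logistic function of [x.l] gives [E (U h) <= C] for [h ~ exp (- th x.l)], uniformly in [kap], and the martingale problem turns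
this into exponential bounds for reaching [- b L] and for staying in the slab until time [exp (2 th L)]. *)
Require Import Defs.
From HB Require Import structures.
From mathcomp Require Import all_boot all_order all_algebra.
From mathcomp Require Import all_classical all_reals all_analysis measurable_realfun.
From mathcomp Require Import ring lra zify.
Set Implicit Arguments. Unset Strict Implicit. Unset Printing Implicit Defensive.
Import Order.TTheory GRing.Theory Num.Theory.
Import numFieldNormedType.Exports.
Local Open Scope classical_set_scope.
Local Open Scope ring_scope.

(** Each equation is solved only up to a defect [e], which the maximum principle turns into an error
    [e/kap]. This is harmless since [kap] is fixed before the grid, the cutoff radius and the time
    step; what survives are the constants of [harn] and [compare], and these must not depend on
    [kap], which ends as [exp (- 2 th L)]. They rest on barriers supported in small balls.

    The obstacle is that the drift at a site and [U] of a tent near it are functions of the same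
    environment. Changing the coefficients in a ball alters [U] by a bounded factor only, because a
    potential that is constant on the ball has the same charge for both operators. The price is a
    ratio: the positive part of the drift meets the lower constant [lo], the negative part the upper
    constant [hi], and the threshold is [hi/lo + 1].

    The logistic function replaces the exponential because it is bounded: cutting it off at radius
    [M] costs order [1/(M kap)]. Space integrals appear as sums over grids, with tents as a
    partition of unity, so that linearity of [U] is used for finite sums only. *)

Local Notation sqrt := Num.sqrt.
Local Notation max := Num.max.
Local Notation min := Num.min.
Local Notation mfun := (measurable_fun setT).
Local Notation le_via y := (@le_trans _ _ y).
Local Notation normDt := (le_trans (ler_normD _ _)).
Local Notation normBt := (le_trans (ler_normB _ _)).
Local Notation normst := (le_trans (ler_norm_sum _ _ _)).
Local Notation normt := (le_trans (ler_norm _)).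
Ltac fieldp := field; rewrite !gt_eqF //.

(** * Euclidean geometry of row vectors and metric continuity *)

Section Vect.
Variables (R : realType) (d : nat).
Local Notation V := 'rV[R]_d.
Implicit Types (u v w x y : V) (c : R).
Lemma dotvC u v : dotv u v = dotv v u.
Proof. by apply: eq_bigr=> i _; rewrite mulrC. Qed.
Lemma dotvDl u v w : dotv (u + v) w = dotv u w + dotv v w.
Proof. by rewrite /dotv -big_split; apply: eq_bigr=> i _; rewrite mxE mulrDl. Qed.
Lemma dotvZl c u w : dotv (c *: u) w = c*dotv u w.
Proof. by rewrite /dotv mulr_sumr; apply: eq_bigr=> i _; rewrite mxE mulrA. Qed.
Lemma dotvDr u v w : dotv u (v + w) = dotv u v + dotv u w.
Proof. by rewrite dotvC dotvDl !(dotvC _ u). Qed.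
Lemma dotvZr c u w : dotv u (c *: w) = c*dotv u w.
Proof. by rewrite dotvC dotvZl dotvC. Qed.
Lemma dotvNl u v : dotv (- u) v = - dotv u v.
Proof. by rewrite -scaleN1r dotvZl mulN1r. Qed.
Lemma dotvNr u v : dotv u (- v) = - dotv u v.
Proof. by rewrite dotvC dotvNl dotvC. Qed.
Lemma dot0v u : dotv 0 u = 0.
Proof. by rewrite -(scale0r u) dotvZl mul0r. Qed.
Lemma dotv0 u : dotv u 0 = 0.
Proof. by rewrite dotvC dot0v. Qed.
Lemma dotv_sumr (I : Type) (r : seq I) (F : I -> V) u :
 dotv u (\sum_(i <- r) F i) = \sum_(i <- r) dotv u (F i).
Proof.
elim: r=> [|i r IH]; first by rewrite !big_nil dotv0.
by rewrite !big_cons dotvDr IH.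
Qed.
Lemma dotv_ge0 u : 0 <= dotv u u.
Proof. by apply: sumr_ge0=> i _; rewrite -expr2 sqr_ge0. Qed.
Lemma dotv_evec u i : dotv u (evec R i) = u 0 i.
Proof.
rewrite /dotv (bigD1 i) //= big1 ?addr0 ?mxE ?eqxx ?mulr1 // => j ji.
by rewrite mxE (negPf ji) andbF mulr0.
Qed.
Lemma row_evec u : u = \sum_i u 0 i *: evec R i.
Proof.
apply/rowP=> j; rewrite summxE (bigD1 j) //= big1 ?addr0 ?mxE ?eqxx ?mulr1 // => i ij.
by rewrite !mxE eq_sym (negPf ij) andbF mulr0.
Qed.
Lemma enorm_ge0 u : 0 <= enorm u. Proof. exact: sqrtr_ge0. Qed.
Lemma enorm_sqr u : enorm u^+2 = dotv u u.
Proof. by rewrite sqr_sqrtr // dotv_ge0. Qed.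
Lemma enormZ c u : enorm (c *: u) = `|c|*enorm u.
Proof.
by rewrite /enorm dotvZl dotvZr mulrA -expr2 sqrtrM ?sqr_ge0 // sqrtr_sqr.
Qed.
Lemma enormN u : enorm (- u) = enorm u.
Proof. by rewrite -scaleN1r enormZ normrN normr1 mul1r. Qed.
Lemma enormB u v : enorm (u - v) = enorm (v - u).
Proof. by rewrite -enormN opprB. Qed.
Lemma enorm0 : enorm (0 : V) = 0.
Proof. by rewrite /enorm dot0v sqrtr0. Qed.
Lemma coord_le u i : `|u 0 i| <= enorm u.
Proof.
rewrite -sqrtr_sqr; apply: ler_wsqrtr; rewrite /dotv (bigD1 i) //= expr2 lerDl.
by apply: sumr_ge0=> j _; rewrite -expr2 sqr_ge0.
Qed.
Lemma enorm_eq0 u : enorm u = 0 -> u = 0.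
Proof.
move=> h; apply/rowP=> i; rewrite mxE; apply/eqP; rewrite -normr_le0 -h.
exact: coord_le.
Qed.
Lemma dotv_le u v : dotv u v <= enorm u*enorm v.
Proof.
have [h|u0] := eqVneq (enorm u) 0.
 by rewrite (enorm_eq0 h) dot0v enorm0 mul0r.
have [h|v0] := eqVneq (enorm v) 0.
 by rewrite (enorm_eq0 h) dotv0 enorm0 mulr0.
have up: 0 < enorm u by rewrite lt_def u0 enorm_ge0.
have vp: 0 < enorm v by rewrite lt_def v0 enorm_ge0.
have := dotv_ge0 (enorm v *: u - enorm u *: v).
rewrite dotvDl !dotvDr !dotvNl !dotvNr !dotvZl !dotvZr -!enorm_sqr (dotvC v u).
move: up vp; set a := enorm u; set b := enorm v; set c := dotv u v=> up vp h.
have ab: 0 < a*b by rewrite mulr_gt0.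
rewrite -(ler_pM2l ab); nra.
Qed.
Lemma dotv_abs u v : `|dotv u v| <= enorm u*enorm v.
Proof.
rewrite ler_norml dotv_le andbT -[dotv u v]opprK lerN2 -dotvNl.
by rewrite (le_trans (dotv_le _ _)) // enormN.
Qed.
Lemma ler_enormD u v : enorm (u + v) <= enorm u + enorm v.
Proof.
rewrite -(@ler_pXn2r _ 2) // ?nnegrE ?addr_ge0 ?enorm_ge0 //.
rewrite enorm_sqr dotvDl !dotvDr -!enorm_sqr (dotvC v u).
have := dotv_le u v; nra.
Qed.
Lemma enorm_tri x y z : enorm (x - z) <= enorm (x - y) + enorm (y - z).
Proof. by rewrite (le_trans _ (ler_enormD _ _)) // addrA subrK. Qed.
Lemma enorm_tri0 x y : enorm x <= enorm y + enorm (x - y).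
Proof. by rewrite (le_trans _ (ler_enormD _ _)) // addrC subrK. Qed.
Lemma enorm_dist x y : `|enorm x - enorm y| <= enorm (x - y).
Proof.
rewrite ler_norml; have := enorm_tri0 x y; have := enorm_tri0 y x.
rewrite (enormB y x)=> h1 h2; lra.
Qed.
Lemma enorm_evec i : enorm (evec R i : V) = 1.
Proof. by rewrite /enorm dotv_evec !mxE !eqxx sqrtr1. Qed.
Lemma enorm_sum_le u : enorm u <= \sum_i `|u 0 i|.
Proof.
rewrite {1}(row_evec u).
apply: (big_ind2 (fun (x : V) c=> enorm x <= c))=> [|x a y b ha hb|i _].
- by rewrite enorm0.
- by rewrite (le_trans (ler_enormD _ _)) // lerD.
rewrite enormZ /enorm dotv_evec !mxE !eqxx sqrtr1 mulr1 //.
Qed.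
Lemma sumd_le (F : 'I_d -> R) (M : R) : (forall i, F i <= M) -> \sum_i F i <= d%:R*M.
Proof.
by move=> h; rewrite -[d in d%:R]card_ord mulr_natl -sumr_const; apply: ler_sum.
Qed.
Lemma sumd_abs (F : 'I_d -> R) (M : R) : (forall i, `|F i| <= M) -> `|\sum_i F i| <= d%:R*M.
Proof. by move=> h; rewrite normst // sumd_le. Qed.
Lemma enorm_le_coord u c : (forall i, `|u 0 i| <= c) -> enorm u <= d%:R*c.
Proof.
move=> h; apply: (le_trans (enorm_sum_le u)).
by rewrite -[d in d%:R]card_ord mulr_natl -sumr_const; apply: ler_sum.
Qed.
Lemma enorm_le_norm u : enorm u <= d%:R * `|u|.
Proof.
apply: enorm_le_coord=> i; rewrite [`|u|]mx_normrE.
by rewrite (le_trans _ (@le_bigmax_cond _ R _ 0 (0, i) predT (fun ij : 'I_1 * 'I_d=> `|u ij.1 ij.2|) _)).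
Qed.
Lemma norm_le_enorm u : `|u| <= enorm u.
Proof.
rewrite [`|u|]mx_normrE; apply: bigmax_le=> [|[i j] _ /=]; first exact: enorm_ge0.
by rewrite [i]ord1; exact: coord_le.
Qed.
(** Phrased with the Euclidean norm because all quantitative bounds use it; [cont_continuous] and
    [continuous_at_cont] translate to and from the sup-norm topology of matrices. *)
Definition cont (f : V -> R) : Prop := forall y e, 0 < e ->
 exists2 dl : R, 0 < dl & forall z, enorm (z - y) < dl -> `|f z - f y| <= e.
Lemma cont_continuous f : cont f -> continuous f.
Proof.
move=> hf x A /nbhs_ballP[e /= e0 hA].
have [r r0 hr] := hf x (e/2) ltac:(lra).
have : @nbhs V V x (f @^-1` A); last by [].
apply/nbhs_ballP; exists (r/(d%:R + 1))=> /=; first by rewrite divr_gt0 // ltr_wpDl.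
move=> y; rewrite -ball_normE /ball_ /= => hy; apply: hA; rewrite /ball /=.
rewrite distrC; apply: (le_lt_trans (hr y _)); last by lra.
rewrite enormB (le_lt_trans (enorm_le_norm _)) //.
rewrite ltr_pdivlMr ?ltr_wpDl // in hy; apply: le_lt_trans hy.
by rewrite mulrC ler_wpM2l // lerDl.
Qed.
Lemma continuous_at_cont (f : V -> R) y : {for y, continuous f} -> forall e, 0 < e ->
 exists2 dl : R, 0 < dl & forall z, enorm (z - y) < dl -> `|f z - f y| <= e.
Proof.
move=> hf e e0.
have h0: nbhs (f y) [set z | `|z - f y| <= e].
 apply/nbhs_ballP; exists e=> //= z; rewrite /ball /= distrC; exact: ltW.
have : @nbhs V V y (f @^-1` [set z | `|z - f y| <= e]) by exact: hf.
move/nbhs_ballP=> [r /= r0 hr]; exists r=> // z hz; apply: hr.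
rewrite -ball_normE /ball_ /= distrC; exact: le_lt_trans (norm_le_enorm _) hz.
Qed.
Lemma cont_lip f (K : R) : (forall x y, `|f x - f y| <= K*enorm (x - y)) -> cont f.
Proof.
move=> hf y e e0; exists (e/(`|K| + 1)); first by rewrite divr_gt0 // ltr_wpDl.
move=> z; rewrite ltr_pdivlMr ?ltr_wpDl // => hz; apply: (le_trans (hf _ _)).
apply: (le_trans (ler_wpM2r (enorm_ge0 _) (ler_norm K))).
apply: le_trans (ltW hz); rewrite mulrC ler_wpM2l ?enorm_ge0 //; lra.
Qed.
Lemma cont_cst c : cont (fun=> c).
Proof. by move=> y e e0; exists 1=> // z _; rewrite subrr normr0 ltW. Qed.
Lemma cont_add f g : cont f -> cont g -> cont (fun y=> f y + g y).
Proof.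
move=> hf hg y e e0; have [r r0 hr] := hf y (e/2) ltac:(lra).
have [s s0 hs] := hg y (e/2) ltac:(lra).
exists (min r s)=> [|z]; rewrite lt_min ?r0 // => /andP[/hr h1 /hs h2].
rewrite opprD addrACA normDt //; lra.
Qed.
Lemma cont_mul f g : cont f -> cont g -> cont (fun y=> f y*g y).
Proof.
move=> hf hg y e e0.
pose M := `|f y| + `|g y| + 2.
have M0: 0 < M by rewrite /M; have := normr_ge0 (f y); have := normr_ge0 (g y); lra.
have eM: 0 < min 1 (e/M) by rewrite lt_min ltr01 divr_gt0.
have [r r0 hr] := hf y _ eM.
have [s s0 hs] := hg y _ eM.
exists (min r s)=> [|z]; rewrite lt_min ?r0 // => /andP[/hr h1 /hs h2].
rewrite le_min in h1; rewrite le_min in h2.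
case/andP: h1=> h11 h12; case/andP: h2=> h21 h22.
have -> : f z*g z - f y*g y = (f z - f y)*g z + f y*(g z - g y) by ring.
rewrite normDt // !normrM.
have gz: `|g z| <= `|g y| + 1.
 by rewrite -[g z](subrK (g y)) normDt // addrC lerD2l.
apply: (le_via (e/M*(`|g y| + 1) + `|f y|*(e/M))).
 by apply: lerD; [apply: ler_pM|apply: ler_wpM2l].
have -> : e/M*(`|g y| + 1) + `|f y|*(e/M) = e/M*(M - 1) by rewrite /M; ring.
rewrite mulrAC ler_pdivrMr // ler_wpM2l //; lra.
Qed.
Lemma cont_comp (h : R -> R) f : cont f -> (forall y, {for f y, continuous h}) ->
 cont (fun y=> h (f y)).
Proof.
move=> hf hh y e e0.
have /nbhs_ballP[r /= r0 hr] : nbhs (f y) (h @^-1` [set z | `|z - h (f y)| <= e]).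
 apply: hh; apply/nbhs_ballP; exists e=> //= z; rewrite /ball /= distrC; exact: ltW.
have [s s0 hs] := hf y (r/2) ltac:(lra).
exists s=> // z /hs hz; apply: hr; rewrite /ball /= distrC; lra.
Qed.
Lemma cont_sum (I : Type) (r : seq I) (f : I -> V -> R) : (forall i, cont (f i)) ->
 cont (fun y=> \sum_(i <- r) f i y).
Proof.
move=> h; elim: r=> [|i r IH].
 by rewrite (_ : (fun _=> _) = fun=> 0); [exact: cont_cst|apply/funext=> y; rewrite big_nil].
by rewrite (_ : (fun _=> _) = fun y=> f i y + \sum_(i <- r) f i y);
 [exact: cont_add|apply/funext=> y; rewrite big_cons].
Qed.
End Vect.

Ltac pos := solve [repeat first [ assumption | apply: ltW; assumption | exact: enorm_ge0 | exact: sqrtr_ge0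
 | exact: expR_ge0 | exact: normr_ge0 | exact: ler0n | exact: ler01 | exact: sqr_ge0
 | rewrite invr_ge0 | apply: mulr_ge0 | apply: addr_ge0 | apply: exprn_ge0 ]].

(** * One-variable calculus *)

Section OneDim.
Variable R : realType.
Lemma eqle (x y : R) : x = y -> x <= y. Proof. by move=> ->. Qed.
Implicit Types f g : R -> R.
Lemma is_derive_bound f (x l : R) : is_derive x 1 f l -> forall e, 0 < e ->
 exists2 dl : R, 0 < dl & forall h, `|h| < dl -> `|f (x + h) - f x - l*h| <= e * `|h|.
Proof.
move=> [df fl] e e0; move: df; rewrite /derivable=> df.
have {}df : (fun h=> h^-1 *: (f (h *: (1 : R) + x) - f x)) @ 0^' --> l by rewrite -fl; exact: df.
move/cvgrPdist_le : df=> /(_ e e0) [r /= r0 hr]; exists r=> // h hr'.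
have [->|h0] := eqVneq h 0.
 by rewrite addr0 subrr mulr0 subr0 normr0 mulr0.
have /= := hr h; rewrite /ball_ /= sub0r normrN=> /(_ hr' h0) {}hr.
have -> : f (x + h) - f x - l*h = - ((l - h^-1 *: (f (h *: (1 : R) + x) - f x))*h).
 by rewrite /GRing.scale /= mulr1 [h + x]addrC; field.
by rewrite normrN normrM ler_wpM2r.
Qed.
Lemma bound_is_derive f (x l : R) : (forall e, 0 < e ->
 exists2 dl : R, 0 < dl & forall h, `|h| < dl -> `|f (x + h) - f x - l*h| <= e * `|h|) ->
 is_derive x 1 f l.
Proof.
move=> hf.
have H: (fun h=> h^-1 *: (f (h *: (1 : R) + x) - f x)) @ 0^' --> l.
 apply/cvgrPdist_le=> e e0; have [r r0 hr] := hf e e0.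
 exists r=> //= h; rewrite /ball_ /= sub0r normrN=> hr' h0.
 have {}hr := hr h hr'.
 have E: l - h^-1 *: (f (h *: (1 : R) + x) - f x) = - ((f (x + h) - f x - l*h)/h).
  by rewrite /GRing.scale /= mulr1 [h + x]addrC; field.
 by rewrite [X in `|X|]E normrN normrM normfV ler_pdivrMr // normr_gt0.
split; first by apply/cvg_ex; exists l.
exact/cvg_lim.
Qed.
(** If [k < 0], then [g1] is negative just to the right of 0, and the mean value theorem yields a
    value of [g] below [g 0]. *)
Lemma min_second_order (g g1 : R -> R) (k : R) :
 (forall t : R, is_derive t 1 g (g1 t)) -> is_derive (0 : R) 1 g1 k ->
 (forall t, g 0 <= g t) -> g1 0 = 0 /\ 0 <= k.
Proof.
move=> hg hk hm.
have g10: g1 0 = 0.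
 have := @derive1_at_min R g (-1) 1 0.
 have h1: (0 : R) \in `](-1), 1[ by rewrite in_itv /= ltrN10 ltr01.
 have hh: forall t, t \in `](-1), 1[ -> derivable g t 1 by move=> t _; have [] := hg t.
 move=> /(_ ltac:(lra) hh h1 (fun t _=> hm t)) [_ E0].
 by have [_ E] := hg 0; rewrite -E E0.
split=> //; rewrite leNgt; apply/negP=> k0.
have [r r0 hr] := is_derive_bound hk (e := - k/2) ltac:(lra).
set t := r/2; have t0: 0 < t by rewrite /t; lra.
have tr: t < r by rewrite /t; lra.
have cg: {within `[0, t], continuous g}.
 apply: continuous_subspaceT=> y; apply: differentiable_continuous.
 by apply/derivable1_diffP; have [] := hg y.
have [c + ] := MVT t0 (fun x _=> hg x) cg; rewrite in_itv /= => /andP[c0 ct].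
rewrite subr0=> E.
have := hr c; rewrite gtr0_norm // => /(_ ltac:(lra)); rewrite add0r g10 subr0.
rewrite ler_norml=> /andP[_ h]; have := hm t=> h2.
have : g1 c*t < 0 by rewrite pmulr_llt0 //; nra.
by lra.
Qed.
(** The squared positive part is the building block of the profiles below: products of such terms
    are continuously differentiable bumps with explicit supports. *)
Lemma is_derive_pos2 (x : R) : is_derive x 1 (fun t=> (max t 0)^+2) (2 * max x 0).
Proof.
apply: bound_is_derive=> e e0; exists e=> // h he.
have A: `|max (x + h) 0^+2 - max x 0^+2 - 2 * max x 0*h| <= h^+2.
 rewrite ler_norml; apply/andP; case: (leP x 0)=> hx; case: (leP (x + h) 0)=> hxh;
  rewrite ?expr0n /=; split; nra.
apply: (le_trans A); rewrite -real_normK ?num_real // expr2 ler_wpM2r //; exact: ltW.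
Qed.
Lemma is_derive_cont f (x l : R) : is_derive x 1 f l -> {for x, continuous f}.
Proof. by move=> [h _]; apply: differentiable_continuous; exact/derivable1_diffP. Qed.
Lemma isd_ext f g (x l l' : R) : is_derive x 1 f l -> f =1 g -> l = l' -> is_derive x 1 g l'.
Proof. by move=> h /funext <- <-. Qed.
Lemma isd_cst (c x : R) : is_derive x 1 (fun=> c) (0 : R).
Proof. exact: is_derive_cst. Qed.
Lemma isd_id (x : R) : is_derive x 1 (fun t=> t) (1 : R).
Proof. exact: is_derive_id. Qed.
Lemma isd_add f g (x a b : R) : is_derive x 1 f a -> is_derive x 1 g b ->
 is_derive x 1 (fun t=> f t + g t) (a + b).
Proof. exact: is_deriveD. Qed.
Lemma isd_opp f (x a : R) : is_derive x 1 f a -> is_derive x 1 (fun t=> - f t) (- a).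
Proof. exact: is_deriveN. Qed.
Lemma isd_mul f g (x a b : R) : is_derive x 1 f a -> is_derive x 1 g b ->
 is_derive x 1 (fun t=> f t*g t) (a*g x + f x*b).
Proof.
move=> hf hg; apply: isd_ext (is_deriveM hf hg) _ _=> //.
by rewrite /GRing.scale /=; ring.
Qed.
Lemma isd_scale c f (x a : R) : is_derive x 1 f a -> is_derive x 1 (fun t=> c*f t) (c*a).
Proof. by move=> hf; apply: isd_ext (isd_mul (isd_cst c x) hf) _ _=> //; ring. Qed.
Lemma isd_comp f g (x a b : R) : is_derive (g x) 1 f a -> is_derive x 1 g b ->
 is_derive x 1 (fun t=> f (g t)) (a*b).
Proof. by move=> hf hg; apply: isd_ext (is_derive1_comp hf hg) _ _. Qed.
Lemma isd_inv (x : R) : x != 0 -> is_derive x 1 (fun t=> t^-1) (- (x^+2)^-1).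
Proof.
move=> x0; have h := @is_deriveV R (fun t : R=> t) x 1 1 x0 (isd_id x).
by apply: isd_ext h _ _=> //; rewrite /GRing.scale /= mulr1.
Qed.
Lemma isd_exp f (x a : R) : is_derive x 1 f a -> is_derive x 1 (fun t=> expR (f t)) (expR (f x)*a).
Proof. by move=> h; exact: isd_comp (is_derive_expR _) h. Qed.
Lemma sqrt_le1 (x : R) : x <= 1 -> sqrt x <= 1.
Proof. by move=> h; rewrite -[X in _ <= X]sqrtr1 ler_wsqrtr. Qed.
Lemma isd_aff (s c x : R) : is_derive x 1 (fun t=> s*t + c) s.
Proof. by apply: isd_ext (isd_add (isd_scale s (isd_id x)) (isd_cst c x)) _ _=> //; ring. Qed.
Lemma cts_cst (c : R) : continuous (fun _ : R=> c).
Proof. by move=> t; exact: cvg_cst. Qed.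
Lemma cts_id : continuous (fun t : R=> t).
Proof. by move=> t; exact: cvg_id. Qed.
Lemma cts_add f g : continuous f -> continuous g -> continuous (fun t=> f t + g t).
Proof. by move=> hf hg t; exact: (continuousD (hf t) (hg t)). Qed.
Lemma cts_mul f g : continuous f -> continuous g -> continuous (fun t=> f t*g t).
Proof. by move=> hf hg t; exact: (continuousM (hf t) (hg t)). Qed.
Lemma cts_opp f : continuous f -> continuous (fun t=> - f t).
Proof. by move=> hf t; exact: (continuousN (hf t)). Qed.
Lemma cts_max f g : continuous f -> continuous g -> continuous (fun t=> max (f t) (g t)).
Proof. by move=> hf hg t; exact: (continuous_max (hf t) (hg t)). Qed.
Lemma MVT_cc f f1 (a b : R) : a < b -> (forall x, a <= x <= b -> is_derive x 1 f (f1 x)) ->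
 exists2 c, a <= c <= b & f b - f a = f1 c*(b - a).
Proof.
move=> ab hf.
have cf: {within `[a, b], continuous f}.
 apply: derivable_within_continuous=> x; rewrite in_itv /= => hx.
 by have [] := hf _ hx.
have hf' x: x \in `]a, b[ -> is_derive x 1 f (f1 x).
 by rewrite in_itv /= => /andP[h1 h2]; apply: hf; rewrite !ltW.
by have [c + ->] := MVT ab hf' cf; rewrite in_itv /= => /andP[h1 h2]; exists c; rewrite ?(ltW h1) ?(ltW h2).
Qed.
Lemma derive_mono f f1 (a b : R) : a <= b ->
 (forall x, a <= x <= b -> is_derive x 1 f (f1 x)) ->
 (forall x, a <= x <= b -> 0 <= f1 x) -> f a <= f b.
Proof.
rewrite le_eqVlt=> /orP[/eqP -> //|ab] hf hf1.
have [c h E] := MVT_cc ab hf; by rewrite -subr_ge0 E mulr_ge0 ?subr_ge0 ?(ltW ab) //; exact: hf1.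
Qed.
Lemma derive_lip f f1 (a b M : R) :
 (forall x, min a b <= x <= max a b -> is_derive x 1 f (f1 x)) ->
 (forall x, min a b <= x <= max a b -> `|f1 x| <= M) -> `|f b - f a| <= M * `|b - a|.
Proof.
wlog ab : a b / a <= b.
 move=> H hf hM; have [/H|/ltW] := leP a b; first by apply.
 by move=> ba; rewrite distrC (distrC b); apply: (H b a ba); rewrite minC maxC.
rewrite min_l // max_r //.
move: (ab); rewrite le_eqVlt=> /orP[/eqP ->|ab'] hf hM; first by rewrite !subrr normr0 mulr0.
by have [c h ->] := MVT_cc ab' hf; rewrite normrM ler_wpM2r // hM.
Qed.
Lemma derive_const f (a b : R) : a <= b ->
 (forall x, a <= x <= b -> is_derive x 1 f 0) -> f a = f b.
Proof.
move=> ab hf; apply/eqP; rewrite -subr_eq0 -normr_le0.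
rewrite -[X in _ <= X](mul0r `|a - b|); apply: (@derive_lip _ (fun=> 0))=> x.
- by rewrite min_r // max_l //; exact: hf.
- by rewrite normr0.
Qed.
Lemma int_der (g : R -> R) (a x : R) : continuous g -> a < x -> is_derive x 1 (fun x=> \int[lebesgue_measure]_(t in `[a, x]) g t) (g x).
Proof.
move=> cg ax; have x1: x < x + 1 by lra.
have ig: lebesgue_measure.-integrable `[a, x + 1] (EFin \o g).
 apply: continuous_compact_integrable; first exact: segment_compact.
 exact: continuous_subspaceT.
have [h1 h2] := continuous_FTC1_closed x1 ig ax (cg x).
by split; [exact: h1|rewrite -derive1E; exact: h2].
Qed.
(** The primitive is an integral from [a], hence differentiable only to the right of [a]; this is
    the origin of side conditions such as [-1 < t] on later profiles. *)
Lemma primitive_ex (g : R -> R) (a : R) : continuous g ->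
 exists P : R -> R, forall x, a < x -> is_derive x 1 P (g x).
Proof. by move=> cg; exists (fun x=> \int[lebesgue_measure]_(t in `[a, x]) g t)=> x; exact: int_der. Qed.
End OneDim.

(** * Functions with explicit gradient and Hessian *)

Section Calc.
Variables (R : realType) (d : nat).
Local Notation V := 'rV[R]_d.
Definition D1 (f : V -> R) (G : V -> V) : Prop :=
 forall y, is_diff y f (fun v=> dotv (G y) v).
Lemma D1_ext f f' G G' : f =1 f' -> G =1 G' -> D1 f G -> D1 f' G'.
Proof. by move=> /funext -> /funext ->. Qed.
Lemma D1_cst c : D1 (fun=> c) (fun=> 0).
Proof.
move=> y; apply: is_diff_eq (is_diff_cst c y) _.
by apply/funext=> v; rewrite dot0v.
Qed.
Lemma D1_coord i : D1 (fun y=> y 0 i) (fun=> evec R i).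
Proof.
move=> y; have df := @differentiable_coord R 1 d y 0 i.
split=> //; apply/funext=> v; rewrite dotvC dotv_evec.
have @f : {linear V -> R}.
 by exists (fun N : V=> N 0 i); do 2![eexists]; do ?[constructor];
   rewrite ?mxE// => ? *; rewrite ?mxE//; move=> ?; rewrite !mxE.
rewrite (_ : (fun _=> _) = f) // diff_lin //; exact: coord_continuous.
Qed.
Lemma D1_add f g F G : D1 f F -> D1 g G -> D1 (fun y=> f y + g y) (fun y=> F y + G y).
Proof.
move=> hf hg y; apply: is_diff_eq (is_diffD (hf y) (hg y)) _.
by apply/funext=> v /=; rewrite dotvDl.
Qed.
Lemma D1_mul f g F G : D1 f F -> D1 g G ->
 D1 (fun y=> f y*g y) (fun y=> f y *: G y + g y *: F y).
Proof.
move=> hf hg y; apply: is_diff_eq (is_diffM (hf y) (hg y)) _.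
by apply/funext=> v /=; rewrite dotvDl !dotvZl.
Qed.
Lemma D1_scale c f F : D1 f F -> D1 (fun y=> c*f y) (fun y=> c *: F y).
Proof.
move=> hf; apply: D1_ext (D1_mul (D1_cst c) hf)=> // y /=; by rewrite scaler0 addr0.
Qed.
Lemma D1_comp (h h1 : R -> R) (f : V -> R) F : (forall y, is_derive (f y) 1 h (h1 (f y))) ->
 D1 f F -> D1 (fun y=> h (f y)) (fun y=> h1 (f y) *: F y).
Proof.
move=> hh hf y; have [dh vh] := hh y.
have hd: is_diff (f y) h (fun t=> t *: h1 (f y)).
 split; first exact/derivable1_diffP.
 rewrite diff1E; last exact/derivable1_diffP.
 by apply/funext=> t; rewrite derive1E vh.
apply: is_diff_eq (is_diff_comp (hf y) hd) _.
by apply/funext=> v /=; rewrite dotvZl /GRing.scale /= mulrC.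
Qed.
Lemma D1_sum (I : Type) (r : seq I) (f : I -> V -> R) (G : I -> V -> V) :
 (forall i, D1 (f i) (G i)) ->
 D1 (fun y=> \sum_(i <- r) f i y) (fun y=> \sum_(i <- r) G i y).
Proof.
move=> h; elim: r=> [|i r IH].
 by apply: D1_ext (D1_cst 0)=> y; rewrite big_nil.
by apply: D1_ext (D1_add (h i) IH)=> y; rewrite big_cons.
Qed.
Lemma D1_cont f G : D1 f G -> cont f.
Proof.
by move=> h y; apply: continuous_at_cont; apply: differentiable_continuous; have [] := h y.
Qed.
Lemma D1_derive f G y v : D1 f G -> 'D_v f y = dotv (G y) v.
Proof. by move=> h; have [df e] := h y; rewrite deriveE // e. Qed.
Lemma D1_line f G (c v : V) (t : R) : D1 f G ->
 is_derive t 1 (fun t : R=> f (c + t *: v)) (dotv (G (c + t *: v)) v).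
Proof.
move=> hf.
have hl: is_diff t (fun t : R=> c + t *: v) (fun s=> s *: v).
 apply: is_diff_eq (is_diffD (is_diff_cst c t) (is_diff_scalel _ v)) _=> /=.
 by apply/funext=> s /=; rewrite add0r.
have [h1 h2] := is_diff_comp hl (hf (c + t *: v)).
split; first exact/derivable1_diffP.
by rewrite deriveE // h2 /= scale1r.
Qed.
(** Gradient and Hessian are carried as data, so that [LL] is an algebraic expression in them and
    the rules for sums, products and compositions are computations with matrices. *)
Definition C2 (f : V -> R) (G : V -> V) (H : V -> 'M[R]_d) : Prop :=
 [/\ D1 f G, (forall j, D1 (fun y=> G y 0 j) (fun y=> row j (H y)))
  & (forall j i, cont (fun y=> H y j i))].
Definition LL (a : V -> 'M[R]_d) (b : V -> V) (G : V -> V) (H : V -> 'M[R]_d) (y : V) : R :=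
 2^-1*(\sum_i \sum_j a y i j*H y j i) + \sum_i b y 0 i*G y 0 i.
Definition bsupp (f : V -> R) : Prop := exists M : R, forall y, M < enorm y -> f y = 0.
Lemma C2_derive2 f G H i j y : C2 f G H -> 'D_(evec R i) ('D_(evec R j) f) y = H y j i.
Proof.
move=> [h1 h2 _].
have -> : 'D_(evec R j) f = fun y=> G y 0 j.
 by apply/funext=> z; rewrite (D1_derive _ _ h1) dotv_evec.
by rewrite (D1_derive _ _ (h2 j)) dotv_evec mxE.
Qed.
Lemma C2_Lgen a b f G H y : C2 f G H -> Lgen a b f y = LL a b G H y.
Proof.
move=> h; rewrite /Lgen /LL; congr (_*_ + _).
 by apply: eq_bigr=> i _; apply: eq_bigr=> j _; rewrite (C2_derive2 _ _ _ h).
by have [h1 _ _] := h; apply: eq_bigr=> i _; rewrite (D1_derive _ _ h1) dotv_evec.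
Qed.
Lemma C2_C2c f G H : C2 f G H -> bsupp f -> C2c f.
Proof.
move=> h hs; have [h1 h2 h3] := h; split; first by move=> y; have [] := h1 y.
have E j: 'D_(evec R j) f = fun y=> G y 0 j.
 by apply/funext=> z; rewrite (D1_derive _ _ h1) dotv_evec.
split; first by move=> j y; rewrite E; have [] := h2 j y.
split=> // i j; rewrite (_ : 'D_(evec R i) _ = fun y=> H y j i); first exact: cont_continuous.
by apply/funext=> y; rewrite (C2_derive2 _ _ _ h).
Qed.
Lemma C2_ext f f' G G' H H' : f =1 f' -> G =1 G' -> H =1 H' -> C2 f G H -> C2 f' G' H'.
Proof. by move=> /funext -> /funext -> /funext ->. Qed.
Lemma C2_cst c : C2 (fun=> c) (fun=> 0) (fun=> 0).
Proof.
split; first exact: D1_cst.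
 2: by move=> j i; rewrite (_ : (fun _=> _) = fun=> 0); [exact: cont_cst|apply/funext=> z; rewrite mxE].
move=> j; apply: D1_ext (D1_cst 0)=> y; first by rewrite mxE.
by apply/rowP=> i; rewrite !mxE.
Qed.
Lemma C2_affine (l : V) c : C2 (fun y=> dotv y l + c) (fun=> l) (fun=> 0).
Proof.
split.
 3: by move=> j i; rewrite (_ : (fun _=> _) = fun=> 0); [exact: cont_cst|apply/funext=> z; rewrite mxE].
 apply: D1_ext (D1_add (D1_sum (index_enum 'I_d) (fun i=> D1_scale (l 0 i) (D1_coord i))) (D1_cst c)).
 - by move=> y /=; rewrite /dotv; congr (_ + _); apply: eq_bigr=> i _; rewrite mulrC.
 - by move=> y /=; rewrite addr0 -row_evec.
move=> j; apply: D1_ext (D1_cst (l 0 j))=> y //.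
by apply/rowP=> i; rewrite !mxE.
Qed.
Lemma C2_add f g F G Hf Hg : C2 f F Hf -> C2 g G Hg ->
 C2 (fun y=> f y + g y) (fun y=> F y + G y) (fun y=> Hf y + Hg y).
Proof.
move=> [f1 f2 f3] [g1 g2 g3]; split; first exact: D1_add.
 move=> j; apply: D1_ext (D1_add (f2 j) (g2 j))=> y; first by rewrite mxE.
 by apply/rowP=> i; rewrite !mxE.
move=> j i; rewrite (_ : (fun _=> _) = (fun y=> Hf y j i + Hg y j i)).
 by apply: cont_add; [exact: f3|exact: g3].
by apply/funext=> z; rewrite mxE.
Qed.
Lemma C2_mul f g F G Hf Hg : C2 f F Hf -> C2 g G Hg ->
 C2 (fun y=> f y*g y) (fun y=> f y *: G y + g y *: F y)
   (fun y=> \matrix_(j, i) (f y*Hg y j i + g y*Hf y j i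
                + (G y 0 j*F y 0 i + F y 0 j*G y 0 i))).
Proof.
move=> [f1 f2 f3] [g1 g2 g3]; split; first exact: D1_mul.
 move=> j; apply: D1_ext (D1_add (D1_mul f1 (g2 j)) (D1_mul g1 (f2 j)))=> y; first by rewrite !mxE.
 by apply/rowP=> i; rewrite !mxE; ring.
move=> j i; rewrite (_ : (fun _=> _) = (fun y=> f y*Hg y j i + g y*Hf y j i
                + (G y 0 j*F y 0 i + F y 0 j*G y 0 i))); last first.
 by apply/funext=> z; rewrite mxE.
have cF k: cont (fun y=> F y 0 k) by apply: D1_cont (f2 k).
have cG k: cont (fun y=> G y 0 k) by apply: D1_cont (g2 k).
by apply: cont_add; apply: cont_add; apply: cont_mul=> //; [exact: D1_cont f1|exact: D1_cont g1].
Qed.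
Lemma C2_scale c f F Hf : C2 f F Hf -> C2 (fun y=> c*f y) (fun y=> c *: F y) (fun y=> c *: Hf y).
Proof.
move=> hf; apply: C2_ext (C2_mul (C2_cst c) hf)=> // y /=; first by rewrite scaler0 addr0.
by apply/matrixP=> i j; rewrite !mxE; ring.
Qed.
Lemma C2_sum (I : Type) (r : seq I) (f : I -> V -> R) (G : I -> V -> V) (H : I -> V -> 'M[R]_d) :
 (forall i, C2 (f i) (G i) (H i)) ->
 C2 (fun y=> \sum_(i <- r) f i y) (fun y=> \sum_(i <- r) G i y) (fun y=> \sum_(i <- r) H i y).
Proof.
move=> h; elim: r=> [|i r IH].
 by apply: C2_ext (C2_cst 0)=> y; rewrite big_nil.
by apply: C2_ext (C2_add (h i) IH)=> y; rewrite big_cons.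
Qed.
Lemma C2_comp (h h1 h2 : R -> R) (f : V -> R) F Hf :
 (forall y, is_derive (f y) 1 h (h1 (f y))) -> (forall y, is_derive (f y) 1 h1 (h2 (f y))) ->
 (forall y, {for f y, continuous h2}) ->
 C2 f F Hf ->
 C2 (fun y=> h (f y)) (fun y=> h1 (f y) *: F y)
   (fun y=> \matrix_(j, i) (h2 (f y)*(F y 0 j*F y 0 i) + h1 (f y)*Hf y j i)).
Proof.
move=> d1 d2 c2 [f1 f2 f3]; split; first exact: D1_comp.
 move=> j; apply: D1_ext (D1_mul (D1_comp d2 f1) (f2 j))=> y; first by rewrite !mxE.
 by apply/rowP=> i; rewrite !mxE; ring.
move=> j i; rewrite (_ : (fun _=> _) = (fun y=> h2 (f y)*(F y 0 j*F y 0 i) + h1 (f y)*Hf y j i)); last first.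
 by apply/funext=> z; rewrite mxE.
have cF k: cont (fun y=> F y 0 k) by apply: D1_cont (f2 k).
have cf := D1_cont f1.
apply: cont_add; apply: cont_mul=> //.
- exact: cont_comp.
- exact: cont_mul.
- by apply: cont_comp=> // y; exact: is_derive_cont (d2 y).
Qed.
Lemma C2_quad (A : 'M[R]_d) (c : V) : A^T = A ->
 C2 (fun y=> dotv (y - c) ((y - c) *m A)) (fun y=> 2 *: ((y - c) *m A)) (fun=> 2 *: A).
Proof.
move=> As.
have Aij i j: A i j = A j i by rewrite -{1}As mxE.
have hi i := C2_mul (C2_affine (evec R i) (- c 0 i)) (C2_affine (row i A) (- dotv c (row i A))).
apply: C2_ext (C2_sum (index_enum 'I_d) hi)=> y /=.
- rewrite /dotv; apply: eq_bigr=> i _; rewrite -/(dotv y (evec R i)) dotv_evec !mxE; congr (_*_).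
 rewrite -/(dotv y (row i A)) -/(dotv c (row i A)) -dotvNl -dotvDl.
 by apply: eq_bigr=> j _; rewrite !mxE Aij.
- apply/rowP=> k; rewrite summxE !mxE mulr_sumr.
 transitivity (\sum_i ((y - c) 0 i*A i k + (i == k)%:R * \sum_j (y - c) 0 j*A j i)).
  apply: eq_bigr=> i _; rewrite !mxE -dotvNl -dotvDl dotv_evec; congr (_*_ + _).
  rewrite eqxx /= mulrC eq_sym; congr (_*_).
  by apply: eq_bigr=> j _; rewrite !mxE Aij.
 rewrite big_split /= [X in _ + X](bigD1 k) //= eqxx mul1r [X in _ + (_ + X)]big1 ?addr0; last first.
  by move=> i /negPf ->; rewrite mul0r.
 by rewrite -mulr_sumr mulr_natl mulr2n.
- apply/matrixP=> j i; rewrite summxE !mxE.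
 transitivity (\sum_k ((k == i)%:R*A k j + (k == j)%:R*A k i)).
  by apply: eq_bigr=> k _; rewrite !mxE !eqxx /= (eq_sym i) (eq_sym j); ring.
 rewrite big_split /= (bigD1 i) //= eqxx mul1r big1 ?addr0; last by move=> k /negPf ->; rewrite mul0r.
 rewrite (bigD1 j) //= eqxx mul1r big1 ?addr0; last by move=> k /negPf ->; rewrite mul0r.
 by rewrite Aij; ring.
Qed.
(** The set [M < enorm y] is open, so every directional difference quotient vanishes for small
    increments; the argument is run for [f] and then for the components of [G]. *)
Lemma C2_supp f G H M y : C2 f G H -> (forall y, M < enorm y -> f y = 0) -> M < enorm y ->
 G y = 0 /\ H y = 0.
Proof.
move=> [h1 h2 _] hM My.
have key g F z: D1 g F -> (forall y, M < enorm y -> g y = 0) -> M < enorm z -> F z = 0.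
 move=> hg h0 hz; apply/rowP=> i.
 have [_ E] := D1_line z (evec R i) 0 hg.
 have : is_derive (0 : R) 1 (fun t : R=> g (z + t *: evec R i)) 0.
  apply: bound_is_derive=> e e0; exists (enorm z - M); first by rewrite subr_gt0.
  move=> t ht; rewrite add0r scale0r addr0 mul0r subr0 (h0 z) // subr0 h0; first by rewrite normr0 mulr_ge0 // ltW.
  have := enorm_tri0 z (z + t *: evec R i); rewrite opprD addrA subrr sub0r enormN enormZ.
  by rewrite enorm_evec; lra.
 move=> [_]; rewrite E scale0r addr0 dotv_evec mxE //.
have G0 z: M < enorm z -> G z = 0 by apply: key h1 hM.
split; first exact: G0.
apply/row_matrixP=> j; rewrite row0; apply: key (h2 j) _ My=> z hz.
by rewrite G0 ?mxE.
Qed.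

End Calc.

(** * Trace of a product of nonnegative forms *)

Section PsdTrace.
Variable R : realType.

(* One step of the LDL^T decomposition: splitting off the first pivot writes
   tr (a H) as a nonnegative value of the form H plus the trace of the Schur
   complement against a principal submatrix of H. *)
Lemma psd_trace n (a H : 'M[R]_n) :
 (forall i j, a i j = a j i) ->
 (forall v : 'I_n -> R, (exists i, v i != 0) -> 0 < \sum_i \sum_j v i*a i j*v j) ->
 (forall v : 'I_n -> R, 0 <= \sum_i \sum_j v i*H i j*v j) ->
 0 <= \sum_i \sum_j a i j*H j i.
Proof.
elim: n a H=> [|n IH] a H as_ ap hp; first by rewrite big_ord0.
set al := a ord0 ord0.
have al0: 0 < al.
 have := ap (fun i=> (i == ord0)%:R) (ex_intro _ ord0 _); rewrite eqxx oner_eq0=> /(_ isT).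
 rewrite big_ord_recl /= big_ord_recl /= mul1r mulr1 big1 ?addr0; last by move=> i _; rewrite mulr0.
 by rewrite big1 ?addr0 // => i _; rewrite big1 // => j _; rewrite !mul0r.
pose a' := \matrix_(i, j < n) (a (lift ord0 i) (lift ord0 j) - a ord0 (lift ord0 i)*a ord0 (lift ord0 j)/al).
pose H' := \matrix_(i, j < n) (H (lift ord0 i) (lift ord0 j)).
have H1: 0 <= \sum_i \sum_j a' i j*H' j i.
 apply: IH.
 - by move=> i j; rewrite !mxE as_ [a ord0 (lift ord0 i)*_]mulrC.
 - move=> v [i0 vi0].
  (* The first coordinate that minimizes the form of [a] when the others are given; the minimum is
     the form of the Schur complement [a']. *)
  pose v0 := - (\sum_j a ord0 (lift ord0 j)*v j)/al.
  pose w i := if unlift ord0 i is Some k then v k else v0.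
  have w0: w ord0 = v0 by rewrite /w unlift_none.
  have wl k: w (lift ord0 k) = v k by rewrite /w liftK.
  have := ap w (ex_intro _ (lift ord0 i0) _); rewrite wl=> /(_ vi0).
  congr (0 < _); rewrite big_ord_recl /= big_ord_recl /= w0 -/al.
  under eq_bigr do rewrite wl.
  under [X in _ + X]eq_bigr=> i _.
   rewrite big_ord_recl /= w0 !wl as_ /al.
   under eq_bigr do rewrite wl.
   over.
  rewrite big_split /=.
  pose s := \sum_j a ord0 (lift ord0 j)*v j.
  have -> : \sum_(i < n) v0*a ord0 (lift ord0 i)*v i = v0*s.
   by rewrite /s mulr_sumr; apply: eq_bigr=> i _; rewrite mulrA.
  have -> : \sum_(i < n) v i*a ord0 (lift ord0 i)*v0 = s*v0.
   by rewrite /s mulr_suml; apply: eq_bigr=> i _; rewrite [v i*_]mulrC.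
  have -> : \sum_i \sum_j v i*a' i j*v j =
   \sum_(i < n) \sum_(j < n) v i*a (lift ord0 i) (lift ord0 j)*v j - s*s/al.
   rewrite {1}/s mulr_suml mulr_suml -sumrB; apply: eq_bigr=> i _.
   rewrite {1}/s mulr_sumr mulr_suml -sumrB; apply: eq_bigr=> j _.
   by rewrite mxE; fieldp.
  rewrite /v0 -/s; field; by rewrite gt_eqF.
 - move=> v.
  pose w i := if unlift ord0 i is Some k then v k else 0.
  have w0: w ord0 = 0 by rewrite /w unlift_none.
  have wl k: w (lift ord0 k) = v k by rewrite /w liftK.
  have := hp w; congr (0 <= _); rewrite big_ord_recl /= w0 big1 ?add0r; last by move=> j _; rewrite !mul0r.
  apply: eq_bigr=> i _; rewrite big_ord_recl w0 mulr0 add0r wl; apply: eq_bigr=> j _.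
  by rewrite wl mxE.
(* The rank-one part split off from [a] is its first row times itself over the pivot, and its trace
   against [H] is the form of [H] on that row. *)
have H2 := hp (fun i=> a ord0 i).
have -> : \sum_i \sum_j a i j*H j i = (\sum_i \sum_j a ord0 i*H i j*a ord0 j)/al
  + \sum_i \sum_j a' i j*H' j i.
 rewrite exchange_big /= mulr_suml big_ord_recl [in RHS]big_ord_recl /= -addrA; congr (_ + _).
  rewrite mulr_suml; apply: eq_bigr=> i _; rewrite -/al as_; field; by rewrite gt_eqF.
 rewrite [X in _ = _ + X]exchange_big /= -big_split /=; apply: eq_bigr=> i _.
 rewrite mulr_suml big_ord_recl [in RHS]big_ord_recl /= -addrA; congr (_ + _).
  by rewrite -/al; fieldp.
 rewrite -big_split; apply: eq_bigr=> j _ /=; rewrite !mxE as_.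
 by fieldp.
by rewrite addr_ge0 // divr_ge0 // ltW.
Qed.
End PsdTrace.

(** * Elliptic coefficients, maximum principle, inverse diffusion matrix *)

Section Coefs.
Variables (R : realType) (d : nat).
Local Notation V := 'rV[R]_d.
Implicit Types (a : V -> 'M[R]_d) (b : V -> V).

(** The standing assumptions for one fixed environment, with drift and Lipschitz bounds taken
    entrywise. All deterministic constants below depend on [d], [nu], [be], [K] only. *)
Record coefs (nu be K : R) a b : Prop := Coefs {
 c_nu : 1 <= nu; c_be : 0 <= be; c_K : 0 <= K;
 c_sym : forall x, (a x)^T = a x;
 c_ell : forall x y, nu^-1*enorm y^+2 <= quadf y (a x) <= nu*enorm y^+2;
 c_b : forall x i, `|b x 0 i| <= be;
 c_aL : forall x y i j, `|a x i j - a y i j| <= K*enorm (x - y);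
 c_bL : forall x y i, `|b x 0 i - b y 0 i| <= K*enorm (x - y) }.
Lemma quadfE (y : V) (A : 'M[R]_d) : quadf y A = dotv y (y *m A).
Proof.
rewrite /quadf /dotv exchange_big /=; apply: eq_bigr=> j _; rewrite mxE mulr_sumr.
by apply: eq_bigr=> i _; rewrite mulrC.
Qed.
Lemma dotv_mulmx (u v : V) (A : 'M[R]_d) : dotv u (v *m A) = dotv (u *m A^T) v.
Proof.
rewrite /dotv; under eq_bigr do rewrite mxE mulr_sumr.
rewrite exchange_big /=; apply: eq_bigr=> i _; rewrite mxE mulr_suml; apply: eq_bigr=> j _.
by rewrite mxE; ring.
Qed.
Lemma quad_line (x v : V) (f : V -> R) G H : C2 f G H ->
 is_derive (0 : R) 1 (fun t : R=> dotv (G (x + t *: v)) v) (\sum_i \sum_j v 0 i*H x i j*v 0 j).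
Proof.
move=> [_ h2 _].
have h3 := D1_sum (index_enum 'I_d) (fun j=> D1_scale (v 0 j) (h2 j)).
have := D1_line x v 0 h3; rewrite scale0r addr0.
congr is_derive; first by apply/funext=> t; apply: eq_bigr=> i _; rewrite mulrC.
rewrite dotvC dotv_sumr; apply: eq_bigr=> i _; rewrite dotvZr /dotv mulr_sumr.
by apply: eq_bigr=> j _; rewrite mxE; ring.
Qed.
(** Along every line through the minimum the first derivative vanishes and the second is
    nonnegative; the second order part of [LL] is then a trace as in [psd_trace]. *)
Lemma LL_min_ge0 nu be K a b f G H x : coefs nu be K a b -> C2 f G H ->
 (forall y, f x <= f y) -> 0 <= LL a b G H x.
Proof.
move=> hc hf hm; have [h1 _ _] := hf.
have key v: dotv (G x) v = 0 /\ 0 <= \sum_i \sum_j v 0 i*H x i j*v 0 j.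
 have := min_second_order (fun t=> D1_line x v t h1) (quad_line x v hf).
 rewrite !scale0r !addr0; apply=> t; exact: hm.
rewrite /LL [X in _ + X]big1 ?addr0; last first.
 by move=> i _; rewrite -(dotv_evec (G x)) (key _).1 mulr0.
rewrite mulr_ge0 ?invr_ge0 //; apply: psd_trace.
- by move=> i j; rewrite -{1}(c_sym hc) mxE.
- move=> v [i0 vi0].
 have /andP[h _] := c_ell hc x (\row_i v i).
 apply: lt_le_trans (le_trans h _).
  rewrite mulr_gt0 ?invr_gt0 ?(lt_le_trans _ (c_nu hc)) // exprn_gt0 // lt_def enorm_ge0 andbT.
  apply/eqP=> /enorm_eq0 /rowP/(_ i0); rewrite !mxE=> E.
  by rewrite E eqxx in vi0.
 rewrite /quadf le_eqVlt; apply/orP; left; apply/eqP.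
 by apply: eq_bigr=> i _; apply: eq_bigr=> j _; rewrite !mxE.
- move=> v; have [_] := key (\row_i v i); congr (0 <= _).
 by apply: eq_bigr=> i _; apply: eq_bigr=> j _; rewrite !mxE.
Qed.
Lemma ball_compact (M : R) : exists2 B : set V, compact B & forall y, enorm y <= M -> B y.
Proof.
exists [set v | forall i, [set` `[- `|M|, `|M|]] (v 0 i)].
 by apply: (@rV_compact R d (fun=> [set` `[- `|M|, `|M|]]))=> i; exact: segment_compact.
move=> y hy i /=; rewrite in_itv /= -ler_norml (le_trans (coord_le _ _)) //.
by rewrite (le_trans hy) // ler_norm.
Qed.
(** The minimum over a compact set containing the support is global, because it is negative and [f]
    vanishes elsewhere. *)
Lemma bsupp_min (f : V -> R) : cont f -> bsupp f -> (exists y, f y < 0) ->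
 exists x, forall y, f x <= f y.
Proof.
move=> cf [M hM] [y0 hy0].
have [B cB inB] := ball_compact M.
have By0: B y0 by apply: inB; rewrite leNgt; apply/negP=> /hM E; rewrite E ltxx in hy0.
have B0: B !=set0 by exists y0.
have [c _ hc] := EVT_min_rV B0 cB (continuous_subspaceT (cont_continuous cf)).
have hy: f c <= f y0 by apply: hc; rewrite inE.
exists c=> y; have [h|/hM ->] := leP (enorm y) M; first by apply: hc; rewrite inE; exact: inB.
by apply: ltW; apply: le_lt_trans hy hy0.
Qed.
(** At a global minimum below [- (e/kap)] the operator is nonnegative while [(kap + W) f] is below
    [- e]. The bound involves neither the coefficients nor [W], which makes all later comparisons
    uniform. *)
Lemma max_principle nu be K a b (kap e : R) (W : V -> R) f G H :
 coefs nu be K a b -> 0 < kap -> 0 <= e -> (forall x, 0 <= W x) -> C2 f G H -> bsupp f ->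
 (forall x, - e <= (kap + W x)*f x - LL a b G H x) -> forall x, - (e/kap) <= f x.
Proof.
move=> hc k0 e0 hW hf hs h x; rewrite leNgt; apply/negP=> hx.
have ek: 0 <= e/kap by rewrite divr_ge0 // ltW.
have [f1 _ _] := hf.
have [c hm] : exists c, forall y, f c <= f y.
 by apply: bsupp_min=> //; [exact: D1_cont f1|exists x; lra].
have L0 := LL_min_ge0 hc hf hm.
have fc: f c < - (e/kap) by apply: le_lt_trans (hm x) hx.
have := h c; have := hW c=> W0 hc'.
have : kap*f c < - e.
 by rewrite -(ltr_pM2l k0) mulrN mulrCA mulfV ?gt_eqF // mulr1 in fc.
have : W c*f c <= 0 by rewrite mulr_ge0_le0 //; lra.
move: hc'; rewrite mulrDl; lra.
Qed.

Section Ineq.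
Variables (nu be K : R) (a : V -> 'M[R]_d) (b : V -> V).
Hypothesis hc : coefs nu be K a b.
Let nu0 : 0 < nu := lt_le_trans ltr01 (c_nu hc).
Lemma c_aE x i j : a x i j = a x j i.
Proof. by rewrite -{1}(c_sym hc) mxE. Qed.
Lemma quadf_evec x i j (s : R) :
 quadf (evec R i + s *: evec R j) (a x) = a x i i + s*a x i j + (s*a x j i + s^+2*a x j j).
Proof.
rewrite quadfE mulmxDl dotvDl !dotvDr -scalemxAl !dotvZl !dotvZr.
rewrite !(dotvC (evec R _)) !dotv_evec /evec -!rowE !mxE; ring.
Qed.
Lemma c_abound x i j : `|a x i j| <= nu.
Proof.
have diag k: a x k k <= nu.
 have /andP[_] := c_ell hc x (evec R k).
 have := quadf_evec x k k 0; rewrite scale0r addr0=> ->.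
 by rewrite enorm_evec expr0n !mul0r expr1n !addr0 mulr1.
have h s: 0 <= quadf (evec R i + s *: evec R j) (a x).
 have /andP[+ _] := c_ell hc x (evec R i + s *: evec R j); apply: le_trans.
 by rewrite mulr_ge0 ?invr_ge0 ?(ltW nu0) // sqr_ge0.
(* Nonnegativity of the form on [e_i + e_j] and [e_i - e_j] bounds an off-diagonal entry by the mean
   of two diagonal ones. *)
have := h 1; have := h (-1); rewrite !quadf_evec (c_aE x j i).
have := diag i; have := diag j=> *; rewrite ler_norml; apply/andP; split; nra.
Qed.
Definition ainv x := invmx (a x).
Lemma a_unit x : a x \in unitmx.
Proof.
rewrite -row_free_unit; apply: inj_row_free=> v hv.
have /andP[h _] := c_ell hc x v; rewrite quadfE hv dotv0 in h.
apply: enorm_eq0; apply/eqP; rewrite -sqrf_eq0; apply/eqP/le_anti; rewrite sqr_ge0 andbT.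
by rewrite pmulr_rle0 ?invr_gt0 in h.
Qed.
Lemma ainv_sym x : (ainv x)^T = ainv x.
Proof. by rewrite /ainv trmx_inv (c_sym hc). Qed.
Lemma ainv_ell x (z : V) : nu^-1*enorm z^+2 <= dotv z (z *m ainv x) <= nu*enorm z^+2.
Proof.
set y := z *m ainv x.
have zE: z = y *m a x by rewrite /y mulmxKV // a_unit.
have /andP[h1 h2] := c_ell hc x y; rewrite quadfE -zE dotvC in h1 h2.
have hzy := dotv_le z y; have n0 := enorm_ge0 z; have n1 := enorm_ge0 y.
have y1: enorm y <= nu*enorm z.
 have [y0|y0] := eqVneq (enorm y) 0; first by rewrite y0 mulr_ge0 // ltW.
 have yp: 0 < enorm y by rewrite lt_def y0.
 rewrite -(ler_pM2r yp); have := le_trans h1 hzy; rewrite mulrC ler_pdivrMr // expr2; lra.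
have z1: enorm z^+2 <= nu*dotv z y.
 (* Cauchy--Schwarz for the form [a x] applied to [y] and [z = a y]. *)
 have key (t : R) : 0 <= dotv z y - 2*t*enorm z^+2 + t^+2*nu*enorm z^+2.
  have /andP[g1 _] := c_ell hc x (y - t *: z).
  have g2: 0 <= quadf (y - t *: z) (a x).
   by apply: le_trans g1; rewrite mulr_ge0 ?invr_ge0 ?(ltW nu0) ?sqr_ge0.
  have /andP[_ g3] := c_ell hc x z.
  move: g2; rewrite quadfE mulmxBl -zE -scalemxAl dotvDl !dotvDr !dotvNl !dotvNr !dotvZl !dotvZr.
  have -> : dotv y (z *m a x) = enorm z^+2.
   by rewrite dotv_mulmx (c_sym hc) -zE enorm_sqr.
  by rewrite -enorm_sqr -quadfE (dotvC y z); have := sqr_ge0 t; nra.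
 (* The value of [t] that minimizes the quadratic polynomial in [key]. *)
 have := key nu^-1.
 have -> : dotv z y - 2*nu^-1*enorm z^+2 + nu^-1^+2*nu*enorm z^+2 =
      (nu*dotv z y - enorm z^+2)/nu by fieldp.
 by rewrite pmulr_lge0 ?invr_gt0 // subr_ge0.
apply/andP; split.
 by rewrite mulrC ler_pdivrMr // [X in _ <= X]mulrC.
by apply: (le_trans hzy); rewrite expr2 mulrCA ler_wpM2l.
Qed.
Lemma enorm_ainv x (z : V) : enorm (z *m ainv x) <= nu*enorm z.
Proof.
set y := z *m ainv x.
have zE: z = y *m a x by rewrite /y mulmxKV // a_unit.
have /andP[h1 _] := c_ell hc x y; rewrite quadfE -zE dotvC in h1.
have hzy := dotv_le z y; have n0 := enorm_ge0 z; have n1 := enorm_ge0 y.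
have [y0|y0] := eqVneq (enorm y) 0; first by rewrite y0 mulr_ge0 // ltW.
have yp: 0 < enorm y by rewrite lt_def y0.
rewrite -(ler_pM2r yp); have := le_trans h1 hzy; rewrite mulrC ler_pdivrMr // expr2; lra.
Qed.
Lemma ainv_coord x (z : V) i : `|(z *m ainv x) 0 i| <= nu*enorm z.
Proof. exact: le_trans (coord_le _ _) (enorm_ainv _ _). Qed.
Lemma ainv_bound x i j : `|ainv x i j| <= nu.
Proof.
have := ainv_coord x (evec R i) j; rewrite enorm_evec mulr1; congr (_ <= _).
by rewrite /evec -rowE mxE.
Qed.
(** The identity [A^-1 - B^-1 = A^-1 (B - A) B^-1] for the matrices at [x] and [y], tested on [z],
    with each inverse bounded by [nu]. *)
Lemma ainv_lip x y (z : V) :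
 `|dotv z (z *m ainv x) - dotv z (z *m ainv y)| <= d%:R*d%:R*nu^+2*K*enorm (x - y)*enorm z^+2.
Proof.
set u := z *m ainv x; set w := z *m ainv y.
have zu: z = u *m a x by rewrite /u mulmxKV // a_unit.
have zw: z = w *m a y by rewrite /w mulmxKV // a_unit.
have -> : dotv z u - dotv z w = \sum_i \sum_j w 0 i*(a y i j - a x i j)*u 0 j.
 transitivity (dotv u (w *m a y) - dotv w (u *m a x)).
  by rewrite -zw -zu (dotvC u) (dotvC w).
 rewrite [dotv u _]dotvC [dotv (w *m _) _]dotvC -[w *m a y]/(w *m a y).
 rewrite (dotv_mulmx w) (c_sym hc) (dotvC u) -dotvNl -dotvDl -mulmxBr /dotv.
 under eq_bigr do rewrite mxE mulr_suml.
 rewrite exchange_big /=; apply: eq_bigr=> i _; apply: eq_bigr=> j _.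
 by rewrite !mxE.
have -> : d%:R*d%:R*nu^+2*K*enorm (x - y)*enorm z^+2 =
 d%:R*(d%:R*(nu^+2*K*enorm (x - y)*enorm z^+2)) by ring.
apply: sumd_abs=> i; apply: sumd_abs=> j.
have h1 := ainv_coord y z i; have h2 := ainv_coord x z j; have h3 := c_aL hc y x i j.
rewrite !normrM; rewrite enormB in h3.
have -> : nu^+2*K*enorm (x - y)*enorm z^+2 = (nu*enorm z)*(K*enorm (x - y))*(nu*enorm z) by ring.
by apply: ler_pM=> //; apply: ler_pM.
Qed.

End Ineq.
End Coefs.

(** * Scalar inequalities for Gaussian decay and singular sums *)

Section Decay.
Variable R : realType.
Lemma expR_lip (x y : R) : 0 <= x -> 0 <= y -> `|expR (- x) - expR (- y)| <= `|x - y|*(expR (- x) + expR (- y)).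
Proof.
wlog xy : x y/x <= y.
 move=> H x0 y0; have [h|/ltW h] := leP x y; first exact: H.
 by rewrite distrC (distrC x) (addrC (expR (- x))); apply: H.
move=> x0 y0.
have h: expR (- y) <= expR (- x) by rewrite ler_expR lerN2.
rewrite ger0_norm ?subr_ge0 // ler0_norm ?subr_le0 // opprB.
have h2: expR (- y) = expR (- x)*expR (x - y) by rewrite -expRD; congr expR; ring.
have h3: 1 + (x - y) <= expR (x - y) by exact: expR_ge1Dx.
have e0 := expR_ge0 (- x); have e1 := expR_ge0 (- y).
have : expR (- x)*(1 + (x - y)) <= expR (- y) by rewrite h2 ler_wpM2l.
nra.
Qed.
(** Bound [1 + s] by [expR s], then complete the square in the exponent. *)
Lemma exp_poly (n : nat) (c : R) : 0 < c -> forall s, 0 <= s ->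
 (1 + s)^+n <= expR (n%:R^+2/(4*c))*expR (c*s^+2).
Proof.
move=> c0 s s0; apply: (le_via (expR s^+n)).
 by rewrite lerXn2r ?nnegrE ?addr_ge0 ?expR_ge0 // expR_ge1Dx.
rewrite -expRM_natl -expRD ler_expR.
have : 0 <= (n%:R/(2*c) - s)^+2 by rewrite sqr_ge0.
have -> : (n%:R/(2*c) - s)^+2 = (n%:R^+2/(4*c) + c*s^+2 - n%:R*s)/c.
 by fieldp.
by rewrite pmulr_lge0 ?invr_gt0 // subr_ge0.
Qed.
(** The function [u/(1 + |u|)] has values in [[-1, 1]], and four times its increment over a step
    [eta] dominates the summand; the sum telescopes to at most [4 * 2]. *)
Lemma sum_decay (n : nat) (v eta : R) : 0 < eta -> eta <= 1 ->
 \sum_(j < n) eta*((1 + `|v - eta*j%:R|)^+2)^-1 <= 8.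
Proof.
move=> e0 e1.
pose B (u : R) := u/(1 + `|u|).
have B1 u: `|B u| <= 1.
 rewrite normrM normfV [X in _/X]ger0_norm ?addr_ge0 // ler_pdivrMr ?mul1r ?ltr_wpDr //.
 by rewrite lerDr.
have key u: eta*((1 + `|u|)^+2)^-1 <= 4*(B u - B (u - eta)).
 have aux (x z : R) : 0 <= x -> z <= 4*(1 + x) -> 0 < z ->
   eta*((1 + x)^+2)^-1 <= 4*(eta/((1 + x)*z)).
  move=> x0 xz z0; rewrite mulrCA ler_wpM2l ?(ltW e0) //.
  have x1: 0 < 1 + x by lra.
  rewrite expr2 !invfM mulrCA ler_wpM2l ?invr_ge0 ?(ltW x1) //.
  by rewrite -[4/z]invrK invf_div lef_pV2 ?posrE ?divr_gt0 // ler_pdivrMr // mulrC.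
 rewrite /B; have [u0|u0] := leP u 0.
  have -> : u/(1 + `|u|) - (u - eta)/(1 + `|u - eta|) = eta/((1 + `|u|)*(1 + `|u| + eta)).
   rewrite !ler0_norm //; last by lra.
   by field; rewrite !gt_eqF //; lra.
  by apply: aux=> //; have := normr_ge0 u; lra.
 have [u1|u1] := leP eta u.
  have -> : u/(1 + `|u|) - (u - eta)/(1 + `|u - eta|) = eta/((1 + `|u|)*(1 + `|u| - eta)).
   rewrite !ger0_norm //; try lra.
   by field; rewrite !gt_eqF //; lra.
  by apply: aux; rewrite ?ger0_norm //; lra.
 rewrite gtr0_norm // ltr0_norm; last by lra.
 have h1: eta*((1 + u)^+2)^-1 <= eta.
  rewrite ger_pMr // invf_le1 ?exprn_gt0 //; last lra.
  by rewrite expr_ge1 //; lra.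
 have h2: u/2 <= u/(1 + u) by rewrite ler_wpM2l ?(ltW u0) // lef_pV2 ?posrE; lra.
 have h3: (eta - u)/2 <= (eta - u)/(1 + (eta - u)).
  by rewrite ler_wpM2l ?lef_pV2 ?posrE; lra.
 have -> : (u - eta)/(1 - (u - eta)) = - ((eta - u)/(1 + (eta - u))).
  by rewrite -mulNr opprB; congr (_/(1 + _)); ring.
 lra.
apply: (le_via (\sum_(j < n) 4*(B (v - eta*j%:R) - B (v - eta*j.+1%:R)))).
 apply: ler_sum=> j _.
 have -> : v - eta*(nat_of_ord j).+1%:R = v - eta*(nat_of_ord j)%:R - eta by rewrite -natr1; ring.
 exact: key.
rewrite -mulr_sumr -(big_mkord xpredT (fun j=> B (v - eta*j%:R) - B (v - eta*j.+1%:R))).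
have -> : \sum_(0 <= j < n) (B (v - eta*j%:R) - B (v - eta*j.+1%:R)) = B (v - eta*0%:R) - B (v - eta*n%:R).
 have := telescope_sumr (fun j=> B (v - eta*j%:R)) (leq0n n).
 move=> E; rewrite -opprB -E -sumrN; apply: eq_bigr=> j _; by rewrite opprB.
have := B1 (v - eta*0%:R); have := B1 (v - eta*n%:R); rewrite !ler_norml; lra.
Qed.
(** Each summand is at most the increment of twice the square root over the preceding step, so the
    singularity at time 0 is summed uniformly in [tau]. *)
Lemma sum_sqrtV (n0 n1 : nat) (tau : R) : 0 < tau -> (0 < n0)%N ->
 \sum_(n0 <= k < n1) tau*(sqrt (tau*k%:R))^-1 <= 2*sqrt (tau*n1%:R).
Proof.
move=> t0 n0p.
have key (k : nat) : (0 < k)%N -> tau*(sqrt (tau*k%:R))^-1 <=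
  2*(sqrt (tau*k%:R) - sqrt (tau*k.-1%:R)).
 case: k=> // k _ /=.
 set a := sqrt _; set b := sqrt (tau*k%:R).
 have a2: a^+2 = tau*k.+1%:R by rewrite sqr_sqrtr // mulr_ge0 // ltW.
 have b2: b^+2 = tau*k%:R by rewrite sqr_sqrtr // mulr_ge0 // ltW.
 have a0: 0 < a by rewrite sqrtr_gt0 mulr_gt0.
 have b0: 0 <= b by rewrite sqrtr_ge0.
 rewrite ler_pdivrMr //.
 have : a^+2 - b^+2 = tau by rewrite a2 b2 -natr1; ring.
 nra.
have [le|lt] := leqP n0 n1; last by rewrite big_geq ?(ltnW lt) // mulr_ge0 ?sqrtr_ge0.
apply: (le_via (\sum_(n0 <= k < n1) 2*(sqrt (tau*k%:R) - sqrt (tau*k.-1%:R)))).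
 by apply: ler_sum_nat=> k /andP[h _]; apply: key; exact: leq_trans h.
rewrite -mulr_sumr ler_wpM2l //.
have E: \sum_(n0 <= k < n1) (sqrt (tau*k%:R) - sqrt (tau*k.-1%:R)) =
  sqrt (tau*n1.-1%:R) - sqrt (tau*n0.-1%:R).
 have := telescope_sumr (fun k=> sqrt (tau*k.-1%:R)) le=> <-.
 by [].
rewrite E lerBlDr (le_trans _ (_ : sqrt (tau*n1%:R) <= _)) ?lerDl ?sqrtr_ge0 //.
by rewrite ler_wsqrtr // ler_wpM2l ?(ltW t0) // ler_nat leq_pred.
Qed.

End Decay.

(** * Frozen Gaussian kernels and the parametrix error *)

Section Kernel.
Variables (R : realType) (d : nat).
Local Notation V := 'rV[R]_d.
Variables (nu be K : R) (a : V -> 'M[R]_d) (b : V -> V).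
Hypothesis hc : coefs nu be K a b.
Let nu0 : 0 < nu := lt_le_trans ltr01 (c_nu hc).
Definition Qf (y z : V) : R := dotv z (z *m ainv a y).
(** Heat kernel of the driftless operator with diffusion matrix frozen at [y], without its
    normalizing constant; the missing factor reappears as [Jn]. *)
Definition GZ (y : V) (t : R) (z : V) : R := (sqrt t)^-1^+d*expR (- (Qf y z/(2*t))).
(** A majorant of all the Gaussians that factors over the coordinates, so that its grid sums reduce
    to [sum_decay]. *)
Definition KK (t : R) (z : V) : R := \prod_i ((sqrt t)^-1*((1 + `|z 0 i|/sqrt t)^+2)^-1).
Lemma Qf_ge y z : nu^-1*enorm z^+2 <= Qf y z.
Proof. by have /andP[] := ainv_ell hc y z. Qed.
Lemma Qf_le y z : Qf y z <= nu*enorm z^+2.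
Proof. by have /andP[] := ainv_ell hc y z. Qed.
Lemma Qf_ge0 y z : 0 <= Qf y z.
Proof. by apply: le_trans (Qf_ge y z); rewrite mulr_ge0 ?invr_ge0 ?(ltW nu0) ?sqr_ge0. Qed.
Lemma GZ_ge0 y t z : 0 <= GZ y t z.
Proof. by rewrite mulr_ge0 ?expR_ge0 // exprn_ge0 // invr_ge0 sqrtr_ge0. Qed.
Lemma KK_ge0 t z : 0 <= KK t z.
Proof.
by apply: prodr_ge0=> i _; rewrite mulr_ge0 ?invr_ge0 ?sqrtr_ge0 // exprn_ge0.
Qed.
Lemma GZ_exp y t z : 0 < t -> GZ y t z = expR (- (d%:R/2 * ln t) - Qf y z/2*t^-1).
Proof.
move=> t0; rewrite /GZ expRD; congr (_*expR _); last by fieldp.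
have -> : sqrt t = expR (ln t/2).
 rewrite -[in LHS](lnK (x := t)) ?posrE //.
 have -> : expR (ln t) = expR (ln t/2)^+2 by rewrite -expRM_natl; congr expR; field.
 by rewrite sqrtr_sqr ger0_norm // expR_ge0.
by rewrite -expRN -expRM_natl; congr expR; ring.
Qed.
(** Cost of absorbing [n] powers of [1 + |z|/sqrt t], together with the [2 d] powers needed for
    [KK], into half of the Gaussian exponent. *)
Definition gC (n : nat) : R := expR ((n + d.*2)%:R^+2*nu).
Lemma gC_gt0 n : 0 < gC n. Proof. exact: expR_gt0. Qed.
Lemma GZ_le n y t z : 0 < t -> (1 + enorm z/sqrt t)^+n*GZ y t z <=
 gC n*expR (- ((enorm z/sqrt t)^+2/(4*nu)))*KK t z.
Proof.
move=> t0; set s := sqrt t; have s0: 0 < s by rewrite sqrtr_gt0.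
set r := enorm z/s; have r0: 0 <= r by rewrite divr_ge0 ?enorm_ge0 ?ltW.
have st: s^+2 = t by rewrite sqr_sqrtr // ltW.
rewrite /GZ /KK -/s.
have -> : \prod_i (s^-1*((1 + `|z 0 i|/s)^+2)^-1) = s^-1^+d*(\prod_i (1 + `|z 0 i|/s)^+2)^-1.
 by rewrite big_split /= prodr_const card_ord prodfV.
rewrite mulrCA [X in _ <= X]mulrCA ler_wpM2l ?exprn_ge0 ?invr_ge0 ?(ltW s0) //.
set P := \prod_i _.
have P0: 0 < P by apply: prodr_gt0=> i _; rewrite exprn_gt0 // ltr_wpDr // divr_ge0 // ltW.
have P1: P <= (1 + r)^+d.*2.
 rewrite -muln2 mulnC exprM.
 apply: (le_via (\prod_(i < d) (1 + r)^+2)); last by rewrite prodr_const card_ord.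
 apply: ler_prod=> i _; rewrite exprn_ge0 ?addr_ge0 ?divr_ge0 ?(ltW s0) //=.
 rewrite lerXn2r ?nnegrE ?addr_ge0 ?divr_ge0 ?enorm_ge0 ?(ltW s0) //.
 by rewrite lerD2l ler_pM2r ?invr_gt0 // coord_le.
rewrite ler_pdivlMr // mulrAC.
apply: (le_via ((1 + r)^+(n + d.*2)*expR (- (r^+2/(2*nu))))).
 rewrite exprD; apply: ler_pM; rewrite ?mulr_ge0 ?exprn_ge0 ?addr_ge0 ?expR_ge0 ?(ltW P0) //.
  by rewrite ler_wpM2l ?exprn_ge0 ?addr_ge0.
 rewrite ler_expR lerN2.
 have -> : r^+2/(2*nu) = nu^-1*enorm z^+2/(2*t).
  by rewrite /r -st expr_div_n; fieldp.
 by rewrite ler_wpM2r ?invr_ge0 ?mulr_ge0 ?(ltW t0) // Qf_ge.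
have c0: 0 < (4*nu)^-1 by rewrite invr_gt0 mulr_gt0.
have := exp_poly (n + d.*2) c0 r0.
have -> : (n + d.*2)%:R^+2/(4*(4*nu)^-1) = (n + d.*2)%:R^+2*nu by fieldp.
rewrite -/(gC n)=> h.
apply: (le_trans (ler_wpM2r (expR_ge0 _) h)); rewrite -mulrA -expRD ler_wpM2l ?(ltW (gC_gt0 n)) //.
rewrite ler_expR le_eqVlt; apply/orP; left; apply/eqP; field; by rewrite gt_eqF.
Qed.
Lemma GZ_le_sup y t z : 0 < t -> GZ y t z <= (sqrt t)^-1^+d.
Proof.
move=> t0; rewrite /GZ ler_piMr ?exprn_ge0 ?invr_ge0 ?sqrtr_ge0 // -expR0 ler_expR oppr_le0.
by rewrite divr_ge0 ?Qf_ge0 // mulr_ge0 // ltW.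
Qed.
Lemma GZ_le1 n y t z : 0 < t -> (1 + enorm z/sqrt t)^+n*GZ y t z <= gC n*KK t z.
Proof.
move=> t0; apply: le_trans (GZ_le n y z t0) _; rewrite ler_wpM2r ?KK_ge0 //.
rewrite ger_pMr ?gC_gt0 // -expR0 ler_expR oppr_le0 divr_ge0 ?sqr_ge0 ?mulr_ge0 ?(ltW nu0) //.
Qed.
Lemma Qf_diff y z z' : `|Qf y z - Qf y z'| <= nu*enorm (z - z')*(enorm z + enorm z').
Proof.
have -> : Qf y z - Qf y z' = dotv (z - z') (z *m ainv a y) + dotv z' ((z - z') *m ainv a y).
 rewrite /Qf mulmxBl !dotvDl dotvDr !dotvNl !dotvNr; ring.
rewrite normDt //.
have h1 := dotv_abs (z - z') (z *m ainv a y); have h2 := dotv_abs z' ((z - z') *m ainv a y).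
have h3 := enorm_ainv hc y z; have h4 := enorm_ainv hc y (z - z').
have e1 := enorm_ge0 (z - z'); have e2 := enorm_ge0 z'.
have h5 := ler_wpM2l e1 h3; have h6 := ler_wpM2l e2 h4.
nra.
Qed.
Lemma GZ_diffQ y y' t z z' : 0 < t ->
 `|GZ y t z - GZ y' t z'| <= `|Qf y z - Qf y' z'|/(2*t)*(GZ y t z + GZ y' t z').
Proof.
move=> t0; rewrite /GZ -mulrBr normrM ger0_norm ?exprn_ge0 ?invr_ge0 ?sqrtr_ge0 //.
rewrite -mulrDr mulrCA ler_wpM2l ?exprn_ge0 ?invr_ge0 ?sqrtr_ge0 //.
have t2: 0 < 2*t by lra.
apply: le_trans (expR_lip _ _) _; rewrite ?divr_ge0 ?Qf_ge0 ?(ltW t2) //.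
by rewrite -mulrBl normrM [`|(2*t)^-1|]ger0_norm // invr_ge0 ltW.
Qed.
Definition ZG t y x : V := (- (GZ y t (x - y)/t)) *: ((x - y) *m ainv a y).
Definition ZH t y x : 'M[R]_d := \matrix_(j, i) (GZ y t (x - y) *
 (((x - y) *m ainv a y) 0 j*((x - y) *m ainv a y) 0 i/t^+2 - ainv a y j i/t)).
Lemma Z_C2 t y : 0 < t -> C2 (fun x=> GZ y t (x - y)) (ZG t y) (ZH t y).
Proof.
move=> t0; pose c : R := (sqrt t)^-1^+d; pose m : R := - (2*t)^-1.
pose h (q : R) := c*expR (m*q).
have dm (k : R) (q : R) : is_derive q 1 (fun q=> k*expR (m*q)) (k * m*expR (m*q)).
 have h1: is_derive q 1 ( *%R m) m.
  apply: is_derive_eq (is_deriveZ m (is_derive_id q 1)) _.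
  by rewrite /GRing.scale /= mulr1.
 have h2 := is_derive1_comp (is_derive_expR (m*q)) h1.
 have h3 := is_deriveZ k h2; apply: is_derive_eq h3 _.
 by rewrite /GRing.scale /=; ring.
have hq := C2_quad y (ainv_sym hc y).
have := @C2_comp _ _ h (fun q=> c * m*expR (m*q)) (fun q=> c * m * m*expR (m*q)) _ _ _ _ _ _ hq.
move=> /(_ (fun z=> dm c _) (fun z=> dm (c * m) _)) H.
have {}H := H (fun z=> is_derive_cont (dm (c * m * m) _)).
have hE x: h (dotv (x - y) ((x - y) *m ainv a y)) = GZ y t (x - y).
 by rewrite /h /GZ /Qf /c /m; congr (_*expR _); ring.
apply: C2_ext H=> x /=.
- exact: hE.
- rewrite /ZG -hE /h scalerA; congr (_ *: _); rewrite /m; field; by rewrite gt_eqF.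
- apply/matrixP=> j i; rewrite !mxE -hE /h /m; field; by rewrite gt_eqF.
Qed.
(** Relative parametrix error: the kernel frozen at [y] solves its own heat equation exactly, so
    only the differences [a x - a y] and the drift remain. *)
Definition Pk t y x : R :=
 2^-1*(\sum_i \sum_j (a x i j - a y i j) *
  (((x - y) *m ainv a y) 0 j*((x - y) *m ainv a y) 0 i/t^+2 - ainv a y j i/t))
 - \sum_i b x 0 i*(((x - y) *m ainv a y) 0 i/t).
Definition ek t y x : R := GZ y t (x - y)*Pk t y x.
Definition dtZ t y x : R := GZ y t (x - y)*(Qf y (x - y)/(2*t^+2) - d%:R/(2*t)).
Lemma Z_LL t y x : 0 < t -> LL a b (ZG t y) (ZH t y) x = dtZ t y x + ek t y x.
Proof.
move=> t0; set w := (x - y) *m ainv a y.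
have E1: \sum_i \sum_j a y i j*(w 0 j*w 0 i/t^+2 - ainv a y j i/t) = Qf y (x - y)/t^+2 - d%:R/t.
 transitivity ((\sum_i \sum_j a y i j*(w 0 j*w 0 i))/t^+2 - (\sum_i \sum_j a y i j*ainv a y j i)/t).
  rewrite !mulr_suml -sumrB; apply: eq_bigr=> i _; rewrite !mulr_suml -sumrB; apply: eq_bigr=> j _; ring.
 congr (_/_ - _/_).
  have -> : Qf y (x - y) = dotv w (w *m a y) by rewrite /Qf -/w dotvC /w mulmxKV // (a_unit hc).
  by rewrite -quadfE; apply: eq_bigr=> i _; apply: eq_bigr=> j _; ring.
 transitivity (\sum_(i < d) (1%:M : 'M[R]_d) i i).
  apply: eq_bigr=> i _; rewrite -(mulmxV (a_unit hc y)) mxE; by apply: eq_bigr.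
 by under eq_bigr do rewrite mxE eqxx; rewrite sumr_const card_ord.
have -> : dtZ t y x = GZ y t (x - y)*(2^-1*(Qf y (x - y)/t^+2 - d%:R/t)).
 by rewrite /dtZ; fieldp.
rewrite -E1 /ek /Pk -/w /LL -mulrDr addrA -mulrDr; rewrite mulrBr; congr (_ + _).
 rewrite mulrCA; congr (_*_); rewrite -big_split mulr_sumr; apply: eq_bigr=> i _ /=.
 rewrite -big_split mulr_sumr; apply: eq_bigr=> j _ /=; rewrite !mxE -/w; ring.
rewrite -mulrN -sumrN mulr_sumr; apply: eq_bigr=> i _; rewrite !mxE -/w; ring.
Qed.
Definition c3 : R := d%:R*d%:R*K*nu^+2 + d%:R*be*nu.
(** Second derivatives of the kernel cost [1/t], but the Lipschitz bound on [a] contributes a factor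
    [|x - y|] of order [sqrt t]; the result is the integrable singularity [t^(-1/2)]. *)
Lemma Pk_le t y x : 0 < t -> `|Pk t y x| <= c3*(sqrt t)^-1*(1 + enorm (x - y)/sqrt t)^+3.
Proof.
move=> t0; set s := sqrt t; have s0: 0 < s by rewrite sqrtr_gt0.
have st: t = s^+2 by rewrite sqr_sqrtr // ltW.
set z := x - y; set r := enorm z/s; have r0: 0 <= r by rewrite divr_ge0 ?enorm_ge0 ?ltW.
have zr: enorm z = r*s by rewrite /r divfK // gt_eqF.
have K0 := c_K hc; have b0 := c_be hc; have n1 := c_nu hc.
have w1 i := ainv_coord hc y z i.
have nn: 0 <= nu*enorm z by rewrite mulr_ge0 ?enorm_ge0 // ltW.
rewrite /Pk -/z normBt // normrM ger0_norm ?invr_ge0 //.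
have h1: `|\sum_i \sum_j (a x i j - a y i j)*((z *m ainv a y) 0 j*(z *m ainv a y) 0 i/t^+2 - ainv a y j i/t)|
  <= d%:R*(d%:R*(K*enorm z*((nu*enorm z)*(nu*enorm z)/t^+2 + nu/t))).
 apply: sumd_abs=> i; apply: sumd_abs=> j; rewrite normrM; apply: ler_pM=> //; first exact: c_aL hc _ _ _ _.
 rewrite normBt // !normrM !normfV.
 rewrite [`|t^+2|]ger0_norm ?exprn_ge0 ?(ltW t0) // [`|t|]gtr0_norm //.
 apply: lerD; first by rewrite ler_wpM2r ?invr_ge0 ?exprn_ge0 ?(ltW t0) //; apply: ler_pM.
 by rewrite ler_wpM2r ?invr_ge0 ?(ltW t0) // (ainv_bound hc).
have h2: `|\sum_i b x 0 i*((z *m ainv a y) 0 i/t)| <= d%:R*(be*(nu*enorm z/t)).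
 apply: sumd_abs=> i; rewrite normrM; apply: ler_pM=> //; first exact: c_b hc _ _.
 by rewrite normrM normfV [`|t|]gtr0_norm // ler_wpM2r ?invr_ge0 ?(ltW t0).
apply: le_trans (lerD (ler_wpM2l _ h1) h2) _; first by rewrite invr_ge0.
have -> : 2^-1*(d%:R*(d%:R*(K*enorm z*(nu*enorm z*(nu*enorm z)/t^+2 + nu/t)))) +
 d%:R*(be*(nu*enorm z/t)) =
 (d%:R*d%:R*K*nu*(nu*r^+3 + r)/2 + d%:R*be*nu*r)*s^-1.
 by rewrite zr st; fieldp.
rewrite [X in _ <= X]mulrAC ler_wpM2r ?invr_ge0 ?(ltW s0) // /c3 mulrDl.
have r3: 0 <= r^+3 by rewrite exprn_ge0.
have r2: 0 <= r^+2 by rewrite exprn_ge0.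
have E3: (1 + r)^+3 = 1 + 3*r + 3*r^+2 + r^+3 by ring.
apply: lerD.
 have D0: 0 <= d%:R*d%:R*K by rewrite !mulr_ge0.
 have m1: nu <= nu^+2 by rewrite expr2 ler_peMl // ltW.
 have h: nu*(nu*r^+3 + r)/2 <= nu^+2*(1 + r)^+3.
  rewrite E3; have := ler_wpM2r r0 m1; have := ler_wpM2l (sqr_ge0 nu) r3; have := ler_wpM2l (sqr_ge0 nu) r2.
  have := sqr_ge0 nu; have := ler_wpM2l (sqr_ge0 nu) r0; rewrite !mulr0=> *; lra.
 by have := ler_wpM2l D0 h; rewrite !mulrA.
rewrite ler_wpM2l ?mulr_ge0 ?(ltW nu0) // E3; lra.
Qed.

End Kernel.

(** * Size and modulus of continuity of the kernels *)

Section KernelDiff.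
Variables (R : realType) (d : nat).
Local Notation V := 'rV[R]_d.
Variables (nu be K : R) (a : V -> 'M[R]_d) (b : V -> V).
Hypothesis hc : coefs nu be K a b.
Let nu0 : 0 < nu := lt_le_trans ltr01 (c_nu hc).
Local Notation C3 := (c3 d nu be K).
Local Notation gc := (gC d nu).
Lemma c3_ge0 : 0 <= C3.
Proof.
by rewrite /c3 addr_ge0 // !mulr_ge0 ?(c_K hc) ?(c_be hc) ?(ltW nu0) // exprn_ge0 // ltW.
Qed.
Lemma ek_le t y x : 0 < t -> `|ek a b t y x| <= C3*gc 3*(sqrt t)^-1*KK t (x - y).
Proof.
move=> t0; rewrite /ek normrM ger0_norm ?GZ_ge0 //.
apply: (le_trans (ler_wpM2l (GZ_ge0 _ _ _ _) (Pk_le hc _ _ t0))).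
have := GZ_le1 hc 3 y (x - y) t0=> h.
have e (u v w z : R) : u*(v*w*z) = v*w*(z*u) by ring.
rewrite e; apply: (le_trans (ler_wpM2l _ h)); first by rewrite mulr_ge0 ?c3_ge0 // invr_ge0 sqrtr_ge0.
by rewrite le_eqVlt; apply/orP; left; apply/eqP; ring.
Qed.
Lemma GZ_le0 y t z : 0 < t -> GZ a y t z <= gc 0*KK t z.
Proof. by move=> t0; have := GZ_le1 hc 0 y z t0; rewrite expr0 mul1r. Qed.
Lemma ZG_le t y x i : 0 < t -> `|ZG a t y x 0 i| <= nu*gc 1*(sqrt t)^-1*KK t (x - y).
Proof.
move=> t0; set s := sqrt t; have s0: 0 < s by rewrite sqrtr_gt0.
have st: t = s^+2 by rewrite sqr_sqrtr // ltW.
rewrite mxE normrM normrN [`|_/t|]ger0_norm ?divr_ge0 ?GZ_ge0 ?(ltW t0) //.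
have h1 := ainv_coord hc y (x - y) i.
apply: (le_trans (ler_wpM2l _ h1)); first by rewrite divr_ge0 ?GZ_ge0 ?(ltW t0).
have := GZ_le1 hc 1 y (x - y) t0; rewrite expr1 -/s=> h.
have -> : GZ a y t (x - y)/t*(nu*enorm (x - y)) = nu*s^-1*((enorm (x - y)/s)*GZ a y t (x - y)).
 by rewrite {2}st; fieldp.
have -> : nu*gc 1*s^-1*KK t (x - y) = nu*s^-1*(gc 1*KK t (x - y)) by ring.
rewrite ler_wpM2l ?mulr_ge0 ?invr_ge0 ?(ltW s0) ?(ltW nu0) //.
by apply: le_trans h; rewrite ler_wpM2r ?GZ_ge0 // lerDr.
Qed.

Lemma GZ_diff1 n y t z z' : 0 < t -> enorm (z - z') <= sqrt t ->
 (1 + enorm z/sqrt t)^+n * `|GZ a y t z - GZ a y t z'| <=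
 nu*2^+n*gc n.+1*(enorm (z - z')/sqrt t)*(KK t z + KK t z').
Proof.
move=> t0; set s := sqrt t=> hz; have s0: 0 < s by rewrite sqrtr_gt0.
have st: t = s^+2 by rewrite sqr_sqrtr // ltW.
set r := enorm z/s; set r' := enorm z'/s; set de := enorm (z - z')/s.
have r0: 0 <= r by rewrite divr_ge0 ?enorm_ge0 ?ltW.
have r'0: 0 <= r' by rewrite divr_ge0 ?enorm_ge0 ?ltW.
have d0: 0 <= de by rewrite divr_ge0 ?enorm_ge0 ?ltW.
have d1: de <= 1 by rewrite ler_pdivrMr // mul1r.
have rr: r <= r' + de by rewrite /r /r' /de -mulrDl ler_pM2r ?invr_gt0 // enorm_tri0.
have rr': r' <= r + de by rewrite /r /r' /de -mulrDl ler_pM2r ?invr_gt0 // (enormB z z') enorm_tri0.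
have h1: `|GZ a y t z - GZ a y t z'| <= nu*de*((1 + r)*GZ a y t z + (1 + r')*GZ a y t z').
 apply: (le_trans (GZ_diffQ hc _ _ _ _ t0)).
 have q: `|Qf a y z - Qf a y z'|/(2*t) <= nu*de*((r + r')/2).
  rewrite ler_pdivrMr ?mulr_gt0 // (le_trans (Qf_diff hc y z z')) // le_eqVlt; apply/orP; left; apply/eqP.
  by rewrite /r /r' /de st; fieldp.
 apply: (le_trans (ler_wpM2r _ q)); first by rewrite addr_ge0 ?GZ_ge0.
 rewrite -[X in X <= _](mulrA (nu*de)); apply: ler_wpM2l; first by rewrite mulr_ge0 ?(ltW nu0).
 by rewrite mulrDr; apply: lerD; rewrite ler_wpM2r ?GZ_ge0 //; lra.
apply: (le_trans (ler_wpM2l (exprn_ge0 n _) h1)); first by lra.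
have g1 := GZ_le1 hc n.+1 y z t0; have g2 := GZ_le1 hc n.+1 y z' t0.
rewrite -/s -/r in g1; rewrite -/s -/r' in g2.
have p1: (1 + r)^+n <= 2^+n*(1 + r')^+n.
 rewrite -exprMn lerXn2r ?nnegrE //; lra.
have p2: 1 <= 2^+n :> R by apply: exprn_ege1; rewrite ler1n.
have -> : (1 + r)^+n*(nu*de*((1 + r)*GZ a y t z + (1 + r')*GZ a y t z')) =
 nu*de*((1 + r)^+n.+1*GZ a y t z + (1 + r)^+n*(1 + r')*GZ a y t z') by rewrite exprS; ring.
have -> : nu*2^+n*gc n.+1*de*(KK t z + KK t z') =
 nu*de*(2^+n*(gc n.+1*KK t z) + 2^+n*(gc n.+1*KK t z')) by ring.
apply: ler_wpM2l; first by rewrite mulr_ge0 ?(ltW nu0).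
apply: lerD.
 apply: (le_trans g1); rewrite ler_peMl ?mulr_ge0 ?KK_ge0 ?(ltW (gC_gt0 _ _ _)) //.
apply: le_trans (ler_wpM2l (exprn_ge0 n _) g2); last by [].
rewrite [X in _ <= X]mulrA; apply: ler_wpM2r; first exact: GZ_ge0.
by rewrite exprSr mulrA; apply: ler_wpM2r=> //; lra.
Qed.
Definition c4 : R := 2*d%:R*d%:R*K*nu^+2 + d%:R*nu*(K + be).
Lemma Pk_diff t y x x' : 0 < t -> t <= 1 -> enorm (x - x') <= sqrt t ->
 `|Pk a b t y x - Pk a b t y x'| <=
 c4*(enorm (x - x')/t)*(1 + enorm (x - y)/sqrt t)^+2*4.
Proof.
move=> t0 t1; set s := sqrt t=> hz; have s0: 0 < s by rewrite sqrtr_gt0.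
have st: t = s^+2 by rewrite sqr_sqrtr // ltW.
have s1: s <= 1 by rewrite -sqrtr1 ler_wsqrtr.
have K0 := c_K hc; have b0 := c_be hc; have n1 := c_nu hc.
set z := x - y; set z' := x' - y; set w := z *m ainv a y; set w' := z' *m ainv a y.
set dx := enorm (x - x').
have zz': z - z' = x - x' by rewrite /z /z' opprB addrA subrK.
set r := enorm z/s; set r' := enorm z'/s; set de := dx/s.
have r0: 0 <= r by rewrite divr_ge0 ?enorm_ge0 ?ltW.
have r'0: 0 <= r' by rewrite divr_ge0 ?enorm_ge0 ?ltW.
have d0: 0 <= de by rewrite divr_ge0 ?enorm_ge0 ?ltW.
have d1: de <= 1 by rewrite ler_pdivrMr // mul1r.
have rr': r' <= r + de.
 by rewrite /r /r' /de /dx -zz' -mulrDl ler_pM2r ?invr_gt0 // (enormB z z') enorm_tri0.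
have zr: enorm z = r*s by rewrite /r divfK // gt_eqF.
have zr': enorm z' = r'*s by rewrite /r' divfK // gt_eqF.
have dxe: dx = de*s by rewrite /de divfK // gt_eqF.
have dx0: 0 <= dx by exact: enorm_ge0.
have wi i: `|w 0 i| <= nu*(r*s) by rewrite -zr; exact: ainv_coord hc y z i.
have wi' i: `|w' 0 i| <= nu*(r'*s) by rewrite -zr'; exact: ainv_coord hc y z' i.
have wd i: `|w 0 i - w' 0 i| <= nu*dx.
 have := ainv_coord hc y (z - z') i; rewrite {2}zz' -/dx mulmxBl -/w -/w'.
 by congr (`| _ | <= _); rewrite !mxE.
have nr: 0 <= nu*(r*s) by rewrite mulr_ge0 ?(ltW nu0) // mulr_ge0 // ltW.
have nr': 0 <= nu*(r'*s) by rewrite mulr_ge0 ?(ltW nu0) // mulr_ge0 // ltW.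
pose m i j := w 0 j*w 0 i/t^+2 - ainv a y j i/t.
pose m' i j := w' 0 j*w' 0 i/t^+2 - ainv a y j i/t.
have t2: 0 < t^+2 by rewrite exprn_gt0.
have mB i j: `|m i j| <= nu^+2*(1 + r)^+2/t.
 rewrite /m normBt // !normrM !normfV [`|t^+2|]gtr0_norm // [`|t|]gtr0_norm //.
 apply: (le_via ((nu*(r*s))*(nu*(r*s))/t^+2 + nu/t)).
  apply: lerD; first by rewrite ler_wpM2r ?invr_ge0 ?(ltW t2) //; apply: ler_pM.
  by rewrite ler_wpM2r ?invr_ge0 ?(ltW t0) // (ainv_bound hc).
 have -> : nu*(r*s)*(nu*(r*s))/t^+2 + nu/t = (nu^+2*r^+2 + nu)/t.
  by rewrite st; fieldp.
 rewrite ler_pM2r ?invr_gt0 //.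
 have : nu <= nu^+2 by rewrite expr2 ler_peMl // ltW.
 have : 0 <= nu^+2*r by rewrite mulr_ge0 ?sqr_ge0.
 have -> : (1 + r)^+2 = 1 + 2*r + r^+2 by ring.
 lra.
have mD i j: `|m i j - m' i j| <= nu^+2*(dx*(r + r')*s)/t^+2.
 have -> : m i j - m' i j = ((w 0 j - w' 0 j)*w 0 i + w' 0 j*(w 0 i - w' 0 i))/t^+2.
  by rewrite /m /m'; fieldp.
 rewrite normrM normfV [`|t^+2|]gtr0_norm // ler_wpM2r ?invr_ge0 ?(ltW t2) //.
 rewrite normDt // !normrM.
 apply: (le_via (nu*dx*(nu*(r*s)) + nu*(r'*s)*(nu*dx))).
  by apply: lerD; apply: ler_pM.
 by rewrite le_eqVlt; apply/orP; left; apply/eqP; ring.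
have -> : Pk a b t y x - Pk a b t y x' =
 2^-1*(\sum_i \sum_j ((a x i j - a x' i j) * m i j + (a x' i j - a y i j)*(m i j - m' i j)))
 - \sum_i ((b x 0 i - b x' 0 i)*(w 0 i/t) + b x' 0 i*((w 0 i - w' 0 i)/t)).
 rewrite /Pk -/z -/z' -/w -/w'.
 have -> : \sum_i \sum_j (a x i j - a y i j)*(w 0 j*w 0 i/t^+2 - ainv a y j i/t) =
  \sum_i \sum_j (a x' i j - a y i j)*(w' 0 j*w' 0 i/t^+2 - ainv a y j i/t) +
  \sum_i \sum_j ((a x i j - a x' i j) * m i j + (a x' i j - a y i j)*(m i j - m' i j)).
  rewrite -big_split; apply: eq_bigr=> i _ /=; rewrite -big_split; apply: eq_bigr=> j _ /=.
  by rewrite /m /m'; ring.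
 have -> : \sum_i b x 0 i*(w 0 i/t) = \sum_i b x' 0 i*(w' 0 i/t) +
  \sum_i ((b x 0 i - b x' 0 i)*(w 0 i/t) + b x' 0 i*((w 0 i - w' 0 i)/t)).
  by rewrite -big_split; apply: eq_bigr=> i _ /=; ring.
 ring.
rewrite normBt // normrM ger0_norm ?invr_ge0 //.
have h1: `|\sum_i \sum_j ((a x i j - a x' i j) * m i j + (a x' i j - a y i j)*(m i j - m' i j))| <=
  d%:R*(d%:R*(K*dx*(nu^+2*(1 + r)^+2/t) + K*(r'*s)*(nu^+2*(dx*(r + r')*s)/t^+2))).
 apply: sumd_abs=> i; apply: sumd_abs=> j; rewrite normDt // !normrM.
 apply: lerD; apply: ler_pM=> //; first exact: c_aL hc _ _ _ _.
 by rewrite -zr'; exact: c_aL hc _ _ _ _.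
have h2: `|\sum_i ((b x 0 i - b x' 0 i)*(w 0 i/t) + b x' 0 i*((w 0 i - w' 0 i)/t))| <=
  d%:R*(K*dx*(nu*(r*s)/t) + be*(nu*dx/t)).
 apply: sumd_abs=> i; rewrite normDt // !normrM normfV [`|t|]gtr0_norm //.
 apply: lerD; apply: ler_pM=> //; try exact: c_bL hc _ _ _; try exact: c_b hc _ _;
  by rewrite ?mulr_ge0 ?invr_ge0 ?(ltW t0) // ler_wpM2r ?invr_ge0 ?(ltW t0).
apply: (le_trans (lerD (ler_wpM2l _ h1) h2)); first by rewrite invr_ge0.
have -> : 2^-1*(d%:R*(d%:R*(K*dx*(nu^+2*(1 + r)^+2/t) +
  K*(r'*s)*(nu^+2*(dx*(r + r')*s)/t^+2)))) +
  d%:R*(K*dx*(nu*(r*s)/t) + be*(nu*dx/t)) =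
 (d%:R*d%:R*K*nu^+2*((1 + r)^+2/2 + r'*(r + r')/2) +
  d%:R*nu*(K*(r*s) + be))*(dx/t).
 by rewrite st; fieldp.
have -> : c4*(dx/t)*(1 + r)^+2*4 = (c4*((1 + r)^+2*4))*(dx/t) by ring.
apply: ler_wpM2r; first by rewrite divr_ge0 // ltW.
rewrite /c4 mulrDl.
have r2: 0 <= r^+2 by rewrite sqr_ge0.
have q1: r'*(r + r') <= 2*(1 + r)^+2 by nra.
have q2: r*s <= r by rewrite ler_piMr.
have q3: (1 + r)^+2 = 1 + 2*r + r^+2 by ring.
apply: lerD.
 have D0: 0 <= d%:R*d%:R*K*nu^+2 by pos.
 have -> : 2*d%:R*d%:R*K*nu^+2*((1 + r)^+2*4) = d%:R*d%:R*K*nu^+2*(8*(1 + r)^+2) by ring.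
 apply: ler_wpM2l=> //; have := sqr_ge0 (1 + r); lra.
have -> : d%:R*nu*(K + be)*((1 + r)^+2*4) = d%:R*nu*(K*((1 + r)^+2*4) + be*((1 + r)^+2*4)) by ring.
apply: ler_wpM2l; first by pos.
apply: lerD; first by apply: ler_wpM2l=> //; lra.
by rewrite -[X in X <= _]mulr1; apply: ler_wpM2l=> //; lra.
Qed.
Definition c5 : R := 4*c4*gc 2 + C3*nu*8*64*gc 4 + C3*gc 3.
Lemma c4_ge0 : 0 <= c4.
Proof.
by rewrite /c4 addr_ge0 // !mulr_ge0 ?addr_ge0 ?(c_K hc) ?(c_be hc) ?(ltW nu0) // exprn_ge0 // ltW.
Qed.
Lemma c5_ge0 : 0 <= c5.
Proof.
have g2 := gC_gt0 d nu 2; have g3 := gC_gt0 d nu 3; have g4 := gC_gt0 d nu 4.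
by have c30 := c3_ge0; have c40 := c4_ge0; rewrite /c5; pos.
Qed.
Lemma ek_diff t y x x' : 0 < t -> t <= 1 ->
 `|ek a b t y x - ek a b t y x'| <= c5*(enorm (x - x')/t)*(KK t (x - y) + KK t (x' - y)).
Proof.
move=> t0 t1; set s := sqrt t; have s0: 0 < s by rewrite sqrtr_gt0.
have st: t = s^+2 by rewrite sqr_sqrtr // ltW.
have k0 := KK_ge0 t (x - y); have k0' := KK_ge0 t (x' - y).
have c30 := c3_ge0; have c40 := c4_ge0.
have n0: 0 <= nu := ltW nu0.
have g2: 0 <= gc 2 := ltW (gC_gt0 _ _ _).
have g3: 0 <= gc 3 := ltW (gC_gt0 _ _ _).
have g4: 0 <= gc 4 := ltW (gC_gt0 _ _ _).
have dx0 := enorm_ge0 (x - x').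
(* Beyond distance [sqrt t] the size bound [ek_le] already implies the claim, because there
   [1/sqrt t] is at most [|x - x'|/t]. *)
have [hz|/ltW hz] := leP (enorm (x - x')) s; last first.
 rewrite normBt //.
 have h1 := ek_le y x t0; have h2 := ek_le y x' t0; rewrite -/s in h1 h2.
 apply: (le_trans (lerD h1 h2)); rewrite -mulrDr ler_wpM2r ?addr_ge0 //.
 have h3: s^-1 <= enorm (x - x')/t.
  rewrite st expr2 invfM mulrA ler_peMl ?invr_ge0 ?(ltW s0) //.
  by rewrite ler_pdivlMr // mul1r.
 apply: (le_via (C3*gc 3*(enorm (x - x')/t))).
  by rewrite ler_wpM2l // mulr_ge0.
 rewrite ler_wpM2r ?divr_ge0 ?(ltW t0) // /c5 lerDr addr_ge0 // !mulr_ge0 //.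
have -> : ek a b t y x - ek a b t y x' =
 GZ a y t (x - y)*(Pk a b t y x - Pk a b t y x') + (GZ a y t (x - y) - GZ a y t (x' - y))*Pk a b t y x'.
 by rewrite /ek; ring.
have zz': (x' - y) - (x - y) = x' - x by rewrite opprB addrA subrK.
rewrite normDt // normrM [X in _ + X]normrM [`|GZ _ _ _ _|]ger0_norm ?GZ_ge0 //.
have h1 := Pk_diff y t0 t1 hz; have h2 := Pk_le hc y x' t0; rewrite -/s in h2.
have h3 := @GZ_diff1 3 y t (x' - y) (x - y) t0; rewrite zz' (enormB x' x) -/s in h3.
have {}h3 := h3 hz.
have h4 := GZ_le1 hc 2 y (x - y) t0; rewrite -/s in h4.
have e1: GZ a y t (x - y) * `|Pk a b t y x - Pk a b t y x'| <=
  4*c4*gc 2*(enorm (x - x')/t)*(KK t (x - y) + KK t (x' - y)).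
 apply: (le_trans (ler_wpM2l (GZ_ge0 _ _ _ _) h1)).
 have -> : GZ a y t (x - y)*(c4*(enorm (x - x')/t)*(1 + enorm (x - y)/sqrt t)^+2*4) =
   4*c4*(enorm (x - x')/t)*((1 + enorm (x - y)/s)^+2*GZ a y t (x - y)) by rewrite /s; ring.
 have -> : 4*c4*gc 2*(enorm (x - x')/t)*(KK t (x - y) + KK t (x' - y)) =
   4*c4*(enorm (x - x')/t)*(gc 2*(KK t (x - y) + KK t (x' - y))) by ring.
 rewrite ler_wpM2l ?mulr_ge0 ?invr_ge0 ?(ltW t0) //; apply: (le_trans h4).
 by rewrite ler_wpM2l // lerDl.
have e2: `|GZ a y t (x - y) - GZ a y t (x' - y)| * `|Pk a b t y x'| <=
  C3*nu*8*64*gc 4*(enorm (x - x')/t)*(KK t (x - y) + KK t (x' - y)).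
 apply: (le_trans (ler_wpM2l (normr_ge0 _) h2)).
 rewrite distrC.
 have e (u v w : R) : u*(v*w) = v*(w*u) by ring.
 rewrite (e _ (C3/s)); apply: (le_trans (ler_wpM2l _ h3)); first by rewrite mulr_ge0 // invr_ge0 ltW.
 have -> : C3/s*(nu*2^+3*gc 4*(enorm (x - x')/s)*(KK t (x' - y) + KK t (x - y))) =
   C3*nu*8*gc 4*(enorm (x - x')/t)*(KK t (x - y) + KK t (x' - y)).
  by rewrite {3}st; fieldp.
 rewrite ler_wpM2r ?addr_ge0 // ler_wpM2r ?divr_ge0 ?(ltW t0) // ler_wpM2r //.
 by rewrite ler_peMr ?mulr_ge0 //; lra.
apply: (le_trans (lerD e1 e2)); rewrite -mulrDl ler_wpM2r ?addr_ge0 //.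
rewrite -mulrDl ler_wpM2r ?divr_ge0 ?(ltW t0) // /c5 lerDl mulr_ge0 //.
Qed.
Lemma GZ_diff_t t y x x' : 0 < t ->
 `|GZ a y t (x - y) - GZ a y t (x' - y)| <=
 (nu*gc 1 + gc 0)*(enorm (x - x')/sqrt t)*(KK t (x - y) + KK t (x' - y)).
Proof.
move=> t0; set s := sqrt t; have s0: 0 < s by rewrite sqrtr_gt0.
have k0 := KK_ge0 t (x - y); have k0' := KK_ge0 t (x' - y).
have g0: 0 <= gc 0 := ltW (gC_gt0 _ _ _).
have g1: 0 <= nu*gc 1 by rewrite mulr_ge0 ?(ltW nu0) ?(ltW (gC_gt0 _ _ _)).
have dx0: 0 <= enorm (x - x')/s by rewrite divr_ge0 ?enorm_ge0 ?(ltW s0).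
have zz': (x - y) - (x' - y) = x - x' by rewrite opprB addrA subrK.
have [hz|/ltW hz] := leP (enorm (x - x')) s.
 have := @GZ_diff1 0 y t (x - y) (x' - y) t0; rewrite zz'=> /(_ hz).
 rewrite !expr0 mul1r mulr1=> h; apply: (le_trans h).
 by rewrite ler_wpM2r ?addr_ge0 // ler_wpM2r // lerDl.
rewrite normBt // !ger0_norm ?GZ_ge0 //.
have h1 := GZ_le0 y (x - y) t0; have h2 := GZ_le0 y (x' - y) t0.
apply: (le_trans (lerD h1 h2)); rewrite -mulrDr ler_wpM2r ?addr_ge0 //.
have e1: 1 <= enorm (x - x')/s by rewrite ler_pdivlMr // mul1r.
rewrite -[X in X <= _]mulr1; apply: ler_pM=> //; by rewrite lerDr.
Qed.

End KernelDiff.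

(** * Smooth step, rules for the operator, spatial cutoffs *)

Section Step.
Variable R : realType.
Lemma is_derive_pos2_aff (s c t : R) : is_derive t 1 (fun t=> (max (s*t + c) 0)^+2) (2*s * max (s*t + c) 0).
Proof.
by apply: isd_ext (@isd_comp R (fun t=> max t 0^+2) (fun t=> s*t + c) t _ _ (is_derive_pos2 _) (isd_aff s c t)) _ _=> //; ring.
Qed.
Lemma maxr_cont (s c : R) : continuous (fun t : R=> max (s*t + c) 0).
Proof.
apply: cts_max; last exact: cts_cst.
by apply: cts_add; [apply: cts_mul; [exact: cts_cst|exact: cts_id]|exact: cts_cst].
Qed.
Lemma step_ex : exists sg s1 s2 : R -> R, exists C : R, 0 < C /\
 [/\ (forall t : R, -1 < t -> is_derive t 1 sg (s1 t)), (forall t : R, is_derive t 1 s1 (s2 t)), continuous s2 &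
 [/\ (forall t, -1 < t -> 0 <= sg t <= 1), (forall t, -1 < t -> t <= 1 -> sg t = 1),
   (forall t, 2 <= t -> sg t = 0),
   (forall t, s1 t <= 0 /\ `|s1 t| <= C) & (forall t, `|s2 t| <= C /\ (t <= 1 \/ 2 <= t -> s1 t = 0 /\ s2 t = 0))]].
Proof.
(* Minus the derivative of the step, up to normalization: a bump on [[1, 2]] whose squared factors
   make it continuously differentiable. *)
pose k (t : R) := (max (1*t + (-1)) 0)^+2*(max ((-1)*t + 2) 0)^+2.
pose k1 (t : R) := (max (1*t + (-1)) 0)^+2*(2*(-1) * max ((-1)*t + 2) 0)
 + (max ((-1)*t + 2) 0)^+2*(2*1 * max (1*t + (-1)) 0).
have dk (t : R) : is_derive t 1 k (k1 t).
 by apply: isd_ext (isd_mul (is_derive_pos2_aff 1 (-1) t) (is_derive_pos2_aff (-1) 2 t)) _ _=> //; rewrite /k1; ring.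
have ck: continuous k by move=> t; exact: is_derive_cont (dk t).
have [P hP] := primitive_ex (-1) ck.
have k0 t: 0 <= k t by rewrite mulr_ge0 ?sqr_ge0.
have kl t: t <= 1 -> k t = 0 by move=> h; rewrite /k max_r ?expr0n ?mul0r //; lra.
have kr t: 2 <= t -> k t = 0 by move=> h; rewrite /k [X in _*X^+2]max_r ?expr0n ?mulr0 //; lra.
have k1l t: t <= 1 -> k1 t = 0 by move=> h; rewrite /k1 !(max_r (_ : 1*t + -1 <= 0)) ?expr0n ?mul0r ?mulr0 ?addr0 //; lra.
have k1r t: 2 <= t -> k1 t = 0 by move=> h; rewrite /k1 !(max_r (_ : -1*t + 2 <= 0)) ?expr0n ?mul0r ?mulr0 ?addr0 //; lra.
have kle t: k t <= 1.
 have [h|h] := leP t 1; first by rewrite kl.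
 have [h2|h2] := leP 2 t; first by rewrite kr.
 rewrite /k !max_l; try lra.
 by rewrite -exprMn exprn_ile1 //; nra.
have k1le t: `|k1 t| <= 4.
 have [h|h] := leP t 1; first by rewrite k1l // normr0.
 have [h2|h2] := leP 2 t; first by rewrite k1r // normr0.
 rewrite /k1 !max_l; try lra.
 set u := 1*t + -1; set v := -1*t + 2.
 have u0: 0 <= u <= 1 by rewrite /u; lra.
 have v0: 0 <= v <= 1 by rewrite /v; lra.
 have uu: 0 <= u^+2*v <= 1 by nra.
 have vv: 0 <= v^+2*u <= 1 by nra.
 by rewrite ler_norml; lra.
have mono x y: -1 < x -> x <= y -> P x <= P y.
 by move=> hx hy; apply: (derive_mono hy)=> [z hz|z hz]; [apply: hP; lra|exact: k0].
have Pl x: -1 < x -> x <= 1 -> P x = P 1.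
 move=> hx h1; apply: (derive_const h1)=> z hz.
 by have := hP z; rewrite kl; [apply; lra|lra].
have Pr x: 2 <= x -> P x = P 2.
 move=> hx; apply/esym; apply: (derive_const hx)=> z hz.
 by have := hP z; rewrite kr; [apply; lra|lra].
(* The mass of the bump is positive because the bump is at least [1/256] on [[5/4, 7/4]]. *)
have c0: 0 < P 2 - P 1.
 have h1 := mono 1 (5/4) ltac:(lra) ltac:(lra).
 have h2 := mono (7/4) 2 ltac:(lra) ltac:(lra).
 suff : (5/4 : R)*(-(1/256)) + P (5/4) <= (7/4 : R)*(-(1/256)) + P (7/4) by lra.
 apply: (@derive_mono _ (fun x=> x*(-(1/256)) + P x) (fun x=> - (1/256) + k x)); first lra.
  move=> x hx.
  have hPx := hP x ltac:(lra).
  by apply: isd_ext (isd_add (isd_scale (-(1/256)) (isd_id x)) hPx) _ _=> [t|]; ring.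
 move=> x hx; rewrite /k !max_l; try lra.
 set u := 1*x + -1; set v := -1*x + 2.
 have u0: 1/4 <= u by rewrite /u; lra.
 have v0: 1/4 <= v by rewrite /v; lra.
 have : 1/16 <= u*v by nra.
 rewrite -exprMn expr2; nra.
set c := P 2 - P 1 in c0.
exists (fun t=> (P 2 - P t)/c), (fun t=> - k t/c), (fun t=> - k1 t/c), (4/c).
split; first by rewrite divr_gt0.
have ci: 0 < c^-1 by rewrite invr_gt0.
split.
- move=> t ht.
 by apply: isd_ext (isd_scale c^-1 (isd_add (isd_cst (P 2) t) (isd_opp (hP t ht)))) _ _=> [z|]; ring.
- move=> t; by apply: isd_ext (isd_scale c^-1 (isd_opp (dk t))) _ _=> [z|]; ring.
- have ck1: continuous k1.
  have c1 := @maxr_cont 1 (-1); have c2 := @maxr_cont (-1) 2.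
  by apply: cts_add; apply: cts_mul; do ?(apply: cts_mul); rewrite ?expr2 //; try exact: cts_cst;
   rewrite (_ : (fun t=> _^+2) = fun t=> _*_) //; apply: cts_mul.
 by apply: cts_mul; [exact: cts_opp|exact: cts_cst].
split.
- move=> t ht.
 have h1: P 1 <= P t.
  by have [h|/ltW h] := leP t 1; [rewrite (Pl t)|apply: mono=> //; lra].
 have h2: P t <= P 2.
  by have [h|/ltW h] := leP 2 t; [rewrite (Pr t)|apply: mono].
 apply/andP; split; first by apply: divr_ge0; [rewrite subr_ge0|exact: ltW].
 by rewrite ler_pdivrMr // mul1r /c; lra.
- by move=> t h1 h2; rewrite (Pl t) // divff // gt_eqF.
- by move=> t h; rewrite (Pr t) // subrr mul0r.
- move=> t; split; first by rewrite mulNr oppr_le0 divr_ge0 // ltW.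
 rewrite mulNr normrN ger0_norm ?divr_ge0 ?(ltW c0) // ler_pM2r //; have := kle t; lra.
- move=> t; split; first by rewrite mulNr normrN normrM [`|c^-1|]gtr0_norm // ler_pM2r.
 by move=> [h|h]; [rewrite kl // k1l //|rewrite kr // k1r //]; rewrite oppr0 mul0r.
Qed.

End Step.

Section LLrules.
Variables (R : realType) (d : nat).
Local Notation V := 'rV[R]_d.
Implicit Types (a : V -> 'M[R]_d) (b : V -> V) (f g : V -> R) (F G : V -> V) (H Hf Hg : V -> 'M[R]_d).
Lemma LL_cst0 a b x : LL a b (fun=> 0) (fun=> 0) x = 0.
Proof.
rewrite /LL !big1 ?mulr0 ?addr0 // => i _; first by rewrite mxE mulr0.
by rewrite big1 // => j _; rewrite mxE mulr0.
Qed.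
Lemma LL_add a b F G Hf Hg x :
 LL a b (fun y=> F y + G y) (fun y=> Hf y + Hg y) x = LL a b F Hf x + LL a b G Hg x.
Proof.
rewrite /LL addrACA -mulrDr -!big_split /=; congr (_*_ + _).
 by apply: eq_bigr=> i _; rewrite -big_split; apply: eq_bigr=> j _; rewrite mxE mulrDr.
by apply: eq_bigr=> i _; rewrite mxE mulrDr.
Qed.
Lemma LL_scale a b c F Hf x : LL a b (fun y=> c *: F y) (fun y=> c *: Hf y) x = c*LL a b F Hf x.
Proof.
rewrite /LL mulrDr mulrCA; congr (_*_ + _); rewrite mulr_sumr; apply: eq_bigr=> i _; last by rewrite mxE mulrCA.
by rewrite mulr_sumr; apply: eq_bigr=> j _; rewrite mxE mulrCA.
Qed.
Lemma LL_sum a b (I : Type) (r : seq I) (G : I -> V -> V) (H : I -> V -> 'M[R]_d) x :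
 LL a b (fun y=> \sum_(i <- r) G i y) (fun y=> \sum_(i <- r) H i y) x = \sum_(i <- r) LL a b (G i) (H i) x.
Proof.
elim: r=> [|i r IH].
 rewrite big_nil -[RHS](LL_cst0 a b x); congr LL; apply/funext=> y; by rewrite big_nil.
rewrite big_cons -IH -LL_add; congr LL; apply/funext=> y; by rewrite big_cons.
Qed.
Lemma LL_mul a b f g F G Hf Hg x :
 LL a b (fun y=> f y *: G y + g y *: F y)
   (fun y=> \matrix_(j, i) (f y*Hg y j i + g y*Hf y j i + (G y 0 j*F y 0 i + F y 0 j*G y 0 i))) x =
 f x*LL a b G Hg x + g x*LL a b F Hf x
 + 2^-1 * \sum_i \sum_j a x i j*(G x 0 j*F x 0 i + F x 0 j*G x 0 i).
Proof.
have e1: \sum_i \sum_j a x i j*(\matrix_(j, i) (f x*Hg x j i + g x*Hf x j i +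
  (G x 0 j*F x 0 i + F x 0 j*G x 0 i))) j i =
 f x*(\sum_i \sum_j a x i j*Hg x j i) + g x*(\sum_i \sum_j a x i j*Hf x j i)
 + \sum_i \sum_j a x i j*(G x 0 j*F x 0 i + F x 0 j*G x 0 i).
 rewrite !mulr_sumr -!big_split; apply: eq_bigr=> i _ /=.
 rewrite !mulr_sumr -!big_split; apply: eq_bigr=> j _ /=; rewrite mxE; ring.
have e2: \sum_i b x 0 i*(f x *: G x + g x *: F x) 0 i =
 f x*(\sum_i b x 0 i*G x 0 i) + g x*(\sum_i b x 0 i*F x 0 i).
 by rewrite !mulr_sumr -!big_split; apply: eq_bigr=> i _ /=; rewrite !mxE; ring.
rewrite /LL e1 e2; ring.
Qed.
Lemma LL_comp a b (h1 h2 : R) (F : V -> V) (Hf : V -> 'M[R]_d) x G H :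
 G x = h1 *: F x -> H x = \matrix_(j, i) (h2*(F x 0 j*F x 0 i) + h1*Hf x j i) ->
 LL a b G H x = h1*LL a b F Hf x + h2/2 * \sum_i \sum_j a x i j*(F x 0 j*F x 0 i).
Proof.
move=> eG eH; rewrite /LL eG eH.
have e1: \sum_i \sum_j a x i j*(\matrix_(j, i) (h2*(F x 0 j*F x 0 i) + h1*Hf x j i)) j i =
 h1*(\sum_i \sum_j a x i j*Hf x j i) + h2 * \sum_i \sum_j a x i j*(F x 0 j*F x 0 i).
 rewrite !mulr_sumr -!big_split; apply: eq_bigr=> i _ /=.
 rewrite !mulr_sumr -!big_split; apply: eq_bigr=> j _ /=; rewrite mxE; ring.
have e2: \sum_i b x 0 i*(h1 *: F x) 0 i = h1*(\sum_i b x 0 i*F x 0 i).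
 by rewrite !mulr_sumr; apply: eq_bigr=> i _ /=; rewrite !mxE; ring.
rewrite e1 e2; ring.
Qed.

Section Bounds.
Variables (nu be K : R) (a : V -> 'M[R]_d) (b : V -> V).
Hypothesis hc : coefs nu be K a b.
Lemma LL_bound (G : V -> V) (H : V -> 'M[R]_d) (x : V) (g h : R) : (forall i, `|G x 0 i| <= g) -> (forall i j, `|H x i j| <= h) ->
 `|LL a b G H x| <= d%:R*(d%:R*(nu*h)) + d%:R*(be*g).
Proof.
move=> hG hH; rewrite /LL normDt //; apply: lerD.
 rewrite normrM ger0_norm ?invr_ge0 // -[X in _ <= X]mul1r; apply: ler_pM; rewrite ?invr_ge0 //.
  by rewrite invf_le1 // ler1n.
 apply: sumd_abs=> i; apply: sumd_abs=> j; rewrite normrM; apply: ler_pM=> //; exact: c_abound hc _ _ _.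
by apply: sumd_abs=> i; rewrite normrM; apply: ler_pM=> //; exact: c_b hc _ _.
Qed.
Lemma cross_bound (F G : V -> V) (x : V) (f g : R) : (forall i, `|F x 0 i| <= f) -> (forall i, `|G x 0 i| <= g) ->
 `|2^-1 * \sum_i \sum_j a x i j*(G x 0 j*F x 0 i + F x 0 j*G x 0 i)| <= d%:R*(d%:R*(nu*(f*g))).
Proof.
move=> hF hG; rewrite normrM ger0_norm ?invr_ge0 //.
have h: `|\sum_i \sum_j a x i j*(G x 0 j*F x 0 i + F x 0 j*G x 0 i)| <= d%:R*(d%:R*(nu*(2*(f*g)))).
 apply: sumd_abs=> i; apply: sumd_abs=> j; rewrite normrM; apply: ler_pM=> //; first exact: c_abound hc _ _ _.
 rewrite normDt // !normrM mulrDl !mul1r.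
 by apply: lerD; [rewrite [f*g]mulrC|]; apply: ler_pM.
have h' := ler_wpM2l (ltac:(lra) : 0 <= 2^-1 :> R) h.
by apply: (le_trans h'); rewrite le_eqVlt; apply/orP; left; apply/eqP; field.
Qed.
End Bounds.
(** The step profile composed with [|x|^2/M^2]. The bound [C/M] is crude for the Hessian but enough,
    since [M] is always chosen last. *)
Lemma cutoff_ex : exists2 C : R, 0 < C & forall M : R, 1 <= M ->
 exists ch G H, [/\ C2 ch G H, (forall x : V, 0 <= ch x <= 1),
  (forall x, enorm x <= M -> ch x = 1), (forall x, 2*M <= enorm x -> ch x = 0) &
  forall x, (forall i, `|G x 0 i| <= C/M) /\ (forall i j, `|H x i j| <= C/M)].
Proof.
have [sg [s1 [s2 [C [C0 [d1 d2 c2 [s01 sl sr b1 b2]]]]]]] := step_ex R.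
exists (20*C); first by rewrite mulr_gt0.
move=> M M1; have M0: 0 < M by lra.
pose A : 'M[R]_d := (M ^- 2)%:M.
have As: A^T = A by rewrite tr_scalar_mx.
have hq := C2_quad 0 As.
pose q (y : V) := dotv (y - 0) ((y - 0) *m A).
have qE y: q y = enorm y^+2/M^+2.
 by rewrite /q subr0 /A mul_mx_scalar dotvZr enorm_sqr mulrC.
have q0 y: -1 < q y.
 by rewrite qE (@lt_le_trans _ _ 0) ?ltrN10 // divr_ge0 ?sqr_ge0.
have hC := @C2_comp _ _ sg s1 s2 q _ _ (fun y=> d1 _ (q0 y)) (fun y=> d2 _) (fun y=> c2 (q y)) hq.
do 3 eexists; split; first exact: hC.
- by move=> x; exact: s01.
- move=> x hx /=; apply: sl=> //; rewrite qE ler_pdivrMr ?exprn_gt0 // mul1r.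
 by rewrite lerXn2r ?nnegrE ?enorm_ge0 // ltW.
- move=> x hx /=; apply: sr; rewrite qE ler_pdivlMr ?exprn_gt0 //.
 have : (2*M)^+2 <= enorm x^+2 by rewrite lerXn2r ?nnegrE ?enorm_ge0 ?mulr_ge0 // ltW.
 rewrite exprMn; have := sqr_ge0 M; lra.
move=> x /=; rewrite subr0 /A mul_mx_scalar.
have [h|h] := leP 2 (q x).
 have [_ /(_ (or_intror h)) [e1 e2]] := b2 (q x).
 split=> [i|i j]; rewrite !mxE e1 ?e2 !mul0r ?addr0 normr0 divr_ge0 ?mulr_ge0 ?ltW //.
have hx: enorm x <= 2*M.
 rewrite leNgt; apply/negP=> hx; move: h; rewrite qE ltNge ler_pdivlMr ?exprn_gt0 //.
 have : (2*M)^+2 <= enorm x^+2 by rewrite lerXn2r ?nnegrE ?enorm_ge0 ?mulr_ge0 // ltW.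
 rewrite exprMn=> e /negP; apply; have := sqr_ge0 M; lra.
have Mi: 0 < M^-1 by rewrite invr_gt0.
have MM: M ^- 2*M = M^-1 by rewrite -exprVn expr2 mulfVK // gt_eqF.
have xi i: `|M ^- 2*x 0 i| <= 2*M^-1.
 rewrite normrM ger0_norm ?invr_ge0 ?exprn_ge0 ?(ltW M0) // (le_trans (ler_wpM2l _ (le_trans (coord_le x i) hx))) //.
  by rewrite invr_ge0 exprn_ge0 // ltW.
 by rewrite mulrCA MM.
have [_ h1] := b1 (q x); have [h2 _] := b2 (q x).
have Mi1: M^-1 <= 1 by rewrite invf_le1.
split=> [i|i j].
 rewrite !mxE normrM; apply: (le_via (C*(2*(2*M^-1)))).
  by apply: ler_pM=> //; rewrite normrM ger0_norm // ler_wpM2l.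
 nra.
rewrite !mxE normDt // !normrM [`|2|]ger0_norm //.
have M2: `|M ^- 2| <= M^-1.
 by rewrite ger0_norm ?invr_ge0 ?exprn_ge0 ?(ltW M0) // -exprVn expr2 ler_piMl // ltW.
apply: (le_via (C*((2*(2*M^-1))*(2*(2*M^-1))) + C*(2*M^-1))).
 apply: lerD; apply: ler_pM=> //.
  by apply: ler_pM=> //; rewrite ?mulr_ge0 // ler_wpM2l // -normrM.
 rewrite ler_wpM2l //; apply: le_trans M2; case: eqP=> _; rewrite ?mulr1n ?mulr0n ?normr0 //.
have : M^-1*M^-1 <= M^-1 by rewrite ler_piMl // ltW.
have := C0=> *; nra.
Qed.
End LLrules.

(** * Sums with singularity of order 3/4, and grids *)

Section SumQuarter.
Variable R : realType.
Lemma abs_mid3 (l A B C D : R) : 0 <= l -> 0 <= A -> 0 <= B -> A <= C -> B <= D -> `|- l + (- A + B)| <= l + C + D.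
Proof. by move=> *; rewrite ler_norml; apply/andP; split; lra. Qed.
Lemma abs_mid2 (A B C D : R) : 0 <= A -> 0 <= B -> A <= C -> B <= D -> `|A - B| <= C + D.
Proof. by move=> *; rewrite ler_norml; apply/andP; split; lra. Qed.
Lemma sum_quarter (n0 n1 : nat) (tau : R) : 0 < tau -> (0 < n0)%N ->
 \sum_(n0 <= k < n1) tau*((sqrt (sqrt (tau*k%:R)))^+3)^-1 <= 4*sqrt (sqrt (tau*n1%:R)).
Proof.
move=> t0 n0p; pose c (k : nat) : R := sqrt (sqrt (tau*k%:R)).
have c0 k: 0 <= c k by exact: sqrtr_ge0.
have c4 k: c k^+4 = tau*k%:R.
 by rewrite (exprM _ 2 2) !sqr_sqrtr ?sqrtr_ge0 // mulr_ge0 // ltW.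
have key (k : nat) : (0 < k)%N -> tau*(c k^+3)^-1 <= 4*(c k - c k.-1).
 case: k=> // k _ /=.
 have a0: 0 < c k.+1 by rewrite !sqrtr_gt0 mulr_gt0.
 have ab: c k <= c k.+1 by rewrite !ler_wsqrtr // ler_wpM2l ?(ltW t0) // ler_nat.
 rewrite ler_pdivrMr ?exprn_gt0 //.
 have : c k.+1^+4 - c k^+4 = tau by rewrite !c4 -natr1; ring.
 move: a0 ab (c0 k); move: (c k.+1) (c k)=> a b a0 ab b0 <-.
 have -> : a^+4 - b^+4 = (a - b)*(a^+3 + a^+2*b + a*b^+2 + b^+3) by ring.
 rewrite [4*(a - b)]mulrC -[X in _ <= X]mulrA; apply: ler_wpM2l; first by rewrite subr_ge0.
 have b2: b^+2 <= a^+2 by rewrite lerXn2r ?nnegrE // ltW.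
 have b3: b^+3 <= a^+3 by rewrite lerXn2r ?nnegrE // ltW.
 have h1: a^+2*b <= a^+2*a by apply: ler_wpM2l=> //; exact: sqr_ge0.
 have h2: a*b^+2 <= a*a^+2 by apply: ler_wpM2l=> //; exact: ltW.
 have -> : a^+3 = a^+2*a by ring.
 have e: a*a^+2 = a^+2*a by ring.
 have e3: a^+3 = a^+2*a by ring.
 rewrite e in h2; rewrite e3 in b3; lra.
have [le|lt] := leqP n0 n1; last by rewrite big_geq ?(ltnW lt) // mulr_ge0.
apply: (le_via (\sum_(n0 <= k < n1) 4*(c k - c k.-1))).
 by apply: ler_sum_nat=> k /andP[h _]; apply: key; exact: leq_trans h.
rewrite -mulr_sumr ler_wpM2l //.
have -> : \sum_(n0 <= k < n1) (c k - c k.-1) = c n1.-1 - c n0.-1.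
 by have := telescope_sumr (fun k=> c k.-1) le=> <-.
rewrite lerBlDr (le_trans _ (_ : c n1 <= _)) ?lerDl //.
by rewrite /c !ler_wsqrtr // ler_wpM2l ?(ltW t0) // ler_nat leq_pred.
Qed.
End SumQuarter.

Section Grid.
Variables (R : realType) (d : nat).
Local Notation V := 'rV[R]_d.
Definition gpt (p n : nat) (c : R) (k : {ffun 'I_d -> 'I_n}) : V := \row_i ((k i)%:R/p%:R - c).
(** The sum over the grid factors into one-dimensional sums; the mesh must not exceed the width
    [sqrt t] of the kernel. *)
Lemma grid_sum (p n : nat) (c t : R) (x : V) : (0 < p)%N -> 0 < t -> (p%:R)^-1 <= sqrt t ->
 \sum_k (p%:R)^-1^+d*KK t (x - @gpt p n c k) <= 8^+d.
Proof.
move=> p0 t0 hp; set s := sqrt t; have s0: 0 < s by rewrite sqrtr_gt0.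
pose F (i : 'I_d) (j : 'I_n) := (p%:R)^-1*(s^-1*((1 + `|x 0 i - (j%:R/p%:R - c)|/s)^+2)^-1).
have -> : \sum_k (p%:R)^-1^+d*KK t (x - @gpt p n c k) = \sum_(k : {ffun 'I_d -> 'I_n}) \prod_i F i (k i).
 apply: eq_bigr=> k _; rewrite /F [in RHS]big_split /= prodr_const card_ord; congr (_*_).
 by apply: eq_bigr=> i _; rewrite !mxE.
rewrite -(bigA_distr_bigA F) -[d in X in _ <= X]card_ord -prodr_const; apply: ler_prod=> i _.
have pp: 0 < (p%:R : R) by rewrite ltr0n.
apply/andP; split; first by apply: sumr_ge0=> j _; rewrite /F; pos.
pose eta := (p%:R)^-1/s.
have e0: 0 < eta by rewrite divr_gt0 // invr_gt0.
have e1: eta <= 1 by rewrite ler_pdivrMr // mul1r.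
have := sum_decay n ((x 0 i + c)/s) e0 e1; apply: le_trans.
apply: eqle; apply: eq_bigr=> j _.
rewrite /F mulrA -/eta; congr (_*((1 + _)^+2)^-1).
have -> : (x 0 i + c)/s - eta*j%:R = (x 0 i - (j%:R/p%:R - c))/s.
 by rewrite /eta; fieldp.
by rewrite normrM normfV [`|s|]gtr0_norm.
Qed.
End Grid.

(** * Discretized parametrix *)

Section Param.
Variables (R : realType) (d : nat).
Local Notation V := 'rV[R]_d.
Variables (nu be K : R) (a : V -> 'M[R]_d) (b : V -> V).
Hypothesis hc : coefs nu be K a b.
Let nu0 : 0 < nu := lt_le_trans ltr01 (c_nu hc).
Local Notation C3 := (c3 d nu be K).
Local Notation C5 := (c5 d nu be K).
Local Notation gc := (gC d nu).
Local Notation e8 := ((8 : R) ^+ d).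

Variables (p n : nat) (M0 : R).
Hypothesis p0 : (0 < p)%N.
Local Notation I := {ffun 'I_d -> 'I_n}.
Let y_ (k : I) : V := gpt p M0 k.
Let h : R := (p%:R)^-1.
(** Riemann sum, with mesh [h], for the integral of [g] against the kernel at time [t]; the matrix
    is frozen at the integration variable. *)
Definition Sop (t : R) (g : V -> R) (x : V) : R := \sum_(m : I) h^+d*g (y_ m)*GZ a (y_ m) t (x - y_ m).
Definition E1op (t : R) (g : V -> R) (x : V) : R := \sum_(m : I) h^+d*g (y_ m)*ek a b t (y_ m) x.

Let h0 : 0 < h. Proof. by rewrite invr_gt0 ltr0n. Qed.
Lemma op_bound (k : I -> R) (C B t : R) g x : 0 < t -> h <= sqrt t -> 0 <= C -> 0 <= B ->
 (forall m, `|g (y_ m)| <= B) -> (forall m, `|k m| <= C*KK t (x - y_ m)) ->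
 `|\sum_(m : I) h^+d*g (y_ m)*k m| <= B*C*e8.
Proof.
move=> t0 ht C0 B0 gB kC; apply: normst.
apply: (le_via (\sum_m B*C*(h^+d*KK t (x - y_ m)))); last first.
 by rewrite -mulr_sumr; apply: ler_wpM2l; [rewrite mulr_ge0|exact: grid_sum].
apply: ler_sum=> m _; rewrite !normrM [`|h^+d|]ger0_norm ?exprn_ge0 ?(ltW h0) //.
have -> : B*C*(h^+d*KK t (x - y_ m)) = h^+d*B*(C*KK t (x - y_ m)) by ring.
by apply: ler_pM=> //; [pos|apply: ler_wpM2l=> //; pos].
Qed.
Lemma op_bound2 (k : I -> R) (C B t : R) g x x' : 0 < t -> h <= sqrt t -> 0 <= C -> 0 <= B ->
 (forall m, `|g (y_ m)| <= B) -> (forall m, `|k m| <= C*(KK t (x - y_ m) + KK t (x' - y_ m))) ->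
 `|\sum_(m : I) h^+d*g (y_ m)*k m| <= B*C*2*e8.
Proof.
move=> t0 ht C0 B0 gB kC; apply: normst.
apply: (le_via (\sum_m B*C*(h^+d*KK t (x - y_ m) + h^+d*KK t (x' - y_ m)))); last first.
 rewrite -mulr_sumr -[X in _ <= X]mulrA; apply: ler_wpM2l; first by rewrite mulr_ge0.
 rewrite big_split /= mulrDl !mul1r; apply: lerD; exact: grid_sum.
apply: ler_sum=> m _; rewrite !normrM [`|h^+d|]ger0_norm ?exprn_ge0 ?(ltW h0) //.
rewrite -mulrDr.
have e (u v : R) : B*C*(u*v) = u*B*(C*v) by ring.
by rewrite e; apply: ler_pM=> //; [pos|apply: ler_wpM2l=> //; pos].
Qed.
Lemma Sop_le t g x (B : R) : 0 < t -> h <= sqrt t -> 0 <= B -> (forall y, `|g y| <= B) ->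
 `|Sop t g x| <= B*gc 0*e8.
Proof.
move=> t0 ht B0 gB; apply: (op_bound (x := x) t0 ht)=> //; first by apply: ltW; exact: gC_gt0.
by move=> m; rewrite ger0_norm ?GZ_ge0 //; exact: (GZ_le0 hc).
Qed.
Lemma E1op_le t g x (B : R) : 0 < t -> h <= sqrt t -> 0 <= B -> (forall y, `|g y| <= B) ->
 `|E1op t g x| <= B*(C3*gc 3*(sqrt t)^-1)*e8.
Proof.
move=> t0 ht B0 gB; have c30 := c3_ge0 hc; have g3 := gC_gt0 d nu 3.
apply: (op_bound (x := x) t0 ht)=> //; first by pos.
by move=> m; exact: (ek_le hc).
Qed.
Lemma Sop_diff t g x x' (B : R) : 0 < t -> h <= sqrt t -> 0 <= B -> (forall y, `|g y| <= B) ->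
 `|Sop t g x - Sop t g x'| <= B*((nu*gc 1 + gc 0)*(enorm (x - x')/sqrt t))*2*e8.
Proof.
move=> t0 ht B0 gB; rewrite /Sop -sumrB; under eq_bigr do rewrite -mulrBr.
apply: (op_bound2 (x := x) (x' := x') t0)=> //.
 have g1 := gC_gt0 d nu 1; have g2 := gC_gt0 d nu 0; pos.
by move=> m; exact: (GZ_diff_t hc).
Qed.
Lemma E1op_diff t g x x' (B : R) : 0 < t -> t <= 1 -> h <= sqrt t -> 0 <= B -> (forall y, `|g y| <= B) ->
 `|E1op t g x - E1op t g x'| <= B*(C5*(enorm (x - x')/t))*2*e8.
Proof.
move=> t0 t1 ht B0 gB; rewrite /E1op -sumrB; under eq_bigr do rewrite -mulrBr.
apply: (op_bound2 (x := x) (x' := x') t0)=> //; last by move=> m; exact: (ek_diff hc).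
have := c5_ge0 hc=> c50; pos.
Qed.
Definition cE : R := 2*e8*sqrt (C3*gc 3*C5).
(** Geometric mean of the size bound of order [t^(-1/2)] and the Lipschitz bound of order [t^(-1)]:
    the resulting exponent [-3/4] is integrable at 0, whereas the Lipschitz bound alone is not. *)
Lemma E1op_half t g x x' (B : R) : 0 < t -> t <= 1 -> h <= sqrt t -> 0 <= B -> (forall y, `|g y| <= B) ->
 `|E1op t g x - E1op t g x'| <= B*cE*sqrt (enorm (x - x'))*((sqrt (sqrt t))^+3)^-1.
Proof.
move=> t0 t1 ht B0 gB.
have g3 := gC_gt0 d nu 3; have c30 := c3_ge0 hc; have c50 := c5_ge0 hc.
set X := `| _ |; set c := sqrt (sqrt t).
have c0: 0 < c by rewrite !sqrtr_gt0.
have c2: c^+2 = sqrt t by rewrite sqr_sqrtr // sqrtr_ge0.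
have c4: c^+4 = t by rewrite (exprM _ 2 2) c2 sqr_sqrtr // ltW.
have X0: 0 <= X by exact: normr_ge0.
have h1: X <= B*(C3*gc 3*(c^+2)^-1)*2*e8.
 rewrite c2 /X normBt //.
 apply: (le_trans (lerD (E1op_le x t0 ht B0 gB) (E1op_le x' t0 ht B0 gB))).
 apply: eqle; ring.
have h2: X <= B*(C5*(enorm (x - x')/c^+4))*2*e8 by rewrite c4; exact: E1op_diff.
have rhs0: 0 <= B*cE*sqrt (enorm (x - x'))*(c^+3)^-1 by rewrite /cE; pos.
rewrite -(@ler_pXn2r _ 2) ?nnegrE //.
have := ler_pM X0 X0 h1 h2; rewrite -expr2=> h3; apply: (le_trans h3).
rewrite /cE !exprMn [sqrt (enorm _)^+2]sqr_sqrtr ?enorm_ge0 // [sqrt (_*C5)^+2]sqr_sqrtr; last by pos.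
by apply: eqle; fieldp.
Qed.

Variables (lam tau : R) (k0 k1 : nat).
Hypotheses (tau0 : 0 < tau) (k00 : (0 < k0)%N) (k01 : (k0 <= k1)%N) (lam0 : 0 <= lam).
Let tt (k : nat) : R := tau*k%:R.
Let T : R := tt k1.
Let de : R := tt k0.
Hypotheses (T1 : T <= 1) (hde : h <= sqrt de).

Let tt_gt0 k : (k0 <= k)%N -> 0 < tt k.
Proof. by move=> hk; rewrite /tt mulr_gt0 // ltr0n (leq_trans _ hk). Qed.
Let tt_h k : (k0 <= k)%N -> h <= sqrt (tt k).
Proof.
move=> hk; apply: (le_trans hde); rewrite ler_wsqrtr // /de /tt ler_wpM2l ?(ltW tau0) // ler_nat //.
Qed.
Let tt_le k : (k < k1)%N -> tt k <= 1.
Proof.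
by move=> hk; apply: le_trans T1; rewrite /T /tt ler_wpM2l ?(ltW tau0) // ler_nat ltnW.
Qed.
(** Riemann sum for the Laplace transform of [Sop] between the times [de = tt k0] and [T = tt k1]:
    the approximate resolvent applied to [g]. *)
Definition uop (g : V -> R) (x : V) : R :=
 \sum_(k0 <= k < k1) tau*expR (- (lam*tt k))*Sop (tt k) g x.
(** What separates [(lam - L) (uop g)] from the approximate identity at time [de]: the boundary term
    at [T] and the accumulated kernel errors. *)
Definition Eop (g : V -> R) (x : V) : R :=
 - (expR (- (lam*T))*Sop T g x) - \sum_(k0 <= k < k1) tau*expR (- (lam*tt k))*E1op (tt k) g x.

Let wk k : 0 <= tau*expR (- (lam*tt k)) <= tau.
Proof.
rewrite mulr_ge0 ?expR_ge0 ?(ltW tau0) //= ler_piMr ?(ltW tau0) // -expR0 ler_expR oppr_le0.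
by rewrite !mulr_ge0 // ltW.
Qed.
Lemma wsum_le (F : nat -> R) (c : nat -> R) (C : R) :
 (forall k, (k0 <= k)%N -> (k < k1)%N -> `|F k| <= C*c k) ->
 `|\sum_(k0 <= k < k1) tau*expR (- (lam*tt k))*F k| <= C * \sum_(k0 <= k < k1) tau*c k.
Proof.
move=> hF; rewrite mulr_sumr normst //; apply: ler_sum_nat=> k /andP[h1 h2].
have /andP[w0 w1] := wk k.
rewrite normrM [`|tau*_|]ger0_norm // [C*_]mulrCA; apply: ler_pM=> //; exact: hF.
Qed.
Lemma Eop_le g x (B : R) : 0 <= B -> (forall y, `|g y| <= B) ->
 `|Eop g x| <= B*(e8*(expR (- (lam*T))*gc 0 + 2*C3*gc 3*sqrt T)).
Proof.
move=> B0 gB; rewrite /Eop normBt // normrN.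
have T0: 0 < T by apply: tt_gt0.
have s1: `|expR (- (lam*T))*Sop T g x| <= expR (- (lam*T))*(B*gc 0*e8).
 by rewrite normrM ger0_norm ?expR_ge0 //; apply: ler_wpM2l; [exact: expR_ge0|apply: Sop_le=> //; exact: tt_h].
have s2 := @wsum_le (fun k=> E1op (tt k) g x) (fun k=> (sqrt (tt k))^-1) (B*(C3*gc 3)*e8).
have {}s2 : `|\sum_(k0 <= k < k1) tau*expR (- (lam*tt k))*E1op (tt k) g x| <=
  B*(C3*gc 3)*e8 * \sum_(k0 <= k < k1) tau*(sqrt (tt k))^-1.
 apply: s2=> k h1 h2; apply: (le_trans (E1op_le x (tt_gt0 h1) (tt_h h1) B0 gB)); apply: eqle; ring.
have g3 := gC_gt0 d nu 3; have c30 := c3_ge0 hc.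
have s3 := sum_sqrtV k1 tau0 k00.
have s4: 0 <= B*(C3*gc 3)*e8 by pos.
apply: (le_trans (lerD s1 (le_trans s2 (ler_wpM2l s4 s3)))).
apply: eqle; rewrite /T /tt; ring.
Qed.
Lemma Eop_diff g x x' (B : R) : 0 <= B -> (forall y, `|g y| <= B) ->
 `|Eop g x - Eop g x'| <= B*(2*e8*(nu*gc 1 + gc 0)*(enorm (x - x')/sqrt T) + 4*cE*sqrt (enorm (x - x'))).
Proof.
move=> B0 gB.
have T0: 0 < T by apply: tt_gt0.
have -> : Eop g x - Eop g x' = - (expR (- (lam*T))*(Sop T g x - Sop T g x'))
  - \sum_(k0 <= k < k1) tau*expR (- (lam*tt k))*(E1op (tt k) g x - E1op (tt k) g x').
 under [X in _ = _ - X]eq_bigr do rewrite mulrBr.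
 by rewrite /Eop sumrB; ring.
rewrite normBt // normrN [X in _ <= X]mulrDr; apply: lerD.
 rewrite normrM ger0_norm ?expR_ge0 //.
 apply: (le_via (1*(B*((nu*gc 1 + gc 0)*(enorm (x - x')/sqrt T))*2*e8))).
  apply: ler_pM; rewrite ?expR_ge0 //; last by apply: Sop_diff=> //; exact: tt_h.
  by rewrite -expR0 ler_expR oppr_le0 mulr_ge0 // ltW.
 apply: eqle; ring.
have s2 := @wsum_le (fun k=> E1op (tt k) g x - E1op (tt k) g x') (fun k=> ((sqrt (sqrt (tt k)))^+3)^-1)
 (B*cE*sqrt (enorm (x - x'))).
have {}s2 := s2 (fun k h1 h2=> E1op_half x x' (tt_gt0 h1) (tt_le h2) (tt_h h1) B0 gB).
apply: (le_trans s2).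
have cE0: 0 <= cE by rewrite /cE; pos.
have s3 := sum_quarter k1 tau0 k00.
have s4: 0 <= B*cE*sqrt (enorm (x - x')) by pos.
apply: (le_trans (ler_wpM2l s4 s3)).
have s5: sqrt (sqrt (tau*k1%:R)) <= 1 by do 2 apply: sqrt_le1.
have -> : B*(4*cE*sqrt (enorm (x - x'))) = B*cE*sqrt (enorm (x - x'))*(4*1) by ring.
by do 2 (apply: ler_wpM2l=> //).
Qed.
Lemma Eop_lin g g' x : Eop g x - Eop g' x = Eop (fun y=> g y - g' y) x.
Proof.
have e1 t: Sop t g x - Sop t g' x = Sop t (fun y=> g y - g' y) x.
 by rewrite /Sop -sumrB; apply: eq_bigr=> m _; ring.
have e2 t: E1op t g x - E1op t g' x = E1op t (fun y=> g y - g' y) x.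
 by rewrite /E1op -sumrB; apply: eq_bigr=> m _; ring.
rewrite /Eop -e1; under [X in _ = _ - X]eq_bigr do rewrite -e2 mulrBr.
by rewrite sumrB; ring.
Qed.
Definition uG (g : V -> R) (x : V) : V :=
 \sum_(k0 <= k < k1) \sum_m ((tau*expR (- (lam*tt k)))*(h^+d*g (y_ m))) *: ZG a (tt k) (y_ m) x.
Definition uH (g : V -> R) (x : V) : 'M[R]_d :=
 \sum_(k0 <= k < k1) \sum_m ((tau*expR (- (lam*tt k)))*(h^+d*g (y_ m))) *: ZH a (tt k) (y_ m) x.
Lemma u_C2 g : C2 (uop g) (uG g) (uH g).
Proof.
have hk (k : nat) (m : I) : C2 (fun x=> (tau*expR (- (lam*tt (maxn k0 k))))*(h^+d*g (y_ m))*GZ a (y_ m) (tt (maxn k0 k)) (x - y_ m))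
  (fun x=> ((tau*expR (- (lam*tt (maxn k0 k))))*(h^+d*g (y_ m))) *: ZG a (tt (maxn k0 k)) (y_ m) x)
  (fun x=> ((tau*expR (- (lam*tt (maxn k0 k))))*(h^+d*g (y_ m))) *: ZH a (tt (maxn k0 k)) (y_ m) x).
 by apply: C2_scale; apply: (Z_C2 hc); apply: tt_gt0; exact: leq_maxl.
have := C2_sum (index_iota k0 k1) (fun k=> C2_sum (index_enum I) (hk k)).
apply: C2_ext=> x /=; apply: eq_big_nat=> k /andP[h1 _]; rewrite (maxn_idPr h1) //.
by rewrite /Sop mulr_sumr; apply: eq_bigr=> m _; ring.
Qed.
Lemma u_LL g x : LL a b (uG g) (uH g) x =
 \sum_(k0 <= k < k1) tau*expR (- (lam*tt k))*(\sum_m h^+d*g (y_ m)*dtZ a (tt k) (y_ m) x + E1op (tt k) g x).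
Proof.
rewrite /uG /uH LL_sum; apply: eq_big_nat=> k /andP[h1 _].
rewrite LL_sum /E1op -big_split mulr_sumr; apply: eq_bigr=> m _ /=.
by rewrite LL_scale (Z_LL hc) ?tt_gt0 //; ring.
Qed.
Lemma u_main g x : lam*uop g x - LL a b (uG g) (uH g) x =
 \sum_m h^+d*g (y_ m)*(\sum_(k0 <= k < k1) tau*expR (- (lam*tt k)) *
    (lam*GZ a (y_ m) (tt k) (x - y_ m) - dtZ a (tt k) (y_ m) x))
 - \sum_(k0 <= k < k1) tau*expR (- (lam*tt k))*E1op (tt k) g x.
Proof.
rewrite u_LL /uop mulr_sumr -sumrB.
under [X in _ = X - _]eq_bigr do rewrite mulr_sumr.
rewrite exchange_big /= -sumrB; apply: eq_big_nat=> k _.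
have -> : \sum_(m : I) h^+d*g (y_ m)*(tau*expR (- (lam*tt k))*(lam*GZ a (y_ m) (tt k) (x - y_ m) - dtZ a (tt k) (y_ m) x))
 = tau*expR (- (lam*tt k))*(lam*Sop (tt k) g x - \sum_m h^+d*g (y_ m)*dtZ a (tt k) (y_ m) x).
 rewrite /Sop mulr_sumr -sumrB mulr_sumr; apply: eq_bigr=> m _; ring.
ring.
Qed.
Lemma u_le g x (B : R) : 0 <= B -> (forall y, `|g y| <= B) -> `|uop g x| <= B*gc 0*e8.
Proof.
move=> B0 gB; have g0 := gC_gt0 d nu 0.
have s := @wsum_le (fun k=> Sop (tt k) g x) (fun=> 1) (B*gc 0*e8).
have {}s : `|uop g x| <= B*gc 0*e8 * \sum_(k0 <= k < k1) tau*1.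
 by apply: s=> k h1 h2; rewrite mulr1; exact: (Sop_le x (tt_gt0 h1) (tt_h h1) B0 gB).
apply: (le_trans s); rewrite -[X in _ <= X]mulr1; apply: ler_wpM2l; first by pos.
rewrite -mulr_suml sumr_const_nat -[_ *+ _]mulr_natr mulr1 (le_trans _ T1) // /T /tt ler_wpM2l ?(ltW tau0) //.
by rewrite ler_nat leq_subr.
Qed.
Lemma uG_le g x i (B : R) : 0 <= B -> (forall y, `|g y| <= B) -> `|uG g x 0 i| <= 2*(B*(nu*gc 1)*e8).
Proof.
move=> B0 gB; have g1 := gC_gt0 d nu 1.
have -> : uG g x 0 i = \sum_(k0 <= k < k1) tau*expR (- (lam*tt k))*(\sum_m h^+d*g (y_ m)*ZG a (tt k) (y_ m) x 0 i).
 rewrite /uG summxE; apply: eq_bigr=> k _; rewrite summxE mulr_sumr; apply: eq_bigr=> m _.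
 by rewrite mxE; ring.
have s := @wsum_le (fun k=> \sum_m h^+d*g (y_ m)*ZG a (tt k) (y_ m) x 0 i) (fun k=> (sqrt (tt k))^-1) (B*(nu*gc 1)*e8).
have {}s : `|\sum_(k0 <= k < k1) tau*expR (- (lam*tt k))*(\sum_m h^+d*g (y_ m)*ZG a (tt k) (y_ m) x 0 i)|
  <= B*(nu*gc 1)*e8 * \sum_(k0 <= k < k1) tau*(sqrt (tt k))^-1.
 apply: s=> k h1 h2.
 have -> : B*(nu*gc 1)*e8*(sqrt (tt k))^-1 = B*(nu*gc 1*(sqrt (tt k))^-1)*e8 by ring.
 apply: (op_bound (x := x) (tt_gt0 h1) (tt_h h1))=> //; first by pos.
 by move=> m; apply: (ZG_le hc); exact: tt_gt0.
apply: (le_trans s); rewrite [2*_]mulrC; apply: ler_wpM2l; first by pos.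
apply: (le_trans (sum_sqrtV k1 tau0 k00)); rewrite -[X in _ <= X]mulr1; apply: ler_wpM2l=> //.
exact: sqrt_le1.
Qed.
Definition Briem (Q : R) : R := (d%:R/(2*de^+2) + Q/de^+3 + (lam + d%:R/(2*de) + Q/(2*de^+2))^+2)*(sqrt de)^-1^+d.
(** The summand is minus the time derivative of [exp (- lam t)] times the kernel, whose integral is
    the difference of end values. The lemma is the left-endpoint quadrature error, and [Briem]
    bounds the second derivative from time [de] on. *)
Lemma riemann y x (Q : R) : Qf a y (x - y) <= Q ->
 `|\sum_(k0 <= k < k1) tau*expR (- (lam*tt k))*(lam*GZ a y (tt k) (x - y) - dtZ a (tt k) y x)
  - (expR (- (lam*de))*GZ a y de (x - y) - expR (- (lam*T))*GZ a y T (x - y))| <= tau*Briem Q.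
Proof.
move=> hQ; set q := Qf a y (x - y); have q0: 0 <= q := Qf_ge0 hc _ _.
have hQ': q <= Q by [].
have de0: 0 < de by apply: tt_gt0.
pose w (s : R) := - (lam*s) + (- (d%:R/2 * ln s) - q/2*s^-1).
pose w1 (s : R) := - lam + (- (d%:R/2*s^-1) + q/2*(s^+2)^-1).
pose w2 (s : R) := d%:R/2*(s^+2)^-1 - q*(s^+3)^-1.
have dw (s : R) : 0 < s -> is_derive s 1 w (w1 s).
 move=> s0; have sn: s != 0 by rewrite gt_eqF.
 apply: isd_ext (isd_add (isd_opp (isd_scale lam (isd_id s)))
  (isd_add (isd_opp (isd_scale (d%:R/2) (is_derive1_ln s0))) (isd_opp (isd_scale (q/2) (isd_inv sn))))) _ _=> //.
 by rewrite /w1; ring.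
have dw1 (s : R) : 0 < s -> is_derive s 1 w1 (w2 s).
 move=> s0; have sn: s != 0 by rewrite gt_eqF.
 apply: isd_ext (isd_add (isd_cst (- lam) s) (isd_add (isd_opp (isd_scale (d%:R/2) (isd_inv sn)))
   (isd_scale (q/2) (isd_mul (isd_inv sn) (isd_inv sn))))) _ _.
  by move=> t; rewrite /w1 expr2 invfM.
 by rewrite /w2; field.
pose W s := expR (w s); pose W1 s := expR (w s)*w1 s.
pose W2 s := expR (w s)*w1 s*w1 s + expR (w s)*w2 s.
have dW (s : R) : 0 < s -> is_derive s 1 W (W1 s) by move=> s0; exact: isd_exp (dw s s0).
have dW1 (s : R) : 0 < s -> is_derive s 1 W1 (W2 s) by move=> s0; exact: isd_mul (isd_exp (dw s s0)) (dw1 s s0).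
have WE s: 0 < s -> W s = expR (- (lam*s))*GZ a y s (x - y).
 by move=> s0; rewrite (GZ_exp _ _ _ s0) -expRD.
have W1E s: 0 < s -> W1 s = - (expR (- (lam*s))*(lam*GZ a y s (x - y) - dtZ a s y x)).
 move=> s0; rewrite /W1 -/(W s) WE // /dtZ -/q /w1; field; by rewrite gt_eqF.
have W2B s: de <= s -> `|W2 s| <= Briem Q.
 move=> hs; have s0: 0 < s by apply: lt_le_trans hs.
 have i1: s^-1 <= de^-1 by rewrite lef_pV2.
 have i2: (s^+2)^-1 <= (de^+2)^-1 by rewrite lef_pV2 ?posrE ?exprn_gt0 // lerXn2r ?nnegrE // ltW.
 have i3: (s^+3)^-1 <= (de^+3)^-1 by rewrite lef_pV2 ?posrE ?exprn_gt0 // lerXn2r ?nnegrE // ltW.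
 have p1: 0 <= s^-1 by pos.
 have p2: 0 <= (s^+2)^-1 by pos.
 have p3: 0 <= (s^+3)^-1 by pos.
 have d2: 0 <= d%:R/2 :> R by pos.
 have b1: `|w1 s| <= lam + d%:R/(2*de) + Q/(2*de^+2).
  have m1 := ler_wpM2l d2 i1; have m2 := ler_pM (ltac:(pos) : 0 <= q/2) p2 (ltac:(lra) : q/2 <= Q/2) i2.
  have m3: 0 <= d%:R/2*s^-1 by pos.
  have m4: 0 <= q/2*(s^+2)^-1 by pos.
  have -> : d%:R/(2*de) = d%:R/2/de by fieldp.
  have -> : Q/(2*de^+2) = Q/2/de^+2 by fieldp.
  exact: abs_mid3.
 have b2: `|w2 s| <= d%:R/(2*de^+2) + Q/de^+3.
  have m1 := ler_wpM2l d2 i2; have m2 := ler_pM q0 p3 hQ' i3.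
  have m3: 0 <= d%:R/2*(s^+2)^-1 by pos.
  have m4: 0 <= q*(s^+3)^-1 by pos.
  have -> : d%:R/(2*de^+2) = d%:R/2/de^+2 by fieldp.
  exact: abs_mid2.
 have b3: W s <= (sqrt de)^-1^+d.
  rewrite WE // (le_via (1*GZ a y s (x - y))) //.
   apply: ler_wpM2r; first exact: GZ_ge0.
   by rewrite -expR0 ler_expR oppr_le0 mulr_ge0 // ltW.
  rewrite mul1r; apply: (le_trans (GZ_le_sup hc y (x - y) s0)).
  by apply: lerXn2r; rewrite ?nnegrE ?invr_ge0 ?sqrtr_ge0 // lef_pV2 ?posrE ?sqrtr_gt0 // ler_wsqrtr.
 have W0: 0 <= W s by exact: expR_ge0.
 have -> : W2 s = (w2 s + w1 s^+2)*W s by rewrite /W2 /W; ring.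
 rewrite normrM [`|W s|]ger0_norm // /Briem; apply: ler_pM=> //.
 rewrite normDt // lerD // normrX.
 have n0 := normr_ge0 (w1 s).
 by rewrite lerXn2r ?nnegrE //; apply: le_trans b1.
have B0: 0 <= Briem Q by apply: le_trans (W2B de (lexx _)).
have step k: (k0 <= k)%N -> `|tau*W1 (tt k) - (W (tt k.+1) - W (tt k))| <= tau*tau*Briem Q.
 move=> hk; set s := tt k; have s0: 0 < s by apply: tt_gt0.
 have des: de <= s by rewrite /de /s /tt ler_wpM2l ?(ltW tau0) // ler_nat.
 have -> : tt k.+1 = s + tau by rewrite /s /tt -natr1; ring.
 have lip u: s <= u <= s + tau -> `|W1 u - W1 s| <= Briem Q*tau.
  move=> /andP[u1 u2]; apply: (le_via (Briem Q * `|u - s|)).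
   apply: (@derive_lip _ W1 W2)=> v; rewrite (min_l u1) (max_r u1)=> /andP[v1 v2]; [apply: dW1; exact: lt_le_trans v1|apply: W2B; exact: le_trans v1].
  by apply: ler_wpM2l=> //; rewrite ger0_norm ?subr_ge0 // lerBlDl.
 have st: s <= s + tau by rewrite lerDl ltW.
 have := @derive_lip _ (fun u=> W u - W1 s*u) (fun u=> W1 u - W1 s) s (s + tau) (Briem Q*tau).
 rewrite (min_l st) (max_r st)=> H; have : `|W (s + tau) - W1 s*(s + tau) - (W s - W1 s*s)| <= Briem Q*tau * `|s + tau - s|.
  apply: H=> u hu; last exact: lip.
  apply: isd_ext (isd_add (dW u _) (isd_opp (isd_scale (W1 s) (isd_id u)))) _ _=> //; [by case/andP: hu=> hu _; exact: lt_le_trans hu|ring].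
 have e: s + tau - s = tau by rewrite addrAC subrr add0r.
 rewrite e [`|tau|]gtr0_norm // distrC=> H2.
 rewrite (_ : tau*tau*Briem Q = Briem Q*tau*tau); last by ring.
 by rewrite (_ : tau*W1 s - (W (s + tau) - W s) = W s - W1 s*s - (W (s + tau) - W1 s*(s + tau))) //; ring.
have tel: expR (- (lam*T))*GZ a y T (x - y) - expR (- (lam*de))*GZ a y de (x - y) = \sum_(k0 <= k < k1) (W (tt k.+1) - W (tt k)).
 rewrite (telescope_sumr (fun k=> W (tt k)) k01) !WE //; exact: tt_gt0.
have e0 (X1 A1 B1 : R) : X1 - (A1 - B1) = X1 + (B1 - A1) by ring.
rewrite e0 tel.
have -> : \sum_(k0 <= k < k1) tau*expR (- (lam*tt k))*(lam*GZ a y (tt k) (x - y) - dtZ a (tt k) y x) =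
  - \sum_(k0 <= k < k1) tau*W1 (tt k).
 by rewrite -sumrN; apply: eq_big_nat=> k /andP[hk _]; rewrite W1E ?tt_gt0 //; ring.
rewrite -normrN opprD opprK -sumrB normst //.
apply: (le_via (\sum_(k0 <= k < k1) tau*tau*Briem Q)).
 by apply: ler_sum_nat=> k /andP[hk _]; exact: step.
rewrite sumr_const_nat -[X in X <= _]mulr_natr (_ : tau*tau*Briem Q*(k1 - k0)%:R = tau*Briem Q*(tau*(k1 - k0)%:R)); last by ring.
rewrite -[X in _ <= X]mulr1; apply: ler_wpM2l; first by rewrite mulr_ge0 // ltW.
by apply: le_trans T1; rewrite /T /tt ler_wpM2l ?(ltW tau0) // ler_nat leq_subr.
Qed.
Lemma u_approx g x (B Q : R) : 0 <= B -> (forall y, `|g y| <= B) -> (forall m, Qf a (y_ m) (x - y_ m) <= Q) ->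
 `|lam*uop g x - LL a b (uG g) (uH g) x - (expR (- (lam*de))*Sop de g x + Eop g x)|
  <= (n ^ d)%:R*(h^+d*B*(tau*Briem Q)).
Proof.
move=> B0 gB hQ; rewrite u_main.
have -> : expR (- (lam*de))*Sop de g x + Eop g x = \sum_m h^+d*g (y_ m) *
  (expR (- (lam*de))*GZ a (y_ m) de (x - y_ m) - expR (- (lam*T))*GZ a (y_ m) T (x - y_ m))
  - \sum_(k0 <= k < k1) tau*expR (- (lam*tt k))*E1op (tt k) g x.
 rewrite /Eop addrA; congr (_ - _); rewrite /Sop !mulr_sumr -sumrB; apply: eq_bigr=> m _; ring.
have e (A1 B1 C1 : R) : A1 - B1 - (C1 - B1) = A1 - C1 by ring.
rewrite e -sumrB.
under eq_bigr do rewrite -mulrBr.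
apply: normst.
have hb (m : I) : `|h^+d*g (y_ m)*(\sum_(k0 <= k < k1) tau*expR (- (lam*tt k))*(lam*GZ a (y_ m) (tt k) (x - y_ m) - dtZ a (tt k) (y_ m) x) -
  (expR (- (lam*de))*GZ a (y_ m) de (x - y_ m) - expR (- (lam*T))*GZ a (y_ m) T (x - y_ m)))| <= h^+d*B*(tau*Briem Q).
 rewrite normrM; apply: ler_pM=> //; last by apply: riemann.
 rewrite normrM ger0_norm; last by have h1 := h0; pos.
 by apply: ler_wpM2l=> //; have h1 := h0; pos.
apply: (le_trans (ler_sum _ (fun m _=> hb m))).
by rewrite sumr_const card_ffun !card_ord -[X in X <= _]mulr_natl.
Qed.

End Param.

Local Opaque GZ KK gC.

(** * Gaussian grid sums at a small time *)

Section Delta.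
Variables (R : realType) (d : nat).
Local Notation V := 'rV[R]_d.
Variables (nu be K : R) (a : V -> 'M[R]_d) (b : V -> V).
Hypothesis hc : coefs nu be K a b.
Let nu0 : 0 < nu := lt_le_trans ltr01 (c_nu hc).
Local Notation gc := (gC d nu).
Local Notation e8 := ((8 : R) ^+ d).

Variables (p M0 n1 : nat) (de : R).
Hypotheses (p0 : (0 < p)%N) (M00 : (0 < M0)%N) (n10 : (0 < n1)%N) (n1p : (n1 <= p)%N) (dn1 : (d <= n1)%N).
Hypotheses (de0 : 0 < de) (deE : sqrt de = n1%:R/p%:R).
Local Notation n' := (2 * M0 * p)%N.
Local Notation I := {ffun 'I_d -> 'I_n'.+1}.
Let y_ (k : I) : V := gpt p M0%:R k.
Let h : R := (p%:R)^-1.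
(** A grid point at distance 1 from the lower faces of the box; every Gaussian sum is compared with
    the one centred here. *)
Let r : V := const_mx (1 - M0%:R).
Let s := sqrt de.
Let pp : 0 < (p%:R : R). Proof. by rewrite ltr0n. Qed.
Let h0 : 0 < h. Proof. by rewrite invr_gt0. Qed.
Let s0 : 0 < s. Proof. by rewrite sqrtr_gt0. Qed.
Let hs : h <= s.
Proof. by rewrite /s deE /h -[X in X <= _]mul1r ler_wpM2r ?invr_ge0 // ler1n. Qed.

Let Sum1 (c x : V) := \sum_(m : I) h^+d*1*GZ a c de (x - y_ m).
(** The index set is a finite group, and adding [ka] permutes the sum cyclically. Only indices that
    wrap around change their term, and for those both arguments have a coordinate of size at least
    1, where the kernel is exponentially small. *)
Lemma Sum1_shift_grid (c : V) (ka : I) : (forall i, (ka i + 2 * p <= n')%N) ->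
 `|Sum1 c (\row_i (1 - M0%:R + (ka i)%:R*h)) - Sum1 c r| <= 2*e8*(gc 0*expR (- (4*nu*de)^-1)).
Proof.
move=> hk; set x := \row_i _.
have g0 := gC_gt0 d nu 0.
have bij: {on [pred _ | true], bijective (fun m : I=> m + ka)}.
 by exists (fun m=> m - ka)=> m _; rewrite ?addrK ?subrK.
have tail (z : V) (i : 'I_d) : 1 <= `|z 0 i| -> GZ a c de z <= gc 0*expR (- (4*nu*de)^-1)*KK de z.
 move=> hz; have := GZ_le hc 0 c z de0; rewrite expr0 mul1r; move/le_trans; apply.
 apply: ler_wpM2r; first exact: KK_ge0.
 apply: ler_wpM2l; first exact: ltW.
 have z1: 1 <= enorm z by apply: le_trans hz (coord_le z i).
 have -> : (enorm z/s)^+2/(4*nu) = enorm z^+2*(4*nu*de)^-1.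
  by rewrite -[de]sqr_sqrtr ?(ltW de0) // -/s; fieldp.
 by rewrite ler_expR lerN2 ler_peMl ?exprn_ege1 //; pos.
rewrite /Sum1 (reindex _ bij) /= -sumrB; under eq_bigr do rewrite -mulrBr.
apply: normst.
set C := gc 0*_.
have hb (m : I) : `|h^+d*1*(GZ a c de (x - y_ (m + ka)) - GZ a c de (r - y_ m))| <=
  C*(h^+d*KK de (x - y_ (m + ka)) + h^+d*KK de (r - y_ m)).
 rewrite mulr1 normrM ger0_norm; last by pos.
 rewrite -mulrDr mulrCA; apply: ler_wpM2l; first by pos.
 have [/existsP[i hi]|/existsPn hno] := boolP [exists i, (n' < m i + ka i)%N].
  have e1: (x - y_ (m + ka)) 0 i = 1 - (m i)%:R*h + (n'.+1)%:R*h.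
   rewrite !mxE ffunE /=.
   have -> : ((m i + ka i) %% n'.+1 = m i + ka i - n'.+1)%N.
    rewrite -{1}(subnK hi) modnDr modn_small //.
    by have := ltn_ord (m i); have := ltn_ord (ka i); lia.
   rewrite natrB // natrD /h; ring.
  have e2: (r - y_ m) 0 i = 1 - (m i)%:R*h by rewrite !mxE /h; ring.
  have mi: (m i)%:R*h <= n'%:R*h by apply: ler_wpM2r; [exact: ltW|rewrite ler_nat -ltnS].
  have mi2: (2 * p)%:R*h <= (m i)%:R*h.
   apply: ler_wpM2r; first exact: ltW.
   rewrite ler_nat; have := hk i; lia.
  have pE: (2 * p)%:R*h = 2 by rewrite natrM mulfK // gt_eqF.
  have t1: GZ a c de (x - y_ (m + ka)) <= C*KK de (x - y_ (m + ka)).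
   have hh := ltW h0; apply: (tail _ i); rewrite e1 -natr1 mulrDl mul1r ger0_norm; lra.
  have t2: GZ a c de (r - y_ m) <= C*KK de (r - y_ m).
   by apply: (tail _ i); rewrite e2 ler0_norm; lra.
  rewrite mulrDr normBt // !ger0_norm ?GZ_ge0 //; exact: lerD.
 have -> : x - y_ (m + ka) = r - y_ m.
  apply/rowP=> i; rewrite !mxE ffunE /= modn_small ?natrD; first by rewrite /h; ring.
  by rewrite ltnS leqNgt hno.
 rewrite subrr normr0 mulr_ge0 ?addr_ge0 ?KK_ge0 // /C; pos.
apply: (le_trans (ler_sum _ (fun m _=> hb m))).
rewrite -mulr_sumr big_split /=.
rewrite -(reindex (fun m : I=> m + ka) (F := fun m=> h^+d*KK de (x - y_ m)) bij).
rewrite [X in _ <= X]mulrC; apply: ler_wpM2l; first by rewrite /C; pos.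
by rewrite mulrDl !mul1r; apply: lerD; apply: grid_sum.
Qed.
Lemma Sum1_shift (c x : V) : (forall i, `|x 0 i| <= M0%:R - 1) ->
 `|Sum1 c x - Sum1 c r| <= 2*e8*(nu*gc 1*(d%:R/n1%:R) + gc 0*(4*nu*de)).
Proof.
move=> hx.
(* Index of the grid corner below [x], counted from the reference point [r]. *)
pose kn (i : 'I_d) := Num.trunc ((x 0 i + M0%:R - 1) * p%:R).
have xi i: 0 <= (x 0 i + M0%:R - 1) * p%:R.
 by have := hx i; rewrite ler_norml=> /andP[? _]; apply: mulr_ge0=> //; lra.
have tr i: (kn i)%:R <= (x 0 i + M0%:R - 1) * p%:R < (kn i).+1%:R by apply: truncn_itv.
have kb i: (kn i + 2 * p <= n')%N.
 have /andP[h1 _] := tr i.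
 rewrite -(ler_nat R) natrD !natrM; have := hx i; rewrite ler_norml=> /andP[_ h2].
 have : (x 0 i + M0%:R - 1) * p%:R <= (2*M0%:R - 2) * p%:R by apply: ler_wpM2r; [exact: ltW|lra].
 nra.
pose ka : I := [ffun i=> inord (kn i)].
have kaE i: ka i = kn i :> nat by rewrite ffunE inordK // ltnS (leq_trans _ (kb i)) // leq_addr.
set x' : V := \row_i (1 - M0%:R + (ka i)%:R*h).
have xx': enorm (x - x') <= d%:R*h.
 apply: enorm_le_coord=> i; rewrite !mxE kaE.
 have /andP[h1 h2] := tr i; move: h2; rewrite -natr1=> h2.
 have e: (x 0 i + M0%:R - 1) * p%:R*h = x 0 i + M0%:R - 1 by rewrite mulfK // gt_eqF.
 have := ler_wpM2r (ltW h0) h1; have := ler_wpM2r (ltW h0) (ltW h2); rewrite e mulrDl mul1r=> *.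
 by rewrite ger0_norm; lra.
have hsE: d%:R*h/s = d%:R/n1%:R.
 by rewrite /s deE /h; field; rewrite !pnatr_eq0 -!lt0n p0 n10.
have xs: enorm (x - x')/s <= d%:R/n1%:R.
 by rewrite -hsE; apply: ler_wpM2r=> //; rewrite invr_ge0 ltW.
have xs1: enorm (x - x') <= s.
 have : d%:R/n1%:R <= 1 :> R by rewrite ler_pdivrMr ?ltr0n // mul1r ler_nat.
 by move=> /(le_trans xs); rewrite ler_pdivrMr // mul1r.
have -> : Sum1 c x - Sum1 c r = (Sum1 c x - Sum1 c x') + (Sum1 c x' - Sum1 c r) by ring.
have g0 := gC_gt0 d nu 0; have g1 := gC_gt0 d nu 1.
rewrite normDt // mulrDr; apply: lerD; last first.
 apply: (le_trans (Sum1_shift_grid c (ka := ka) _)); first by move=> i; rewrite kaE.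
 do 2 (apply: ler_wpM2l; first by pos).
 have q0: 0 < (4*nu*de)^-1 by rewrite invr_gt0 !mulr_gt0.
 rewrite expRN -[X in _ <= X]invrK lef_pV2 ?posrE ?expR_gt0 //.
 by have := expR_ge1Dx (4*nu*de)^-1; lra.
have := @op_bound2 R d p n' .+1 M0%:R p0 (fun m=> GZ a c de (x - y_ m) - GZ a c de (x' - y_ m)) (nu*gc 1*(d%:R/n1%:R)) 1 de (fun=> 1) x x' de0 hs.
rewrite -/y_ -/h /Sum1 -sumrB; under [in X in _ -> X]eq_bigr do rewrite -mulrBr.
move=> H; apply: le_trans (H _ _ _ _) _=> //; [by pos|by move=> m; rewrite normr1| |by apply: eqle; ring].
move=> m; have e: x - y_ m - (x' - y_ m) = x - x' by rewrite opprB addrA subrK.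
have := @GZ_diff1 _ _ _ _ _ _ _ hc 0 c de (x - y_ m) (x' - y_ m) de0; rewrite e !expr0 !mul1r mulr1=> /(_ xs1) h1.
apply: (le_trans h1); apply: ler_wpM2r; first by rewrite addr_ge0 ?KK_ge0.
by apply: ler_wpM2l=> //; pos.
Qed.
Definition Jn (x : V) : R := \sum_(m : I) h^+d*1*GZ a x de (r - y_ m).
Local Notation DD := (d%:R * d%:R * nu ^+ 2 * K).
Lemma Qf_frozen x x' z : `|Qf a x z - Qf a x' z| <= DD*enorm (x - x')*enorm z^+2.
Proof. exact: (ainv_lip hc). Qed.
Lemma GZ_pow k y z : (enorm z/s)^+k*GZ a y de z <= gc k*KK de z.
Proof.
apply: le_trans (GZ_le1 hc k y z de0); apply: ler_wpM2r; first exact: GZ_ge0.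
apply: lerXn2r; rewrite ?nnegrE ?lerDr //; last first.
 by have := enorm_ge0 z; have := s0; move=> *; pos.
by have := enorm_ge0 z; have := s0; move=> *; pos.
Qed.

Let D0 : 0 <= DD. Proof. have := c_K hc=> K0; pos. Qed.
Lemma Jn_lip x x' : `|Jn x - Jn x'| <= DD*gc 2*e8*enorm (x - x').
Proof.
have g2 := gC_gt0 d nu 2.
have := @op_bound R d p n'.+1 M0%:R p0 (fun m=> GZ a x de (r - y_ m) - GZ a x' de (r - y_ m)) (DD*enorm (x - x')*gc 2) 1 de (fun=> 1) r de0 hs.
rewrite /Jn -sumrB; under [in X in _ -> X]eq_bigr do rewrite -mulrBr.
move=> H; apply: le_trans (H _ _ _ _) _=> //; [by have := enorm_ge0 (x - x')=> e0; pos|by move=> m; rewrite normr1| |by apply: eqle; ring].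
move=> m; set z := r - y_ m.
apply: (le_trans (GZ_diffQ hc _ _ _ _ de0)).
apply: (le_via (DD*enorm (x - x')*enorm z^+2/(2*de)*(GZ a x de z + GZ a x' de z))).
 apply: ler_wpM2r; first by rewrite addr_ge0 ?GZ_ge0.
 by apply: ler_wpM2r; [rewrite invr_ge0; pos|exact: Qf_frozen].
have k1 := GZ_pow 2 x z; have k2 := GZ_pow 2 x' z.
have -> : DD*enorm (x - x')*enorm z^+2/(2*de)*(GZ a x de z + GZ a x' de z) =
 DD*enorm (x - x')*(((enorm z/s)^+2*GZ a x de z + (enorm z/s)^+2*GZ a x' de z)/2).
 by rewrite -{1}[de]sqr_sqrtr ?(ltW de0) // -/s; fieldp.
rewrite -[X in _ <= X]mulrA; apply: ler_wpM2l; last by clear H; lra.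
by have := enorm_ge0 (x - x')=> e0; pos.
Qed.
Lemma Jn_le x : Jn x <= gc 0*e8.
Proof.
have g0 := gC_gt0 d nu 0; rewrite /Jn.
apply: (le_via (\sum_(m : I) gc 0*(h^+d*KK de (r - y_ m)))).
 apply: ler_sum=> m _; rewrite mulr1 [gc 0*_]mulrCA; apply: ler_wpM2l; first by pos.
 exact: GZ_le0 hc _ _ _ de0.
by rewrite -mulr_sumr; apply: ler_wpM2l; [exact: ltW|exact: grid_sum].
Qed.
(** In each coordinate only the [n1] grid points from the reference point upwards, within [sqrt de],
    are kept; each coordinate then contributes at least [exp (- nu/2)]. *)
Lemma Jn_ge x : expR (- (nu/2))^+d <= Jn x.
Proof.
pose F (i : 'I_d) (j : 'I_n'.+1) := h*(s^-1*expR (- (nu*(1 - j%:R*h)^+2/(2*de)))).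
have F0 i j: 0 <= F i j by have e := expR_ge0 (- (nu*(1 - j%:R*h)^+2/(2*de))); have s1 := s0; rewrite /F; pos.
apply: (le_via (\prod_(i < d) \sum_j F i j)).
 rewrite -[d in X in X <= _]card_ord -prodr_const; apply: ler_prod=> i _; rewrite expR_ge0 /=.
 rewrite -(big_mkord xpredT (fun j : nat=> h*(s^-1*expR (- (nu*(1 - j%:R*h)^+2/(2*de)))))).
 have l1: (p <= p + n1)%N by rewrite leq_addr.
 have l2: (p + n1 <= n'.+1)%N.
  have e1: (p + n1 <= 2 * p)%N by lia.
  have e2: (1*(2 * p) <= M0*(2 * p))%N by rewrite leq_mul2r M00 orbT.
  by move: e1 e2; rewrite mul1n mulnCA mulnA; lia.
 rewrite (big_cat_nat (n := p)) //=; last exact: leq_trans l1 l2.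
 rewrite [X in _ <= _ + X](big_cat_nat (n := p + n1)) //=.
 set S1 := \sum_(0 <= j < p) _; set S2 := \sum_(p <= j < _) _; set S3 := \sum_(_ <= j < n'.+1) _.
 have S10: 0 <= S1 by apply: sumr_ge0=> j _; have e := expR_ge0 (- (nu*(1 - j%:R*h)^+2/(2*de))); have s1 := s0; pos.
 have S30: 0 <= S3 by apply: sumr_ge0=> j _; have e := expR_ge0 (- (nu*(1 - j%:R*h)^+2/(2*de))); have s1 := s0; pos.
 suff : expR (- (nu/2)) <= S2 by lra.
 have -> : expR (- (nu/2)) = \sum_(p <= j < p + n1) h*(s^-1*expR (- (nu/2))).
  rewrite sumr_const_nat addKn -[X in _ = X]mulr_natr /s deE /h; field; by rewrite !pnatr_eq0 -!lt0n p0 n10.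
 apply: ler_sum_nat=> j /andP[j1 j2]; apply: ler_wpM2l; first exact: ltW.
 apply: ler_wpM2l; first by rewrite invr_ge0 ltW.
 have e: nu*(1 - j%:R*h)^+2/(2*de) = nu/2*((1 - j%:R*h)^+2/de) by fieldp.
 rewrite ler_expR lerN2 e -[X in _ <= X]mulr1; apply: ler_wpM2l; first by pos.
 have hp: p%:R*h = 1 by rewrite mulfV // gt_eqF.
 rewrite (_ : (1 - j%:R*h)^+2 = (j%:R*h - 1)^+2); last by ring.
 rewrite ler_pdivrMr // mul1r -[X in _ <= X](sqr_sqrtr (ltW de0)) -/s; apply: lerXn2r; rewrite ?nnegrE ?(ltW s0) //.
  have := ler_wpM2r (ltW h0) (_ : p%:R <= j%:R :> R); rewrite hp subr_ge0; apply; by rewrite ler_nat.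
 have := ler_wpM2r (ltW h0) (_ : j%:R <= (p + n1)%:R :> R).
 rewrite natrD mulrDl hp /s deE -/h lerBlDl; apply; by rewrite -natrD ler_nat ltnW.
rewrite (bigA_distr_bigA F) /Jn; apply: ler_sum=> m _.
rewrite mulr1 /F !big_split /= !prodr_const card_ord; apply: ler_wpM2l; first by pos.
apply: (le_via ((s^-1)^+d*expR (- (nu*enorm (r - y_ m)^+2/(2*de))))).
 rewrite -expR_sum; apply: ler_wpM2l; first by have s1 := s0; pos.
 rewrite ler_expR sumrN lerN2 -mulr_suml -mulr_sumr enorm_sqr /dotv; apply: eqle; congr (_*_/_).
 apply: eq_bigr=> i _; rewrite !mxE expr2 /h; ring.
Transparent GZ. rewrite /GZ. Opaque GZ.
apply: ler_wpM2l; first by have s1 := s0; pos.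
rewrite ler_expR lerN2; apply: ler_wpM2r; first by rewrite invr_ge0; pos.
exact: Qf_le hc _ _.
Qed.
(** Three replacements: [g] at the grid point by [g x], the matrix frozen at the grid point by the
    one at [x], and the centre [x] by [r]. *)
Lemma Sop_J (g : V -> R) (x : V) (B e1 A : R) : (forall i, `|x 0 i| <= M0%:R - 1) -> 0 <= e1 -> 0 <= A -> 0 <= B ->
 (forall y, `|g y| <= B) -> (forall y, `|g y - g x| <= e1 + A*enorm (x - y)) ->
 `|Sop a p n'.+1 M0%:R de g x - Jn x*g x| <=
 e8*(e1*gc 0 + A*s*gc 1 + B*(DD*s*gc 3) + B*(2*(nu*gc 1*(d%:R/n1%:R) + gc 0*(4*nu*de)))).
Proof.
move=> hx e10 A0 B0 gB gA.
have g0 := gC_gt0 d nu 0; have g1 := gC_gt0 d nu 1; have g3 := gC_gt0 d nu 3; have s0' := s0.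
have t1: `|\sum_(m : I) h^+d*1*((g (y_ m) - g x)*GZ a (y_ m) de (x - y_ m))| <= 1*(e1*gc 0 + A*s*gc 1)*e8.
 apply: (@op_bound R d p n'.+1 M0%:R p0 _ _ 1 de (fun=> 1) x de0 hs); [by pos|by []|by move=> m; rewrite normr1|].
 move=> m; rewrite normrM [`|GZ _ _ _ _|]ger0_norm ?GZ_ge0 // -/y_; set z := x - y_ m.
 apply: (le_via ((e1 + A*enorm z)*GZ a (y_ m) de z)).
  by apply: ler_wpM2r; [exact: GZ_ge0|exact: gA].
 have k0 := GZ_le0 hc (y_ m) z de0; have k1 := GZ_pow 1 (y_ m) z; rewrite expr1 in k1.
 have -> : (e1 + A*enorm z)*GZ a (y_ m) de z = e1*GZ a (y_ m) de z + A*s*(enorm z/s*GZ a (y_ m) de z).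
  by fieldp.
 have -> : (e1*gc 0 + A*s*gc 1)*KK de z = e1*(gc 0*KK de z) + A*s*(gc 1*KK de z) by ring.
 by apply: lerD; apply: ler_wpM2l=> //; pos.
have t2: `|\sum_(m : I) h^+d*1*(g x*(GZ a (y_ m) de (x - y_ m) - GZ a x de (x - y_ m)))| <= 1*(B*(DD*s*gc 3))*e8.
 apply: (@op_bound R d p n'.+1 M0%:R p0 _ _ 1 de (fun=> 1) x de0 hs); [by pos|by []|by move=> m; rewrite normr1|].
 move=> m; rewrite normrM -/y_; set z := x - y_ m.
 rewrite -[X in _ <= X]mulrA; apply: ler_pM=> //.
 apply: (le_trans (GZ_diffQ hc _ _ _ _ de0)).
 apply: (le_via (DD*enorm z^+3/(2*de)*(GZ a (y_ m) de z + GZ a x de z))).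
  apply: ler_wpM2r; first by rewrite addr_ge0 ?GZ_ge0.
  apply: ler_wpM2r; first by rewrite invr_ge0; pos.
  by apply: (le_trans (Qf_frozen _ _ _)); rewrite enormB -/z; apply: eqle; ring.
 have k1 := GZ_pow 3 (y_ m) z; have k2 := GZ_pow 3 x z.
 have -> : DD*enorm z^+3/(2*de)*(GZ a (y_ m) de z + GZ a x de z) =
  DD*s*(((enorm z/s)^+3*GZ a (y_ m) de z + (enorm z/s)^+3*GZ a x de z)/2).
  by rewrite -{1}[de]sqr_sqrtr ?(ltW de0) // -/s; fieldp.
 by rewrite -[X in _ <= X]mulrA; apply: ler_wpM2l; [by pos|lra].
have t3: `|g x*(Sum1 x x - Sum1 x r)| <= B*(2*e8*(nu*gc 1*(d%:R/n1%:R) + gc 0*(4*nu*de))).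
 by rewrite normrM; apply: ler_pM=> //; exact: Sum1_shift.
have -> : Sop a p n'.+1 M0%:R de g x - Jn x*g x =
  \sum_(m : I) h^+d*1*((g (y_ m) - g x)*GZ a (y_ m) de (x - y_ m)) +
  \sum_(m : I) h^+d*1*(g x*(GZ a (y_ m) de (x - y_ m) - GZ a x de (x - y_ m))) + g x*(Sum1 x x - Sum1 x r).
 rewrite mulrBr -/(Jn x) [g x*Sum1 x r]mulrC addrA -[Sum1 x r]/(Jn x); congr (_ - _).
 rewrite /Sum1 mulr_sumr -!big_split; apply: eq_bigr=> m _ /=; rewrite -/y_ -/h; ring.
apply: normDt; apply: (le_trans (lerD (le_trans (ler_normD _ _) (lerD t1 t2)) t3)).
by apply: eqle; ring.
Qed.
End Delta.

Ltac ppos := solve [repeat first [ assumption | apply: mulr_gt0 | apply: exprn_gt0 | rewrite invr_gt0 | exact: expR_gt0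
 | exact: ltr01 | by rewrite ltr0n | apply: addr_gt0 ]].

(** * Inverting a perturbed multiplication operator *)

Section Neumann.
Variables (R : realType) (T : Type) (E : (T -> R) -> T -> R) (J f : T -> R) (jm Jm F : R).
Hypotheses (jm0 : 0 < jm) (F0 : 0 <= F) (Jge : forall x, jm <= J x) (Jle : forall x, J x <= Jm) (fF : forall x, `|f x| <= F).
Hypothesis E_le : forall g B, 0 <= B -> (forall x, `|g x| <= B) -> forall x, `|E g x| <= B*(jm/2).
Hypothesis E_lin : forall g g' x, E g x - E g' x = E (fun y=> g y - g' y) x.
Let B := 2*F/jm.
Variables (wf wE wJ : T -> T -> R).
Hypotheses (w_f : forall x y, `|f x - f y| <= wf x y) (w_J : forall x y, `|J x - J y| <= wJ x y).
Hypothesis w_E : forall g, (forall x, `|g x| <= B) -> forall x y, `|E g x - E g y| <= wE x y.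
(** Iteration of [g -> (f - E g)/J], a contraction of factor [1/2] since [E] is bounded by [jm/2].
    All iterates stay in the ball of radius [B], so their modulus of continuity is bounded
    independently of [j]. *)
Lemma neumann (j : nat) : exists g : T -> R,
 [/\ forall x, `|g x| <= B, (forall x, `|J x*g x + E g x - f x| <= Jm*B/2^+j) &
   forall x y, `|g x - g y| <= (wf x y + wE x y)/jm + 2*F*wJ x y/jm^+2].
Proof.
pose S g x := (f x - E g x)/J x.
pose gs j := iter j S (fun=> 0).
have B0: 0 <= B by rewrite /B divr_ge0 ?mulr_ge0 ?(ltW jm0).
have Jp x: 0 < J x by apply: lt_le_trans (Jge x).
have BE: B*(jm/2) = F by rewrite /B; fieldp.
have num g x: (forall x, `|g x| <= B) -> `|f x - E g x| <= 2*F.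
 move=> hg; rewrite normBt // (_ : 2*F = F + F); last by ring.
 by apply: lerD=> //; rewrite -[X in _ <= X]BE; exact: E_le.
have SB g: (forall x, `|g x| <= B) -> forall x, `|S g x| <= B.
 move=> hg x; rewrite /S normrM normfV [`|J x|]gtr0_norm // /B; apply: ler_pM=> //; first by rewrite invr_ge0 ltW.
  exact: num.
 by rewrite lef_pV2 ?posrE.
have gB i: forall x, `|gs i x| <= B.
 elim: i=> [|i IH] x /=; [by rewrite normr0|exact: SB].
have gd i x: `|gs i.+1 x - gs i x| <= B/2^+i.
 elim: i x=> [|i IH] x; first by rewrite expr0 divr1 /= subr0; apply: SB=> z; rewrite normr0.
 have -> : gs i.+2 x - gs i.+1 x = - (E (gs i.+1) x - E (gs i) x)/J x by rewrite /= /S; fieldp.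
 rewrite E_lin normrM normrN normfV [`|J x|]gtr0_norm // ler_pdivrMr //.
 have P0: 0 <= B/2^+i by rewrite divr_ge0 // exprn_ge0.
 apply: (le_trans (E_le P0 IH x)).
 rewrite (_ : B/2^+i*(jm/2) = B/2^+i.+1*jm).
  by apply: ler_wpM2l=> //; rewrite divr_ge0 // exprn_ge0.
 by rewrite exprS; field; rewrite expf_neq0 // pnatr_eq0.
exists (gs j.+1); split=> // [x|x y].
 have e: J x*gs j.+1 x = f x - E (gs j) x by rewrite /= /S mulrC divfK // gt_eqF.
 have -> : J x*gs j.+1 x + E (gs j.+1) x - f x = J x*(gs j.+1 x - gs j.+2 x).
  rewrite mulrBr [J x*gs j.+2 x](_ : _ = f x - E (gs j.+1) x); first by ring.
  by rewrite /= /S mulrC divfK // gt_eqF.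
 rewrite normrM gtr0_norm // -mulrA distrC; apply: ler_pM=> //; first exact: ltW.
 apply: (le_trans (gd j.+1 x)); apply: ler_wpM2l=> //.
 by rewrite lef_pV2 ?posrE ?exprn_gt0 // exprS ler_peMl ?exprn_ge0 // ler1n.
rewrite /= /S.
set u := f x - E _ x; set v := f y - E _ y.
have uv: `|u - v| <= wf x y + wE x y.
 have -> : u - v = (f x - f y) - (E (gs j) x - E (gs j) y) by rewrite /u /v; ring.
 by rewrite normBt // lerD //; exact: w_E.
have v2: `|v| <= 2*F by exact: num.
have -> : u/J x - v/J y = (u - v)/J x + v*(J y - J x)/(J x*J y) by fieldp.
have i1 x': (J x')^-1 <= jm^-1 by rewrite lef_pV2 ?posrE.
rewrite normDt // !normrM !normfV; apply: lerD.
 by rewrite [`|J x|]gtr0_norm //; apply: ler_pM=> //; rewrite invr_ge0 ltW.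
apply: ler_pM; rewrite ?invr_ge0 ?mulr_ge0 //; first by apply: ler_pM=> //; rewrite distrC.
rewrite gtr0_norm ?mulr_gt0 // lef_pV2 ?posrE ?mulr_gt0 ?exprn_gt0 // expr2.
by apply: ler_pM=> //; exact: ltW.
Qed.
End Neumann.

(** * Compactly supported functions; the resolvent equation at large parameter *)

Section Bdd.
Variables (R : realType) (d : nat).
Local Notation V := 'rV[R]_d.
Lemma cont_bsupp_bdd (f : V -> R) : cont f -> bsupp f -> exists2 B : R, 0 < B & forall x, `|f x| <= B.
Proof.
move=> cf [M hM].
have [[y hy]|hno] := pselect (exists y, f y != 0); last first.
 exists 1=> // x; rewrite (_ : f x = 0) ?normr0 //.
 by apply/eqP; apply/negP=> /negP h; apply: hno; exists x.
have [|||x hx] := @bsupp_min R d (fun x=> (-1)*(f x*f x)).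
- by apply: cont_mul; [exact: cont_cst|exact: cont_mul].
- by exists M=> z hz; rewrite hM // mulr0 mulr0.
- exists y; rewrite mulN1r oppr_lt0 -expr2 lt_neqAle sqr_ge0 andbT eq_sym expf_neq0 //.
exists (`|f x| + 1); first by rewrite ltr_wpDl.
move=> z; have := hx z; rewrite !mulN1r lerN2 -!expr2 -real_normK ?num_real // -[X in _ <= X]real_normK ?num_real // => h.
have : `|f z| <= `|f x| by rewrite -(@ler_pXn2r _ 2) ?nnegrE.
lra.
Qed.
Lemma C2_bdd (f : V -> R) G H : C2 f G H -> bsupp f -> exists2 B : R, 0 < B &
 forall x, [/\ `|f x| <= B, (forall i, `|G x 0 i| <= B) & forall i j, `|H x i j| <= B].
Proof.
move=> hf [M hM]; have [h1 h2 h3] := hf.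
have [B1 B10 hB1] := cont_bsupp_bdd (D1_cont h1) (ex_intro _ M hM).
have [||B2 B20 hB2] := @cont_bsupp_bdd (fun x=> \sum_i (G x 0 i*G x 0 i)).
- by apply: cont_sum=> i; have c := D1_cont (h2 i); exact: cont_mul.
- by exists M=> y hy; rewrite big1 // => i _; have [-> _] := C2_supp hf hM hy; rewrite mxE mulr0.
have [||B3 B30 hB3] := @cont_bsupp_bdd (fun x=> \sum_i \sum_j (H x i j*H x i j)).
- by apply: cont_sum=> i; apply: cont_sum=> j; have c := h3 i j; exact: cont_mul.
- exists M=> y hy; rewrite big1 // => i _; rewrite big1 // => j _.
 by have [_ ->] := C2_supp hf hM hy; rewrite mxE mulr0.
have sq (t : R) : `|t| <= 1 + t*t by rewrite ler_norml; apply/andP; split; nra.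
exists (B1 + (1 + B2) + (1 + B3)); first by lra.
move=> x; split=> [|i|i j]; first by have := hB1 x; lra.
 apply: (le_trans (sq _)).
 have : G x 0 i*G x 0 i <= \sum_i (G x 0 i*G x 0 i).
  by rewrite (bigD1 i) //= lerDl; apply: sumr_ge0=> k _; rewrite -expr2 sqr_ge0.
 by have := hB2 x; rewrite ler_norml=> /andP[_]; lra.
apply: (le_trans (sq _)).
have : H x i j*H x i j <= \sum_i \sum_j (H x i j*H x i j).
 rewrite (bigD1 i) //= (bigD1 j) //= -addrA lerDl addr_ge0 //.
  by apply: sumr_ge0=> k _; rewrite -expr2 sqr_ge0.
 by apply: sumr_ge0=> k _; apply: sumr_ge0=> l _; rewrite -expr2 sqr_ge0.
by have := hB3 x; rewrite ler_norml=> /andP[_]; lra.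
Qed.
Lemma D1_lip (f : V -> R) G (B : R) : D1 f G -> (forall x i, `|G x 0 i| <= B) ->
 forall x y, `|f x - f y| <= d%:R*B*enorm (x - y).
Proof.
move=> hf hG x y.
have := @derive_lip R (fun t : R=> f (y + t *: (x - y))) (fun t=> dotv (G (y + t *: (x - y))) (x - y)) 0 1 (d%:R*B*enorm (x - y)).
rewrite scale0r addr0 scale1r subr0 normr1 mulr1 [y + (x - y)]addrC subrK; apply=> t _; first exact: D1_line.
apply: (le_trans (dotv_abs _ _)); apply: ler_wpM2r; first exact: enorm_ge0.
exact: enorm_le_coord.
Qed.
Lemma nat_ge (x : R) : exists2 n : nat, (0 < n)%N & x <= n%:R.
Proof.
exists (Num.bound `|x|).+1=> //; apply: (le_trans (ler_norm x)); apply: ltW.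
by apply: (lt_trans (archi_boundP (normr_ge0 x))); rewrite ltr_nat.
Qed.
Lemma div_swap (x e n : R) : 0 < e -> 0 < n -> x/e <= n -> x/n <= e.
Proof. by move=> e0 n0; rewrite !ler_pdivrMr // mulrC. Qed.
Lemma exp_le_inv (s : R) : 0 < s -> expR (- s) <= s^-1.
Proof.
move=> s0; rewrite expRN lef_pV2 ?posrE ?expR_gt0 //.
by have := expR_ge1Dx s; lra.
Qed.
End Bdd.

Section Resolvent.
Variables (R : realType) (d : nat).
Local Notation V := 'rV[R]_d.
Variables (nu be K : R) (a : V -> 'M[R]_d) (b : V -> V).
Hypothesis hc : coefs nu be K a b.
Let nu0 : 0 < nu := lt_le_trans ltr01 (c_nu hc).
Local Notation C3 := (c3 d nu be K).
Local Notation gc := (gC d nu).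
Local Notation e8 := ((8 : R) ^+ d).
Let jm : R := expR (- (nu/2))^+d.
Local Notation DD := (d%:R * d%:R * nu ^+ 2 * K).

Let e80 : 0 < e8. Proof. exact: exprn_gt0. Qed.
Let jm0 : 0 < jm. Proof. by rewrite exprn_gt0 ?expR_gt0. Qed.
Lemma cutoff_error (ch u f : V -> R) (Gc Gu : V -> V) (Hc Hu : V -> 'M[R]_d) (x : V) (lam c Bu BG eps1 eps2 : R) :
 0 <= ch x <= 1 -> (forall i, `|Gc x 0 i| <= c) -> (forall i j, `|Hc x i j| <= c) ->
 `|u x| <= Bu -> (forall i, `|Gu x 0 i| <= BG) -> (ch x = 0 \/ `|lam*u x - LL a b Gu Hu x - f x| <= eps1) ->
 ch x*f x = f x -> 0 <= eps1 ->
 Bu*(d%:R*(d%:R*(nu*c)) + d%:R*(be*c)) + d%:R*(d%:R*(nu*(c*BG))) <= eps2 ->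
 `|lam*(ch x*u x) - LL a b (fun y=> ch y *: Gu y + u y *: Gc y)
   (fun y=> \matrix_(j, i) (ch y*Hu y j i + u y*Hc y j i + (Gu y 0 j*Gc y 0 i + Gc y 0 j*Gu y 0 i))) x - f x| <= eps1 + eps2.
Proof.
move=> /andP[c0 c1] hG hH hu hGu hch hf e10 he2; rewrite LL_mul.
have b1 := LL_bound hc hG hH; have b2 := cross_bound hc hG hGu.
set X := 2^-1*_ in b2 *; set Y := LL a b Gc Hc x in b1 *; set Z := LL a b Gu Hu x in hch *.
have -> : lam*(ch x*u x) - (ch x*Z + u x*Y + X) - f x = ch x*(lam*u x - Z - f x) - (u x*Y + X).
 by rewrite -{1}hf; ring.
have uY: `|u x*Y| <= Bu*(d%:R*(d%:R*(nu*c)) + d%:R*(be*c)) by rewrite normrM; apply: ler_pM.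
rewrite normBt //; apply: lerD.
 case: hch=> [->|h]; first by rewrite mul0r normr0.
 by rewrite normrM ger0_norm // -[X in _ <= X]mul1r; apply: ler_pM.
apply: le_trans he2; rewrite normDt //; exact: lerD.
Qed.
(** Trades the Hoelder modulus of exponent [1/2] coming from [E1op_half] for a small constant plus a
    Lipschitz term, the form required by [Sop_J]. *)
Lemma sqrt_young (A s e : R) : 0 <= A -> 0 <= s -> 0 < e -> A*sqrt s <= e + A^+2/e*s.
Proof.
move=> A0 s0 e0; have [h|/ltW h] := leP (A*sqrt s) e.
 by apply: (le_trans h); rewrite lerDl; pos.
have r0 := sqrtr_ge0 s; apply: (le_via (A^+2/e*s)); last by rewrite lerDr ltW.
rewrite -[s in X in _ <= X]sqr_sqrtr // (_ : A^+2/e*sqrt s^+2 = A*sqrt s*(A*sqrt s/e)); last first.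
 by fieldp.
rewrite ler_peMr //; first by pos.
by rewrite ler_pdivlMr // mul1r.
Qed.
(** The order of choices is essential. [N] fixes the final time [N^-2] and makes the kernel errors
    at most [jm/4]; [lam0] does the same for the boundary term at that time. Only then come the
    cutoff radius [M], the small time [de], the mesh [1/p] and the time step [tau], each depending
    on [f], [eps] and its predecessors. *)
Lemma resolvent_large : exists2 lam0 : R, 0 < lam0 & forall lam, lam0 <= lam ->
 forall (f : V -> R) (L : R), (forall x y, `|f x - f y| <= L*enorm (x - y)) -> bsupp f ->
 forall eps, 0 < eps -> exists phi G H, [/\ C2 phi G H, bsupp phi &
  forall x, `|lam * phi x - LL a b G H x - f x| <= eps].
Proof.
have g0 := gC_gt0 d nu 0; have g1 := gC_gt0 d nu 1; have g2 := gC_gt0 d nu 2; have g3 := gC_gt0 d nu 3.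
have c30 := c3_ge0 hc; have be0 := c_be hc; have K0 := c_K hc.
have [N N0 hN] := nat_ge (8*C3*gc 3*e8/jm).
have NR: 0 < (N%:R : R) by rewrite ltr0n.
have TN: e8*(2*C3*gc 3*N%:R^-1) <= jm/4.
 rewrite (_ : e8*_ = 8*C3*gc 3*e8/4/N%:R); last by fieldp.
 rewrite ler_pdivrMr // (_ : jm/4*N%:R = N%:R*jm/4); last by ring.
 by apply: ler_wpM2r=> //; rewrite -ler_pdivrMr.
pose lam0 : R := N%:R^+2*(4*e8*gc 0/jm).
have lam00: 0 < lam0 by rewrite /lam0; ppos.
exists lam0=> // lam hlam f L hf sf eps eps0.
have lamp: 0 < lam by apply: lt_le_trans hlam.
have TL: e8*(expR (- (lam/N%:R^+2))*gc 0) <= jm/4.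
 have s0: 0 < lam/N%:R^+2 by rewrite divr_gt0 ?exprn_gt0.
 have h1 := exp_le_inv s0; rewrite invf_div in h1.
 apply: (le_via (e8*(N%:R^+2/lam*gc 0))).
  by apply: ler_wpM2l; [exact: ltW|apply: ler_wpM2r; [exact: ltW|]].
 rewrite (_ : e8*_ = e8*N%:R^+2*gc 0/lam); last by fieldp.
 rewrite ler_pdivrMr //.
 have := ler_wpM2l (ltW (divr_gt0 jm0 (ltr0n R 4))) hlam.
 rewrite /lam0 (_ : jm/4*(N%:R^+2*(4*e8*gc 0/jm)) = e8*N%:R^+2*gc 0) //.
 by fieldp.
have [F F0 fF] := cont_bsupp_bdd (cont_lip hf) sf.
have [Rf hRf] := sf.
pose B := 2*F/jm.
have B0: 0 <= B by rewrite /B; pos.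
pose Bu := B*gc 0*e8; pose BG := 2*(B*(nu*gc 1)*e8).
have Bu0: 0 <= Bu by rewrite /Bu; pos.
have BG0: 0 <= BG by rewrite /BG; pos.
have [Cc Cc0 hcut] := cutoff_ex R d.
pose Ec := Bu*(d%:R*(d%:R*(nu*Cc)) + d%:R*(be*Cc)) + d%:R*(d%:R*(nu*(Cc*BG))).
have [M Mp hM] := nat_ge (`|Rf| + 2*Ec/eps).
have MR: 0 < (M%:R : R) by rewrite ltr0n.
have Ec0: 0 <= Ec by rewrite /Ec; pos.
have MRf: Rf <= M%:R.
 apply: (le_trans (ler_norm Rf)); apply: le_trans hM; rewrite lerDl; pos.
have EcM: Ec/M%:R <= eps/2.
 rewrite ler_pdivrMr // (_ : eps/2*M%:R = M%:R*eps/2); last by ring.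
 rewrite ler_pdivlMr // mulrC -ler_pdivrMr //; apply: le_trans hM; rewrite lerDr //.
have [ch [Gc [Hc [hch ch01 ch1 ch0 hchb]]]] := hcut M%:R ltac:(by rewrite ler1n).
pose M0 := (2*M).+1.
pose A1 := (L + B*(2*e8*(nu*gc 1 + gc 0)*N%:R))/jm + 2*F*(DD*gc 2*e8)/jm^+2.
pose A2 := B*(4*cE d nu be K)/jm.
have cE0: 0 <= cE d nu be K by rewrite /cE; pos.
have A20: 0 <= A2 by rewrite /A2; pos.
pose ep := eps/16.
have ep0: 0 < ep by rewrite /ep; lra.
pose e1 := ep/(e8*gc 0).
have e10: 0 < e1 by rewrite /e1 divr_gt0 ?mulr_gt0.
pose A := `|A1| + A2^+2/e1.
have A0: 0 <= A by rewrite /A; pos.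
pose X := e8*(A*gc 1 + B*(DD*gc 3) + B*(8*gc 0*nu)) + lam*(B*gc 0*e8).
have [q q0 hq] := nat_ge (X/ep).
have qR: 0 < (q%:R : R) by rewrite ltr0n.
have [n1 n10 hn1] := nat_ge (d%:R + e8*B*(2*nu*gc 1*d%:R)/ep).
have n1R: 0 < (n1%:R : R) by rewrite ltr0n.
have dn1: (d <= n1)%N.
 by rewrite -(ler_nat R); apply: le_trans hn1; rewrite lerDl; pos.
have n1b: e8*B*(2*nu*gc 1*d%:R)/n1%:R <= ep.
 by apply: div_swap=> //; apply: le_trans hn1; rewrite lerDr.
(* Makes [sqrt de = n1/p = 1/(N q)], a multiple of the mesh that is small with [1/q]. *)
pose p := (N*n1*q)%N.
have p0: (0 < p)%N by rewrite !muln_gt0 N0 n10 q0.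
have pR: 0 < (p%:R : R) by rewrite ltr0n.
have n1p: (n1 <= p)%N by rewrite /p mulnAC leq_pmull // muln_gt0 N0 q0.
pose s : R := n1%:R/p%:R.
have sE: s = (N%:R*q%:R)^-1 by rewrite /s /p !natrM; fieldp.
have s0: 0 < s by rewrite /s divr_gt0.
have sq: s <= q%:R^-1.
 rewrite sE lef_pV2 ?posrE ?mulr_gt0 // ler_peMl ?(ltW qR) // ler1n //.
have s1: s <= 1 by apply: (le_trans sq); rewrite invf_le1 // ler1n.
have Xs: X*s <= ep.
 have X0: 0 <= X by rewrite /X; pos.
 apply: (le_trans (ler_wpM2l X0 sq)); exact: div_swap.
pose de := s^+2.
have de0: 0 < de by rewrite exprn_gt0.
have sde: sqrt de = s by rewrite sqrtr_sqr gtr0_norm.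
have des: de <= s by rewrite /de expr2 ler_piMl // ltW.
pose n := (2*M0 * p).+1.
pose Q := nu*(2*M%:R + d%:R*M0%:R)^+2.
pose Bc := (d%:R/(2*de^+2) + Q/de^+3 + (lam + d%:R/(2*de) + Q/(2*de^+2))^+2)*(sqrt de)^-1^+d.
have Q0: 0 <= Q by rewrite /Q; pos.
have Bc0: 0 <= Bc by rewrite /Bc; pos.
pose Y := (n ^ d)%:R*((p%:R^-1)^+d*B*Bc).
have Y0: 0 <= Y by rewrite /Y; pos.
have [k0 k00 hk0] := nat_ge (Y/ep).
have k0R: 0 < (k0%:R : R) by rewrite ltr0n.
pose tau := de/k0%:R.
have tau0: 0 < tau by rewrite /tau divr_gt0.
have tk0: tau*k0%:R = de by rewrite /tau divfK // gt_eqF.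
(* With this number of steps the final time [tau * k1] is exactly [N^-2]. *)
pose k1 := (k0*q ^ 2)%N.
have k01: (k0 <= k1)%N by rewrite /k1 leq_pmulr // expn_gt0 q0.
have tk1: tau*k1%:R = N%:R^-1^+2.
 by rewrite /k1 natrM natrX mulrA tk0 /de sE; fieldp.
have T1: tau*k1%:R <= 1 by rewrite tk1 exprn_ile1 // ?invr_ge0 // invf_le1 // ler1n.
have sT: sqrt (tau*k1%:R) = N%:R^-1 by rewrite tk1 sqrtr_sqr gtr0_norm // invr_gt0.
have hde: p%:R^-1 <= sqrt (tau*k0%:R).
 rewrite tk0 sde /s -[X in X <= _]mul1r ler_wpM2r ?invr_ge0 ?ler1n //.
have lam0': 0 <= lam by exact: ltW.
pose E := @Eop R d a b p n M0%:R lam tau k0 k1.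
pose J := @Jn R d a p M0 de.
have E_le g B': 0 <= B' -> (forall x, `|g x| <= B') -> forall x, `|E g x| <= B'*(jm/2).
 move=> B'0 gB x; apply: (le_trans (Eop_le hc n M0%:R p0 tau0 k00 k01 lam0' hde x B'0 gB)).
 apply: ler_wpM2l=> //.
 move: TN TL; rewrite sT tk1 exprVn=> h1 h2.
 by rewrite mulrDr (_ : jm/2 = jm/4 + jm/4) ?lerD //; field.
have M00: (0 < M0)%N by [].
have deE: sqrt de = n1%:R/p%:R by rewrite sde.
have Jlip x y: `|J x - J y| <= DD*gc 2*e8*enorm (x - y) by apply: (Jn_lip hc M0 p0 n10 de0 deE).
have Jge x: jm <= J x by apply: (Jn_ge hc p0 M00 n10 n1p dn1 de0 deE).
have Jle x: J x <= gc 0*e8 by apply: (Jn_le hc M0 p0 n10 de0 deE).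
have [j jb] : exists j : nat, gc 0*e8*B/2^+j <= ep.
 have [j j0 hj] := nat_ge (gc 0*e8*B/ep); exists j.
 apply: div_swap; rewrite ?exprn_gt0 //; apply: (le_trans hj).
 by rewrite -natrX ler_nat ltnW // ltn_expl.
have w_E g: (forall x, `|g x| <= B) -> forall x y, `|E g x - E g y| <=
  B*(2*e8*(nu*gc 1 + gc 0)*(enorm (x - y)*N%:R) + 4*cE d nu be K*sqrt (enorm (x - y))).
 move=> gB x y; apply: (le_trans (Eop_diff hc n M0%:R p0 tau0 k00 k01 lam0' T1 hde x y B0 gB)).
 by rewrite sT invrK.
have [g [gB gJ gmod]] := neumann jm0 (ltW F0) Jge Jle fF E_le (Eop_lin a b p n M0%:R lam tau k0 k1) hf Jlip w_E j.
have gA x y: `|g y - g x| <= e1 + A*enorm (x - y).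
 rewrite distrC; apply: (le_trans (gmod x y)).
 set r := enorm (x - y); have r0: 0 <= r := enorm_ge0 _.
 have -> : (L*r + B*(2*e8*(nu*gc 1 + gc 0)*(r*N%:R) + 4*cE d nu be K*sqrt r))/jm
   + 2*F*(DD*gc 2*e8*r)/jm^+2 = A1*r + A2*sqrt r.
  by rewrite /A1 /A2; fieldp.
 have h1 := sqrt_young A20 r0 e10.
 have h2: A1*r <= `|A1|*r by apply: ler_wpM2r=> //; exact: ler_norm.
 by rewrite /A [in X in _ <= X]mulrDl [X in _ <= X]addrCA; exact: lerD.
pose u := uop a p n M0%:R lam tau k0 k1 g.
have hu: C2 u _ _ := u_C2 hc p n M0%:R lam k1 tau0 k00 g.
set Gu := uG _ _ _ _ _ _ _ _ _ in hu; set Hu := uH _ _ _ _ _ _ _ _ _ in hu.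
have main x: enorm x <= 2*M%:R -> `|lam*u x - LL a b Gu Hu x - f x| <= eps/2.
 move=> hx.
 have M0E: M0%:R = 2*M%:R + 1 :> R by rewrite /M0 -natr1 natrM.
 have xi i: `|x 0 i| <= M0%:R - 1 by rewrite M0E addrK; apply: le_trans (coord_le x i) hx.
 have hQ (m : {ffun 'I_d -> 'I_n}) : Qf a (gpt p M0%:R m) (x - gpt p M0%:R m) <= Q.
  apply: (le_trans (Qf_le hc _ _)); rewrite /Q; apply: ler_wpM2l; first exact: ltW.
  have ym: enorm (gpt p M0%:R m : V) <= d%:R*M0%:R.
   apply: enorm_le_coord=> i; rewrite mxE.
   have : (m i)%:R/p%:R <= 2*M0%:R :> R.
    rewrite ler_pdivrMr // -!natrM ler_nat; have := ltn_ord (m i); rewrite /n ltnS //.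
   have : 0 <= (m i)%:R/p%:R :> R by pos.
   by move=> /= h3 h4; clear -h3 h4; rewrite ler_norml; lra.
  apply: lerXn2r; rewrite ?nnegrE ?enorm_ge0 ?addr_ge0 ?mulr_ge0 //.
  by apply: (le_trans (ler_enormD _ _)); rewrite enormN lerD.
 have ap := u_approx hc p0 tau0 k00 k01 lam0' T1 B0 gB hQ.
 rewrite -/u -/Gu -/Hu -/E tk0 in ap.
 have BrE: Briem d lam tau k0 Q = Bc by rewrite /Briem tk0.
 have apb: (n ^ d)%:R*(p%:R^-1^+d*B*(tau*Briem d lam tau k0 Q)) <= ep.
  rewrite BrE (_ : _*(_*_*(tau*Bc)) = Y*tau); last by rewrite /Y; ring.
  have tk: tau <= k0%:R^-1.
   by rewrite /tau -[X in _ <= X]mul1r; apply: ler_wpM2r; [rewrite invr_ge0|exact: le_trans s1].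
  by apply: (le_trans (ler_wpM2l Y0 tk)); exact: div_swap.
 have sj := Sop_J hc p0 M00 n10 n1p dn1 de0 deE xi (ltW e10) A0 B0 gB (gA x).
 rewrite sde -/n -/J in sj.
 have hde' := hde; rewrite tk0 in hde'.
 have sl := Sop_le hc n M0%:R p0 x de0 hde' B0 gB.
 set S := Sop _ _ _ _ _ _ _ in ap sj sl.
 have ex: `|expR (- (lam*de))*S - S| <= lam*s*(B*gc 0*e8).
  have -> : expR (- (lam*de))*S - S = (expR (- (lam*de)) - 1)*S by ring.
  rewrite normrM; apply: ler_pM=> //.
  have l0: 0 <= lam*de by pos.
  have : expR (- (lam*de)) <= 1 by rewrite -expR0 ler_expR oppr_le0.
  have := expR_ge1Dx (- (lam*de))=> h1 h2.
  have h3: lam*de <= lam*s by apply: ler_wpM2l.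
  by clear -h1 h2 h3; rewrite ler0_norm; lra.
 have t1: e8*(e1*gc 0) = ep by rewrite /e1; fieldp.
 have t2: e8*(B*(2*(gc 0*(4*nu*de)))) <= e8*(B*(8*gc 0*nu))*s.
  rewrite (_ : e8*(B*(2*_)) = e8*(B*(8*gc 0*nu))*de); last by ring.
  by apply: ler_wpM2l=> //; pos.
 have gj := le_trans (gJ x) jb.
 set EE := E g x in ap gj; set JJ := J x*g x in sj gj; set UU := lam*u x - LL a b Gu Hu x in ap *.
 have -> : UU - f x = (UU - (expR (- (lam*de))*S + EE)) + (expR (- (lam*de))*S - S) + (S - JJ) + (JJ + EE - f x) by ring.
 apply: (le_via (ep + lam*s*(B*gc 0*e8) + (ep + ep + (X*s - lam*s*(B*gc 0*e8))) + ep)); last first.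
  by clear -Xs eps0; move: Xs; rewrite /ep; lra.
 apply: normDt; apply: lerD; last exact: gj.
 apply: normDt; apply: lerD.
  by apply: normDt; apply: lerD; [exact: le_trans apb|exact: ex].
 apply: (le_trans sj).
 rewrite (_ : e8*_ = e8*(e1*gc 0) + e8*B*(2*nu*gc 1*d%:R)/n1%:R
   + (e8*(A*gc 1 + B*(DD*gc 3))*s + e8*(B*(2*(gc 0*(4*nu*de)))))); last first.
  by fieldp.
 rewrite t1; apply: lerD; first by apply: lerD.
 rewrite /X; apply: (le_trans (lerD (lexx _) t2)); apply: eqle; ring.
do 3 eexists; split; first exact: C2_mul hch hu.
 by exists (2*M%:R)=> y hy; rewrite ch0 ?mul0r // ltW.
move=> x; rewrite (_ : eps = eps/2 + eps/2); last by field.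
have [hG hH] := hchb x.
apply: (cutoff_error (c := Cc/M%:R) (Bu := Bu) (BG := BG) _ hG hH)=> //.
- by apply: (u_le hc n M0%:R p0 tau0 k00 lam0' T1 hde).
- by move=> i; apply: (uG_le hc n M0%:R p0 tau0 k00 lam0' T1 hde).
- have [h|/ltW h] := leP (2*M%:R) (enorm x); first by left; exact: ch0.
 by right; exact: main.
- have [h|h] := leP (enorm x) M%:R; first by rewrite ch1 ?mul1r.
 by rewrite hRf ?mulr0 //; exact: le_lt_trans h.
- by rewrite divr_ge0 // ltW.
- by apply: le_trans EcM; apply: eqle; rewrite /Ec; fieldp.
Qed.
End Resolvent.

(** * The approximate resolvent equation with a potential, at every positive parameter *)

Section Potential.
Variables (R : realType) (d : nat).
Local Notation V := 'rV[R]_d.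
Variables (nu be K : R) (a : V -> 'M[R]_d) (b : V -> V).
Hypothesis hc : coefs nu be K a b.
Definition lips (f : V -> R) : Prop := exists L : R, forall x y, `|f x - f y| <= L*enorm (x - y).
Definition bdd (f : V -> R) : Prop := exists B : R, forall x, `|f x| <= B.
Lemma lips_add f g : lips f -> lips g -> lips (fun x=> f x + g x).
Proof.
move=> [L hL] [L' hL']; exists (L + L')=> x y.
rewrite opprD addrACA normDt // mulrDl; exact: lerD.
Qed.
Lemma lips_mul f g : lips f -> lips g -> bdd f -> bdd g -> lips (fun x=> f x*g x).
Proof.
move=> [L hL] [L' hL'] [B hB] [B' hB']; exists (L*B' + B*L')=> x y.
have -> : f x*g x - f y*g y = (f x - f y)*g x + f y*(g x - g y) by ring.
rewrite normDt // !normrM mulrDl; apply: lerD.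
 by rewrite mulrAC; apply: ler_pM.
by rewrite -mulrA; apply: ler_pM.
Qed.
Lemma lips_cst c : lips (fun=> c).
Proof. by exists 0=> x y; rewrite subrr normr0 mul0r. Qed.
Lemma lips_scale c f : lips f -> lips (fun x=> c*f x).
Proof.
move=> [L hL]; exists (`|c|*L)=> x y; rewrite -mulrBr normrM -mulrA; exact: ler_wpM2l.
Qed.
Lemma lips_bdd f : lips f -> bsupp f -> bdd f.
Proof. by move=> [L hL] hs; have [B _ hB] := cont_bsupp_bdd (cont_lip hL) hs; exists B. Qed.
Lemma C2_lips f G H : C2 f G H -> bsupp f -> lips f.
Proof.
move=> hf hs; have [B _ hB] := C2_bdd hf hs; have [h1 _ _] := hf; exists (d%:R*B).
by apply: (D1_lip h1)=> x i; have [_ + _] := hB x.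
Qed.
Lemma C2_bddf f G H : C2 f G H -> bsupp f -> bdd f.
Proof. by move=> hf hs; have [B _ hB] := C2_bdd hf hs; exists B=> x; have [] := hB x. Qed.
Lemma bsupp_lin (f g : V -> R) c : bsupp f -> bsupp g -> bsupp (fun x=> f x + c*g x).
Proof.
move=> [M hM] [M' hM']; exists (max M M')=> y; rewrite gt_max=> /andP[h1 h2].
by rewrite hM // hM' // mulr0 addr0.
Qed.
Lemma bsupp_mulr (f g : V -> R) : bsupp g -> bsupp (fun x=> f x*g x).
Proof. by move=> [M hM]; exists M=> y hy; rewrite hM // mulr0. Qed.
Lemma mp_abs (kap e : R) (W : V -> R) f G H : 0 < kap -> 0 <= e -> (forall x, 0 <= W x) -> C2 f G H -> bsupp f ->
 (forall x, `|(kap + W x)*f x - LL a b G H x| <= e) -> forall x, `|f x| <= e/kap.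
Proof.
move=> k0 e0 W0 hf sf h x; rewrite ler_norml; apply/andP; split.
 apply: (max_principle hc k0 e0 W0 hf sf)=> y; have := h y; rewrite ler_norml; by case/andP.
rewrite -lerN2 -[X in _ <= X]mulN1r.
have sf': bsupp (fun x=> (-1)*f x) by exact: bsupp_mulr.
apply: (max_principle hc k0 e0 W0 (C2_scale (-1) hf) sf')=> y; rewrite LL_scale.
by have := h y; rewrite ler_norml=> /andP[_]; lra.
Qed.
Lemma pow_small (th e : R) : 0 <= th -> th < 1 -> 0 < e -> exists n : nat, th^+n <= e.
Proof.
move=> th0 th1 e0; have [n n0 hn] := nat_ge ((e*(1 - th))^-1); exists n.
have t1: 0 < 1 - th by lra.
apply: (le_via (expR (- (1 - th))^+n)).
 by apply: lerXn2r; rewrite ?nnegrE ?expR_ge0 //; have := expR_ge1Dx (- (1 - th)); lra.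
rewrite -expRM_natl mulrN.
have s0: 0 < n%:R*(1 - th) by rewrite mulr_gt0 // ltr0n.
apply: (le_trans (exp_le_inv s0)); rewrite -[X in _ <= X]invrK lef_pV2 ?posrE ?invr_gt0 //.
by rewrite -ler_pdivrMr // -invfM.
Qed.
(** Solves [(lam - L) p' = f + (lam - kap - W) p] repeatedly with a large [lam]; by the maximum
    principle consecutive differences contract by [1 - kap/lam], up to the error of each step. *)
Lemma resolvent (kap : R) (W : V -> R) : 0 < kap -> (forall x, 0 <= W x) -> lips W -> bdd W ->
 forall f, lips f -> bsupp f -> forall eps, 0 < eps -> exists phi G H, [/\ C2 phi G H, bsupp phi &
  forall x, `|(kap + W x) * phi x - LL a b G H x - f x| <= eps].
Proof.
move=> k0 W0 lW [Wm hWm] f lf sf eps eps0.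
have [lam0 lam00 hT] := resolvent_large hc.
have [F hF] := lips_bdd lf sf.
have F0: 0 <= F by apply: le_trans (normr_ge0 _) (hF 0).
have Wm0: 0 <= Wm by apply: le_trans (normr_ge0 _) (hWm 0).
pose lam := lam0 + kap + Wm.
have lk: kap < lam by rewrite /lam; lra.
have lp : 0 < lam by apply: lt_trans lk.
have hl: lam0 <= lam by rewrite /lam; lra.
have wb x: 0 <= lam - kap - W x <= lam - kap.
 by have := hWm x; rewrite ger0_norm ?W0 // => h; have := W0 x; rewrite /lam; lra.
(* The geometric series amplifies the error per step, so that the total is
   [e (1 + 2 lam/kap) = eps/2]. *)
pose e := eps/2/(1 + 2 * lam/kap).
have e0: 0 < e by rewrite /e !divr_gt0 // ltr_pwDl // divr_ge0 ?mulr_ge0 // ltW.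
pose th := 1 - kap/lam.
have kl: 0 < kap/lam by rewrite divr_gt0.
have kl1: kap/lam <= 1 by rewrite ler_pdivrMr // mul1r ltW.
pose D := (F + e)/lam.
have lw: lips (fun x=> lam - kap - W x).
 by apply: lips_add; [exact: lips_cst|have [L hL] := lW; exists L=> x y; rewrite -opprD normrN; exact: hL].
have bw: bdd (fun x=> lam - kap - W x).
 by exists (lam - kap)=> x; have /andP[h1 h2] := wb x; rewrite ger0_norm.
have it n: exists p0 G0 H0 p1 G1 H1, [/\ C2 p0 G0 H0, bsupp p0, C2 p1 G1 H1 & bsupp p1] /\
  [/\ forall x, `|lam * p1 x - LL a b G1 H1 x - (f x + (lam - kap - W x) * p0 x)| <= e &
    forall x, `|p1 x - p0 x| <= th^+n*D + 2*e/kap].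
 elim: n=> [|n [p0 [G0 [H0 [p1 [G1 [H1 [[c0 s0 c1 s1] [h1 h2]]]]]]]]].
  have [p [G [H [cp sp hp]]]] := hT lam hl f _ (projT2 (cid lf)) sf e e0.
  exists (fun=> 0), (fun=> 0), (fun=> 0), p, G, H; split; first by split=> //; [exact: C2_cst|exists 0].
  split=> x; first by rewrite mulr0 addr0.
  rewrite subr0 expr0 mul1r; apply: (le_via D); last by rewrite lerDl; pos.
  apply: (mp_abs (W := fun=> 0) lp _ _ cp sp)=> // [|y]; first by lra.
  rewrite addr0; have := ler_normD (lam * p y - LL a b G H y - f y) (f y); rewrite subrK.
  by have := hp y; have := hF y; lra.
 pose f1 x := f x + (lam - kap - W x) * p1 x.
 have lf1: lips f1 by apply: lips_add=> //; apply: lips_mul=> //; [exact: C2_lips c1 s1|exact: C2_bddf c1 s1].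
 have sf1: bsupp f1.
  have := bsupp_lin 1 sf (bsupp_mulr (fun x=> lam - kap - W x) s1).
  by congr bsupp; apply/funext=> x; rewrite mul1r.
 have [p [G [H [cp sp hp]]]] := hT lam hl f1 _ (projT2 (cid lf1)) sf1 e e0.
 exists p1, G1, H1, p, G, H; split; first by [].
 split=> // x.
 pose bd := th^+n*D + 2*e/kap.
 have th0: 0 <= th by rewrite /th; lra.
 have D0: 0 <= D by rewrite /D; pos.
 have bd0: 0 <= bd by rewrite /bd; pos.
 have cd := C2_add cp (C2_scale (-1) c1).
 have sd := bsupp_lin (-1) sp s1.
 have -> : p x - p1 x = p x + (-1) * p1 x by ring.
 have -> : th^+n.+1*D + 2*e/kap = ((lam - kap)*bd + 2*e)/lam.
  by rewrite /bd exprS {1}/th; fieldp.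
 apply: (mp_abs (W := fun=> 0) lp _ _ cd sd)=> // [|y].
  by apply: addr_ge0; [apply: mulr_ge0=> //; rewrite subr_ge0 ltW|pos].
 rewrite addr0 LL_add LL_scale.
 have -> : lam*(p y + -1 * p1 y) - (LL a b G H y + -1*LL a b G1 H1 y) =
  (lam * p y - LL a b G H y - f1 y) - (lam * p1 y - LL a b G1 H1 y - (f y + (lam - kap - W y) * p0 y)) +
  (lam - kap - W y)*(p1 y - p0 y) by rewrite /f1; ring.
 have /andP[w0 w1] := wb y.
 have t1: `|(lam - kap - W y)*(p1 y - p0 y)| <= (lam - kap)*bd.
  by rewrite normrM ger0_norm //; apply: ler_pM=> //; exact: h2.
 rewrite normDt // addrC lerD // normBt // (_ : 2*e = e + e); last by ring.
 by apply: lerD; [exact: hp|exact: h1].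
have D0: 0 < D by rewrite /D divr_gt0 // ltr_wpDl.
have [n hn] := @pow_small th (eps/2/(lam*D)) ltac:(rewrite /th; lra) ltac:(rewrite /th; lra) ltac:(by ppos).
have [p0 [G0 [H0 [p1 [G1 [H1 [[c0 s0 c1 s1] [h1 h2]]]]]]]] := it n.
exists p1, G1, H1; split=> // x.
have -> : (kap + W x) * p1 x - LL a b G1 H1 x - f x =
 (lam * p1 x - LL a b G1 H1 x - (f x + (lam - kap - W x) * p0 x)) - (lam - kap - W x)*(p1 x - p0 x) by ring.
have /andP[w0 w1] := wb x.
have t1: `|(lam - kap - W x)*(p1 x - p0 x)| <= lam*(th^+n*D + 2*e/kap).
 rewrite normrM ger0_norm //; apply: ler_pM=> //; apply: (le_trans w1); lra.
rewrite normBt //; apply: (le_trans (lerD (h1 x) t1)).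
have t2: lam*(th^+n*D) <= eps/2.
 have := ler_wpM2l (ltW (mulr_gt0 lp D0)) hn.
 rewrite (_ : lam*D*(eps/2/(lam*D)) = eps/2); last by fieldp.
 by apply: le_trans; apply: eqle; ring.
have t3: e + lam*(2*e/kap) = eps/2.
 rewrite (_ : e + _ = e*(1 + 2 * lam/kap)); last by fieldp.
 by rewrite /e divfK // gt_eqF // ltr_pwDl // divr_ge0 ?mulr_ge0 // ltW.
by rewrite mulrDr; lra.
Qed.
End Potential.

(** * The resolvent at the origin as a functional *)

Section Func.
Variables (R : realType) (d : nat).
Local Notation V := 'rV[R]_d.
Variables (a : V -> 'M[R]_d) (b : V -> V) (kap : R).
Definition gen (phi : V -> R) G H (x : V) : R := kap * phi x - LL a b G H x.
Definition Uset (f : V -> R) : set R := [set r | exists phi G H e,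
 [/\ C2 phi G H, bsupp phi, 0 <= e, (forall x, f x <= gen phi G H x + e) & r = phi 0 + e/kap]].
(** As an infimum over supersolutions it is monotone and subadditive on all bounded functions;
    additivity is available on functions with approximate solutions, the predicate [appr]. *)
Definition UU (f : V -> R) : R := inf (Uset f).
Definition appr (f : V -> R) : Prop := forall eps, 0 < eps -> exists phi G H,
 [/\ C2 phi G H, bsupp phi & forall x, `|gen phi G H x - f x| <= eps].

Variables (nu be K : R).
Hypotheses (hc : coefs nu be K a b) (kap0 : 0 < kap).
Lemma gen_sub (phi psi : V -> R) G H G' H' x :
 gen (fun y=> phi y + (-1) * psi y) (fun y=> G y + (-1) *: G' y) (fun y=> H y + (-1) *: H' y) x = gen phi G H x - gen psi G' H' x.
Proof. by rewrite /gen LL_add LL_scale; ring. Qed.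
Lemma gen_lin (phi psi : V -> R) G H G' H' c x :
 gen (fun y=> phi y + c * psi y) (fun y=> G y + c *: G' y) (fun y=> H y + c *: H' y) x = gen phi G H x + c*gen psi G' H' x.
Proof. by rewrite /gen LL_add LL_scale; ring. Qed.
Lemma gen_ge (phi : V -> R) G H e : 0 <= e -> C2 phi G H -> bsupp phi -> (forall x, - e <= gen phi G H x) ->
 forall x, - (e/kap) <= phi x.
Proof.
move=> e0 hp sp h; apply: (max_principle (W := fun=> 0) hc kap0 e0 _ hp sp)=> // x.
by rewrite addr0; exact: h.
Qed.
Lemma gen_cmp (phi psi : V -> R) G H G' H' e e' : 0 <= e -> 0 <= e' -> C2 phi G H -> bsupp phi -> C2 psi G' H' -> bsupp psi ->
 (forall x, gen psi G' H' x - e' <= gen phi G H x + e) -> forall x, psi x - e'/kap <= phi x + e/kap.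
Proof.
move=> e0 e'0 c1 s1 c2 s2 h x.
have := gen_ge (addr_ge0 e0 e'0) (C2_add c1 (C2_scale (-1) c2)) (bsupp_lin (-1) s1 s2) _ x.
rewrite mulrDl=> H1; suff : - (e/kap + e'/kap) <= phi x + -1 * psi x by lra.
by apply: H1=> y; rewrite gen_sub; have := h y; lra.
Qed.
Lemma Uset_lb f psi G' H' e' : 0 <= e' -> C2 psi G' H' -> bsupp psi -> (forall x, gen psi G' H' x - e' <= f x) ->
 lbound (Uset f) (psi 0 - e'/kap).
Proof.
move=> e'0 c2 s2 h r [phi [G [H [e [c1 s1 e0 hf ->]]]]].
by apply: (gen_cmp e0 e'0 c1 s1 c2 s2)=> x; apply: le_trans (h x) (hf x).
Qed.
Lemma gen0 x : gen (fun=> 0) (fun=> 0) (fun=> 0) x = 0.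
Proof. by rewrite /gen LL_cst0 mulr0 subr0. Qed.
Lemma bdd_lb f : bdd f -> has_lbound (Uset f).
Proof.
move=> [B hB]; have B0: 0 <= B by apply: le_trans (normr_ge0 _) (hB 0).
exists (0 - B/kap); apply: (Uset_lb B0 (C2_cst _ (0 : R))); first by exists 0.
by move=> x; rewrite gen0; have := hB x; rewrite ler_norml=> /andP[h _]; lra.
Qed.
Lemma bdd_ne f : bdd f -> Uset f !=set0.
Proof.
move=> [B hB]; have B0: 0 <= B by apply: le_trans (normr_ge0 _) (hB 0).
exists (0 + B/kap), (fun=> 0), (fun=> 0), (fun=> 0), B; split=> //; [exact: C2_cst|by exists 0|].
by move=> x; rewrite gen0; have := hB x; rewrite ler_norml=> /andP[_ h]; lra.
Qed.
Lemma U_le f phi G H e : bdd f -> 0 <= e -> C2 phi G H -> bsupp phi -> (forall x, f x <= gen phi G H x + e) ->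
 UU f <= phi 0 + e/kap.
Proof. by move=> bf e0 c1 s1 h; apply: ge_inf; [exact: bdd_lb|exists phi, G, H, e]. Qed.
Lemma U_ge f psi G H e : bdd f -> 0 <= e -> C2 psi G H -> bsupp psi -> (forall x, gen psi G H x - e <= f x) ->
 psi 0 - e/kap <= UU f.
Proof. by move=> bf e0 c1 s1 h; apply: lb_le_inf; [exact: bdd_ne|exact: (Uset_lb e0 c1 s1)]. Qed.
Lemma U_exact f phi G H : bdd f -> C2 phi G H -> bsupp phi -> (forall x, gen phi G H x = f x) -> UU f = phi 0.
Proof.
move=> bf c1 s1 h; apply/eqP; rewrite eq_le; apply/andP; split.
 by have := U_le (e := 0) bf _ c1 s1; rewrite mul0r addr0; apply=> // x; rewrite addr0 h.
by have := U_ge (e := 0) bf _ c1 s1; rewrite mul0r subr0; apply=> // x; rewrite subr0 h.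
Qed.
Lemma U_near f eps : bdd f -> 0 < eps -> exists phi G H e, [/\ C2 phi G H, bsupp phi, 0 <= e,
 (forall x, f x <= gen phi G H x + e) & phi 0 + e/kap <= UU f + eps].
Proof.
move=> bf e0; have [r [phi [G [H [e [c1 s1 e1 h ->]]]]] hr] := inf_adherent e0 (conj (bdd_ne bf) (bdd_lb bf)).
by exists phi, G, H, e; split=> //; exact: ltW.
Qed.
Lemma U_mono f g : bdd f -> bdd g -> (forall x, f x <= g x) -> UU f <= UU g.
Proof.
move=> bf bg h; apply/ler_addgt0Pr=> eps e0.
have [phi [G [H [e [c1 s1 e1 hg /(le_trans _)]]]]] := U_near bg e0; apply.
by apply: (U_le bf e1 c1 s1)=> x; apply: le_trans (h x) (hg x).
Qed.
Lemma bdd_add (f g : V -> R) : bdd f -> bdd g -> bdd (fun x=> f x + g x).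
Proof. by move=> [B hB] [B' hB']; exists (B + B')=> x; rewrite normDt // lerD. Qed.
Lemma bdd_scale c (f : V -> R) : bdd f -> bdd (fun x=> c*f x).
Proof. by move=> [B hB]; exists (`|c|*B)=> x; rewrite normrM ler_wpM2l. Qed.
Lemma U_sub f g : bdd f -> bdd g -> UU (fun x=> f x + g x) <= UU f + UU g.
Proof.
move=> bf bg; apply/ler_addgt0Pr=> eps e0.
have e2: 0 < eps/2 by lra.
have [phi [G [H [e [c1 s1 e1 hf h1]]]]] := U_near bf e2.
have [psi [G' [H' [e' [c2 s2 e1' hg h2]]]]] := U_near bg e2.
have := @U_le (fun x=> f x + g x) _ _ _ (e + e') (bdd_add bf bg) (addr_ge0 e1 e1') (C2_add c1 (C2_scale 1 c2)) (bsupp_lin 1 s1 s2).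
rewrite mul1r mulrDl=> H1; suff : UU (fun x=> f x + g x) <= phi 0 + psi 0 + (e/kap + e'/kap) by lra.
by apply: H1=> x; rewrite gen_lin mul1r; have := hf x; have := hg x; lra.
Qed.
Lemma U_abs f B : 0 <= B -> (forall x, `|f x| <= B) -> `|UU f| <= B/kap.
Proof.
move=> B0 hB; have bf: bdd f by exists B.
have h0: bsupp (fun _ : V=> 0 : R) by exists 0.
have h1 := U_le bf B0 (C2_cst _ (0 : R)) h0; have h2 := U_ge bf B0 (C2_cst _ (0 : R)) h0.
rewrite ler_norml; apply/andP; split.
 by have := h2; rewrite sub0r; apply=> x; rewrite gen0; have := hB x; rewrite ler_norml=> /andP[h _]; lra.
by have := h1; rewrite add0r; apply=> x; rewrite gen0; have := hB x; rewrite ler_norml=> /andP[_ h]; lra.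
Qed.
Lemma U_ge0 f : bdd f -> (forall x, 0 <= f x) -> 0 <= UU f.
Proof.
move=> bf f0; have := U_ge (e := 0) bf (lexx _) (C2_cst _ (0 : R)); rewrite mul0r subr0; apply; first by exists 0.
by move=> x; rewrite gen0 subr0.
Qed.
Lemma gen_bdd phi G H : C2 phi G H -> bsupp phi -> bdd (gen phi G H).
Proof.
move=> hp sp; have [B B0 hB] := C2_bdd hp sp; exists (kap*B + (d%:R*(d%:R*(nu*B)) + d%:R*(be*B)))=> x.
have [b1 b2 b3] := hB x.
rewrite /gen normBt // lerD //; last exact: (LL_bound hc).
by rewrite normrM gtr0_norm // ler_wpM2l // ltW.
Qed.
Lemma appr_bdd f : appr f -> bdd f.
Proof.
move=> /(_ 1 ltr01) [phi [G [H [c1 s1 h]]]]; have [B hB] := gen_bdd c1 s1; exists (B + 1)=> x.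
have := ler_normB (gen phi G H x) (gen phi G H x - f x); rewrite opprB addrCA subrr addr0=> h1.
by apply: (le_trans h1); rewrite lerD.
Qed.
Lemma appr_near f eps phi G H : appr f -> 0 < eps -> C2 phi G H -> bsupp phi ->
 (forall x, `|gen phi G H x - f x| <= eps) -> `|UU f - phi 0| <= eps/kap.
Proof.
move=> af e0 c1 s1 h; have bf := appr_bdd af; have e1 := ltW e0.
have h1 := U_le bf e1 c1 s1; have h2 := U_ge bf e1 c1 s1.
have {}h1 : UU f <= phi 0 + eps/kap by apply: h1=> x; have := h x; rewrite ler_norml; lra.
have {}h2 : phi 0 - eps/kap <= UU f by apply: h2=> x; have := h x; rewrite ler_norml; lra.
by rewrite ler_norml; lra.
Qed.
Lemma appr_lin f g c : appr f -> appr g -> appr (fun x=> f x + c*g x).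
Proof.
move=> af ag eps e0.
have e1: 0 < eps/2 by lra.
have e2: 0 < eps/2/(`|c| + 1) by rewrite divr_gt0 // ltr_wpDl.
have [phi [G [H [c1 s1 h1]]]] := af _ e1; have [psi [G' [H' [c2 s2 h2]]]] := ag _ e2.
do 3 eexists; split; [exact: (C2_add c1 (C2_scale c c2))|exact: (bsupp_lin c s1 s2)|move=> x].
rewrite gen_lin (_ : _ - _ = (gen phi G H x - f x) + c*(gen psi G' H' x - g x)); last by ring.
have t: `|c*(gen psi G' H' x - g x)| <= eps/2.
 rewrite normrM; apply: (le_via ((`|c| + 1)*(eps/2/(`|c| + 1)))).
  by apply: ler_pM=> //; rewrite lerDl.
 by rewrite mulrC divfK // gt_eqF // ltr_wpDl.
by have := h1 x; have := ler_normD (gen phi G H x - f x) (c*(gen psi G' H' x - g x)); lra.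
Qed.
Lemma appr0 : appr (fun=> 0).
Proof.
move=> eps e0; exists (fun=> 0), (fun=> 0), (fun=> 0); split; [exact: C2_cst|by exists 0|].
by move=> x; rewrite gen0 subrr normr0 ltW.
Qed.
Lemma U_lin f g c : appr f -> appr g -> UU (fun x=> f x + c*g x) = UU f + c*UU g.
Proof.
move=> af ag; apply/eqP; rewrite -subr_eq0 -normr_le0; apply/ler_addgt0Pr=> eps e0; rewrite add0r.
pose e := eps*kap/(2 + 2 * `|c|).
have c2: 0 < 2 + 2 * `|c| by have := normr_ge0 c; lra.
have e1: 0 < e by rewrite /e divr_gt0 // mulr_gt0.
have [phi [G [H [c1 s1 h1]]]] := af _ e1; have [psi [G' [H' [c2' s2 h2]]]] := ag _ e1.
have u1 := appr_near af e1 c1 s1 h1; have u2 := appr_near ag e1 c2' s2 h2.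
have cc: 0 < e*(1 + `|c|) by rewrite mulr_gt0 // ltr_pwDl.
have := appr_near (appr_lin c af ag) cc (C2_add c1 (C2_scale c c2')) (bsupp_lin c s1 s2) _.
have hh x: `|gen (fun y=> phi y + c * psi y) (fun y=> G y + c *: G' y) (fun y=> H y + c *: H' y) x - (f x + c*g x)| <= e*(1 + `|c|).
 rewrite gen_lin (_ : _ - _ = (gen phi G H x - f x) + c*(gen psi G' H' x - g x)); last by ring.
 have := ler_wpM2l (normr_ge0 c) (h2 x); rewrite -normrM=> t.
 by have := h1 x; have := ler_normD (gen phi G H x - f x) (c*(gen psi G' H' x - g x)); nra.
move=> /(_ hh) u3.
set X := UU (fun x=> _) in u3 *.
have -> : X - (UU f + c*UU g) = (X - (phi 0 + c * psi 0)) - (UU f - phi 0) - c*(UU g - psi 0) by ring.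
have t := ler_wpM2l (normr_ge0 c) u2; rewrite -normrM in t.
have eE: e*(1 + `|c|)/kap + e/kap + `|c|*(e/kap) = eps.
 by rewrite /e; fieldp.
have := ler_normB (X - (phi 0 + c * psi 0) - (UU f - phi 0)) (c*(UU g - psi 0)).
have := ler_normB (X - (phi 0 + c * psi 0)) (UU f - phi 0).
lra.
Qed.
Lemma U0 : UU (fun=> 0) = 0.
Proof.
have := U_lin 1 appr0 appr0; rewrite (_ : (fun x=> _) = fun=> 0); last by apply/funext=> x; rewrite mulr0 addr0.
by rewrite mul1r=> h; lra.
Qed.
Lemma U_scale c f : appr f -> UU (fun x=> c*f x) = c*UU f.
Proof.
move=> af; have := U_lin c appr0 af; rewrite U0 add0r=> <-; congr UU; apply/funext=> x; by rewrite add0r.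
Qed.
Lemma appr_sum (I : Type) (r : seq I) (c : I -> R) (f : I -> V -> R) : (forall i, appr (f i)) ->
 appr (fun x=> \sum_(i <- r) c i*f i x) /\ UU (fun x=> \sum_(i <- r) c i*f i x) = \sum_(i <- r) c i*UU (f i).
Proof.
move=> af; elim: r=> [|i r [IH1 IH2]].
 have e: (fun x=> \sum_(i <- [::]) c i*f i x) = fun=> 0 by apply/funext=> x; rewrite big_nil.
 by rewrite e big_nil U0; split=> //; exact: appr0.
have e: (fun x=> \sum_(i <- i :: r) c i*f i x) = (fun x=> \sum_(i <- r) c i*f i x + c i*f i x).
 by apply/funext=> x; rewrite big_cons addrC.
rewrite e; split; first exact: appr_lin.
by rewrite U_lin // IH2 big_cons addrC.
Qed.
Lemma lips_appr f : lips f -> bsupp f -> appr f.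
Proof.
move=> lf sf eps e0; have [|||phi [G [H [c1 s1 h]]]] := @resolvent R d nu be K a b hc kap (fun=> 0) kap0 _ _ _ f lf sf eps e0.
- by [].
- exact: lips_cst.
- by exists 0=> x; rewrite normr0.
- by exists phi, G, H; split=> // x; have := h x; rewrite addr0.
Qed.
End Func.

(** * Real powers and the radial barrier profile *)

Section Pw.
Variable R : realType.
Definition pw (e y : R) : R := expR (e * ln y).
Lemma pw_gt0 e y : 0 < pw e y. Proof. exact: expR_gt0. Qed.
Lemma pwD e f y : pw (e + f) y = pw e y * pw f y. Proof. by rewrite /pw mulrDl expRD. Qed.
Lemma pw_natl (n : nat) e y : pw (n%:R*e) y = pw e y^+n.
Proof. by rewrite /pw -mulrA expRM_natl. Qed.
Lemma pw1 y : 0 < y -> pw 1 y = y. Proof. by move=> y0; rewrite /pw mul1r lnK ?posrE. Qed.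
Lemma pw_ge e y z : e <= 0 -> 0 < y -> y <= z -> pw e z <= pw e y.
Proof. by move=> e0 y0 yz; rewrite ler_expR ler_wnM2l // ler_ln ?posrE // (lt_le_trans y0). Qed.
Lemma pwN e y : pw (- e) y = (pw e y)^-1. Proof. by rewrite /pw mulNr expRN. Qed.
Lemma pw_half (d : nat) (r : R) : 0 < r -> pw (- (d%:R/2)) (r^+2) = r^-1^+d.
Proof.
move=> r0; rewrite (_ : - (d%:R/2) = d%:R*(- 2^-1)); last by field.
rewrite pw_natl pwN; congr (_^-1^+_).
apply: (@pexpIrn _ 2); rewrite ?nnegrE ?(ltW (pw_gt0 _ _)) ?(ltW r0) //.
by rewrite -pw_natl mulfV ?pnatr_eq0 // pw1 // exprn_gt0.
Qed.
Lemma isd_pw (e : R) (Y : R -> R) (x y1 : R) : 0 < Y x -> is_derive x 1 Y y1 ->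
 is_derive x 1 (fun s=> pw e (Y s)) (pw e (Y x)*(e*(y1/Y x))).
Proof.
move=> y0 hY; apply: isd_exp; apply: isd_scale.
by apply: isd_ext (isd_comp (is_derive1_ln y0) hY) _ _=> //; rewrite mulrC.
Qed.
End Pw.

Section Bar1.
Variables (R : realType) (d : nat) (rho q1 sg : R).
Hypotheses (d0 : (0 < d)%N) (rho0 : 0 < rho) (rq : rho^+2 <= q1) (q16 : q1 <= 16^-1) (sg1 : sg = 1 \/ sg = -1).
Local Notation D := (d%:R : R).
Let r2 : 0 < rho^+2 := exprn_gt0 2 rho0.
Let q10 : 0 < q1 := lt_le_trans r2 rq.

Ltac hyp := move: (rho0) (rq) (q16) (r2) (q10) => hR1 hR2 hR3 hR4 hR5.
(** Continuously differentiable regularization of [q]: the identity beyond [rho^2], a parabola with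
    minimum [rho^2/2] before. *)
Definition bY (q : R) : R := q + (2*rho^+2)^-1*(max ((-1)*q + rho^+2) 0)^+2.
Definition bY1 (q : R) : R := 1 + (2*rho^+2)^-1*(2*(-1) * max ((-1)*q + rho^+2) 0).
Definition bu (q : R) : R := max ((- q1^-1)*q + 1) 0.
Definition bA q := pw (- (D/2)) (bY q).
Definition bt q := pw 4^-1 (bY q).
Definition bth q := q*bY1 q/bY q.
Definition bh q := bA q + sg*(bA q*bt q).
Definition bh1 q := bA q*(- (D/2)*(bY1 q/bY q)) +
 sg*(bA q*(- (D/2)*(bY1 q/bY q))*bt q + bA q*(bt q*(4^-1*(bY1 q/bY q)))).
(** Minus the derivative of the barrier as a function of the squared distance [q]. For
    [k = q^(-d/2)] one has [d k + 2 q k' = 0], the radial harmonic equation; the factor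
    [1 + sg q^(1/4)] makes the profile strictly super- or subharmonic according to the sign [sg]. *)
Definition bk q := bh q*bu q^+2.
Definition bk1 q := bh1 q*bu q^+2 + bh q*(2*(- q1^-1)*bu q).
Lemma bY_out q : rho^+2 <= q -> bY q = q /\ bY1 q = 1.
Proof. hyp; by move=> h; rewrite /bY /bY1 max_r ?expr0n ?mulr0 ?addr0 //; lra. Qed.
Lemma bY_in q : q <= rho^+2 -> bY q = (rho^+4 + q^+2)/(2*rho^+2) /\ bY1 q = q/rho^+2.
Proof.
hyp.
move=> h; rewrite /bY /bY1 max_l; last by lra.
by split; fieldp.
Qed.
Lemma bY_ge q : rho^+2/2 <= bY q.
Proof.
hyp.
have [h|/ltW h] := leP q (rho^+2); last by have [-> _] := bY_out h; lra.
have [-> _] := bY_in h; rewrite ler_pdivlMr ?mulr_gt0 //.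
by have := sqr_ge0 q; rewrite (_ : rho^+4 = rho^+2*rho^+2); [nra|ring].
Qed.
Lemma bY_gt0 q : 0 < bY q. Proof. hyp; by apply: lt_le_trans (bY_ge q); lra. Qed.
Lemma bY_le q : 0 <= q -> q <= q1 -> bY q <= q1.
Proof.
hyp.
move=> h0 h1; have [h|/ltW h] := leP q (rho^+2); last by have [-> _] := bY_out h.
have [-> _] := bY_in h; apply: le_trans rq; rewrite ler_pdivrMr ?mulr_gt0 //.
have : q^+2 <= rho^+2*rho^+2 by rewrite expr2; apply: ler_pM.
by rewrite (_ : rho^+4 = rho^+2*rho^+2); [lra|ring].
Qed.
Lemma bY_q2 q : q <= 2*bY q.
Proof.
hyp.
have [h|/ltW h] := leP q (rho^+2); first by have := bY_ge q; lra.
by have [-> _] := bY_out h; lra.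
Qed.
Lemma bth01 q : 0 <= q -> 0 <= bth q <= 1.
Proof.
hyp.
move=> h0; have [h|/ltW h] := leP q (rho^+2); last first.
 by have [e1 e2] := bY_out h; rewrite /bth e1 e2 mulr1 divff ?lexx ?ler01 // gt_eqF //; lra.
have y0 := bY_gt0 q; have [e1 e2] := bY_in h; rewrite /bth e2; apply/andP; split; first by pos.
rewrite ler_pdivrMr // mul1r e1 ler_pdivlMr ?mulr_gt0 //.
rewrite (_ : q*(q/rho^+2)*(2*rho^+2) = 2*q^+2); last by fieldp.
have : q^+2 <= rho^+2*rho^+2 by rewrite expr2; apply: ler_pM.
by rewrite (_ : rho^+4 = rho^+2*rho^+2); [lra|ring].
Qed.
Lemma bth_in q : 0 <= q -> q <= rho^+2/2 -> bth q <= 1/2 /\ bY q <= rho^+2.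
Proof.
hyp.
move=> h0 h; have y0 := bY_gt0 q; have [e1 e2] := bY_in (ltac:(lra) : q <= rho^+2); rewrite /bth e2.
have q2: q^+2 <= rho^+2/2*(rho^+2/2) by rewrite expr2; apply: ler_pM.
have r4: rho^+4 = rho^+2*rho^+2 by ring.
have rr: 0 < rho^+2*rho^+2 by rewrite mulr_gt0.
split; last by rewrite e1 ler_pdivrMr ?mulr_gt0 // r4; lra.
rewrite ler_pdivrMr // e1 (_ : q*(q/rho^+2) = 2*q^+2/(2*rho^+2)); last by fieldp.
rewrite [X in _ <= X]mulrA; apply: ler_wpM2r; first by rewrite invr_ge0 mulr_ge0 // ltW.
by rewrite r4; lra.
Qed.
Lemma bt4 q : bt q^+4 = bY q.
Proof. hyp; by rewrite /bt -pw_natl mulfV ?pnatr_eq0 // pw1 // bY_gt0. Qed.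
Lemma bt_gt0 q : 0 < bt q. Proof. exact: pw_gt0. Qed.
Lemma bA_gt0 q : 0 < bA q. Proof. exact: pw_gt0. Qed.
Lemma bA_t q : bA q = (bt q)^-1^+(2*d).
Proof.
hyp.
have e: (2*d)%:R * - 4^-1 = - (D/2) by rewrite natrM; lra.
by rewrite /bA /bt -pwN -pw_natl e.
Qed.
Lemma bt_le q : 0 <= q -> q <= q1 -> bt q <= 2^-1.
Proof.
hyp.
move=> h0 h1; rewrite -(@ler_pXn2r _ 4) ?nnegrE ?(ltW (bt_gt0 _)) // bt4.
by apply: (le_trans (bY_le h0 h1)); apply: (le_trans q16); apply: eqle; field.
Qed.
Lemma bt_tiny (e : R) q : 0 < e -> 0 <= q -> q <= q1 -> q1 <= e^+4 -> bt q <= e.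
Proof.
hyp.
move=> e0 h0 h1 h; rewrite -(@ler_pXn2r _ 4) ?nnegrE ?(ltW (bt_gt0 _)) ?(ltW e0) // bt4.
exact: le_trans (bY_le h0 h1) h.
Qed.
Lemma bA_le q : bA q <= (2/rho)^+d.
Proof.
hyp.
rewrite (_ : 2/rho = (rho/2)^-1); last by rewrite invf_div.
rewrite -(@pw_half R d (rho/2)) ?divr_gt0 //.
apply: pw_ge; [by rewrite oppr_le0 divr_ge0|by rewrite exprn_gt0 ?divr_gt0|].
by apply: le_trans (bY_ge q); rewrite (_ : (rho/2)^+2 = rho^+2/4); [lra|field].
Qed.
Lemma bA_ge q : bY q <= rho^+2 -> (rho^-1)^+d <= bA q.
Proof.
hyp.
move=> h; rewrite -(@pw_half R d rho) //; by apply: pw_ge; [rewrite oppr_le0 divr_ge0|exact: bY_gt0|exact: h].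
Qed.
Lemma bu01 q : 0 <= q -> 0 <= bu q <= 1.
Proof.
hyp.
move=> h; rewrite /bu le_max lexx orbT /= ge_max ler01 andbT.
have : 0 <= q1^-1*q by rewrite mulr_ge0 // invr_ge0 ltW.
lra.
Qed.
Lemma bu_out q : q1 <= q -> bu q = 0.
Proof.
hyp.
by move=> h; have e: 1 <= q1^-1*q; [rewrite mulrC ler_pdivlMr // mul1r|rewrite /bu max_r //; lra].
Qed.
Lemma bu_in q : q <= q1 -> bu q = 1 - q/q1.
Proof.
hyp.
by move=> h; have e: q1^-1*q <= 1; [rewrite mulrC ler_pdivrMr // mul1r|rewrite /bu max_l; [ring|lra]].
Qed.
Lemma isd_bY (q : R) : is_derive q 1 bY (bY1 q).
Proof. hyp; by apply: isd_ext (isd_add (isd_id q) (isd_scale _ (is_derive_pos2_aff (-1) (rho^+2) q))) _ _. Qed.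
Lemma isd_bk (q : R) : is_derive q 1 bk (bk1 q).
Proof.
hyp.
have y0 := bY_gt0 q; have hY := isd_bY q.
have hA := isd_pw (- (D/2)) y0 hY; have ht := isd_pw 4^-1 y0 hY.
have hh: is_derive q 1 bh (bh1 q).
 by apply: isd_ext (isd_add hA (isd_scale sg (isd_mul hA ht))) _ _.
by apply: isd_ext (isd_mul hh (is_derive_pos2_aff (- q1^-1) 1 q)) _ _.
Qed.
Lemma bk1_cont : continuous bk1.
Proof.
hyp.
have cY: continuous bY by move=> q; exact: is_derive_cont (isd_bY q).
have cm := @maxr_cont R (-1) (rho^+2); have cu := @maxr_cont R (- q1^-1) 1.
have cY1: continuous bY1 by apply: cts_add; [exact: cts_cst|apply: cts_mul; [exact: cts_cst|apply: cts_mul; [exact: cts_cst|]]].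
have cA: continuous bA by move=> q; exact: is_derive_cont (isd_pw _ (bY_gt0 q) (isd_bY q)).
have ct: continuous bt by move=> q; exact: is_derive_cont (isd_pw _ (bY_gt0 q) (isd_bY q)).
have cr: continuous (fun q=> bY1 q/bY q).
 apply: cts_mul=> //.
 have iy (q : R) := isd_comp (isd_inv (lt0r_neq0 (bY_gt0 q))) (isd_bY q).
 by move=> q; exact: is_derive_cont (iy q).
have ch: continuous bh by apply: cts_add=> //; apply: cts_mul; [exact: cts_cst|exact: cts_mul].
have ch1: continuous bh1.
 apply: cts_add; first by apply: cts_mul=> //; apply: cts_mul=> //; exact: cts_cst.
 apply: cts_mul; first exact: cts_cst.
 apply: cts_add; apply: cts_mul=> //; apply: cts_mul=> //; apply: cts_mul=> //; exact: cts_cst.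
apply: cts_add; apply: cts_mul=> //.
 by rewrite (_ : (fun t=> _^+2) = fun t=> bu t*bu t) //; exact: cts_mul.
by apply: cts_mul=> //; exact: cts_cst.
Qed.

Let sga : `|sg| = 1. Proof. by case: sg1=> ->; rewrite ?normrN normr1. Qed.
(** Where [bth = 1], that is beyond [rho^2], the main bracket reduces to [sg t u/2]. This first
    power of [t] has to beat a coefficient error of order [t^2]; the term with [q/q1] is the cost of
    the cutoff [bu]. *)
Lemma bk_bounds q : 0 <= q -> q <= q1 ->
 [/\ `|bk q| <= 2*bA q*bu q, `|q*bk1 q| <= (D + 4)*bA q*bu q &
  D*bk q + 2*(q*bk1 q) = bA q*bu q*(bu q*(D*(1 - bth q) + sg*bt q*(D*(1 - bth q) + bth q/2))
   - 4*(1 + sg*bt q)*(q/q1))].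
Proof.
hyp.
move=> h0 h1.
have A0 := bA_gt0 q; have t0 := bt_gt0 q; have t1 := bt_le h0 h1; have /andP[th0 th1] := bth01 h0.
have /andP[u0 u1] := bu01 h0; have y0 := bY_gt0 q.
have D1: 1 <= D by rewrite ler1n.
have qq: 0 <= q/q1 <= 1 by rewrite divr_ge0 ?(ltW q10) //= ler_pdivrMr // mul1r.
have st: - (1/2) <= sg*bt q <= 1/2 by case: sg1=> ->; lra.
have e1: bk q = bA q*(1 + sg*bt q)*bu q^+2 by rewrite /bk /bh; ring.
have e2: q*bk1 q = bA q*(- (D/2)*(1 + sg*bt q) + sg*bt q/4)*bth q*bu q^+2
  - 2*(bA q*(1 + sg*bt q))*(q/q1)*bu q.
 by rewrite /bk1 /bh1 /bh /bth; fieldp.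
have uu: bu q^+2 <= bu q by rewrite expr2 ler_piMl.
have s1: 0 <= 1 + sg*bt q <= 2 by lra.
split.
- rewrite e1 ger0_norm; last by case/andP: s1=> s1 _; pos.
 have -> : bA q*(1 + sg*bt q)*bu q^+2 = (1 + sg*bt q)*(bA q*bu q^+2) by ring.
 have -> : 2*bA q*bu q = 2*(bA q*bu q) by ring.
 case/andP: s1=> s1 s2; apply: ler_pM=> //; first by pos.
 by apply: ler_wpM2l=> //; exact: ltW.
- rewrite e2; set X := - (D/2)*(1 + sg*bt q) + sg*bt q/4.
 have X1: `|X| <= D by rewrite /X ler_norml; case/andP: st=> st1 st2; apply/andP; split; nra.
 have a1: `|bA q*X*bth q*bu q^+2| <= D*(bA q*bu q).
  have -> : bA q*X*bth q*bu q^+2 = X*(bA q*(bth q*bu q^+2)) by ring.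
  rewrite normrM [`|bA q*_|]ger0_norm; last by pos.
  apply: ler_pM=> //; first by pos.
  apply: ler_wpM2l; first exact: ltW.
  by rewrite -[X in _ <= X]mul1r; apply: ler_pM=> //; exact: sqr_ge0.
 have a2: `|2*(bA q*(1 + sg*bt q))*(q/q1)*bu q| <= 4*(bA q*bu q).
  case/andP: s1=> s1 s2; case/andP: qq=> qq1 qq2.
  rewrite ger0_norm; last by pos.
  have -> : 2*(bA q*(1 + sg*bt q))*(q/q1)*bu q = (2*(1 + sg*bt q)*(q/q1))*(bA q*bu q) by ring.
  apply: ler_wpM2r; first by pos.
  by rewrite -[X in _ <= X]mulr1; apply: ler_pM=> //; [by pos|lra].
 have -> : (D + 4)*bA q*bu q = D*(bA q*bu q) + 4*(bA q*bu q) by ring.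
 by rewrite normBt // lerD.
- by rewrite e2 e1; fieldp.
Qed.
Lemma bk_ge0 q : 0 <= q -> q <= q1 -> 0 <= bk q.
Proof.
hyp.
move=> h0 h1; have A0 := bA_gt0 q; have t0 := bt_gt0 q; have t1 := bt_le h0 h1.
have -> : bk q = bA q*(1 + sg*bt q)*bu q^+2 by rewrite /bk /bh; ring.
have : 0 <= 1 + sg*bt q by case: sg1=> ->; lra.
by move=> s1; pos.
Qed.
(** Integrating [bk] from [q] to [q1], instead of writing down a Green function, treats dimensions
    1, 2 and higher alike. *)
Lemma bPsi_ex : exists Psi : R -> R, [/\ (forall q : R, -1 < q -> is_derive q 1 Psi (- bk q)), (forall q, q1 <= q -> Psi q = 0),
 (forall q, 0 <= q -> 0 <= Psi q), (forall q, 0 <= q -> Psi q <= 3*(2/rho)^+d) &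
 forall q, rho^+2 <= q -> q <= q1 -> Psi q <= bA q*bt q^+2*bu q^+2].
Proof.
hyp.
have ck: continuous bk by move=> q; exact: is_derive_cont (isd_bk q).
have [P hP] := primitive_ex (-1) ck.
have kout q: q1 <= q -> bk q = 0 by move=> h; rewrite /bk bu_out // expr0n mulr0.
pose Psi q := P q1 - P q.
have dP (q : R) : -1 < q -> is_derive q 1 Psi (- bk q).
 by move=> h; apply: isd_ext (isd_add (isd_cst (P q1) q) (isd_opp (hP q h))) _ _=> //; ring.
have out q: q1 <= q -> Psi q = 0.
 move=> h; rewrite /Psi; apply/eqP; rewrite subr_eq0; apply/eqP; apply: (derive_const h)=> z /andP[z1 _].
 by rewrite -(kout z z1); apply: hP; have := q10; lra.
have ge0 q: 0 <= q -> 0 <= Psi q.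
 move=> h; have [hq|/ltW hq] := leP q q1; last by rewrite out.
 rewrite /Psi subr_ge0; apply: (derive_mono hq)=> z /andP[z1 z2]; first by apply: hP; lra.
 by apply: bk_ge0=> //; lra.
have mono q q': 0 <= q -> q <= q' -> q' <= q1 -> Psi q' <= Psi q.
 move=> h hq hq'; rewrite /Psi lerD2l lerN2; apply: (derive_mono hq)=> z /andP[z1 z2]; first by apply: hP; lra.
 by apply: bk_ge0; lra.
have far q: rho^+2 <= q -> q <= q1 -> Psi q <= bA q*bt q^+2*bu q^+2.
 move=> h1 h2; have q0: 0 < q by exact: lt_le_trans h1.
 (* Split [s^(-d/2)] into [s^(-(d-1)/2)] and [s^(-1/2)]: the first factor and [bu] are nonincreasing
    and are evaluated at [q], the second has primitive [2 sqrt s]. *)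
 pose c := 2*(bA q*bt q^+2)*bu q^+2.
 have A0 := bA_gt0 q; have t0 := bt_gt0 q.
 have c0: 0 <= c by rewrite /c; pos.
 have key: c*(2 * pw 2^-1 q) - P q <= c*(2 * pw 2^-1 q1) - P q1.
  apply: (@derive_mono _ (fun s=> c*(2 * pw 2^-1 s) - P s) (fun s=> c * pw (- 2^-1) s - bk s)); [exact: h2| |]; move=> s /andP[s1 s2].
   have s0: 0 < s by lra.
   have h := isd_pw 2^-1 (Y := fun t=> t) s0 (isd_id s).
   apply: isd_ext (isd_add (isd_scale c (isd_scale 2 h)) (isd_opp (hP s _))) _ _=> //; first by lra.
   rewrite (_ : - 2^-1 = 2^-1 + (-1)); last by field.
   by rewrite pwD pwN pw1 //; fieldp.
  have s0: 0 < s by lra.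
  have hs: rho^+2 <= s by lra.
  rewrite subr_ge0.
  have [b1 _ _] := bk_bounds (ltW s0) s2.
  have ks: bk s <= 2*bA s*bu s^+2.
   have t1 := bt_le (ltW s0) s2; have ts := bt_gt0 s; have As := bA_gt0 s.
   have -> : bk s = (1 + sg*bt s)*(bA s*bu s^+2) by rewrite /bk /bh; ring.
   rewrite -[X in _ <= X]mulrA; apply: ler_wpM2r; first by pos.
   by case: sg1=> ->; lra.
  apply: (le_trans ks).
  have [Yq _] := bY_out h1; have [Ys _] := bY_out hs.
  have eq1 z: bY z = z -> bA z = pw (- ((D - 1)/2)) z * pw (- 2^-1) z.
   by move=> e; have e3: - ((D - 1)/2) + - 2^-1 = - (D/2); [field|rewrite /bA e -pwD e3].
  have eq2: bA q*bt q^+2 = pw (- ((D - 1)/2)) q.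
   have e3: - (D/2) + 2%:R*4^-1 = - ((D - 1)/2) by field.
   by rewrite /bt Yq -pw_natl /bA Yq -pwD e3.
  rewrite /c eq2 (eq1 s Ys).
  have p1: pw (- ((D - 1)/2)) s <= pw (- ((D - 1)/2)) q.
   apply: pw_ge=> //; rewrite oppr_le0 divr_ge0 // subr_ge0 ler1n //.
  have us: bu s^+2 <= bu q^+2.
   have /andP[u0 _] := bu01 (ltW s0); have /andP[u1 _] := bu01 (ltW q0).
   apply: lerXn2r; rewrite ?nnegrE // !bu_in // lerD2l lerN2 ler_wpM2r // invr_ge0 ltW //.
  have w0 := pw_gt0 (- 2^-1) s; have w1 := pw_gt0 (- ((D - 1)/2)) s.
  have -> : 2*(pw (- ((D - 1)/2)) s * pw (- 2^-1) s)*bu s^+2 = pw (- ((D - 1)/2)) s*bu s^+2*(2 * pw (- 2^-1) s) by ring.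
  have -> : 2 * pw (- ((D - 1)/2)) q*bu q^+2 * pw (- 2^-1) s = pw (- ((D - 1)/2)) q*bu q^+2*(2 * pw (- 2^-1) s) by ring.
  apply: ler_wpM2r; first by pos.
  by apply: ler_pM=> //; [exact: ltW|exact: sqr_ge0].
 have sq1: pw 2^-1 q1 <= 4^-1.
  rewrite -(@ler_pXn2r _ 2) ?nnegrE ?(ltW (pw_gt0 _ _)) // -pw_natl mulfV ?pnatr_eq0 // pw1 //.
  by apply: (le_trans q16); apply: eqle; field.
 have w := pw_gt0 2^-1 q.
 have c1: c*(2 * pw 2^-1 q1) <= c*(2*4^-1) by do 2 apply: ler_wpM2l=> //.
 have c2: 0 <= c*(2 * pw 2^-1 q) by pos.
 rewrite /Psi; have -> : bA q*bt q^+2*bu q^+2 = c*(2*4^-1) by rewrite /c; field.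
 lra.
have near q: 0 <= q -> Psi q <= 3*(2/rho)^+d.
 move=> h; have AM0: 0 <= (2/rho)^+d by pos.
 have rr: 0 <= rho^+2 by exact: ltW.
 have t1: Psi (rho^+2) <= (2/rho)^+d.
  apply: (le_trans (far _ (lexx _) rq)).
  have A0 := bA_gt0 (rho^+2); have t0 := bt_gt0 (rho^+2); have tl := bt_le rr rq; have /andP[u0 u1] := bu01 rr.
  rewrite -mulrA -[X in _ <= X]mulr1; apply: ler_pM; [exact: ltW|by pos|exact: bA_le|].
  by rewrite -exprMn exprn_ile1 //; [pos|nra].
 have [hq|/ltW hq] := leP q q1; last by rewrite out //; pos.
 have [hr|/ltW hr] := leP q (rho^+2); last first.
  by apply: le_trans (mono _ _ rr hr hq) _; lra.
 have : `|Psi (rho^+2) - Psi q| <= 2*(2/rho)^+d * `|rho^+2 - q|.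
  apply: (@derive_lip _ Psi (fun s=> - bk s))=> s; rewrite min_l // max_r // => /andP[s1 s2]; first by apply: dP; lra.
  have sq: s <= q1 by exact: le_trans rq.
  have [b1 _ _] := bk_bounds (ltac:(lra) : 0 <= s) sq.
  rewrite normrN; apply: (le_trans b1); rewrite -mulrA; apply: ler_wpM2l=> //.
  have /andP[u0 u1] := bu01 (ltac:(lra) : 0 <= s).
  rewrite -[X in _ <= X]mulr1; apply: ler_pM=> //; [exact: ltW (bA_gt0 _)|exact: bA_le].
 have r1: `|rho^+2 - q| <= 1 by rewrite ger0_norm; have := le_trans rq q16; lra.
 have m := ler_wpM2l (ltac:(pos) : 0 <= 2*(2/rho)^+d) r1.
 by rewrite ler_norml=> /andP[h1 h2]; lra.
by exists Psi.
Qed.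
End Bar1.

(** * Tent functions *)

Section Tent.
Variables (R : realType) (d : nat).
Local Notation V := 'rV[R]_d.
(** A product of hats, so that translates over a grid of mesh [rho] add up to one ([pou]). It stands
    for the indicator of a ball of radius about [rho]. *)
Definition tent (rho : R) (x0 x : V) : R := \prod_i max (1 - `|x 0 i - x0 0 i|/rho) 0.
Lemma tent_ge0 rho x0 x : 0 <= tent rho x0 x.
Proof. by apply: prodr_ge0=> i _; rewrite le_max lexx orbT. Qed.
Lemma tent_le1 rho x0 x : 0 < rho -> tent rho x0 x <= 1.
Proof.
move=> r0; apply: prodr_ile1=> i _.
rewrite le_max lexx orbT /= ge_max ler01 andbT gerBl divr_ge0 // ltW //.
Qed.
Lemma tent_abs rho x0 x : 0 < rho -> `|tent rho x0 x| <= 1.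
Proof. by move=> r0; rewrite ger0_norm ?tent_ge0 // tent_le1. Qed.
Lemma tent_ge rho x0 x : 0 < rho -> enorm (x - x0) <= rho/2 -> 2^-1^+d <= tent rho x0 x.
Proof.
move=> r0 h; rewrite -[d in X in X <= _]card_ord -prodr_const; apply: ler_prod=> i _.
rewrite invr_ge0 ler0n /= le_max; apply/orP; left.
have : `|x 0 i - x0 0 i| <= rho/2 by have := coord_le (x - x0) i; rewrite !mxE=> /le_trans; apply.
move=> h'; have : `|x 0 i - x0 0 i|/rho <= 2^-1 by rewrite ler_pdivrMr // mulrC.
lra.
Qed.
Lemma tent_supp rho x0 x : 0 < rho -> d%:R*rho < enorm (x - x0) -> tent rho x0 x = 0.
Proof.
move=> r0 h.
have [i hi] : exists i, rho < `|x 0 i - x0 0 i|.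
 apply: contrapT=> hno; move: h; rewrite ltNge=> /negP; apply; apply: enorm_le_coord=> i; rewrite !mxE leNgt.
 by apply/negP=> h'; apply: hno; exists i.
rewrite /tent (bigD1 i) //= max_r ?mul0r //.
have : 1 <= `|x 0 i - x0 0 i|/rho by rewrite ler_pdivlMr // mul1r ltW.
lra.
Qed.
Lemma tent_near rho x0 x : 0 < rho -> tent rho x0 x != 0 -> enorm (x - x0) <= d%:R*rho.
Proof. by move=> r0; apply: contraR; rewrite -ltNge=> /(tent_supp r0) ->. Qed.
Lemma tent_bsupp rho x0 : 0 < rho -> bsupp (tent rho x0).
Proof.
move=> r0; exists (enorm x0 + d%:R*rho)=> y hy; apply: tent_supp=> //.
have := enorm_tri0 y x0; lra.
Qed.
Lemma lips_prod (I : Type) (r : seq I) (f : I -> V -> R) : (forall i, lips (f i)) -> (forall i, bdd (f i)) ->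
 lips (fun x=> \prod_(i <- r) f i x) /\ bdd (fun x=> \prod_(i <- r) f i x).
Proof.
move=> hl hb; elim: r=> [|i r [IH1 IH2]].
 rewrite (_ : (fun x=> _) = fun=> 1); last by apply/funext=> x; rewrite big_nil.
 by split; [exact: lips_cst|exists 1=> x; rewrite normr1].
rewrite (_ : (fun x=> _) = fun x=> f i x * \prod_(j <- r) f j x); last by apply/funext=> x; rewrite big_cons.
split; first exact: lips_mul.
have [B hB] := hb i; have [B' hB'] := IH2; exists (B*B')=> x; rewrite normrM; exact: ler_pM.
Qed.
Lemma maxr_lip (s t : R) : `|max s 0 - max t 0| <= `|s - t|.
Proof.
have [h1|h1] := leP s 0; have [h2|h2] := leP t 0.
- by rewrite subrr normr0.
- by rewrite sub0r normrN gtr0_norm // ler0_norm; lra.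
- by rewrite subr0 gtr0_norm // ger0_norm; lra.
- by [].
Qed.
Lemma tent_lips rho x0 : 0 < rho -> lips (tent rho x0).
Proof.
move=> r0; pose f (i : 'I_d) (x : V) := max (1 - `|x 0 i - x0 0 i|/rho) 0.
have l1 i: lips (f i).
 exists rho^-1=> x y; apply: (le_trans (maxr_lip _ _)).
 have -> : 1 - `|x 0 i - x0 0 i|/rho - (1 - `|y 0 i - x0 0 i|/rho) = (`|y 0 i - x0 0 i| - `|x 0 i - x0 0 i|)/rho by ring.
 rewrite normrM [`|rho^-1|]gtr0_norm ?invr_gt0 // mulrC; apply: ler_wpM2l; first by rewrite invr_ge0 ltW.
 apply: (le_trans (ler_dist_dist _ _)); rewrite opprB addrA subrK distrC.
 by have := coord_le (x - y) i; rewrite !mxE.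
have l2 i: bdd (f i).
 exists 1=> x; rewrite ger0_norm ?le_max ?lexx ?orbT // ge_max ler01 andbT gerBl divr_ge0 // ltW //.
exact: (lips_prod (index_enum _) l1 l2).1.
Qed.
Lemma tent_bdd rho x0 : 0 < rho -> bdd (tent rho x0).
Proof. by move=> r0; exists 1=> x; exact: tent_abs. Qed.
End Tent.

(** * Barriers and two-sided bounds for the resolvent of tents *)

Section BarV.
Variables (R : realType) (d : nat).
Local Notation V := 'rV[R]_d.
Local Notation D := (d%:R : R).
Definition Ce (nu be K : R) : R := sqrt nu*(D*(D*(K*nu)) + 2*(D*(be*nu)) + 2*(D*(D*(K*nu^+3)))).
Definition CE nu be K : R := 2*Ce nu be K*(D + 6).

Section One.
Variables (nu be K : R) (a : V -> 'M[R]_d) (b : V -> V).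
Hypothesis hc : coefs nu be K a b.
Let nu0 : 0 < nu := lt_le_trans ltr01 (c_nu hc).
Variables (x0 : V) (Psi k k1 : R -> R).
Hypotheses (dPsi : forall q : R, -1 < q -> is_derive q 1 Psi (- k q)) (dk : forall q : R, is_derive q 1 k (k1 q)) (ck1 : continuous k1).
Let q (x : V) := Qf a x0 (x - x0).
Let w (x : V) := (x - x0) *m ainv a x0.
Definition barG (x : V) : V := (- k (q x)) *: (2 *: w x).
Definition barH (x : V) : 'M[R]_d := \matrix_(j, i) (- k1 (q x)*((2 *: w x) 0 j*(2 *: w x) 0 i) + - k (q x)*(2 *: ainv a x0) j i).
Lemma bar_C2 : C2 (fun x=> Psi (q x)) barG barH.
Proof.
have hq := C2_quad x0 (ainv_sym hc x0).
have q0 y: -1 < q y by apply: lt_le_trans (Qf_ge0 hc _ _); rewrite ltrN10.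
have dk' (s : R) : is_derive s 1 (fun s=> - k s) (- k1 s) by exact: isd_opp.
by apply: (@C2_comp _ _ Psi (fun s=> - k s) (fun s=> - k1 s) q _ _ (fun y=> dPsi (q0 y)) (fun y=> dk' _) _ hq)=> y; exact: (cts_opp ck1).
Qed.
(** With diffusion frozen at [x0] and no drift the identity is exact; Lipschitz continuity and the
    drift give relative errors of order [|x - x0|], that is [sqrt q]. *)
Lemma bar_LL x : `|- LL a b barG barH x - (D*k (q x) + 2*(q x*k1 (q x)))| <=
 Ce nu be K*sqrt (q x)*(`|k (q x)| + `|q x*k1 (q x)|).
Proof.
have K0 := c_K hc; have be0 := c_be hc; have nup := nu0.
set z := x - x0; set A := ainv a x0; set qx := q x.
have qE: qx = dotv z (z *m A) by [].
have q0: 0 <= qx := Qf_ge0 hc _ _.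
rewrite (@LL_comp _ _ a b (- k qx) (- k1 qx) (fun x=> 2 *: w x) (fun=> 2 *: A) x barG barH erefl erefl).
set W := z *m A.
have wE: w x = W by [].
pose e1 := \sum_i \sum_j (a x i j - a x0 i j)*A j i.
pose e2 := \sum_i b x 0 i*W 0 i.
pose e3 := \sum_i \sum_j (a x i j - a x0 i j)*(W 0 j*W 0 i).
have S1: \sum_i \sum_j a x0 i j*A j i = D.
 have -> : \sum_i \sum_j a x0 i j*A j i = \sum_i (a x0 *m A) i i by apply: eq_bigr=> i _; rewrite mxE.
 rewrite mulmxV ?(a_unit hc) //; under eq_bigr do rewrite mxE eqxx.
 by rewrite sumr_const card_ord.
have S2: \sum_i \sum_j a x0 i j*(W 0 j*W 0 i) = qx.
 have -> : \sum_i \sum_j a x0 i j*(W 0 j*W 0 i) = quadf W (a x0).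
  by apply: eq_bigr=> i _; apply: eq_bigr=> j _; ring.
 rewrite quadfE (_ : W *m a x0 = z); last by rewrite /W mulmxKV // (a_unit hc).
 by rewrite dotvC.
have L1: LL a b (fun x=> 2 *: w x) (fun=> 2 *: A) x = D + e1 + 2*e2.
 rewrite /LL -S1 /e1 -big_split /= wE; congr (_ + _).
  rewrite mulr_sumr; apply: eq_bigr=> i _; rewrite -big_split mulr_sumr; apply: eq_bigr=> j _ /=; by rewrite !mxE; field.
 by rewrite /e2 mulr_sumr; apply: eq_bigr=> i _; rewrite mxE; ring.
have L2: \sum_i \sum_j a x i j*((2 *: w x) 0 j*(2 *: w x) 0 i) = 4*(qx + e3).
 rewrite wE -S2 /e3 -big_split /= mulr_sumr; apply: eq_bigr=> i _; rewrite -big_split mulr_sumr; apply: eq_bigr=> j _ /=.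
 by rewrite !mxE; ring.
rewrite L1 L2.
have -> : - (- k qx*(D + e1 + 2*e2) + - k1 qx/2*(4*(qx + e3))) - (D*k qx + 2*(qx*k1 qx)) =
 k qx*(e1 + 2*e2) + 2*(k1 qx*e3) by field.
set r := enorm z; have r0: 0 <= r := enorm_ge0 _.
have rq: r <= sqrt nu*sqrt qx.
 rewrite -sqrtrM ?(ltW nu0) // -[r]ger0_norm // -sqrtr_sqr ler_wsqrtr //.
 have := Qf_ge hc x0 z; rewrite -/qx -/r mulrC ler_pdivrMr // mulrC //.
have r2: r^+2 <= nu*qx.
 have := Qf_ge hc x0 z; rewrite -/qx -/r mulrC ler_pdivrMr // mulrC //.
have Wi i: `|W 0 i| <= nu*r by exact: (ainv_coord hc).
have b1: `|e1| <= D*(D*(K*nu))*r.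
 apply: (le_via (D*(D*(K*r*nu)))); last by apply: eqle; ring.
 apply: sumd_abs=> i; apply: sumd_abs=> j; rewrite normrM; apply: ler_pM=> //; [exact: (c_aL hc)|exact: (ainv_bound hc)].
have b2: `|e2| <= D*(be*nu)*r.
 apply: (le_via (D*(be*(nu*r)))); last by apply: eqle; ring.
 by apply: sumd_abs=> i; rewrite normrM; apply: ler_pM=> //; exact: (c_b hc).
have b3: `|e3| <= D*(D*(K*nu^+3))*r*qx.
 apply: (le_via (D*(D*(K*r*(nu*(nu*(nu*qx))))))); last by apply: eqle; ring.
 apply: sumd_abs=> i; apply: sumd_abs=> j; rewrite normrM; apply: ler_pM=> //; first exact: (c_aL hc).
 rewrite normrM; apply: (le_via ((nu*r)*(nu*r))); first exact: ler_pM.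
 rewrite (_ : nu*r*(nu*r) = nu*(nu*r^+2)); last by ring.
 by do 2 (apply: ler_wpM2l; first exact: ltW).
have ke: `|k qx*(e1 + 2*e2)| <= (D*(D*(K*nu)) + 2*(D*(be*nu)))*r * `|k qx|.
 rewrite normrM mulrC; apply: ler_wpM2r=> //; apply: normDt; rewrite normrM [`|2|]ger0_norm //.
 rewrite (_ : (D*(D*(K*nu)) + 2*(D*(be*nu)))*r = D*(D*(K*nu))*r + 2*(D*(be*nu)*r)); last by ring.
 by apply: lerD=> //; apply: ler_wpM2l.
have k1e: `|2*(k1 qx*e3)| <= 2*(D*(D*(K*nu^+3)))*r * `|qx*k1 qx|.
 rewrite normrM [`|2|]ger0_norm // !normrM [`|qx|]ger0_norm //.
 apply: (le_via (2*(`|k1 qx|*(D*(D*(K*nu^+3))*r*qx)))); last by apply: eqle; ring.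
 by apply: ler_wpM2l=> //; apply: ler_wpM2l.
apply: normDt; apply: (le_trans (lerD ke k1e)).
set P1 := D*(D*(K*nu)) + 2*(D*(be*nu)); set P2 := 2*(D*(D*(K*nu^+3))).
have P10: 0 <= P1 by rewrite /P1; pos.
have P20: 0 <= P2 by rewrite /P2; pos.
rewrite /Ce -/P1 -/P2.
apply: (le_via ((P1 + P2)*r*(`|k qx| + `|qx*k1 qx|))).
 have n1 := normr_ge0 (k qx); have n2 := normr_ge0 (qx*k1 qx).
 have c1: 0 <= P2*r * `|k qx| by pos.
 have c2: 0 <= P1*r * `|qx*k1 qx| by pos.
 rewrite (_ : (P1 + P2)*r*(`|k qx| + `|qx*k1 qx|) = P1*r * `|k qx| + P2*r * `|qx*k1 qx| + (P2*r * `|k qx| + P1*r * `|qx*k1 qx|)); last by ring.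
 by rewrite lerDl addr_ge0.
apply: ler_wpM2r; first by rewrite addr_ge0.
rewrite (_ : sqrt nu*_*_ = (P1 + P2)*(sqrt nu*sqrt qx)); last by ring.
by apply: ler_wpM2l=> //; rewrite addr_ge0.
Qed.
End One.
Lemma Ce_ge0 nu be K : 0 <= nu -> 0 <= be -> 0 <= K -> 0 <= Ce nu be K.
Proof. by move=> h1 h2 h3; rewrite /Ce; pos. Qed.

(* With this barrier profile the error in [bar_LL] is of relative order [t^2 = Y^(1/2)]. *)
Lemma bar_err (rho q1 sg : R) (nu be K q X : R) : (0 < d)%N -> 0 < rho -> rho^+2 <= q1 -> q1 <= 16^-1 -> (sg = 1 \/ sg = -1) ->
 0 <= Ce nu be K -> 0 <= q -> q <= q1 ->
 `|X - (D*bk d rho q1 sg q + 2*(q*bk1 d rho q1 sg q))| <= Ce nu be K*sqrt q*(`|bk d rho q1 sg q| + `|q*bk1 d rho q1 sg q|) ->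
 `|X - (D*bk d rho q1 sg q + 2*(q*bk1 d rho q1 sg q))| <= CE nu be K*bt rho q^+2*(bA d rho q*bu q1 q).
Proof.
move=> d0 rho0 rq q16 sg1 C0 h0 h1 hX.
have [b1 b2 _] := bk_bounds d0 rho0 rq q16 sg1 h0 h1.
have t0 := bt_gt0 rho q.
have st: sqrt q <= 2*bt rho q^+2.
 rewrite -[2*_]ger0_norm; last by pos.
 rewrite -sqrtr_sqr ler_wsqrtr // exprMn -exprM (bt4 rho0 rq q16).
 have := bY_q2 rho0 rq q16 q; have := bY_gt0 rho0 rq q16 q; lra.
have A0 := bA_gt0 d rho q; have /andP[u0 u1] := bu01 rho0 rq q16 h0.
apply: (le_trans hX); rewrite /CE.
apply: (le_via (Ce nu be K*(2*bt rho q^+2)*((D + 6)*bA d rho q*bu q1 q))); last by apply: eqle; ring.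
apply: ler_pM; [by pos|by rewrite addr_ge0|by apply: ler_wpM2l|].
rewrite (_ : (D + 6)*bA d rho q*bu q1 q = 2*bA d rho q*bu q1 q + (D + 4)*bA d rho q*bu q1 q); last by ring.
exact: lerD.
Qed.
End BarV.

Section BarAlg.
Variable R : realType.
Implicit Types (A C D t th u v : R).
Lemma low_in C D t th u v : 0 <= C -> 0 <= D -> 0 <= t -> t <= 1 -> 0 <= th -> th <= 1 -> 0 <= u -> u <= 1 -> 0 <= v ->
 u*(D*(1 - th) + -1*t*(D*(1 - th) + th/2)) - 4*(1 + -1*t)*v + C*t^+2 <= D + C.
Proof.
move=> C0 D0 t0 t1 th0 th1 u0 u1 v0.
have e1: 0 <= t*(D*(1 - th) + th/2) by rewrite mulr_ge0 // addr_ge0 ?mulr_ge0 ?subr_ge0.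
have e2: u*(D*(1 - th)) <= D*(1 - th) by rewrite ler_piMl // mulr_ge0 // subr_ge0.
have e3: 0 <= u*(t*(D*(1 - th) + th/2)) by rewrite mulr_ge0.
have e4: 0 <= (1 - t)*v by rewrite mulr_ge0 // subr_ge0.
have e5: 0 <= D*th by rewrite mulr_ge0.
have e6: C*t^+2 <= C*1 by apply: ler_wpM2l=> //; rewrite exprn_ile1.
lra.
Qed.
Lemma small_t2 C t e : 0 <= C -> 0 <= t -> t <= e -> (C + 1)*e <= 8^-1 -> C*t^+2 <= t/8 - t^+2.
Proof.
move=> C0 t0 te h; have h1 := ler_wpM2l (ltac:(lra) : 0 <= C + 1) te.
have := ler_wpM2r t0 (le_trans h1 h); rewrite expr2; lra.
Qed.
Lemma low_out C D t u v : 0 <= t -> t <= 8^-1 -> C*t^+2 <= t/8 - t^+2 -> 0 <= u -> 0 <= v -> u = 1 - v ->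
 u*(D*(1 - 1) + -1*t*(D*(1 - 1) + 1/2)) - 4*(1 + -1*t)*v + C*t^+2 + t^+2 <= - (t/8).
Proof.
move=> t0 t1 Ct u0 v0 uE; rewrite subrr mulr0 !add0r.
have e1: (1 + -1*t)*v >= v/2 by have := ler_wpM2r v0 (ltac:(lra) : 1/2 <= 1 + -1*t); lra.
have [hu|hu] := leP (1/2) u; first by have := ler_wpM2r t0 hu; lra.
have : 0 <= u*t by rewrite mulr_ge0.
lra.
Qed.
Lemma up_in C D t th u v : 1 <= D -> 0 <= C -> 0 <= t -> t <= 2^-1 -> 0 <= th -> th <= 1 -> 0 <= v -> v <= t/64 -> u = 1 - v ->
 C*t^+2 <= t/8 ->
 D*(1 - th)/2 <= u*(D*(1 - th) + 1*t*(D*(1 - th) + th/2)) - 4*(1 + 1*t)*v - C*t^+2.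
Proof.
move=> D1 C0 t0 t1 th0 th1 v0 v1 uE Ct.
have Dth: 0 <= D*(1 - th) by rewrite mulr_ge0 //; lra.
have tb: t/2 <= t*(D*(1 - th) + th/2).
 by apply: ler_wpM2l=> //; have := ler_wpM2r (ltac:(lra) : 0 <= 1 - th) D1; lra.
have u12: 1/2 <= u by lra.
have e1: (1 + 1*t)*v <= 2*v by apply: ler_wpM2r=> //; lra.
have e2: 1/2*(D*(1 - th) + t/2) <= u*(D*(1 - th) + 1*t*(D*(1 - th) + th/2)).
 by apply: ler_pM=> //; [rewrite addr_ge0 // divr_ge0|rewrite mul1r; lra].
lra.
Qed.
Lemma up_out C D t th u v : 0 <= D -> 0 <= C -> 0 <= t -> t <= 2^-1 -> 0 <= th -> th <= 1 -> 0 <= u -> 0 <= v -> v <= 1 ->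
 - (8 + C) <= u*(D*(1 - th) + 1*t*(D*(1 - th) + th/2)) - 4*(1 + 1*t)*v - C*t^+2.
Proof.
move=> D0 C0 t0 t1 th0 th1 u0 v0 v1.
have Dth: 0 <= D*(1 - th) by rewrite mulr_ge0 // subr_ge0.
have e1: 0 <= u*(D*(1 - th) + 1*t*(D*(1 - th) + th/2)).
 by rewrite mulr_ge0 // mul1r addr_ge0 // mulr_ge0 // addr_ge0 // divr_ge0.
have e2: (1 + 1*t)*v <= 2*1 by apply: ler_pM=> //; lra.
have e3: C*t^+2 <= C*1 by apply: ler_wpM2l=> //; rewrite exprn_ile1 //; lra.
lra.
Qed.
Lemma normB_le (x y e : R) : `|x - y| <= e -> x <= y + e /\ y - e <= x.
Proof. by rewrite ler_norml; lra. Qed.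
End BarAlg.
Lemma CE_ge0 (R : realType) (d : nat) (nu be K : R) : 1 <= nu -> 0 <= be -> 0 <= K -> 0 <= CE d nu be K.
Proof. by move=> n1 b0 K0; have := @Ce_ge0 R d nu be K (ltac:(lra)) b0 K0; rewrite /CE=> h; pos. Qed.
Section BarTest.
Variables (R : realType) (d : nat) (nu be K : R) (a : 'rV[R]_d -> 'M[R]_d) (b : 'rV[R]_d -> 'rV[R]_d).
Hypothesis hc : coefs nu be K a b.
Lemma Qf_far (x0 z : 'rV[R]_d) (r q : R) : 1 <= nu -> 0 <= r -> enorm z <= r -> nu*r^+2 <= q -> Qf a x0 z <= q.
Proof.
move=> nu1 r0 h hq; apply: (le_trans (Qf_le hc _ _)); apply: le_trans hq; apply: ler_wpM2l; first by lra.
by apply: lerXn2r; rewrite ?nnegrE ?enorm_ge0.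
Qed.
Lemma Qf_near (x0 z : 'rV[R]_d) (r : R) : 1 <= nu -> 0 <= r -> Qf a x0 z <= r^+2/nu -> enorm z <= r.
Proof.
move=> nu1 r0 h; have nu0: 0 < nu by lra.
have := le_trans (Qf_ge hc x0 z) h; rewrite [r^+2/nu]mulrC ler_pM2l ?invr_gt0 // => h2.
by rewrite -(@ler_pXn2r _ 2) ?nnegrE ?enorm_ge0.
Qed.
Lemma bar_test (x0 : 'rV[R]_d) (ro q1 sg kap : R) :
 (0 < d)%N -> 1 <= nu -> 0 <= be -> 0 <= K -> 0 < ro -> ro^+2 <= q1 -> q1 <= 16^-1 -> sg = 1 \/ sg = -1 ->
 let q x := Qf a x0 (x - x0) in exists (Psi : R -> R) G H,
 [/\ C2 (fun x=> Psi (q x)) G H, bsupp (fun x=> Psi (q x)), (forall s, q1 <= s -> Psi s = 0), (forall s, 0 <= s -> 0 <= Psi s) &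
   forall s, 0 <= s -> Psi s <= 3*(2/ro)^+d] /\ [/\
 forall s, ro^+2 <= s -> s <= q1 -> Psi s <= bA d ro s*bt ro s^+2*bu q1 s^+2,
 forall x, q1 < q x -> gen a b kap (fun x=> Psi (q x)) G H x = kap*Psi (q x) &
 forall x, q x <= q1 -> let A := bA d ro (q x) in let t := bt ro (q x) in let th := bth ro (q x) in let u := bu q1 (q x) in
 `|gen a b kap (fun x=> Psi (q x)) G H x - kap*Psi (q x) -
  A*u*(u*(d%:R*(1 - th) + sg*t*(d%:R*(1 - th) + th/2)) - 4*(1 + sg*t)*(q x/q1))| <= CE d nu be K*t^+2*(A*u)].
Proof.
move=> d0 nu1 be0 K0 ro0 rq q16 hs q; have nu0: 0 < nu by lra.
have Ce0: 0 <= Ce d nu be K by apply: Ce_ge0=> //; exact: ltW.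
have [Psi [dP Pout Pge Ple Pfar]] := bPsi_ex d0 ro0 rq q16 hs.
have hC2 := bar_C2 hc x0 dP (isd_bk d sg ro0 rq q16) (@bk1_cont R d ro q1 sg ro0 rq q16).
have qge x: 0 <= q x := Qf_ge0 hc _ _.
exists Psi, (barG a x0 (bk d ro q1 sg)), (barH a x0 (bk d ro q1 sg) (bk1 d ro q1 sg)); split; [split=> //|split=> // x hq].
- exists (enorm x0 + nu)=> x hx'; apply: Pout; rewrite leNgt; apply/negP=> hq.
 have h1: enorm (x - x0) <= nu.
  apply: (Qf_near (x0 := x0) nu1 (ltW nu0)); apply: ltW; apply: lt_le_trans hq _.
  by rewrite expr2 mulfK ?gt_eqF //; apply: (le_trans q16); apply: le_trans nu1; rewrite invf_le1 ?ler1n.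
 by have := enorm_tri0 x x0; clear -h1 hx'; lra.
- have := bar_LL hc x0 (bk d ro q1 sg) (bk1 d ro q1 sg) x; rewrite -/(q x) /gen.
 have bu0: bu q1 (q x) = 0 by apply: (bu_out ro0 rq q16); exact: ltW.
 rewrite /bk /bk1 bu0 expr0n !mulr0 !addr0 !mulr0 normr0 !addr0 mulr0 subr0 normrN normr_le0=> /eqP ->; exact: subr0.
cbv zeta; have := bar_err d0 ro0 rq q16 hs Ce0 (qge x) hq (bar_LL hc x0 (bk d ro q1 sg) (bk1 d ro q1 sg) x).
have [_ _ ->] := bk_bounds d0 ro0 rq q16 hs (qge x) hq.
by rewrite /gen [kap*_ - _]addrC addrK.
Qed.
Lemma tent_appr kap rho (x : 'rV[R]_d) : 0 < kap -> 0 < rho -> appr a b kap (tent rho x).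
Proof. by move=> k0 r0; apply: (lips_appr hc k0); [exact: tent_lips|exact: tent_bsupp]. Qed.
Lemma U_tent2 kap rho r (x y : 'rV[R]_d) c c' : 0 < kap -> 0 < rho -> 0 < r ->
 UU a b kap (fun z=> c*tent rho x z + c'*tent r y z) = c*UU a b kap (tent rho x) + c'*UU a b kap (tent r y).
Proof.
move=> k0 h1 h2; have ap1 := tent_appr x k0 h1.
rewrite -(U_scale hc k0 _ ap1) -(U_lin hc k0) //; last exact: tent_appr.
by have := appr_lin c (appr0 a b kap) ap1; congr appr; apply/funext=> z; rewrite add0r.
Qed.
End BarTest.
(** Subsolution ([sg = -1]): [(kap - L) Psi] is at most a multiple of [rho^-d] on the small tent and
    at most [- 1/16] of the large one. Since [Psi] is nonnegative at the origin, evaluation there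
    gives the inequality. *)
Lemma bar_low (R : realType) (d : nat) (nu be K : R) : (0 < d)%N -> 1 <= nu -> 0 <= be -> 0 <= K -> exists cl rl : R, [/\ 0 < cl, 0 < rl & forall a b, coefs nu be K a b -> forall kap, 0 < kap -> kap <= 1 ->
 forall r rho : R, r <= rl -> 0 < rho -> rho <= r -> forall x0 x' : 'rV[R]_d, enorm (x0 - x') <= r ->
 cl*rho^+d*UU a b kap (tent r x') <= UU a b kap (tent rho x0)].
Proof.
move=> d0 nu1 be0 K0; pose C := CE d nu be K; pose D : R := d%:R.
have nu0: 0 < nu by lra.
have D1: 1 <= D by rewrite ler1n.
have C0: 0 <= C := CE_ge0 d nu1 be0 K0.
(* For [t <= t0] the error [C t^2] is at most [t/8 - t^2]; the choice [q1 = t0^4] keeps [bt] below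
   [t0] on the whole support. *)
pose t0 : R := (8*(C + 1))^-1.
have t00: 0 < t0 by rewrite invr_gt0; lra.
have tC: (C + 1)*t0 = 8^-1 by rewrite /t0; field; rewrite gt_eqF //; lra.
have t01: t0 <= 8^-1 by rewrite lef_pV2 ?posrE; lra.
pose q1 := t0^+4.
have q10: 0 < q1 by exact: exprn_gt0.
have q1t: q1 <= t0^+2*t0^+2 by rewrite /q1; apply: eqle; ring.
have t02: t0^+2 <= 64^-1 by rewrite expr2; apply: le_trans (ler_pM _ _ t01 t01) _; rewrite ?(ltW t00) //; apply: eqle; field.
have t02p: 0 < t0^+2 by exact: exprn_gt0.
have q16: q1 <= 16^-1 by apply: (le_trans q1t); nra.
(* Keeps the support of the tent of radius [r] about [x'] in [q <= q1/2], where [u >= 1/2]. *)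
pose rl := t0^+2/(2*nu*(D + 1)).
have rl0: 0 < rl by rewrite divr_gt0 // !mulr_gt0 //; lra.
have rl1: nu*((D + 1)*rl)^+2 <= q1/2.
 have -> : nu*((D + 1)*rl)^+2 = q1/(4*nu) by rewrite /rl /q1; field; rewrite !gt_eqF //; lra.
 apply: ler_wpM2l; first exact: ltW.
 by rewrite lef_pV2 ?posrE ?mulr_gt0 //; lra.
have rlt: rl <= t0^+2.
 rewrite /rl ler_pdivrMr ?mulr_gt0 //; try lra; rewrite ler_peMr ?(ltW t02p) //.
 have : 1 <= nu*(D + 1) by nra.
 lra.
pose s := sqrt nu.
have s0: 0 < s by rewrite sqrtr_gt0.
have s2: s^+2 = nu by rewrite sqr_sqrtr // ltW.
have s1: 1 <= s by rewrite -[X in X <= _]sqrtr1 ler_wsqrtr.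
(* Covers the core [q < ro^2]: [D + C] bounds the operator part, 3 the term [kap Psi], the final 1
   the large tent, and [2^d] compensates the lower bound [2^-d] of the small tent. *)
pose C' : R := 2^+d*((4*s)^+d*(D + C + 3) + 1).
have C'0: 0 < C' by rewrite /C' mulr_gt0 ?exprn_gt0 // ltr_wpDl //; pos.
exists (16*C')^-1, rl; split=> //; first by rewrite invr_gt0 mulr_gt0.
move=> a b hc kap kap0 kap1 r rho hr rho0 rr x0 x' hx.
have r0: 0 < r by exact: lt_le_trans rr.
have r1: r <= 1 by apply: (le_trans hr); apply: (le_trans rlt); lra.
(* The core [q <= ro^2] then lies within distance [rho/2] of [x0], where the small tent is at least
   [2^-d]. *)
pose ro := rho/(2*s).
have ro0: 0 < ro by rewrite divr_gt0 ?mulr_gt0.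
have ro2: 0 < ro^+2 by exact: exprn_gt0.
have ron: nu*ro^+2 = (rho/2)^+2 by rewrite /ro -s2; fieldp.
have rq: ro^+2 <= q1.
 apply: (le_trans _ (_ : rl^+2 <= _)); last by rewrite (_ : q1 = (t0^+2)^+2); [apply: lerXn2r; rewrite ?nnegrE // ltW|rewrite /q1; ring].
 apply: lerXn2r; rewrite ?nnegrE ?(ltW ro0) ?(ltW rl0) //; apply: (le_trans _ (le_trans rr hr)).
 by rewrite /ro ler_pdivrMr ?mulr_gt0 // ler_peMr ?(ltW rho0) //; lra.
have [Psi [G [H [[hC2 sPsi Pout Pge Ple] [Pfar hfar hnear]]]]] :=
 bar_test hc x0 kap d0 nu1 be0 K0 ro0 rq q16 (or_intror erefl : -1 = 1 :> R \/ -1 = -1 :> R).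
pose q (x : 'rV[R]_d) := Qf a x0 (x - x0).
have qge x: 0 <= q x := Qf_ge0 hc _ _.
have C'r: C'/rho^+d*2^-1^+d = (2/ro)^+d*(D + C + 3) + (rho^-1)^+d.
 rewrite /C' (_ : 2/ro = 4*s/rho); last by rewrite /ro; fieldp.
 by rewrite !exprMn !exprVn; field; rewrite !expf_neq0 // gt_eqF.
have key x: gen a b kap (fun x=> Psi (q x)) G H x
  - 0 <= C'/rho^+d*tent rho x0 x + - 16^-1*tent r x' x.
 rewrite subr0.
 have te0 := tent_ge0 rho x0 x; have te1 := tent_ge0 r x' x; have te2 := tent_le1 x' x r0.
 have Crho: 0 <= C'/rho^+d*tent rho x0 x.
  by apply: mulr_ge0=> //; rewrite divr_ge0 ?exprn_ge0 ?(ltW C'0) ?(ltW rho0).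
 have tfar: q1/2 < q x -> tent r x' x = 0.
  move=> hq; apply/eqP; apply/negPn/negP=> hne; have h1 := tent_near r0 hne.
  move: hq; apply/negP; rewrite -leNgt; apply: (@Qf_far R d nu be K a b hc x0 (x - x0) ((D + 1)*rl))=> //; first by rewrite mulr_ge0 ?(ltW rl0) //; lra.
  have := enorm_tri x x' x0; rewrite (enormB x' x0)=> h2.
  have : D*r <= D*rl by apply: ler_wpM2l.
  by rewrite mulrDl mul1r=> h3; clear -h1 h2 h3 hx hr; lra.
 have [hq|hq] := ltP q1 (q x).
  rewrite (hfar x hq) -/(q x) (Pout _ (ltW hq)) tfar ?mulr0 ?addr0 //.
  by apply: lt_trans hq; clear -q10; lra.
 have /= herr := hnear x hq; rewrite -/(q x) in herr; set Y := _ - kap*_ in herr.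
 have -> : gen a b kap (fun x=> Psi (q x)) G H x = kap*Psi (q x) + Y by rewrite /Y; ring.
 have A0 := bA_gt0 d ro (q x); have tt0 := bt_gt0 ro (q x); have /andP[u0 u1] := bu01 ro0 rq q16 (qge x).
 have /andP[th0 th1] := bth01 ro0 rq q16 (qge x).
 have tl: bt ro (q x) <= t0 by apply: (bt_tiny ro0 rq q16 t00 (qge x) hq).
 have uE := bu_in ro0 rq q16 hq.
 have qq: 0 <= q x/q1 by rewrite divr_ge0 // ltW.
 set A := bA d ro (q x) in herr A0; set t := bt ro (q x) in herr tt0 tl; set th := bth ro (q x) in herr th0 th1.
 set u := bu q1 (q x) in herr u0 u1 uE; set v := q x/q1 in herr uE qq.
 have Au0: 0 <= A*u by rewrite mulr_ge0 // ltW.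
 have tC': (C + 1)*t0 <= 8^-1 by rewrite tC.
 have Ct := small_t2 C0 (ltW tt0) tl tC'.
 have t18: t <= 8^-1 by exact: le_trans t01.
 have t1: t <= 1 by apply: (le_trans t18); rewrite invf_le1 ?ler1n.
 have [X1 _] := normB_le herr; rewrite -/C [C*t^+2*(A*u)]mulrC -mulrDr in X1.
 have [hro|hro] := ltP (q x) (ro^+2).
  have h1: Y <= (2/ro)^+d*(D + C).
   apply: (le_trans X1); have Al := bA_le d ro0 rq q16 (q x); rewrite -/A in Al.
   have B1 := low_in C0 (ler0n R d) (ltW tt0) t1 th0 th1 u0 u1 qq.
   apply: (le_via (A*u*(D + C))); first by apply: ler_wpM2l.
   apply: ler_wpM2r; first by rewrite addr_ge0.
   by rewrite -[X in _ <= X]mulr1; apply: ler_pM=> //; exact: ltW.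
  have h2 := Ple (q x) (qge x).
  have h3: kap*Psi (q x) <= 3*(2/ro)^+d.
   by apply: le_trans h2; rewrite ler_piMl //; exact: Pge.
  have h4: 2^-1^+d <= tent rho x0 x.
   apply: tent_ge=> //; apply: (Qf_near hc (x0 := x0) nu1); first by rewrite divr_ge0 // ltW.
   by rewrite -ron [nu*_]mulrC mulfK ?gt_eqF //; exact: ltW.
  have h5: C'/rho^+d*2^-1^+d <= C'/rho^+d*tent rho x0 x.
   by apply: ler_wpM2l=> //; rewrite divr_ge0 ?exprn_ge0 ?(ltW C'0) ?(ltW rho0).
  have h6: 1 <= rho^-1^+d by rewrite exprn_ege1 // -[X in X <= _]invr1 lef_pV2 ?posrE //; exact: le_trans rr r1.
  by clear -h1 h3 h5 h6 te2 C'r; move: h5; rewrite C'r; lra.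
 have thE: th = 1.
  by have [e1 e2] := bY_out ro0 rq q16 hro; rewrite /th /bth e1 e2 mulr1 divff // gt_eqF //; exact: lt_le_trans hro.
 have hP: kap*Psi (q x) <= A*u*t^+2.
  have h1: Psi (q x) <= A*t^+2*u^+2 by exact: Pfar.
  apply: (le_via (Psi (q x))); first by rewrite ler_piMl //; exact: Pge.
  apply: (le_trans h1); rewrite (_ : A*u*t^+2 = A*t^+2*u); last by ring.
  by apply: ler_wpM2l; [pos|rewrite expr2 ler_piMl].
 have hB := low_out d%:R (ltW tt0) t18 Ct u0 qq uE; rewrite thE in X1.
 have X2: kap*Psi (q x) + Y <= - (A*u*t/8).
  by have := ler_wpM2l Au0 hB; rewrite mulrDr; clear -X1 hP; lra.
 have At0: 0 <= A*u*t by rewrite mulr_ge0 // ltW.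
 have [hq2|hq2] := ltP (q1/2) (q x); first by rewrite (tfar hq2) mulr0 addr0; clear -X2 At0 Crho; lra.
 have u12: 1/2 <= u.
  have v12: v <= 1/2 by rewrite /v ler_pdivrMr // mulrC mul1r.
  by clear -v12 uE; lra.
 have At1: 1 <= A*t.
  rewrite /A (bA_t d ro0 rq q16) -/t.
  have ti: 1 <= t^-1 by rewrite -[X in X <= _]invr1 lef_pV2 ?posrE.
  have -> : t^-1^+(2*d)*t = t^-1^+(2*d).-1.
   by rewrite -{1}(prednK (_ : 0 < 2*d)%N) ?muln_gt0 ?d0 // exprS mulrAC mulVf ?mul1r // gt_eqF.
  exact: exprn_ege1.
 have : 1/2*1 <= u*(A*t) by apply: ler_pM.
 have -> : u*(A*t) = A*u*t by ring.
 by clear -X2 Crho te1 te2; lra.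
have bf: bdd (fun x=> C'/rho^+d*tent rho x0 x + - 16^-1*tent r x' x).
 by apply: bdd_add; apply: bdd_scale; exact: tent_bdd.
have := U_ge hc kap0 bf (lexx 0) hC2 sPsi key.
rewrite mul0r subr0 (U_tent2 hc) // => hU.
have P0 := Pge (q 0) (qge 0).
have rd: 0 < rho^+d by exact: exprn_gt0.
have hU2: 16^-1*UU a b kap (tent r x') <= C'/rho^+d*UU a b kap (tent rho x0).
 by move: (le_trans P0 hU); lra.
have := ler_wpM2l (ltW (divr_gt0 rd C'0)) hU2.
have -> : rho^+d/C'*(C'/rho^+d*UU a b kap (tent rho x0)) = UU a b kap (tent rho x0) by fieldp.
by apply: le_trans; apply: eqle; fieldp.
Qed.
(** Supersolution ([sg = 1]): [(kap - L) Psi] is at least [c rho^-d] times the small tent, with a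
    negative part paid by the large one. The additive term is the value of [Psi] at the origin,
    which vanishes as soon as [|x0| >= 1]. *)
Lemma bar_up (R : realType) (d : nat) (nu be K : R) : (0 < d)%N -> 1 <= nu -> 0 <= be -> 0 <= K -> exists2 ru : R, 0 < ru & forall r, 0 < r -> r <= ru -> exists Cu rho0 : R, [/\ 0 < Cu, 0 < rho0 &
 forall a b, coefs nu be K a b -> forall kap, 0 < kap -> kap <= 1 ->
 forall rho, 0 < rho -> rho <= rho0 -> forall x0 : 'rV[R]_d,
 UU a b kap (tent rho x0) <= Cu*rho^+d*UU a b kap (tent r x0) + (if 1 <= enorm x0 then 0 else Cu)].
Proof.
move=> d0 nu1 be0 K0; pose C := CE d nu be K; pose D : R := d%:R.
have nu0: 0 < nu by lra.
have D1: 1 <= D by rewrite ler1n.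
have C0: 0 <= C := CE_ge0 d nu1 be0 K0.
exists 4^-1=> [|r r0 hr]; first by rewrite invr_gt0.
(* On [q <= q1] one has [|x - x0| <= r/2], where the tent of radius [r] is at least [2^-d] and can
   absorb the negative part. *)
pose q1 := (r/2)^+2/nu.
have q10: 0 < q1 by rewrite divr_gt0 // exprn_gt0 // divr_gt0.
have q16: q1 <= 16^-1.
 rewrite /q1 ler_pdivrMr // (le_trans _ (_ : 16^-1*1 <= _)) //; last by apply: ler_wpM2l; rewrite ?invr_ge0.
 by rewrite mulr1 expr2; nra.
(* As long as [t <= t2], the coefficient error is at most [t/8] and the cutoff term satisfies
   [v <= t/64], so the sign is favourable. *)
pose t2 := q1/(128*(C + 1)).
have C1: 0 < C + 1 by lra.
have t20: 0 < t2 by rewrite divr_gt0 // mulr_gt0.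
have t2a: (C + 1)*t2 <= 8^-1.
 rewrite (_ : _*t2 = q1/128); last by rewrite /t2; fieldp.
 lra.
have t2b: t2 <= q1/128.
 rewrite /t2; apply: ler_wpM2l; first exact: ltW.
 by rewrite lef_pV2 ?posrE ?mulr_gt0 //; lra.
have t21: t2 <= 1 by lra.
have t24: t2^+4 <= q1.
 apply: (le_via t2); last by lra.
 by rewrite exprS ler_piMr ?(ltW t20) // exprn_ile1 // ltW.
(* Ensures [ro^2 <= t2^4], so that the support of the small tent lies in the favourable region. *)
pose rho0 := t2^+2/(2*nu*D).
have D0: 0 < D by lra.
have rho00: 0 < rho0 by rewrite /rho0; ppos.
pose c : R := (8*(2*nu*D)^+d)^-1.
have c0: 0 < c by rewrite /c; ppos.
pose C2' : R := t2^-1^+(2*d)*(8 + C)*2^+d.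
have C20: 0 < C2' by rewrite /C2' !mulr_gt0 ?exprn_gt0 ?invr_gt0 //; lra.
pose C3' : R := 3*(nu*D)^-1^+d.
have C30: 0 < C3' by rewrite /C3' mulr_gt0 // exprn_gt0 // invr_gt0 mulr_gt0.
exists (C2'/c + C3'/c), rho0; split=> //; first by rewrite addr_gt0 // divr_gt0.
move=> a b hc kap kap0 kap1 rho rhop hrho x0.
(* The small tent, of radius at most [D rho], lives in [q <= ro^2/2], where [bth <= 1/2] and the
   profile is superharmonic to leading order. *)
pose ro := 2*nu*D*rho.
have ro0: 0 < ro by rewrite !mulr_gt0.
have ro2: 0 < ro^+2 by exact: exprn_gt0.
have rot: ro <= t2^+2.
 have := ler_wpM2l (ltW (mulr_gt0 (mulr_gt0 (ltr0n R 2) nu0) D0)) hrho.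
 rewrite -/ro /rho0 (_ : 2*nu*D*(t2^+2/(2*nu*D)) = t2^+2) //; fieldp.
have ro4: ro^+2 <= t2^+4 by rewrite (_ : t2^+4 = (t2^+2)^+2); [apply: lerXn2r; rewrite ?nnegrE ?exprn_ge0 // ltW|ring].
have rq: ro^+2 <= q1 by exact: le_trans t24.
have [Psi [G [H [[hC2 sPsi Pout Pge Ple] [Pfar hfar hnear]]]]] :=
 bar_test hc x0 kap d0 nu1 be0 K0 ro0 rq q16 (or_introl erefl : 1 = 1 :> R \/ 1 = -1 :> R).
pose q (x : 'rV[R]_d) := Qf a x0 (x - x0).
have qge x: 0 <= q x := Qf_ge0 hc _ _.
have key x: c/rho^+d*tent rho x0 x + - C2'*tent r x0 x <=
  gen a b kap (fun x=> Psi (q x)) G H x + 0.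
 rewrite addr0.
 have te0 := tent_ge0 rho x0 x; have te1 := tent_ge0 r x0 x; have te2 := tent_le1 x0 x rhop.
 have Crr: 0 <= C2'*tent r x0 x by rewrite mulr_ge0 // ltW.
 have kP: 0 <= kap*Psi (q x) by rewrite mulr_ge0 ?Pge // ltW.
 have tin: tent rho x0 x != 0 -> q x <= ro^+2/2.
  move=> hne; have h1 := tent_near rhop hne.
  apply: (@Qf_far R d nu be K a b hc x0 (x - x0) (D*rho))=> //; first by rewrite mulr_ge0 // ltW.
  rewrite (_ : ro^+2/2 = 2*nu*(nu*(D*rho)^+2)); last by rewrite /ro; field.
  by rewrite ler_peMl //; [rewrite mulr_ge0 ?sqr_ge0 // ltW|lra].
 have [hq|hq] := ltP q1 (q x).
  have tz: tent rho x0 x = 0.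
   by apply/eqP; apply/negPn/negP=> /tin h; move: hq; apply/negP; rewrite -leNgt; clear -h rq ro2; lra.
  by rewrite (hfar x hq) -/(q x) tz mulr0 add0r; clear -Crr kP; lra.
 have /= herr := hnear x hq; rewrite -/(q x) in herr; set Y := _ - kap*_ in herr.
 have -> : gen a b kap (fun x=> Psi (q x)) G H x = kap*Psi (q x) + Y by rewrite /Y; ring.
 have A0 := bA_gt0 d ro (q x); have tt0 := bt_gt0 ro (q x); have /andP[u0 u1] := bu01 ro0 rq q16 (qge x).
 have /andP[th0 th1] := bth01 ro0 rq q16 (qge x).
 have tl: bt ro (q x) <= 2^-1 by apply: (bt_le ro0 rq q16 (qge x) hq).
 have uE := bu_in ro0 rq q16 hq.
 have qq: 0 <= q x/q1 by rewrite divr_ge0 // ltW.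
 have q2Y := bY_q2 ro0 rq q16 (q x).
 rewrite -(bt4 ro0 rq q16) in q2Y.
 have AE := bA_t d ro0 rq q16 (q x).
 have Age := @bA_ge R d ro q1 ro0 rq q16 (q x).
 have thin := @bth_in R ro q1 ro0 rq q16 (q x) (qge x).
 have t4E := bt4 ro0 rq q16 (q x).
 set A := bA d ro (q x) in herr A0 AE Age; set t := bt ro (q x) in herr tt0 tl q2Y AE t4E; set th := bth ro (q x) in herr th0 th1 thin.
 set u := bu q1 (q x) in herr u0 u1 uE; set v := q x/q1 in herr uE qq.
 have Au0: 0 <= A*u by rewrite mulr_ge0 // ltW.
 have [_ X1] := normB_le herr; rewrite -/C [C*t^+2*(A*u)]mulrC -mulrBr in X1.
 have v1: v <= 1 by rewrite /v ler_pdivrMr // mul1r.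
 have [ht|ht] := leP t t2.
  have Ct: C*t^+2 <= t/8.
   by apply: (le_trans (small_t2 C0 (ltW tt0) ht t2a)); rewrite lerBlDr lerDl sqr_ge0.
  have t3: v <= t/64.
   rewrite /v ler_pdivrMr //; apply: (le_trans q2Y).
   have h1: t^+4 <= t*t2.
    rewrite exprS; apply: ler_wpM2l; first exact: ltW.
    have tt1: t <= 1 := le_trans ht t21.
    by apply: le_trans ht; rewrite exprS ler_piMr ?(ltW tt0) //; apply: exprn_ile1=> //; exact: ltW.
   by have := ler_wpM2l (ltW tt0) t2b; clear -h1; lra.
  have u12: 1/2 <= u by clear -t3 uE tl; lra.
  have e3: A*u*(D*(1 - th)/2) <= Y.
   by apply: le_trans X1; apply: ler_wpM2l=> //; apply: up_in=> //; exact: ltW.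
  have Dth: 0 <= D*(1 - th) by rewrite mulr_ge0 // subr_ge0.
  have e4: A*(1/2)*(D*(1 - th)/2) <= Y.
   apply: le_trans e3; apply: ler_wpM2r; first by rewrite divr_ge0.
   by apply: ler_wpM2l=> //; exact: ltW.
  have [tz|tnz] := eqVneq (tent rho x0 x) 0.
   have e5: 0 <= A*(1/2)*(D*(1 - th)/2) by rewrite mulr_ge0 ?divr_ge0 // mulr_ge0 ?divr_ge0 // ltW.
   by rewrite tz mulr0 add0r; clear -e4 e5 kP Crr; lra.
  have [th2 Yr] := thin (tin tnz).
  have e5: 8^-1*(ro^-1)^+d <= A*(1/2)*(D*(1 - th)/2).
   have h1: 1*(1/2) <= D*(1 - th) by apply: ler_pM=> //; clear -th2; lra.
   have h2 := Age Yr.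
   have : ro^-1^+d*(1*(1/2)) <= A*(D*(1 - th)) by apply: ler_pM=> //; rewrite ?exprn_ge0 ?invr_ge0 ?(ltW ro0) // mul1r divr_ge0.
   by clear; lra.
  have e6: c/rho^+d = 8^-1*(ro^-1)^+d.
   rewrite /c /ro invfM -exprVn [in RHS]invfM exprMn -exprVn; ring.
  have e7: c/rho^+d*tent rho x0 x <= c/rho^+d.
   by rewrite ler_piMr // divr_ge0 ?exprn_ge0 ?(ltW rhop) ?(ltW c0).
  by rewrite e6 in e7 *; clear -e4 e5 e7 kP Crr; lra.
 have tz: tent rho x0 x = 0.
  apply/eqP; apply/negPn/negP=> /tin /thin [_ h]; move: ht; apply/negP; rewrite -leNgt.
  by rewrite -(@ler_pXn2r _ 4) ?nnegrE ?(ltW tt0) ?(ltW t20) // t4E; exact: le_trans ro4.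
 have Al: A <= t2^-1^+(2*d).
  rewrite AE; apply: lerXn2r; rewrite ?nnegrE ?invr_ge0 ?(ltW tt0) ?(ltW t20) // lef_pV2 ?posrE //; exact: ltW.
 have h1: - (t2^-1^+(2*d)*(8 + C)) <= Y.
  apply: le_trans X1; apply: (le_via (A*u*(- (8 + C)))); last first.
   by apply: ler_wpM2l=> //; apply: up_out=> //; exact: ltW.
  rewrite mulrN lerN2; apply: ler_wpM2r; first by rewrite addr_ge0.
  by rewrite -[X in _ <= X]mulr1; apply: ler_pM=> //; exact: ltW.
 have h2: 2^-1^+d <= tent r x0 x.
  by apply: tent_ge=> //; apply: (Qf_near hc (x0 := x0) nu1)=> //; rewrite divr_ge0 // ltW.
 have h3: t2^-1^+(2*d)*(8 + C) <= C2'*tent r x0 x.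
  have := ler_wpM2l (ltW C20) h2; apply: le_trans; apply: eqle.
  have e: 2^+d*2^-1^+d = 1 :> R by rewrite -exprMn mulfV ?expr1n // pnatr_eq0.
  by rewrite /C2' -[X in _ = X]mulrA e mulr1.
 by rewrite tz mulr0 add0r; clear -h1 h3 kP; lra.
have bf: bdd (fun x=> c/rho^+d*tent rho x0 x + - C2'*tent r x0 x).
 by apply: bdd_add; apply: bdd_scale; exact: tent_bdd.
have := U_le hc kap0 bf (lexx 0) hC2 sPsi key.
rewrite mul0r addr0 (U_tent2 hc) // => hU.
have rd: 0 < rho^+d by exact: exprn_gt0.
have Ur0: 0 <= UU a b kap (tent r x0) by apply: (U_ge0 hc kap0); [exact: tent_bdd|move=> x; exact: tent_ge0].
have hU2: UU a b kap (tent rho x0) <= C2'/c*rho^+d*UU a b kap (tent r x0) + rho^+d/c*Psi (q 0).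
 have := ler_wpM2l (ltW (divr_gt0 rd c0)) hU.
 rewrite (_ : rho^+d/c*(c/rho^+d*UU a b kap (tent rho x0) + - C2'*UU a b kap (tent r x0)) =
   UU a b kap (tent rho x0) - C2'/c*rho^+d*UU a b kap (tent r x0)); last by fieldp.
 by rewrite lerBlDl.
apply: (le_trans hU2); apply: lerD.
 apply: ler_wpM2r=> //; apply: ler_wpM2r; first exact: ltW.
 by rewrite lerDl divr_ge0 // ltW.
have [h1|h1] := leP 1 (enorm x0).
 rewrite Pout ?mulr0 //; apply: (le_trans _ (Qf_ge hc x0 (0 - x0))).
 rewrite sub0r enormN /q1 mulrC; apply: ler_wpM2l; first by rewrite invr_ge0 ltW.
 apply: (le_via 1); last exact: exprn_ege1.
 by rewrite exprn_ile1 ?divr_ge0 ?(ltW r0) //; lra.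
apply: (le_via (rho^+d/c*(3*(2/ro)^+d))).
 by apply: ler_wpM2l; [rewrite divr_ge0 // ltW|exact: Ple].
rewrite (_ : rho^+d/c*(3*(2/ro)^+d) = C3'/c); first by rewrite lerDr divr_ge0 // ltW.
rewrite (_ : 2/ro = (nu*D)^-1/rho); last by rewrite /ro; fieldp.
rewrite /C3' exprMn [rho^-1^+d]exprVn; set e := (nu*D)^-1^+d.
by fieldp.
Qed.

(** * Uniform continuity and the partition of unity by tents *)

Section UnifCont.
Variables (R : realType) (d : nat).
Local Notation V := 'rV[R]_d.
Lemma enorm_nbhs (x : V) (c : R) : 0 < c -> nbhs x [set x' : V | enorm (x' - x) < c].
Proof.
move=> c0.
have cg: cont (fun x' : V=> enorm (x' - x)).
 apply: (@cont_lip R d _ 1)=> y z; rewrite mul1r; apply: (le_trans (enorm_dist _ _)).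
 by rewrite opprB addrA subrK.
have h: continuous (fun x' : V=> enorm (x' - x)) := cont_continuous cg.
apply: (h x [set t : R | t < c]).
apply/nbhs_ballP; exists c=> //= t; rewrite /ball /= /ball_ subrr enorm0 sub0r normrN=> ht.
exact: le_lt_trans (ler_norm t) ht.
Qed.
Lemma unif_cont (f : V -> R) : cont f -> bsupp f -> forall e, 0 < e ->
 exists2 dl : R, 0 < dl & forall x y, enorm (x - y) < dl -> `|f x - f y| <= e.
Proof.
move=> cf [M hM] e e0.
have [B cB inB] := ball_compact d M.
pose P (dl : R) (x : V) := forall y, enorm (y - x) < dl -> `|f x - f y| <= e.
have /compact_near_coveringP hcov := cB.
have : \forall dl \near (0 : R)^'+, B `<=` P dl.
 apply: hcov=> x _; have [dl dl0 hd] := cf x (e/2) ltac:(lra).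
 have d2: 0 < dl/2 by lra.
 exists ([set x' : V | enorm (x' - x) < dl/2], [set t : R | t < dl/2])=> /=.
  by split; [exact: enorm_nbhs|exact: nbhs_right_lt].
 move=> [x' t] [/= h1 h2] y hy.
 have a1 := hd x' (lt_trans h1 (ltac:(lra) : dl/2 < dl)).
 have a2: `|f y - f x| <= e/2 by apply: hd; apply: (le_lt_trans (enorm_tri y x' x)); lra.
 have -> : f x' - f y = (f x' - f x) - (f y - f x) by ring.
 by apply: normBt; lra.
move=> hnear.
have [dl [dl0 hdl]] : exists dl : R, 0 < dl /\ B `<=` P dl.
 by near (0 : R)^'+ => t; exists t; split; near: t=> //; exact: nbhs_right_gt.
exists dl=> // x y hxy.
have [hx|hx] := leP (enorm x) M; first by apply: hdl; [exact: inB|rewrite enormB].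
have [hy|hy] := leP (enorm y) M; first by rewrite distrC; apply: hdl; first exact: inB.
by rewrite !hM // subrr normr0 ltW.
Unshelve. all: by end_near. Qed.
End UnifCont.

Section Pou.
Variable R : realType.
Definition clamp (s : R) : R := min (max s 0) 1.
(** A hat is a difference of two consecutive ramps, so sums of translated hats telescope. *)
Lemma hat_clamp (s : R) : max (1 - `|s|) 0 = clamp (s + 1) - clamp s.
Proof.
rewrite /clamp; have [h|h] := leP 0 s; rewrite ?(ger0_norm h) ?(ltr0_norm h).
 have [h1|h1] := leP s 1; rewrite ?(max_l h) ?(max_l (_ : 0 <= s + 1)) ?(min_r (_ : 1 <= s + 1)); try lra.
  by rewrite max_l ?min_l //; lra.
 by rewrite max_r ?(min_r (ltW h1)) ?subrr //; lra.
have [h1|h1] := leP (-1) s.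
 rewrite max_l; last lra.
 rewrite (max_l (_ : 0 <= s + 1)) ?(min_l (_ : s + 1 <= 1)) ?(max_r (ltW h)) ?(min_l (_ : 0 <= 1)) //; lra.
by rewrite max_r ?(max_r (_ : s + 1 <= 0)) ?(max_r (ltW h)) ?subrr //; lra.
Qed.
Lemma clamp01 s : 0 <= clamp s <= 1.
Proof. by rewrite /clamp le_min le_max lexx orbT ler01 /= ge_min lexx orbT. Qed.
Lemma hat_sum (n : nat) (y : R) : \sum_(j < n) max (1 - `|y - j%:R|) 0 = clamp (y + 1) - clamp (y + 1 - n%:R).
Proof.
elim: n=> [|n IH]; first by rewrite big_ord0 subr0 subrr.
rewrite big_ord_recr /= IH hat_clamp -natr1.
have -> : y - n%:R + 1 = y + 1 - n%:R by ring.
have -> : y + 1 - (n%:R + 1) = y - n%:R by ring.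
ring.
Qed.

Variable d : nat.
Local Notation V := 'rV[R]_d.
Local Notation I n := {ffun 'I_d -> 'I_n}.
Lemma tent_grid (p n : nat) (c : R) (k : I n) (x : V) : (0 < p)%N ->
 tent (p%:R^-1) (gpt p c k) x = \prod_i max (1 - `|(x 0 i + c) * p%:R - (k i)%:R|) 0.
Proof.
move=> p0; have pp: 0 < p%:R :> R by rewrite ltr0n.
apply: eq_bigr=> i _; rewrite mxE invrK; congr (max (1 - _) 0).
rewrite -[X in _*X = _](ger0_norm (ltW pp)) -normrM; congr `|_|; field; by rewrite gt_eqF.
Qed.
Lemma pou (p n : nat) (c : R) (x : V) : (0 < p)%N ->
 \sum_k tent (p%:R^-1) (@gpt R d p n c k) x = \prod_i (clamp ((x 0 i + c) * p%:R + 1) - clamp ((x 0 i + c) * p%:R + 1 - n%:R)).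
Proof.
move=> p0.
rewrite (eq_bigr (fun k : I n=> \prod_i max (1 - `|(x 0 i + c) * p%:R - (k i)%:R|) 0)); last by move=> k _; exact: tent_grid.
rewrite -(bigA_distr_bigA (fun i (j : 'I_n)=> max (1 - `|(x 0 i + c) * p%:R - j%:R|) 0)).
by apply: eq_bigr=> i _; rewrite hat_sum.
Qed.
Lemma pou_le1 (p n : nat) (c : R) (x : V) : (0 < p)%N -> \sum_k tent (p%:R^-1) (@gpt R d p n c k) x <= 1.
Proof.
move=> p0; rewrite pou //; apply: prodr_ile1=> i _; rewrite -hat_sum; apply/andP; split.
 by apply: sumr_ge0=> j _; rewrite le_max lexx orbT.
by rewrite hat_sum; have := clamp01 ((x 0 i + c) * p%:R + 1); have := clamp01 ((x 0 i + c) * p%:R + 1 - n%:R); lra.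
Qed.
Lemma pou_eq1 (p c : nat) (x : V) : (0 < p)%N -> enorm x <= c%:R ->
 \sum_k tent (p%:R^-1) (@gpt R d p (2*c * p).+1 c%:R k) x = 1.
Proof.
move=> p0 hx; have pp: 0 < p%:R :> R by rewrite ltr0n.
rewrite pou // big1 // => i _.
have := le_trans (coord_le x i) hx; rewrite ler_norml=> /andP[h1 h2].
have a1: 0 <= (x 0 i + c%:R) * p%:R by apply: mulr_ge0; [lra|exact: ltW].
have a2: (x 0 i + c%:R) * p%:R <= 2*c%:R * p%:R by apply: ler_wpM2r; [exact: ltW|lra].
rewrite /clamp -natr1 !natrM (max_l (_ : 0 <= (x 0 i + c%:R) * p%:R + 1)) ?(min_r (_ : 1 <= (x 0 i + c%:R) * p%:R + 1)); try lra.
by rewrite max_r ?(min_l ler01) ?subr0 //; lra.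
Qed.
(** Multilinear interpolation at the grid points. It reduces [U f] to finite combinations of [U] of
    tents, the only functions for which Harnack bounds are proved. *)
Lemma approx_grid (f : V -> R) (M : R) : cont f -> (forall y, M < enorm y -> f y = 0) -> forall w, 0 < w ->
 exists2 p0 : nat, (0 < p0)%N & forall p c : nat, (p0 <= p)%N -> M <= c%:R -> forall x,
  `|f x - \sum_k f (@gpt R d p (2*c * p).+1 c%:R k)*tent (p%:R^-1) (gpt p c%:R k) x| <= w.
Proof.
move=> cf hM w w0; have [dl dl0 hd] := unif_cont cf (ex_intro _ M hM) w0.
have [p0 p00 hp0] := nat_ge (2*d.+1%:R/dl).
exists p0=> // p c hp hc x.
have pp: (0 < p)%N by exact: leq_trans hp.
have pR: 0 < p%:R :> R by rewrite ltr0n.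
have rp: 0 < p%:R^-1 :> R by rewrite invr_gt0.
pose S := \sum_(k : I (2*c * p).+1) tent p%:R^-1 (gpt p c%:R k) x.
have fS: f x = f x*S.
 have [h|h] := leP (enorm x) M; last by rewrite hM // mul0r.
 by rewrite /S pou_eq1 ?mulr1 //; exact: le_trans hc.
rewrite [X in `|X - _|]fS /S mulr_sumr -sumrB; apply: normst.
apply: (le_via (\sum_(k : I (2*c * p).+1) w*tent p%:R^-1 (gpt p c%:R k) x)); last first.
 by rewrite -mulr_sumr -[X in _ <= X]mulr1; apply: ler_wpM2l; [exact: ltW|exact: pou_le1].
apply: ler_sum=> k _; rewrite -mulrBl normrM [`|tent _ _ _|]ger0_norm ?tent_ge0 //.
have [->|hne] := eqVneq (tent p%:R^-1 (gpt p c%:R k) x) 0; first by rewrite !mulr0.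
apply: ler_wpM2r; first exact: tent_ge0.
apply: hd; apply: (le_lt_trans (tent_near rp hne)).
rewrite -ltr_pdivlMr ?invrK ?invr_gt0 //.
have : p0%:R <= p%:R :> R by rewrite ler_nat.
move=> h; have h2 := le_trans hp0 h; rewrite ler_pdivrMr // in h2.
by have := ltr0n R d.+1; rewrite -natr1 in h2 *; have := ler0n R d; nra.
Qed.
End Pou.

(** * A bump and a concave truncation *)

Section Bump.
Variables (R : realType) (d : nat).
Local Notation V := 'rV[R]_d.
Lemma is_derive_pos3 (s c t : R) : is_derive t 1 (fun t=> (max (s*t + c) 0)^+3) (3*s*(max (s*t + c) 0)^+2).
Proof.
have := isd_mul (isd_aff s c t) (is_derive_pos2_aff s c t).
move=> H; apply: isd_ext H _ _=> [z|].
 by have [h|h] := leP 0 (s*z + c); [rewrite ?max_l //; ring|rewrite ?max_r ?(ltW h) // !expr0n mulr0].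
by have [h|h] := leP 0 (s*t + c); [rewrite ?max_l //; ring|rewrite ?max_r ?(ltW h) // !expr0n !mulr0 addr0].
Qed.
(** The function [(1 - |x - x0|^2)_+^3]. Its absolute derivative bounds give local strict
    comparisons at any point. *)
Lemma bump_ex (x0 : V) : exists ch G H, [/\ C2 ch G H, (forall x : V, 0 <= ch x <= 1), ch x0 = 1,
 (forall x, 1 <= enorm (x - x0) -> ch x = 0) & forall x, (forall i, `|G x 0 i| <= 6) /\ (forall i j, `|H x i j| <= 30)].
Proof.
pose h (t : R) := (max ((-1)*t + 1) 0)^+3.
pose h1 (t : R) := 3*(-1)*(max ((-1)*t + 1) 0)^+2.
pose h2 (t : R) := 3*(-1)*(2*(-1) * max ((-1)*t + 1) 0).
have d1 (t : R) : is_derive t 1 h (h1 t) by exact: is_derive_pos3.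
have d2 (t : R) : is_derive t 1 h1 (h2 t) by apply: isd_scale; exact: is_derive_pos2_aff.
have c2: continuous h2 by apply: cts_mul; [exact: cts_cst|apply: cts_mul; [exact: cts_cst|exact: maxr_cont]].
have As: (1%:M : 'M[R]_d)^T = 1%:M by rewrite tr_scalar_mx.
have hq := C2_quad x0 As.
pose q (y : V) := dotv (y - x0) ((y - x0) *m 1%:M).
have qE y: q y = enorm (y - x0)^+2 by rewrite /q mulmx1 enorm_sqr.
have hC := @C2_comp _ _ h h1 h2 q _ _ (fun y=> d1 _) (fun y=> d2 _) (fun y=> c2 (q y)) hq.
have m01 y: 0 <= max ((-1)*q y + 1) 0 <= 1.
 rewrite le_max lexx orbT /= ge_max ler01 andbT qE; have := sqr_ge0 (enorm (y - x0)); lra.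
have out y: 1 <= enorm (y - x0) -> max ((-1)*q y + 1) 0 = 0.
 by move=> hy; rewrite max_r // qE; have := exprn_ege1 2 hy; lra.
do 3 eexists; split; first exact: hC.
- by move=> x; have /andP[a b] := m01 x; rewrite /h exprn_ge0 //= exprn_ile1.
- by rewrite /h -/(q x0) qE subrr enorm0 expr0n mulr0 add0r max_l ?ler01 // expr1n.
- by move=> x hx; rewrite /h -/(q x) out // expr0n.
move=> x /=; rewrite -/(q x) mulmx1.
have /andP[a b] := m01 x.
have [hx|/ltW hx] := leP 1 (enorm (x - x0)).
 split=> [i|i j]; rewrite !mxE /h2 /h1 out // ?expr0n /= ?mulr0 !mul0r ?addr0 normr0 //.
have zi i: `|(x - x0) 0 i| <= 1 by apply: le_trans (coord_le _ _) hx.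
set m := max _ _ in a b *.
have m2: 0 <= m^+2 <= 1 by rewrite sqr_ge0 exprn_ile1.
have h1b: `|h1 (q x)| <= 3 by rewrite /h1 -/m ler_norml; lra.
have h2b: `|h2 (q x)| <= 6 by rewrite /h2 -/m ler_norml; lra.
have g2 i: `|(2 *: (x - x0)) 0 i| <= 2.
 by rewrite mxE normrM [`|2|]ger0_norm // -[X in _ <= X]mulr1; apply: ler_wpM2l.
split=> [i|i j].
 by rewrite mxE normrM (_ : 6 = 3*2); [exact: ler_pM|ring].
rewrite mxE; apply: normDt; rewrite (_ : 30 = 6*(2*2) + 3*2); last by ring.
apply: lerD; rewrite normrM; apply: ler_pM=> //; first by rewrite normrM; exact: ler_pM.
by rewrite !mxE normrM ger0_norm // -[X in _ <= X]mulr1; apply: ler_wpM2l=> //; case: eqP=> _; rewrite ?normr1 ?normr0.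
Qed.
End Bump.

Section Theta.
Variable R : realType.
(** A concave function, the identity up to [t0] and constant from [t1] on, with derivative
    [b^2/(a^2 + b^2)] for the two one-sided ramps. The inequality [t T1 t <= Th t] is concavity, and
    it keeps the term [kap Th (u)] on the good side. *)
Lemma theta_ex (t0 t1 : R) : 0 < t0 -> t0 < t1 -> exists Th T1 T2 : R -> R,
 [/\ (forall t : R, -2 < t -> is_derive t 1 Th (T1 t)), (forall t : R, is_derive t 1 T1 (T2 t)), continuous T2,
   [/\ forall t, 0 <= T1 t <= 1, (forall t, T2 t <= 0), (forall t, t <= t0 -> T1 t = 1 /\ T2 t = 0) & (forall t, t1 <= t -> T1 t = 0 /\ T2 t = 0)] &
   [/\ forall t, -2 < t -> t <= t0 -> Th t = t, (forall t, t1 <= t -> Th t = Th t1 /\ t0 <= Th t) , (forall t, 0 <= t -> t*T1 t <= Th t) & forall t, 0 <= t -> Th t <= t]].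
Proof.
move=> t00 t01.
pose a2 (t : R) := (max (1*t + - t0) 0)^+2; pose b2 (t : R) := (max ((-1)*t + t1) 0)^+2.
pose a (t : R) := max (1*t + - t0) 0; pose b (t : R) := max ((-1)*t + t1) 0.
have ages t: 0 <= a t by rewrite le_max lexx orbT.
have bges t: 0 <= b t by rewrite le_max lexx orbT.
have S0 t: 0 < a2 t + b2 t.
 have [h|h] := leP t t0.
  apply: ltr_wpDl; first exact: sqr_ge0.
  by rewrite /b2 max_l ?exprn_gt0 //; lra.
 apply: ltr_pwDl; last exact: sqr_ge0.
 by rewrite /a2 max_l ?exprn_gt0 //; lra.
pose T1 t := b2 t*(a2 t + b2 t)^-1.
pose T2 t := - (2*(a t*b t*(a t + b t))*((a2 t + b2 t)^+2)^-1).
have da (t : R) : is_derive t 1 a2 (2*1*a t) by exact: is_derive_pos2_aff.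
have db (t : R) : is_derive t 1 b2 (2*(-1)*b t) by exact: is_derive_pos2_aff.
have d2 (t : R) : is_derive t 1 T1 (T2 t).
 have := isd_mul (db t) (@isd_comp R (fun z=> z^-1) (fun t=> a2 t + b2 t) t _ _ (isd_inv (lt0r_neq0 (S0 t))) (isd_add (da t) (db t))).
 move=> Hd; apply: isd_ext Hd _ _=> // ; rewrite /T2.
 have Sn := lt0r_neq0 (S0 t); move: Sn; rewrite /a2 /b2 -/(a t) -/(b t)=> Sn; field; exact: Sn.
have ca: continuous a by exact: maxr_cont.
have cb: continuous b by exact: maxr_cont.
have c2: continuous T2.
 have cS: continuous (fun t=> ((a2 t + b2 t)^+2)^-1).
  have dS (t : R) := isd_mul (isd_add (da t) (db t)) (isd_add (da t) (db t)).
  have n0 (t : R) : (a2 t + b2 t)*(a2 t + b2 t) != 0 by rewrite mulf_neq0 // lt0r_neq0.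
  have dI (t : R) := @isd_comp R (fun z=> z^-1) (fun t=> (a2 t + b2 t)*(a2 t + b2 t)) t _ _ (isd_inv (n0 t)) (dS t).
  by move=> t; apply: is_derive_cont; exact: dI.
 by apply: cts_opp; apply: cts_mul=> //; apply: cts_mul; [exact: cts_cst|apply: cts_mul; [exact: cts_mul|exact: cts_add]].
have c1: continuous T1 by move=> t; exact: is_derive_cont (d2 t).
have T101 t: 0 <= T1 t <= 1.
 rewrite /T1 divr_ge0 ?sqr_ge0 ?(ltW (S0 t)) //= ler_pdivrMr // mul1r lerDr sqr_ge0 //.
have T2n t: T2 t <= 0.
 rewrite oppr_le0; have h1 := ages t; have h2 := bges t; have h3 := ltW (S0 t); pos.
have Tl t: t <= t0 -> T1 t = 1 /\ T2 t = 0.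
 move=> h; have a0: a t = 0 by rewrite /a max_r //; lra.
 have a20: a2 t = 0 by rewrite /a2 -/(a t) a0 expr0n.
 have := S0 t; rewrite a20 add0r=> bp.
 by rewrite /T1 /T2 a20 add0r a0 !mul0r mulr0 mul0r oppr0 divff // gt_eqF.
have Tr t: t1 <= t -> T1 t = 0 /\ T2 t = 0.
 move=> h; have b0: b t = 0 by rewrite /b max_r //; lra.
 have b20: b2 t = 0 by rewrite /b2 -/(b t) b0 expr0n.
 by rewrite /T1 /T2 b20 b0 mul0r mulr0 mul0r mulr0 mul0r oppr0.
have [P hP] := primitive_ex (-2) c1.
pose Th t := P t - P 0.
have d1 (t : R) : -2 < t -> is_derive t 1 Th (T1 t).
 by move=> h; apply: isd_ext (isd_add (hP t h) (isd_cst (- P 0) t)) _ _=> //; rewrite addr0.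
have Thl t: -2 < t -> t <= t0 -> Th t = t.
 move=> h1 h2.
 have key s: -2 < s -> s <= t0 -> (Th t0 - t0) = (Th s - s).
  move=> hs1 hs2; apply/esym; apply: (@derive_const _ (fun z=> Th z - z) s t0 hs2)=> z /andP[z1 z2].
  have := isd_add (d1 z (lt_le_trans hs1 z1)) (isd_opp (isd_id z)).
  by have [-> _] := Tl z z2; rewrite subrr.
 have := key t h1 h2; rewrite (key 0 ltac:(lra) (ltW t00)) {1}/Th subrr subr0=> e.
 by move: e=> /esym/eqP; rewrite subr_eq0=> /eqP.
have mono s t: -2 < s -> s <= t -> Th s <= Th t.
 move=> hs st; apply: (derive_mono st)=> z /andP[z1 z2]; first by apply: d1; exact: lt_le_trans z1.
 by have /andP[] := T101 z.
have t1p: -2 < t1 by lra.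
exists Th, T1, T2; split=> //; split=> //.
- move=> t h; split; last by rewrite -{1}(Thl t0); [apply: mono; lra|lra|].
 apply/esym; apply: (derive_const h)=> z /andP[z1 z2].
 by have := d1 z (lt_le_trans t1p z1); have [-> _] := Tr z z1.
- move=> t h.
 have := @derive_mono _ (fun z=> Th z - z*T1 z) (fun z=> - z*T2 z) 0 t h.
 rewrite mul0r (_ : Th 0 = 0) ?subrr ?subr_ge0; last by rewrite /Th subrr.
 apply=> z /andP[z1 z2].
  by apply: isd_ext (isd_add (d1 z _) (isd_opp (isd_mul (isd_id z) (d2 z)))) _ _=> //; [lra|ring].
 by rewrite mulNr -mulrN mulr_ge0 // oppr_ge0.
- move=> t h.
 have := @derive_mono _ (fun z=> z - Th z) (fun z=> 1 - T1 z) 0 t h.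
 rewrite (_ : Th 0 = 0) ?subrr ?subr_ge0; last by rewrite /Th subrr.
 apply=> z /andP[z1 z2]; first by apply: isd_add (isd_id z) (isd_opp (d1 z _)); lra.
 by have := T101 z; lra.
Qed.
End Theta.

(** * Approximate equilibrium potentials *)

Section Equil.
Variables (R : realType) (d : nat).
Local Notation V := 'rV[R]_d.
Variables (nu be K : R).
Lemma mp_le1 a b (hc : coefs nu be K a b) (kap : R) (W : V -> R) phi G H : 0 < kap -> (forall x, 0 <= W x) ->
 C2 phi G H -> bsupp phi -> (forall x, (kap + W x) * phi x - LL a b G H x <= kap + W x) -> forall x, phi x <= 1.
Proof.
move=> k0 W0 hp sp h x; rewrite leNgt; apply/negP=> hx.
have [h1 _ _] := hp.
have hm := C2_scale (-1) hp.
have [y hy] : exists y, forall z, -1 * phi y <= -1 * phi z.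
 apply: (@bsupp_min R d (fun z=> -1 * phi z)).
 - by have [c _ _] := hm; exact: D1_cont c.
 - exact: bsupp_mulr.
 - by exists x; lra.
have L0 := LL_min_ge0 hc hm hy; rewrite LL_scale in L0.
have hy': 1 < phi y by have := hy x; lra.
have := h y; have : 0 < kap + W y by have := W0 y; lra.
nra.
Qed.

(* [Th] flattens the approximate equilibrium potential [u] of the ball, so that its charge lives in a bounded
   annulus and does not see the coefficients inside the ball. *)
Lemma equilibrium a b a' b' (hc : coefs nu be K a b) (kap r : R) (c : V) : 0 < kap -> kap <= 1 -> 0 <= r ->
 (forall x, r < enorm (x - c) -> a x = a' x /\ b x = b' x) -> forall eps, 0 < eps ->
 exists psi G H, [/\ C2 psi G H, bsupp psi, (forall x, gen a b kap psi G H x = gen a' b' kap psi G H x) &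
  [/\ forall x, - eps <= gen a b kap psi G H x, (forall x, r + 3 < enorm (x - c) -> `|gen a b kap psi G H x| <= eps),
    (forall x, enorm (x - c) <= r -> kap/2 <= gen a b kap psi G H x <= kap) & (forall x, enorm (x - c) <= r -> 1/2 <= psi x <= 1)]].
Proof.
move=> k0 k1 r0 hag eps e0.
have nu0: 0 <= nu by have := c_nu hc; lra.
have be0 := c_be hc.
pose Cb : R := d%:R*(d%:R*(nu*30)) + d%:R*(be*6).
have Cb0: 0 <= Cb by rewrite /Cb; pos.
pose eta := kap/(4*(kap + Cb)).
have kC: 0 < kap + Cb by lra.
have eta0: 0 < eta by rewrite divr_gt0 ?mulr_gt0.
have etaE: eta*(kap + Cb) = kap/4 by rewrite /eta; fieldp.
have eta1: eta <= 1/4 by rewrite /eta ler_pdivrMr ?mulr_gt0 //; lra.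
pose ep := min (eps/2) (kap*eta/16).
have ep0: 0 < ep by rewrite lt_min; apply/andP; split; [lra|ppos].
have epe: ep <= eps/2 by rewrite ge_min lexx.
have epk: ep <= kap*eta/16 by rewrite ge_min lexx orbT.
have epk': ep/kap <= eta/16.
 by rewrite ler_pdivrMr //; lra.
have ep4: ep <= kap/4 by have := ler_wpM2l (ltW k0) eta1; lra.
(* A killing rate large enough to push [u] above [1 - eta/2] wherever the bump fits into the set
   [Vb = 1]. *)
pose N := 8*(kap + Cb + 1)/eta.
have N0: 0 < N by apply: divr_gt0=> //; apply: mulr_gt0=> //; lra.
pose Vb (x : V) := max (1 - max (enorm (x - c) - (r + 1)) 0) 0.
have V01 x: 0 <= Vb x <= 1.
 rewrite le_max lexx orbT /= ge_max ler01 andbT lerBlDr lerDl le_max lexx orbT //.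
have Vin x: enorm (x - c) <= r + 1 -> Vb x = 1.
 by move=> h; rewrite /Vb (max_r (_ : enorm (x - c) - (r + 1) <= 0)) ?subr0 ?max_l ?ler01 //; lra.
have Vout x: r + 2 <= enorm (x - c) -> Vb x = 0.
 by move=> h; rewrite /Vb (max_l (_ : 0 <= enorm (x - c) - (r + 1))) ?max_r //; lra.
have lV: lips Vb.
 exists 1=> x y; rewrite mul1r; apply: (le_trans (maxr_lip _ _)).
 have -> : 1 - max (enorm (x - c) - (r + 1)) 0 - (1 - max (enorm (y - c) - (r + 1)) 0) =
  - (max (enorm (x - c) - (r + 1)) 0 - max (enorm (y - c) - (r + 1)) 0) by ring.
 rewrite normrN; apply: (le_trans (maxr_lip _ _)).
 have -> : enorm (x - c) - (r + 1) - (enorm (y - c) - (r + 1)) = enorm (x - c) - enorm (y - c) by ring.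
 by apply: (le_trans (enorm_dist _ _)); rewrite opprB addrA subrK.
pose W x := N*Vb x.
have W0 x: 0 <= W x by rewrite mulr_ge0 ?(ltW N0) //; have /andP[] := V01 x.
have lW: lips W by exact: lips_scale.
have bW: bdd W.
 by exists N=> x; rewrite ger0_norm // /W ler_piMr ?(ltW N0) //; have /andP[] := V01 x.
have sW: bsupp W.
 exists (enorm c + (r + 2))=> x hx; rewrite /W Vout ?mulr0 //.
 by have := enorm_tri0 x c; lra.
(* Up to [ep], [u] is the probability of being killed by the potential [W] before an independent
   exponential time of rate [kap]. *)
have [u [G [H [hu su hr]]]] := resolvent hc k0 W0 lW bW lW sW ep0.
have hr' x: W x - ep <= (kap + W x)*u x - LL a b G H x <= W x + ep by have := hr x; rewrite ler_norml; lra.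
have u1 x: u x <= 1.
 by apply: (mp_le1 hc k0 W0 hu su)=> y; have /andP[_] := hr' y; lra.
have u0 x: - (ep/kap) <= u x.
 by apply: (max_principle hc k0 (ltW ep0) W0 hu su)=> y; have /andP[+ _] := hr' y; have := W0 y; lra.
have um x: -2 < u x by have := u0 x; lra.
(* Far from the ball [W] vanishes on the support of the bump at [x], so [u + eta ch] still satisfies
   the inequality that keeps it below 1. *)
have uout x: r + 3 < enorm (x - c) -> u x <= 1 - eta.
 move=> hx; have [ch [Gc [Hc [hch ch01 chx chout chb]]]] := bump_ex x.
 have hs := C2_add hu (C2_scale eta hch).
 have sch: bsupp ch.
  exists (enorm x + 1)=> y hy; apply: chout; have := enorm_tri0 y x; lra.
 have ss := bsupp_lin eta su sch.
 suff : u x + eta*ch x <= 1 by rewrite chx; lra.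
 apply: (mp_le1 hc k0 W0 hs ss)=> y; rewrite LL_add LL_scale.
 have [b1 b2] := chb y; have bL := LL_bound hc b1 b2; rewrite -/Cb ler_norml in bL.
 have Wch: W y*ch y = 0.
  have [h1|h1] := leP 1 (enorm (y - x)); first by rewrite chout // mulr0.
  rewrite /W Vout ?mulr0 ?mul0r //.
  by have := enorm_tri x y c; rewrite (enormB x y); lra.
 have /andP[c0 c1] := ch01 y.
 have t1: eta*(kap*ch y - LL a b Gc Hc y) <= eta*(kap + Cb).
  apply: ler_wpM2l; first exact: ltW.
  have := ler_wpM2l (ltW k0) c1; case/andP: bL=> *; lra.
 have -> : (kap + W y)*(u y + eta*ch y) - (LL a b G H y + eta*LL a b Gc Hc y) =
   ((kap + W y)*u y - LL a b G H y) + eta*(kap*ch y - LL a b Gc Hc y) + eta*(W y*ch y) by ring.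
 by rewrite Wch mulr0 addr0; have /andP[_ h2] := hr' y; rewrite etaE in t1; lra.
(* Comparison from below with [1 - eta/4] times the bump at [x]; within distance 1 of [x] the large
   potential [N] outweighs all other terms. *)
have uin x: enorm (x - c) <= r -> 1 - eta/2 <= u x.
 move=> hx; have [ch [Gc [Hc [hch ch01 chx chout chb]]]] := bump_ex x.
 pose m := - (1 - eta/4).
 have hs := C2_add hu (C2_scale m hch).
 have sch: bsupp ch.
  exists (enorm x + 1)=> y hy; apply: chout; have := enorm_tri0 y x; lra.
 have ss := bsupp_lin m su sch.
 suff : - (ep/kap) <= u x + m*ch x by rewrite chx /m; lra.
 apply: (max_principle hc k0 (ltW ep0) W0 hs ss)=> y; rewrite LL_add LL_scale.
 have [b1 b2] := chb y; have bL := LL_bound hc b1 b2; rewrite -/Cb ler_norml in bL.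
 have /andP[c0 c1] := ch01 y; have /andP[h1 _] := hr' y.
 have -> : (kap + W y)*(u y + m*ch y) - (LL a b G H y + m*LL a b Gc Hc y) =
   ((kap + W y)*u y - LL a b G H y) + m*((kap + W y)*ch y - LL a b Gc Hc y) by ring.
 have [hy|hy] := leP 1 (enorm (y - x)).
  have z: ch y = 0 by exact: chout.
  have zout: forall z, 1 < enorm (z - x) -> ch z = 0 by move=> z' hz'; apply: chout; exact: ltW.
  have LLc: 0 <= LL a b Gc Hc y.
   by apply: (LL_min_ge0 hc hch)=> z'; rewrite z; have /andP[] := ch01 z'.
  have m0: m <= 0 by rewrite /m; lra.
  rewrite z mulr0 sub0r mulrN; have := mulr_le0_ge0 m0 LLc; have := W0 y; lra.
 have VE: W y = N by rewrite /W Vin ?mulr1 //; have := enorm_tri y x c; lra.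
 rewrite VE in h1 *.
 have t1: (kap + N)*ch y - LL a b Gc Hc y <= kap + N + Cb.
  have := ler_wpM2l (ltac:(lra) : 0 <= kap + N) c1; case/andP: bL=> *; lra.
 have t2: m*(kap + N + Cb) <= m*((kap + N)*ch y - LL a b Gc Hc y) by rewrite /m; nra.
 have NE: N*eta = 8*(kap + Cb + 1) by rewrite /N divfK // gt_eqF.
 have t3: - N <= m*(kap + N + Cb).
  rewrite /m; have : 0 <= eta*(kap + Cb) by rewrite mulr_ge0 ?(ltW eta0) ?(ltW kC).
  lra.
 by lra.
have t01: 0 < 1 - eta by lra.
have t12: 1 - eta < 1 - eta/2 by lra.
have [Th [T1 [T2 [dT dT1 cT2 [T101 T2n Tl Tr] [Thl Thr Thm Thle]]]]] := theta_ex t01 t12.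
have hpsi := @C2_comp _ _ Th T1 T2 u _ _ (fun y=> dT _ (um y)) (fun y=> dT1 _) (fun y=> cT2 (u y)) hu.
set GG := (fun y=> _ *: _) in hpsi; set HH := (fun y=> \matrix_(_, _) _) in hpsi.
have LLp x: LL a b GG HH x = T1 (u x)*LL a b G H x + T2 (u x)/2 * \sum_i \sum_j a x i j*(G x 0 j*G x 0 i).
 exact: LL_comp.
have qa x: 0 <= \sum_i \sum_j a x i j*(G x 0 j*G x 0 i).
 have -> : \sum_i \sum_j a x i j*(G x 0 j*G x 0 i) = quadf (G x) (a x).
  by apply: eq_bigr=> i _; apply: eq_bigr=> j _; ring.
 have /andP[h _] := c_ell hc x (G x); apply: le_trans h; rewrite mulr_ge0 ?sqr_ge0 // invr_ge0 //.
have flat x: enorm (x - c) <= r -> GG x = 0 /\ HH x = 0.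
 move=> hx; have [z1 z2] := Tr _ (uin x hx); rewrite /GG /HH z1 z2 scale0r; split=> //.
 by apply/matrixP=> i j; rewrite !mxE !mul0r addr0.
have LL0 aa bb x: enorm (x - c) <= r -> LL aa bb GG HH x = 0.
 move=> hx; have [g0 h0] := flat x hx; rewrite /LL g0 h0 !big1 ?mulr0 ?addr0 // => i _; first by rewrite mxE mulr0.
 by rewrite big1 // => j _; rewrite mxE mulr0.
exists (fun x=> Th (u x)), GG, HH; split.
- exact: hpsi.
- have [M hM] := su; exists M=> y hy; rewrite hM // Thl //; lra.
- move=> x; rewrite /gen; congr (_ - _).
 have [hx|hx] := leP (enorm (x - c)) r; first by rewrite !LL0.
 by have [e1 e2] := hag x hx; rewrite /LL e1 e2.
(* The first term is nonnegative by concavity of [Th], the second because [u <= 1], the last because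
   [T2 <= 0]; the third is the defect of [u]. *)
have base x: gen a b kap (fun x=> Th (u x)) GG HH x = kap*(Th (u x) - u x*T1 (u x))
  + T1 (u x)*(W x*(1 - u x)) + T1 (u x)*((kap + W x)*u x - LL a b G H x - W x)
  + - (T2 (u x)/2) * \sum_i \sum_j a x i j*(G x 0 j*G x 0 i).
 by rewrite /gen LLp; ring.
have psi01 x: enorm (x - c) <= r -> 1/2 <= Th (u x) <= 1.
 move=> hx; have ux := uin x hx; have [_ h] := Thr _ ux.
 have ux0: 0 <= u x by lra.
 by have := Thle _ ux0; have := u1 x; lra.
split.
- move=> x; rewrite base; have /andP[z1 z2] := T101 (u x).
 have s1: 0 <= Th (u x) - u x*T1 (u x).
  have [h|h] := leP 0 (u x); first by rewrite subr_ge0; exact: Thm.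
  have [-> _] := Tl (u x) ltac:(lra); rewrite Thl ?mulr1 ?subrr //; lra.
 have s2: 0 <= T1 (u x)*(W x*(1 - u x)).
  by rewrite mulr_ge0 // mulr_ge0 // subr_ge0.
 have s3: - ep <= T1 (u x)*((kap + W x)*u x - LL a b G H x - W x).
  have /andP[h1 h2] := hr' x.
  have := ler_wpM2l z1 (ltac:(lra) : - ep <= (kap + W x)*u x - LL a b G H x - W x).
  have := ler_wpM2r (ltW ep0) z2; lra.
 have s4: 0 <= - (T2 (u x)/2) * \sum_i \sum_j a x i j*(G x 0 j*G x 0 i).
  by rewrite mulr_ge0 //; have := T2n (u x); lra.
 have := mulr_ge0 (ltW k0) s1; lra.
- move=> x hx; have ux := uout x hx; have [z1 z2] := Tl _ ux.
 have Wz: W x = 0 by rewrite /W Vout ?mulr0 //; lra.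
 have -> : gen a b kap (fun x=> Th (u x)) GG HH x = (kap + W x)*u x - LL a b G H x by rewrite base z1 z2 Thl // Wz; ring.
 by have := hr' x; rewrite Wz ler_norml; lra.
- move=> x hx; rewrite /gen LL0 // subr0; have /andP[h1 h2] := psi01 x hx.
 by have := ler_wpM2l (ltW k0) h1; have := ler_wpM2l (ltW k0) h2; lra.
- exact: psi01.
Qed.
End Equil.

(** * Harnack bounds and change of coefficients in a ball *)

Section Harn.
Variables (R : realType) (d : nat) (nu be K : R).
Local Notation V := 'rV[R]_d.
(** Two-sided comparison of the occupation density near [x0] with that of a tent nearby, uniform in
    the coefficients, in [kap] and in [rho]. The correction for [|x0| < 1] reflects the singularity
    of the Green function at its pole, the origin. *)
Definition harn (r rho0 : R) : Prop := [/\ 0 < r, d%:R*r <= 1, 0 < rho0, d%:R*rho0 <= 1 &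
 forall Rad : R, exists c C : R, [/\ 0 < c, 0 < C & forall a b, coefs nu be K a b -> forall kap, 0 < kap -> kap <= 1 ->
 forall rho, 0 < rho -> rho <= rho0 -> forall x0 x' : V, enorm (x0 - x') <= Rad ->
 c*rho^+d*UU a b kap (tent r x') <= UU a b kap (tent rho x0) /\
 UU a b kap (tent rho x0) <= C*rho^+d*UU a b kap (tent r x') + (if 1 <= enorm x0 then 0 else C)]].
Lemma harn_ex : (0 < d)%N -> 1 <= nu -> 0 <= be -> 0 <= K -> exists r rho0, harn r rho0.
Proof.
move=> d0 nu1 be0 K0.
have [cl [rl [cl0 rl0 hlow]]] := bar_low d0 nu1 be0 K0.
have [ru ru0 hup] := bar_up d0 nu1 be0 K0.
have dR: 0 < d%:R :> R by rewrite ltr0n.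
pose r := min (min rl ru) d%:R^-1.
have r0: 0 < r by rewrite !lt_min rl0 ru0 invr_gt0.
have rrl: r <= rl by rewrite !ge_min lexx.
have rru: r <= ru by rewrite !ge_min lexx orbT.
have rd: r <= d%:R^-1 by rewrite ge_min lexx orbT.
have [Cu [rho0 [Cu0 rho00 hU]]] := hup r r0 rru.
pose rh := min rho0 r.
have rh0: 0 < rh by rewrite lt_min rho00.
exists r, rh; split=> //.
- by rewrite mulrC -ler_pdivlMr // mul1r.
- rewrite mulrC -ler_pdivlMr // mul1r; apply: le_trans rd; by rewrite ge_min lexx orbT.
move=> Rad; have [n n0 hn] := nat_ge (Rad/r); rewrite ler_pdivrMr // in hn.
pose c0 := cl*r^+d.
have c00: 0 < c0 by rewrite mulr_gt0 // exprn_gt0.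
have cn0: 0 < c0^+n by exact: exprn_gt0.
exists (cl*c0^+n), (Cu/c0^+n + Cu); split; [exact: mulr_gt0|by apply: addr_gt0=> //; apply: divr_gt0|].
move=> a b hc kap kap0 kap1 rho rho0' hrho x0 x' hx.
have rhr: rho <= r by apply: (le_trans hrho); rewrite ge_min lexx orbT.
have rhr0: rho <= rho0 by apply: (le_trans hrho); rewrite ge_min lexx.
have U0 x: 0 <= UU a b kap (tent r x) by apply: (U_ge0 hc kap0); [exact: tent_bdd|move=> y; exact: tent_ge0].
(* Harnack chain: the segment from [y] to [x] is cut into [m] pieces of length at most [r], and
   [bar_low] with equal radii is applied to each. *)
have chain m (y x : V) : enorm (y - x) <= m%:R*r -> c0^+m*UU a b kap (tent r x) <= UU a b kap (tent r y).
 elim: m y=> [|m IH] y h.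
  rewrite mul0r in h; have : enorm (y - x) = 0 by apply: le_anti; rewrite h enorm_ge0.
  by move=> /enorm_eq0 /eqP; rewrite subr_eq0=> /eqP ->; rewrite expr0 mul1r.
 have mp: 0 < m.+1%:R :> R by rewrite ltr0n.
 pose y' := y - m.+1%:R^-1 *: (y - x).
 have h1: enorm (y - y') <= r.
  rewrite /y' opprB addrCA subrr addr0 enormZ ger0_norm ?invr_ge0 ?(ltW mp) //.
  by rewrite mulrC ler_pdivrMr // mulrC.
 have h2: enorm (y' - x) <= m%:R*r.
  have -> : y' - x = (m%:R/m.+1%:R) *: (y - x).
   rewrite /y' addrAC -[X in X - _ *: _]scale1r -scalerBl; congr (_ *: _).
   by rewrite -natr1; field; rewrite natr1 gt_eqF.
  rewrite enormZ ger0_norm ?divr_ge0 ?(ltW mp) //.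
  rewrite (_ : m%:R/m.+1%:R*enorm (y - x) = m%:R*(enorm (y - x)/m.+1%:R)); last by ring.
  by apply: ler_wpM2l=> //; rewrite ler_pdivrMr // mulrC.
 have h3 := hlow a b hc kap kap0 kap1 r r rrl r0 (lexx _) y y' h1.
 apply: le_trans h3; rewrite exprS -mulrA -/c0; apply: ler_wpM2l; first exact: ltW.
 exact: IH.
have hx': enorm (x' - x0) <= n%:R*r by rewrite enormB; exact: le_trans hn.
have hx'': enorm (x0 - x') <= n%:R*r by exact: le_trans hn.
split.
 have h1 := hlow a b hc kap kap0 kap1 r rho rrl rho0' rhr x0 x0; rewrite subrr enorm0 in h1.
 have {}h1 := h1 (ltW r0); apply: le_trans h1.
 rewrite (_ : cl*c0^+n*rho^+d*_ = cl*rho^+d*(c0^+n*UU a b kap (tent r x'))); last by ring.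
 apply: ler_wpM2l; last exact: chain.
 by rewrite mulr_ge0 ?exprn_ge0 // ltW.
apply: (le_trans (hU a b hc kap kap0 kap1 rho rho0' rhr0 x0)); apply: lerD; last first.
 by case: ifP=> // _; rewrite lerDr divr_ge0 // ltW.
have h1: UU a b kap (tent r x0) <= UU a b kap (tent r x')/c0^+n by rewrite ler_pdivlMr // mulrC; exact: chain.
have p0: 0 <= Cu*rho^+d by rewrite mulr_ge0 ?exprn_ge0 // ltW.
apply: (le_trans (ler_wpM2l p0 h1)).
have p1: 0 <= rho^+d*UU a b kap (tent r x') by rewrite mulr_ge0 ?exprn_ge0 // ltW.
rewrite (_ : Cu*rho^+d*(UU a b kap (tent r x')/c0^+n) = Cu/c0^+n*(rho^+d*UU a b kap (tent r x'))); last by ring.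
by rewrite -[X in _ <= X]mulrA; apply: ler_wpM2r=> //; rewrite lerDl ltW.
Qed.
Lemma gen_cont (a : V -> 'M[R]_d) (b : V -> V) (hc : coefs nu be K a b) kap (phi : V -> R) G H : C2 phi G H -> cont (gen a b kap phi G H).
Proof.
move=> [h1 h2 h3].
have c1 := D1_cont h1.
have ca i j: cont (fun x=> a x i j) by apply: (@cont_lip R d _ K)=> x y; exact: (c_aL hc).
have cb i: cont (fun x=> b x 0 i) by apply: (@cont_lip R d _ K)=> x y; exact: (c_bL hc).
have cL: cont (fun x=> LL a b G H x).
 apply: cont_add; first by apply: cont_mul; [exact: cont_cst|apply: cont_sum=> i; apply: cont_sum=> j; exact: cont_mul].
 by apply: cont_sum=> i; apply: cont_mul=> //; exact: D1_cont (h2 i).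
have := cont_add (cont_mul (@cont_cst R d kap) c1) (cont_mul (@cont_cst R d (-1)) cL).
rewrite /gen; congr cont; apply/funext=> x; by rewrite mulN1r.
Qed.
Lemma gen_supp (a : V -> 'M[R]_d) (b : V -> V) kap (phi : V -> R) G H M : C2 phi G H -> (forall y, M < enorm y -> phi y = 0) ->
 forall y, M < enorm y -> gen a b kap phi G H y = 0.
Proof.
move=> hp hM y hy; have [g0 h0] := C2_supp hp hM hy.
rewrite /gen hM // mulr0 sub0r /LL g0 h0 !big1 ?mulr0 ?addr0 ?oppr0 // => i _; first by rewrite mxE mulr0.
by rewrite big1 // => j _; rewrite mxE mulr0.
Qed.
Lemma U_close (a : V -> 'M[R]_d) (b : V -> V) (hc : coefs nu be K a b) kap (f g : V -> R) w : 0 < kap -> bdd f -> bdd g -> 0 <= w -> (forall x, `|f x - g x| <= w) ->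
 UU a b kap f <= UU a b kap g + w/kap.
Proof.
move=> k0 bf bg w0 h.
have bd: bdd (fun x=> f x + -1*g x) by apply: bdd_add=> //; exact: bdd_scale.
have := U_sub hc k0 bg bd.
rewrite (_ : (fun x=> g x + (f x + -1*g x)) = f); last by apply/funext=> x; ring.
move/le_trans; apply; rewrite lerD2l; apply: normt; apply: (U_abs hc k0 w0)=> x.
by rewrite mulN1r.
Qed.

Variables (r rho0 : R).
Hypothesis hh : harn r rho0.
Lemma U_tent_ge0 (a : V -> 'M[R]_d) (b : V -> V) (hc : coefs nu be K a b) kap rho (x : V) : 0 < kap -> 0 < rho -> 0 <= UU a b kap (tent rho x).
Proof. by move=> k0 r0; apply: (U_ge0 hc k0); [exact: tent_bdd|move=> y; exact: tent_ge0]. Qed.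
Lemma gpt_bound (p c : nat) (k : {ffun 'I_d -> 'I_(2*c * p).+1}) : (0 < p)%N -> enorm (gpt p c%:R k : V) <= d%:R*c%:R.
Proof.
move=> p0; have pp: 0 < p%:R :> R by rewrite ltr0n.
apply: enorm_le_coord=> i; rewrite mxE.
have h1: (k i)%:R/p%:R <= 2*c%:R :> R by rewrite ler_pdivrMr // -!natrM ler_nat -ltnS.
have h2: 0 <= (k i)%:R/p%:R :> R by rewrite divr_ge0.
by rewrite ler_norml; lra.
Qed.
(** A ball about the origin is covered by finitely many tents of a fixed size, so the additive
    constants of [harn] cause no blow-up as [kap] decreases. *)
Lemma U_local : exists2 C0 : R, 0 < C0 & forall a b, coefs nu be K a b -> forall kap, 0 < kap -> kap <= 1 ->
 forall f, (forall x : V, 0 <= f x <= 1) -> (forall x, 2 < enorm x -> f x = 0) -> UU a b kap f <= C0*(UU a b kap (tent r 0) + 1).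
Proof.
have [r0 rd rh0 rhd hH] := hh.
have [p p0 hp] := nat_ge (rho0^-1).
have pR: 0 < p%:R :> R by rewrite ltr0n.
have pr: p%:R^-1 <= rho0 by rewrite -[rho0]invrK lef_pV2 ?posrE ?invr_gt0.
have pi: 0 < p%:R^-1 :> R by rewrite invr_gt0.
have [c [C [c0 C0 hcC]]] := hH (d%:R*2%:R).
pose n := #|{ffun 'I_d -> 'I_(2*2 * p).+1}|.
exists (n%:R*(C * p%:R^-1^+d + C) + 1); first by apply: ltr_wpDl=> //; apply: mulr_ge0=> //; apply: addr_ge0; [apply: mulr_ge0; [exact: ltW|apply: exprn_ge0; exact: ltW]|exact: ltW].
move=> a b hc kap k0 k1 f f01 fout.
have U0 := U_tent_ge0 hc 0 k0 r0.
have bf: bdd f by exists 1=> x; have /andP[h1 h2] := f01 x; rewrite ger0_norm.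
have ap (k : {ffun 'I_d -> 'I_(2*2 * p).+1}) := tent_appr hc (gpt p 2%:R k) k0 pi.
have [as_ sE] := appr_sum hc k0 (index_enum {ffun 'I_d -> 'I_(2*2 * p).+1}) (fun=> 1) ap.
have h1: UU a b kap f <= \sum_(k : {ffun 'I_d -> 'I_(2*2 * p).+1}) 1*UU a b kap (tent p%:R^-1 (gpt p 2%:R k)).
 rewrite -sE; apply: (U_mono hc k0 bf (appr_bdd hc k0 as_))=> x.
 under eq_bigr do rewrite mul1r.
 have [hx|hx] := leP (enorm x) 2; first by rewrite pou_eq1 //; have /andP[] := f01 x.
 by rewrite fout //; apply: sumr_ge0=> k _; exact: tent_ge0.
apply: (le_trans h1).
have pd0: 0 <= p%:R^-1^+d :> R by apply: exprn_ge0; exact: ltW.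
have hk (k : {ffun 'I_d -> 'I_(2*2 * p).+1}) : 1*UU a b kap (tent p%:R^-1 (gpt p 2%:R k)) <= (C * p%:R^-1^+d + C)*(UU a b kap (tent r 0) + 1).
 rewrite mul1r; have [_ h2] := hcC a b hc kap k0 k1 _ pi pr (gpt p 2%:R k) 0 ltac:(rewrite subr0; exact: gpt_bound).
 apply: (le_trans h2).
 have h3: (if 1 <= enorm (gpt p 2%:R k : V) then 0 else C) <= C by case: ifP=> // _; exact: ltW.
 have h4: 0 <= C * p%:R^-1^+d by rewrite mulr_ge0 // ltW.
 have h5: 0 <= C*UU a b kap (tent r 0) by rewrite mulr_ge0 // ltW.
 by rewrite mulrDr mulr1 mulrDl; lra.
apply: (le_trans (ler_sum _ (fun k _=> hk k))); rewrite sumr_const -[X in X <= _]mulr_natl -/n mulrA.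
by apply: ler_wpM2r; [lra|rewrite lerDl].
Qed.
(** The potential [psi] of [equilibrium] has the same charge [e] for both coefficient fields, so
    both functionals give [psi 0] on [e]. Up to small errors, [e] is a nonnegative combination of
    small tents near [c], and [harn] turns the two values into comparable multiples of [U] and [U']
    of the tent at [c]. *)
Lemma compare (Rb : R) : 1 <= Rb -> exists C k1 : R, [/\ 0 < C, 0 < k1, k1 <= 1 & forall a b a' b', coefs nu be K a b -> coefs nu be K a' b' ->
 forall kap, 0 < kap -> kap <= k1 -> forall c : V, c = 0 \/ Rb + 6 < enorm c ->
 (forall x, Rb < enorm (x - c) -> a x = a' x /\ b x = b' x) ->
 UU a b kap (tent r c) <= C*UU a' b' kap (tent r c)].
Proof.
move=> Rb1; have [r0 rd rh0 rhd hH] := hh.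
have [cc [C [cc0 C0 hcC]]] := hH (Rb + 3).
have [Cl Cl0 hloc] := U_local.
pose c' := min cc (1/2).
have c'0: 0 < c' by rewrite lt_min cc0; lra.
have c'c: c' <= cc by rewrite ge_min lexx.
have c'h: c' <= 1/2 by rewrite ge_min lexx orbT.
pose C1 := C + 2*Cl.
have C10: 0 < C1 by rewrite /C1; lra.
(* Only for [c = 0]: the charge near the pole is of order [kap], and [2 kap Cl <= 1/8] lets
   [psi 0 >= 1/2] absorb its contribution. *)
pose k1 := min 1 (16*Cl)^-1.
have k10: 0 < k1 by rewrite lt_min ltr01 invr_gt0 mulr_gt0.
exists (6*C1/c'), k1; split=> //; [by apply: divr_gt0=> //; apply: mulr_gt0|by rewrite ge_min lexx|].
move=> a b a' b' hc hc' kap k0 hk c hcase hag.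
have kap1: kap <= 1 by apply: (le_trans hk); rewrite ge_min lexx.
have kCl: 2*kap*Cl <= 1/8.
 have : kap <= (16*Cl)^-1 by apply: (le_trans hk); rewrite ge_min lexx orbT.
 by rewrite -[(16*Cl)^-1]mul1r ler_pdivlMr ?mulr_gt0 //; lra.
set U := UU a b kap (tent r c); set U' := UU a' b' kap (tent r c).
have U0: 0 <= U := U_tent_ge0 hc c k0 r0.
have U'0: 0 <= U' := U_tent_ge0 hc' c k0 r0.
apply/ler_addgt0Pr=> sg sg0.
(* The defect is divided by [kap] twice, by the maximum principle and by the factor [m + kap]; hence
   the square. *)
pose eps := min (kap/24) (sg*(c'*kap^+2)/9).
have eps0: 0 < eps by rewrite lt_min; apply/andP; split; [lra|ppos].
have epsk: eps <= kap/24 by rewrite ge_min lexx.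
have epss: eps <= sg*(c'*kap^+2)/9 by rewrite ge_min lexx orbT.
pose s := eps/kap.
have s0: 0 < s by rewrite divr_gt0.
have s24: s <= 1/24 by rewrite /s ler_pdivrMr //; lra.
have ssg: 9*s/(c'*kap) <= sg.
 rewrite ler_pdivrMr ?mulr_gt0 // /s mulrA ler_pdivrMr //.
 by rewrite (_ : sg*(c'*kap)*kap = sg*(c'*kap^+2)); [lra|ring].
have Rb0: 0 <= Rb by lra.
have [psi [G [H [hpsi spsi hgen [e_ge e_out e_in psi_in]]]]] := equilibrium hc k0 kap1 Rb0 hag eps0.
set e := gen a b kap psi G H in hgen e_ge e_out e_in.
have ce: cont e := gen_cont hc kap hpsi.
have [M hM] := spsi.
have eM y: M < enorm y -> e y = 0 by exact: gen_supp.
have be_: bdd e := gen_bdd hc k0 hpsi spsi.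
have Ue: UU a b kap e = psi 0 by exact: (U_exact hc k0 be_ hpsi spsi).
have Ue': UU a' b' kap e = psi 0 by apply: (U_exact hc' k0 be_ hpsi spsi)=> x; rewrite -hgen.
have [p0 p00 happ] := approx_grid ce eM eps0.
have [p1 p10 hp1] := nat_ge (rho0^-1).
pose p := maxn p0 p1.
have pp: (0 < p)%N by rewrite leq_max p00.
have pR: 0 < p%:R :> R by rewrite ltr0n.
have pi: 0 < p%:R^-1 :> R by rewrite invr_gt0.
have pr: p%:R^-1 <= rho0.
 rewrite -[rho0]invrK lef_pV2 ?posrE ?invr_gt0 //; apply: (le_trans hp1); by rewrite ler_nat leq_maxr.
have [c0 c00 hc0] := nat_ge M.
have {}happ := happ p c0 (leq_maxl _ _) hc0.
pose I := {ffun 'I_d -> 'I_(2*c0 * p).+1}.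
pose x_ (k : I) : V := gpt p c0%:R k.
pose rd' : R := p%:R^-1^+d.
have rd'0: 0 < rd' by exact: exprn_gt0.
pose u_ k := UU a b kap (tent p%:R^-1 (x_ k)); pose u'_ k := UU a' b' kap (tent p%:R^-1 (x_ k)).
have u0 k: 0 <= u_ k := U_tent_ge0 hc (x_ k) k0 pi.
have u'0 k: 0 <= u'_ k := U_tent_ge0 hc' (x_ k) k0 pi.
have [apE UE] := appr_sum hc k0 (index_enum I) (fun k=> e (x_ k)) (fun k=> tent_appr hc (x_ k) k0 pi).
have [apE' UE'] := appr_sum hc' k0 (index_enum I) (fun k=> e (x_ k)) (fun k=> tent_appr hc' (x_ k) k0 pi).
have [ap1 U1] := appr_sum hc k0 (index_enum I) (fun=> 1) (fun k=> tent_appr hc (x_ k) k0 pi).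
have [ap1' U1'] := appr_sum hc' k0 (index_enum I) (fun=> 1) (fun k=> tent_appr hc' (x_ k) k0 pi).
have sumT x: 0 <= \sum_(k : I) 1*tent p%:R^-1 (x_ k) x <= 1.
 under eq_bigr do rewrite mul1r.
 by rewrite pou_le1 // andbT; apply: sumr_ge0=> k _; exact: tent_ge0.
have su: \sum_k u_ k <= 1/kap.
 have := U_abs hc k0 ler01 (f := fun x=> \sum_(k : I) 1*tent p%:R^-1 (x_ k) x).
 rewrite U1; under [X in `|X|]eq_bigr do rewrite mul1r.
 move=> h; apply: normt; apply: h=> x; have /andP[h1 h2] := sumT x; by rewrite ger0_norm.
have su': \sum_k u'_ k <= 1/kap.
 have := U_abs hc' k0 ler01 (f := fun x=> \sum_(k : I) 1*tent p%:R^-1 (x_ k) x).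
 rewrite U1'; under [X in `|X|]eq_bigr do rewrite mul1r.
 move=> h; apply: normt; apply: h=> x; have /andP[h1 h2] := sumT x; by rewrite ger0_norm.
have L1: \sum_k e (x_ k)*u_ k <= psi 0 + s.
 rewrite -Ue -UE; apply: (U_close hc k0 (appr_bdd hc k0 apE) be_ (ltW eps0))=> x; rewrite distrC; exact: happ.
have L2: psi 0 <= \sum_k e (x_ k)*u'_ k + s.
 rewrite -Ue' -UE'; apply: (U_close hc' k0 be_ (appr_bdd hc' k0 apE') (ltW eps0))=> x; exact: happ.
pose In (k : I) := enorm (x_ k - c) <= Rb + 3.
(* Total discretized charge near the ball. It has no lower bound, so the estimates are made for
   [m + kap], the second summand coming from the charge inside the ball. *)
pose m := \sum_(k | In k) (e (x_ k) + eps)*rd'.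
have ee k: 0 <= e (x_ k) + eps by have := e_ge (x_ k); lra.
have m0: 0 <= m by apply: sumr_ge0=> k _; apply: mulr_ge0=> //; exact: ltW.
have sE (u : I -> R) : \sum_k (e (x_ k) + eps)*u k = \sum_k e (x_ k)*u k + eps * \sum_k u k.
 by rewrite mulr_sumr -big_split; apply: eq_bigr=> k _; rewrite mulrDl.
have es: eps*(1/kap) = s by rewrite /s mul1r.
have Q1: cc * m*U <= psi 0 + 2*s.
 have h1: cc * m*U <= \sum_k (e (x_ k) + eps)*u_ k.
  rewrite [X in _ <= X](bigID In) /=; apply: (le_via (\sum_(k | In k) (e (x_ k) + eps)*u_ k)); last first.
   by rewrite lerDl; apply: sumr_ge0=> k _; exact: mulr_ge0.
  rewrite /m mulr_sumr mulr_suml; apply: ler_sum=> k hk'.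
  have [h2 _] := hcC a b hc kap k0 kap1 _ pi pr (x_ k) c hk'.
  rewrite (_ : cc*((e (x_ k) + eps)*rd')*U = (e (x_ k) + eps)*(cc*rd'*U)); last by ring.
  exact: ler_wpM2l.
 rewrite sE in h1; have := ler_wpM2l (ltW eps0) su; rewrite es; lra.
(* On the ball of radius [Rb] the charge is at least [kap/2], and the tent at [c] is supported there
   because [d r <= 1 <= Rb]. *)
have Q2: kap/2*U <= psi 0 + s.
 rewrite -Ue /U -(U_scale hc k0 _ (tent_appr hc c k0 r0)).
 have b1: bdd (fun x=> e x + eps) by apply: bdd_add=> //; exists eps=> x; rewrite gtr0_norm.
 have b2: bdd (fun x=> kap/2*tent r c x) by apply: bdd_scale; exact: tent_bdd.
 apply: (le_via (UU a b kap (fun x=> e x + eps))).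
  apply: (U_mono hc k0 b2 b1)=> x.
  have [hx|hx] := leP (enorm (x - c)) Rb.
   have /andP[h1 _] := e_in x hx; have := tent_le1 c x r0; have := tent_ge0 r c x=> t0 t1.
   have k2: 0 <= kap/2 by rewrite divr_ge0 ?(ltW k0).
   by rewrite (le_trans (ler_wpM2l k2 t1)) // mulr1 (le_trans h1) // lerDl ltW.
  rewrite tent_supp ?mulr0 //; first by have := e_ge x; lra.
  by lra.
 apply: (U_close hc k0 b1 be_ (ltW eps0))=> x; by rewrite addrAC subrr add0r gtr0_norm.
have Q3: \sum_k e (x_ k)*u'_ k <= \sum_(k | In k) (e (x_ k) + eps)*u'_ k + 2*s.
 apply: (le_via (\sum_k (e (x_ k) + eps)*u'_ k)).
  by rewrite sE lerDl mulr_ge0 ?(ltW eps0) //; apply: sumr_ge0.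
 rewrite (bigID In) /= lerD2l.
 apply: (le_via (\sum_(k | ~~ In k) 2*eps*u'_ k)).
  apply: ler_sum=> k hk'; apply: ler_wpM2r=> //; rewrite /In -ltNge in hk'.
  by have := e_out _ hk'; rewrite ler_norml; clear; lra.
 rewrite -mulr_sumr -mulrA -es; apply: ler_wpM2l=> //; apply: ler_wpM2l; first exact: ltW.
 by apply: le_trans su'; rewrite [X in _ <= X](bigID In) /= lerDr; apply: sumr_ge0.
have mU': 0 <= m*U' by exact: mulr_ge0.
have kU': 0 <= kap*U' by rewrite mulr_ge0 // ltW.
have fin (X : R) : psi 0 <= X -> 0 < c'*(m + kap) -> c'*(m + kap)*U <= 2*X + 3*s.
 move=> hX _.
 have h1: c'*(m*U) <= cc*(m*U) by apply: ler_wpM2r=> //; exact: mulr_ge0.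
 have h2: c'*(kap*U) <= 1/2*(kap*U) by apply: ler_wpM2r=> //; rewrite mulr_ge0 // ltW.
 by move: Q1 Q2 h1 h2 hX; clear; lra.
have mk: 0 < m + kap by rewrite ltr_wpDl.
have mk': 0 < c'*(m + kap) by exact: mulr_gt0.
have Cmk: C1 * m*U' <= C1*(m + kap)*U'.
 by apply: ler_wpM2r=> //; apply: ler_wpM2l; [exact: ltW|rewrite lerDl ltW].
suff key : c'*(m + kap)*U <= 6*C1*(m + kap)*U' + 9*s.
 have h1: U <= (6*C1*(m + kap)*U' + 9*s)/(c'*(m + kap)) by rewrite ler_pdivlMr // mulrC.
 apply: (le_trans h1).
 rewrite mulrDl; apply: lerD; first by apply: eqle; fieldp.
 apply: le_trans ssg; apply: ler_wpM2l; first by rewrite mulr_ge0 // ltW.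
 by rewrite lef_pV2 ?posrE ?mulr_gt0 // ler_pM2l // lerDr.
have [hc00|hfar] := hcase; last first.
 have Q4: \sum_(k | In k) (e (x_ k) + eps)*u'_ k <= C * m*U'.
  rewrite /m mulr_sumr mulr_suml; apply: ler_sum=> k hk'.
  have [_ h2] := hcC a' b' hc' kap k0 kap1 _ pi pr (x_ k) c hk'.
  rewrite ifT in h2; last first.
   by have := enorm_tri0 c (x_ k); rewrite enormB; have := hk'; rewrite /In; move: hfar; clear; lra.
  rewrite addr0 in h2.
  rewrite (_ : C*((e (x_ k) + eps)*rd')*U' = (e (x_ k) + eps)*(C*rd'*U')); last by ring.
  exact: ler_wpM2l.
 have X1: psi 0 <= C1*(m + kap)*U' + 3*s.
  have h1: C * m*U' <= C1 * m*U' by apply: ler_wpM2r=> //; apply: ler_wpM2r=> //; rewrite /C1 lerDl mulr_ge0 // ltW.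
  by move: L2 Q3 Q4 Cmk h1; clear; lra.
 have h2 := fin _ X1 mk'; have h3: 0 <= C1*(m + kap)*U' by rewrite mulr_ge0 ?mulr_ge0 // ltW.
 by move: h2 h3; clear; lra.
(* Nodes near the pole, where [harn] has an additive constant. They lie in the ball, so their charge
   is at most [kap], and [U_local] bounds them together. *)
pose In1 (k : I) := enorm (x_ k) < 1.
have Q5: \sum_(k | In k) (e (x_ k) + eps)*u'_ k <= C * m*U' + 2*kap*(Cl*(U' + 1)).
 have h1: \sum_(k | In k) (e (x_ k) + eps)*u'_ k <= \sum_(k | In k) (C*((e (x_ k) + eps)*rd')*U') + \sum_(k | In1 k) 2*kap*u'_ k.
  rewrite [X in _ <= _ + X]big_mkcond [X in _ <= X + _]big_mkcond [X in X <= _]big_mkcond -big_split; apply: ler_sum=> k _ /=.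
  have hnn: 0 <= C*((e (x_ k) + eps)*rd')*U'.
   by apply: mulr_ge0=> //; apply: mulr_ge0; [exact: ltW|apply: mulr_ge0=> //; exact: ltW].
  have kk0: 0 <= 2*kap*u'_ k by apply: mulr_ge0=> //; apply: mulr_ge0=> //; exact: ltW.
  case: ifP=> hIn; last by case: ifP=> _; rewrite add0r.
  case: ifP=> hIn1.
   apply: (le_via (2*kap*u'_ k)); last by rewrite lerDr.
   apply: ler_wpM2r=> //.
   have /andP[_ h2] := e_in (x_ k) ltac:(rewrite hc00 subr0; apply: le_trans Rb1; exact: ltW).
   move: h2 epsk k0; clear; lra.
  rewrite addr0; have [_ h2] := hcC a' b' hc' kap k0 kap1 _ pi pr (x_ k) c hIn.
  rewrite ifT in h2; last by move: hIn1; rewrite /In1 ltNge=> /negbFE.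
  rewrite addr0 in h2.
  rewrite (_ : C*((e (x_ k) + eps)*rd')*U' = (e (x_ k) + eps)*(C*rd'*U')); last by ring.
  exact: ler_wpM2l.
 apply: (le_trans h1); apply: lerD; first by rewrite /m mulr_sumr mulr_suml.
 rewrite -mulr_sumr; apply: ler_wpM2l; first by apply: mulr_ge0=> //; exact: ltW.
 have [ap3 U3] := appr_sum hc' k0 (index_enum I) (fun k=> (In1 k)%:R) (fun k=> tent_appr hc' (x_ k) k0 pi).
 have -> : \sum_(k | In1 k) u'_ k = UU a' b' kap (fun x=> \sum_k (In1 k)%:R*tent p%:R^-1 (x_ k) x).
  by rewrite U3 big_mkcond; apply: eq_bigr=> k _; case: ifP=> _; rewrite ?mul1r ?mul0r.
 rewrite /U' hc00; apply: (hloc a' b' hc' kap k0 kap1).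
  move=> x; apply/andP; split; first by apply: sumr_ge0=> k _; rewrite mulr_ge0 ?tent_ge0.
  have /andP[_ h2] := sumT x; apply: le_trans h2; apply: ler_sum=> k _; apply: ler_wpM2r; first exact: tent_ge0.
  by case: (In1 k).
 move=> x hx; rewrite big1 // => k _; case hk1 : (In1 k); last by rewrite mul0r.
 rewrite mul1r tent_supp //.
 have := enorm_tri0 x (x_ k); move: hk1; rewrite /In1=> hk1.
 have : d%:R * p%:R^-1 <= d%:R*rho0 by apply: ler_wpM2l.
 move: hx hk1 rhd; clear; lra.
have psi0: 1/2 <= psi 0 by have /andP[] := psi_in 0 ltac:(by rewrite hc00 subr0 enorm0).
have X1: psi 0 <= 2*(C1*(m + kap)*U').
 have h1: C1*(m + kap)*U' = C*(m*U') + 2*Cl*(m*U') + C*(kap*U') + 2*Cl*(kap*U') by rewrite /C1; ring.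
 have h2: 0 <= Cl*(m*U') by rewrite mulr_ge0 // ltW.
 have h3: 0 <= C*(kap*U') by rewrite mulr_ge0 // ltW.
 by move: L2 Q3 Q5 psi0 kCl s24 h1 h2 h3; clear; lra.
have h2 := fin _ X1 mk'; have h3: 0 <= C1*(m + kap)*U' by rewrite mulr_ge0 ?mulr_ge0 // ltW.
by move: h2 h3 s0; clear; lra.
Qed.
End Harn.

(** * Expectations of bounded variables and independence *)

Section Expect.
Context (dT : measure_display) (T : measurableType dT) (R : realType) (P : probability T R).
Implicit Types (X Y : T -> R).
Definition bm X : Prop := mfun X /\ exists B : R, forall w, `|X w| <= B.
Definition EE X : R := \int[P]_(w in setT) X w.
Lemma bm_int X : bm X -> P.-integrable setT (EFin \o X).
Proof.
move=> [mX [B hB]]; apply: measurable_bounded_integrable=> //.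
 by apply: (@le_lt_trans _ _ 1%E); [exact: probability_le1|exact: ltry].
by exists B; split=> [|x Bx w _]; [exact: num_real|apply: le_trans (hB w) (ltW Bx)].
Qed.
Lemma bm_cst c : bm (fun=> c).
Proof. by split; [exact: measurable_cst|exists `|c|]. Qed.
Lemma bm_add X Y : bm X -> bm Y -> bm (fun w=> X w + Y w).
Proof.
move=> [mX [B hB]] [mY [C hC]]; split; first exact: measurable_funD.
by exists (B + C)=> w; rewrite normDt // lerD.
Qed.
Lemma bm_mul X Y : bm X -> bm Y -> bm (fun w=> X w*Y w).
Proof.
move=> [mX [B hB]] [mY [C hC]]; split; first exact: measurable_funM.
by exists (B*C)=> w; rewrite normrM ler_pM.
Qed.
Lemma bm_scale c X : bm X -> bm (fun w=> c*X w).
Proof. by move=> h; apply: bm_mul=> //; exact: bm_cst. Qed.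
Lemma bm_sum (I : Type) (r : seq I) (F : I -> T -> R) : (forall i, bm (F i)) -> bm (fun w=> \sum_(i <- r) F i w).
Proof.
move=> h; elim: r=> [|i r IH]; first by under [X in bm X]eq_fun do rewrite big_nil; exact: bm_cst.
by under [X in bm X]eq_fun do rewrite big_cons; exact: bm_add.
Qed.
Lemma bm_ind (p : T -> bool) : measurable [set w | p w] -> bm (fun w=> (p w)%:R).
Proof.
move=> mp; split; last by exists 1=> w; case: (p w); rewrite ?normr1 ?normr0.
have := @measurable_indic _ T R setT _ mp; congr (measurable_fun _ _).
by apply/funext=> w; rewrite indicE; congr (_%:R : R); rewrite (_ : (w \in _) = p w) //; apply/idP/idP; rewrite inE.
Qed.
Lemma EE_eq X Y : (forall w, X w = Y w) -> EE X = EE Y.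
Proof. by move=> h; congr EE; apply/funext. Qed.
Lemma EE_cst c : EE (fun=> c) = c.
Proof. by rewrite /EE Rintegral_cst // [X in fine X]probability_setT mulr1. Qed.
Lemma EE_add X Y : bm X -> bm Y -> EE (fun w=> X w + Y w) = EE X + EE Y.
Proof. by move=> hX hY; apply: RintegralD=> //; exact: bm_int. Qed.
Lemma EE_scale c X : bm X -> EE (fun w=> c*X w) = c*EE X.
Proof. by move=> hX; apply: RintegralZl=> //; exact: bm_int. Qed.
Lemma EE_le X Y : bm X -> bm Y -> (forall w, X w <= Y w) -> EE X <= EE Y.
Proof. by move=> hX hY h; apply: le_Rintegral=> //; exact: bm_int. Qed.
Lemma EE_ge0 X : (forall w, 0 <= X w) -> 0 <= EE X.
Proof. by move=> h; exact: Rintegral_ge0. Qed.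
Lemma EE_abs X B : bm X -> (forall w, `|X w| <= B) -> `|EE X| <= B.
Proof.
move=> hX h; rewrite ler_norml; apply/andP; split.
 by rewrite -[- B]EE_cst; apply: EE_le=> //; [exact: bm_cst|move=> w; have := h w; rewrite ler_norml=> /andP[]].
by rewrite -[B]EE_cst; apply: EE_le=> //; [exact: bm_cst|move=> w; have := h w; rewrite ler_norml=> /andP[]].
Qed.
Lemma EE_sub X Y : bm X -> bm Y -> EE (fun w=> X w - Y w) = EE X - EE Y.
Proof. by move=> hX hY; apply: RintegralB=> //; exact: bm_int. Qed.
Lemma bm_sub X Y : bm X -> bm Y -> bm (fun w=> X w - Y w).
Proof.
move=> hX hY; have := bm_add hX (bm_scale (-1) hY); congr bm.
by apply/funext=> w; rewrite mulN1r.
Qed.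
Lemma EE_close X Y e : bm X -> bm Y -> (forall w, `|X w - Y w| <= e) -> `|EE X - EE Y| <= e.
Proof. by move=> hX hY h; rewrite -EE_sub //; apply: EE_abs=> //; exact: bm_sub. Qed.
Lemma EE_sum (I : Type) (r : seq I) (F : I -> T -> R) : (forall i, bm (F i)) ->
 EE (fun w=> \sum_(i <- r) F i w) = \sum_(i <- r) EE (F i).
Proof.
move=> h; elim: r=> [|i r IH]; first by rewrite big_nil -[RHS]EE_cst; apply: EE_eq=> w; rewrite big_nil.
rewrite big_cons -IH -EE_add //; last exact: bm_sum.
by apply: EE_eq=> w; rewrite big_cons.
Qed.
Lemma EE_ind (p : T -> bool) : measurable [set w | p w] -> EE (fun w=> (p w)%:R) = fine (P [set w | p w]).
Proof.
move=> mp; rewrite /EE /Rintegral -[X in fine (P X)]setIT -integral_indic //; congr fine.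
apply: eq_integral=> w _; congr EFin; rewrite indicE; congr (_%:R : R).
by rewrite (_ : (w \in _) = p w) //; apply/idP/idP; rewrite inE.
Qed.
Lemma EE_integral X : bm X -> (\int[P]_(w in setT) (X w)%:E = (EE X)%:E)%E.
Proof. by move=> hX; rewrite /EE /Rintegral fineK //; apply: integrable_fin_num=> //; exact: bm_int. Qed.
Lemma stair (y : R) (m : nat) : 0 <= y -> [/\ (m%:R <= y -> \sum_(k < m) (k.+1%:R <= y)%R%:R = m%:R :> R),
 \sum_(k < m) (k.+1%:R <= y)%R%:R <= y :> R & (y <= m%:R -> y <= \sum_(k < m) (k.+1%:R <= y)%R%:R + 1 :> R)].
Proof.
move=> y0; elim: m=> [|m [i1 i2 i3]]; first by rewrite big_ord0; split=> // h; lra.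
rewrite big_ord_recr /=; have [h|h] := leP m.+1%:R y.
 have hm: m%:R <= y by apply: le_trans h; rewrite ler_nat.
 by rewrite i1 // natr1; split=> // h2; lra.
rewrite addr0; split=> // _; have [hy|hy] := leP y m%:R; first exact: i3.
by rewrite i1 ?(ltW hy) // natr1 ltW.
Qed.
(** Staircase with steps [1/n], a combination of indicators of the events [s <= X]. Equality or
    independence of such events thereby passes to expectations. *)
Definition stp (n m : nat) X (w : T) : R := \sum_(k < m) n%:R^-1*(k.+1%:R/n%:R <= X w)%R%:R.
Lemma stp_near (n m : nat) X w : (0 < n)%N -> 0 <= X w -> X w <= m%:R/n%:R -> `|X w - stp n m X w| <= n%:R^-1.
Proof.
move=> n0 x0 xm; have nR: 0 < n%:R :> R by rewrite ltr0n.
have y0: 0 <= X w*n%:R by rewrite mulr_ge0 // ltW.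
have [_ h2 h3] := stair m y0; rewrite ler_pdivlMr // in xm; have {}h3 := h3 xm.
have sE: stp n m X w = (\sum_(k < m) (k.+1%:R <= X w*n%:R)%R%:R)/n%:R.
 rewrite mulrC mulr_sumr; apply: eq_bigr=> k _; by rewrite ler_pdivrMr.
rewrite sE ler_norml; apply/andP; split.
 rewrite lerBrDr addrC lerBlDr ler_pdivrMr // mulrDl mulVf ?gt_eqF //; lra.
rewrite lerBlDr -[X in X <= _](mulfK (lt0r_neq0 nR)) -[X in X + _]mul1r -mulrDl ler_pM2r ?invr_gt0 //; lra.
Qed.
Lemma bm_stp (n m : nat) X : mfun X -> bm (stp n m X).
Proof.
move=> mX; apply: bm_sum=> k; apply: bm_scale; apply: bm_ind.
have := measurable_fun_ler (@measurable_cst _ _ _ _ setT (k.+1%:R/n%:R : R)) mX.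
by move=> /(_ measurableT [set true] I); rewrite setTI; congr measurable; apply/seteqP; split.
Qed.
Lemma ge_measurable X s : mfun X -> measurable [set w | s <= X w].
Proof.
move=> mX; have := measurable_fun_ler (@measurable_cst _ _ _ _ setT (s : R)) mX.
by move=> /(_ measurableT [set true] I); rewrite setTI; congr measurable; apply/seteqP; split.
Qed.
Lemma abs_inv_eq0 (x C : R) : (forall n, (0 < n)%N -> `|x| <= C/n%:R) -> x = 0.
Proof.
move=> h; apply/eqP; rewrite -normr_le0; apply/ler_addgt0Pr=> e e0; rewrite add0r.
have C0: 0 <= C by have := h 1%N isT; rewrite divr1; apply: le_trans.
have [n n0 hn] := nat_ge (C/e); apply: (le_trans (h n n0)).
by rewrite ler_pdivrMr ?ltr0n // -ler_pdivrMl // mulrC.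
Qed.
Lemma EE_stp (n m : nat) X : mfun X ->
 EE (stp n m X) = \sum_(k < m) n%:R^-1*fine (P [set w | k.+1%:R/n%:R <= X w]).
Proof.
move=> mX; have mk k: measurable [set w | k.+1%:R/n%:R <= X w] by exact: ge_measurable.
rewrite EE_sum=> [|k]; last by apply: bm_scale; exact: bm_ind.
by apply: eq_bigr=> k _; rewrite EE_scale ?EE_ind //; exact: bm_ind.
Qed.
Lemma EE_same X Y (B : R) : mfun X -> mfun Y -> (forall w, 0 <= X w <= B) -> (forall w, 0 <= Y w <= B) ->
 (forall s, P [set w | s <= X w] = P [set w | s <= Y w]) -> EE X = EE Y.
Proof.
move=> mX mY hX hY hE.
have bX: bm X by split=> //; exists B=> w; have /andP[h1 h2] := hX w; rewrite ger0_norm.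
have bY: bm Y by split=> //; exists B=> w; have /andP[h1 h2] := hY w; rewrite ger0_norm.
apply/eqP; rewrite -subr_eq0; apply/eqP; apply: (@abs_inv_eq0 _ 2)=> n n0.
have nR: 0 < n%:R :> R by rewrite ltr0n.
have [m _ hm] := nat_ge (B*n%:R); rewrite -ler_pdivlMr // in hm.
have e1: `|EE X - EE (stp n m X)| <= n%:R^-1.
 apply: EE_close=> // [|w]; first exact: bm_stp.
 by have /andP[h1 h2] := hX w; apply: stp_near=> //; apply: le_trans hm.
have e2: `|EE Y - EE (stp n m Y)| <= n%:R^-1.
 apply: EE_close=> // [|w]; first exact: bm_stp.
 by have /andP[h1 h2] := hY w; apply: stp_near=> //; apply: le_trans hm.
have e3: EE (stp n m X) = EE (stp n m Y) by rewrite !EE_stp //; apply: eq_bigr=> k _; rewrite hE.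
rewrite e3 in e1; move: e1 e2; clear; rewrite !ler_norml; lra.
Qed.
Lemma EE_indep X Y (B : R) : mfun X -> mfun Y -> (forall w, 0 <= X w <= B) -> (forall w, 0 <= Y w <= B) ->
 (forall s u, P ([set w | s <= X w] `&` [set w | u <= Y w]) = (P [set w | (s <= X w)%R]*P [set w | (u <= Y w)%R])%E) ->
 EE (fun w=> X w*Y w) = EE X*EE Y.
Proof.
move=> mX mY hX hY hE.
have bX: bm X by split=> //; exists B=> w; have /andP[h1 h2] := hX w; rewrite ger0_norm.
have bY: bm Y by split=> //; exists B=> w; have /andP[h1 h2] := hY w; rewrite ger0_norm.
apply/eqP; rewrite -subr_eq0; apply/eqP; apply: (@abs_inv_eq0 _ (4*B + 2))=> n n0.
have nR: 0 < n%:R :> R by rewrite ltr0n.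
have ni: n%:R^-1 <= 1 :> R by rewrite invf_le1 // ler1n.
have ni0: 0 <= n%:R^-1 :> R by rewrite invr_ge0 ltW.
have [m _ hm] := nat_ge (B*n%:R); rewrite -ler_pdivlMr // in hm.
have bsX: bm (stp n m X) by exact: bm_stp.
have bsY: bm (stp n m Y) by exact: bm_stp.
have nX w: `|X w - stp n m X w| <= n%:R^-1 by have /andP[h1 h2] := hX w; apply: stp_near=> //; apply: le_trans hm.
have nY w: `|Y w - stp n m Y w| <= n%:R^-1 by have /andP[h1 h2] := hY w; apply: stp_near=> //; apply: le_trans hm.
have key (x y x' y' : R) : 0 <= x <= B -> 0 <= y <= B -> `|x - x'| <= n%:R^-1 -> `|y - y'| <= n%:R^-1 ->
  `|x*y - x'*y'| <= (2*B + 1)/n%:R.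
 move=> /andP[x0 x1] /andP[y0 y1] hx hy.
 have -> : x*y - x'*y' = x*(y - y') + (x - x')*y - (x - x')*(y - y') by ring.
 apply: normBt; rewrite (_ : (2*B + 1)/n%:R = B*n%:R^-1 + n%:R^-1*B + 1*n%:R^-1); last by ring.
 apply: lerD; last by rewrite normrM; apply: ler_pM=> //; apply: le_trans ni.
 apply: normDt; apply: lerD; rewrite normrM.
  by apply: ler_pM=> //; rewrite ger0_norm.
 by apply: ler_pM=> //; rewrite ger0_norm.
have e1: `|EE (fun w=> X w*Y w) - EE (fun w=> stp n m X w*stp n m Y w)| <= (2*B + 1)/n%:R.
 by apply: EE_close=> [||w]; [exact: bm_mul|exact: bm_mul|exact: key].
have inB Z: bm Z -> (forall w, 0 <= Z w <= B) -> 0 <= EE Z <= B.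
 move=> bZ hZ; rewrite EE_ge0=> [|w]; last by have /andP[] := hZ w.
 by rewrite -[X in _ <= X]EE_cst /=; apply: EE_le=> //; [exact: bm_cst|move=> w; have /andP[] := hZ w].
have e2: `|EE X*EE Y - EE (stp n m X)*EE (stp n m Y)| <= (2*B + 1)/n%:R.
 by apply: key; [exact: inB|exact: inB|exact: EE_close|exact: EE_close].
have e3: EE (fun w=> stp n m X w*stp n m Y w) = EE (stp n m X)*EE (stp n m Y).
 have mkX k: measurable [set w | k.+1%:R/n%:R <= X w] by exact: ge_measurable.
 have mkY k: measurable [set w | k.+1%:R/n%:R <= Y w] by exact: ge_measurable.
 rewrite !EE_stp // mulr_suml.
 rewrite (EE_eq (Y := fun w=> \sum_(k < m) \sum_(j < m) (n%:R^-1*n%:R^-1)*((k.+1%:R/n%:R <= X w) && (j.+1%:R/n%:R <= Y w))%R%:R)); last first.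
  move=> w; rewrite /stp mulr_suml; apply: eq_bigr=> k _; rewrite mulr_sumr; apply: eq_bigr=> j _.
  by rewrite mulrACA; congr (_*_); case: (_ <= X w); rewrite ?mul1r ?mul0r.
 have bb k j: bm (fun w=> (n%:R^-1*n%:R^-1)*((k.+1%:R/n%:R <= X w) && (j.+1%:R/n%:R <= Y w))%R%:R).
  apply: bm_scale; apply: bm_ind.
  by have := measurableI _ _ (mkX k) (mkY j); congr measurable; apply/seteqP; split=> w /= => [[-> ->]|/andP[-> ->]].
 rewrite EE_sum=> [|k]; last by apply: bm_sum=> j; exact: bb.
 apply: eq_bigr=> k _; rewrite EE_sum=> [|j]; last exact: bb.
 rewrite mulr_sumr; apply: eq_bigr=> j _.
 have mI: measurable [set w | (k.+1%:R/n%:R <= X w) && (j.+1%:R/n%:R <= Y w)].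
  by have := measurableI _ _ (mkX k) (mkY j); congr measurable; apply/seteqP; split=> w /= => [[-> ->]|/andP[-> ->]].
 rewrite EE_scale ?EE_ind //; last exact: bm_ind.
 rewrite mulrACA; congr (_*_).
 rewrite (_ : [set w | _] = [set w | k.+1%:R/n%:R <= X w] `&` [set w | j.+1%:R/n%:R <= Y w]); last first.
  by apply/seteqP; split=> w /= => [/andP[-> ->]|[-> ->]].
 by rewrite hE fineM // fin_num_measure.
rewrite e3 in e1; move: e1 e2; clear; rewrite !ler_norml [(4*B + 2)/_](_ : _ = 2*((2*B + 1)/n%:R)); last by ring.
lra.
Qed.
End Expect.

(** * Erasing the environment in a ball *)

Section Modify.
Variables (R : realType) (d : nat).
Local Notation V := 'rV[R]_d.
Definition chib (c : V) (rb : R) (x : V) : R := min (max (rb - enorm (x - c)) 0) 1.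
Lemma chib01 c rb x : 0 <= chib c rb x <= 1.
Proof. by rewrite /chib le_min le_max lexx orbT ler01 /= ge_min lexx orbT. Qed.
Lemma chib_in c rb x : enorm (x - c) <= rb - 1 -> chib c rb x = 1.
Proof. by move=> h; rewrite /chib max_l ?min_r //; lra. Qed.
Lemma chib_out c rb x : rb <= enorm (x - c) -> chib c rb x = 0.
Proof. by move=> h; rewrite /chib max_r ?min_l ?ler01 //; lra. Qed.
Lemma minr_lip (x y z : R) : `|min x z - min y z| <= `|x - y|.
Proof.
by have [h1|h1] := leP x z; have [h2|h2] := leP y z=> //; have [h3|h3] := leP 0 (x - y); rewrite ?(ger0_norm h3) ?(ltr0_norm h3) ler_norml; lra.
Qed.
Lemma chib_lip c rb x y : `|chib c rb x - chib c rb y| <= enorm (x - y).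
Proof.
apply: (le_trans (minr_lip _ _ _)); apply: (le_trans (maxr_lip _ _)).
have -> : rb - enorm (x - c) - (rb - enorm (y - c)) = enorm (y - c) - enorm (x - c) by ring.
by apply: (le_trans (enorm_dist _ _)); rewrite opprB addrA subrK enormB.
Qed.
(** With [ch = chib c rb], interpolation between the environment and driftless Brownian motion:
    coefficients are deterministic within [rb - 1] of [c] and untouched beyond [rb]. *)
Definition moda (ch : V -> R) (a : V -> 'M[R]_d) (x : V) : 'M[R]_d := (1 - ch x) *: a x + (ch x)%:M.
Definition modb (ch : V -> R) (b : V -> V) (x : V) : V := (1 - ch x) *: b x.
Lemma quadf_lin (y : V) (A B : 'M[R]_d) (s t : R) : quadf y (s *: A + t *: B) = s*quadf y A + t*quadf y B.
Proof.
rewrite /quadf !mulr_sumr -big_split; apply: eq_bigr=> i _ /=; rewrite !mulr_sumr -big_split; apply: eq_bigr=> j _ /=.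
by rewrite !mxE; ring.
Qed.
Lemma quadf1 (y : V) : quadf y 1%:M = enorm y^+2.
Proof. by rewrite quadfE mulmx1 enorm_sqr. Qed.
Lemma coefs_weak nu be K K' (a : V -> 'M[R]_d) (b : V -> V) : K <= K' -> coefs nu be K a b -> coefs nu be K' a b.
Proof.
move=> h hc; have h0 := c_K hc; split; try by case: hc.
- exact: le_trans h.
- by move=> x y i j; apply: (le_trans (c_aL hc x y i j)); apply: ler_wpM2r; first exact: enorm_ge0.
- by move=> x y i; apply: (le_trans (c_bL hc x y i)); apply: ler_wpM2r; first exact: enorm_ge0.
Qed.
Lemma modify_lip (s t u v w M K D : R) : 0 <= s <= 1 -> 0 <= t <= 1 -> `|u| <= M -> `|u - v| <= K*D -> `|s - t| <= D -> `|w| <= 1 -> 0 <= K*D ->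
 `|((1 - s)*u + s*w) - ((1 - t)*v + t*w)| <= (K + M + 1)*D.
Proof.
move=> /andP[s0 s1] /andP[t0 t1] hu huv hst hw KD.
have -> : ((1 - s)*u + s*w) - ((1 - t)*v + t*w) = (1 - t)*(u - v) + (s - t)*(- u) + (s - t)*w by ring.
have D0: 0 <= D by apply: le_trans hst.
have -> : (K + M + 1)*D = 1*(K*D) + D*M + D*1 by ring.
apply: normDt; apply: lerD; last by rewrite normrM ler_pM.
apply: normDt; apply: lerD; last by rewrite normrM normrN ler_pM.
by rewrite normrM ler_pM // ger0_norm; lra.
Qed.
(** The cutoff is 1-Lipschitz, so the interpolation only adds the size of the coefficients to the
    Lipschitz constant; ellipticity is kept because [nu >= 1]. *)
Lemma coefs_mod nu be K (a : V -> 'M[R]_d) (b : V -> V) (c : V) (rb : R) : coefs nu be K a b ->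
 coefs nu be (K + nu + be + 1) (moda (chib c rb) a) (modb (chib c rb) b).
Proof.
move=> hc; have n1 := c_nu hc; have b0 := c_be hc; have K0 := c_K hc.
have nV: nu^-1 <= 1 by rewrite invf_le1 //; lra.
have modaE x: moda (chib c rb) a x = (1 - chib c rb x) *: a x + chib c rb x *: 1%:M by rewrite /moda scalemx1.
split=> //.
- by lra.
- by move=> x; rewrite modaE linearD !linearZ /= (c_sym hc) tr_scalar_mx.
- move=> x y; rewrite modaE quadf_lin quadf1; have /andP[h1 h2] := c_ell hc x y; have /andP[c0 c1] := chib01 c rb x.
 have e0 := sqr_ge0 (enorm y).
 have c1': 0 <= 1 - chib c rb x by lra.
 have q1 := ler_wpM2l c1' h1; have q2 := ler_wpM2l c1' h2.
 have q3 := ler_wpM2l c0 (ler_wpM2r e0 nV); have q4 := ler_wpM2l c0 (ler_wpM2r e0 n1).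
 by apply/andP; split; lra.
- move=> x i; rewrite mxE normrM -[X in _ <= X]mul1r; have /andP[c0 c1] := chib01 c rb x.
 by apply: ler_pM=> //; [rewrite ger0_norm; lra|exact: (c_b hc)].
- move=> x y i j; rewrite !mxE.
 have e0 := enorm_ge0 (x - y).
 have := @modify_lip (chib c rb x) (chib c rb y) (a x i j) (a y i j) ((i == j)%:R) nu K (enorm (x - y)) (chib01 _ _ _) (chib01 _ _ _)
  (c_abound hc x i j) (c_aL hc x y i j) (chib_lip _ _ _ _).
 rewrite !mulr_natr=> h; apply: (le_trans (h _ _)); first by case: (i == j); rewrite ?normr1 ?normr0.
  by rewrite mulr_ge0.
 by apply: ler_wpM2r=> //; lra.
- move=> x y i; rewrite !mxE.
 have e0 := enorm_ge0 (x - y).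
 have := @modify_lip (chib c rb x) (chib c rb y) (b x 0 i) (b y 0 i) 0 be K (enorm (x - y)) (chib01 _ _ _) (chib01 _ _ _)
  (c_b hc x i) (c_bL hc x y i) (chib_lip _ _ _ _).
 rewrite !mulr0 !addr0=> h; apply: (le_trans (h _ _)); first by rewrite normr0.
  by rewrite mulr_ge0.
 by apply: ler_wpM2r=> //; lra.
Qed.
Lemma mod_out (a : V -> 'M[R]_d) (b : V -> V) c rb x : rb < enorm (x - c) ->
 a x = moda (chib c rb) a x /\ b x = modb (chib c rb) b x.
Proof. by move=> h; rewrite /moda /modb chib_out ?(ltW h) // subr0 !scale1r (_ : 0%:M = 0) ?addr0 //; apply/matrixP=> i j; rewrite !mxE mul0rn. Qed.
Lemma mxnorm_coord (A : 'M[R]_d) i j : `|A i j| <= mxnorm A.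
Proof.
rewrite -sqrtr_sqr; apply: ler_wsqrtr; rewrite (bigD1 i) //= (bigD1 j) //= -addrA lerDl.
apply: addr_ge0; first by apply: sumr_ge0=> k _; exact: sqr_ge0.
by apply: sumr_ge0=> k _; apply: sumr_ge0=> m _; exact: sqr_ge0.
Qed.
End Modify.

(** * Consequences of the assumptions on the environment *)

Section EnvCoefs.
Variables (R : realType) (d : nat).
Local Notation V := 'rV[R]_d.
Context (dO : measure_display) (Omega : measurableType dO).
Variables (P : probability Omega R) (t : V -> Omega -> Omega) (a : Omega -> 'M[R]_d) (b : Omega -> V).
Variables (nu beta K Rr : R).
Hypothesis hE : env_assumptions P t a b nu beta K Rr.
Lemma env_coefs w : 1 <= nu -> 0 <= beta -> 0 <= K -> coefs nu beta K (fun y=> a (t y w)) (fun y=> b (t y w)).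
Proof.
move=> n1 b0 K0; have [_ [_ [_ [_ [_ [_ [hs [he [hb [hl _]]]]]]]]]] := hE.
have mn0 (A : 'M[R]_d) : 0 <= mxnorm A by exact: sqrtr_ge0.
split=> //.
- by move=> x i; apply: le_trans (hb x w); exact: coord_le.
- move=> x y i j; apply: le_trans (hl x y w).
 have := mxnorm_coord (a (t x w) - a (t y w)) i j; rewrite !mxE=> h; apply: (le_trans h).
 by rewrite lerDl enorm_ge0.
- move=> x y i; apply: le_trans (hl x y w).
 have := coord_le (b (t x w) - b (t y w)) i; rewrite !mxE=> h; apply: (le_trans h).
 by rewrite lerDr.
Qed.
(** The subsets of the product whose section at [x] is measurable form a sigma-algebra containing
    the rectangles. *)
Lemma shift_measurable x (A : set Omega) : measurable A -> measurable (t x @^-1` A).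
Proof.
move=> mA; have [_ [_ [hj _]]] := hE.
have h := hj A mA.
pose S : set (set (V*Omega)) := [set E | measurable [set w | E (x, w)]].
suff : S [set p : V*Omega | A (t p.1 p.2)] by [].
apply: (smallest_sub _ _ h); last first.
 move=> E [B [C [_ [mC ->]]]]; rewrite /S /=.
 have [hB|hB] := pselect (B x); first by rewrite (_ : [set w | _] = C) //; apply/seteqP; split=> w /= => [[]|].
 by rewrite (_ : [set w | _] = set0) //; apply/seteqP; split=> w /= => [[]|].
split.
- by rewrite /S /= (_ : [set w | _] = set0) //; apply/seteqP; split.
- move=> E hS; rewrite /S /= (_ : [set w | _] = ~` [set w | E (x, w)]); first exact: measurableC.
 by apply/seteqP; split=> w /= => [[]|].
- move=> F hS; rewrite /S /= (_ : [set w | _] = \bigcup_i [set w | F i (x, w)]); first exact: bigcupT_measurable.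
 by apply/seteqP; split=> w /= [i _ hi]; exists i.
Qed.
Lemma a_measurable x i j : mfun (fun w=> a (t x w) i j).
Proof.
have [_ [_ [_ [_ [ha _]]]]] := hE; move=> _ B mB; rewrite setTI.
have := shift_measurable x (ha i j measurableT B mB); rewrite setTI; exact.
Qed.
Lemma b_measurable x i : mfun (fun w=> b (t x w) 0 i).
Proof.
have [_ [_ [_ [_ [_ [hb _]]]]]] := hE; move=> _ B mB; rewrite setTI.
have := shift_measurable x (hb i measurableT B mB); rewrite setTI; exact.
Qed.
Lemma stationary (g : V -> R) (B : R) x : mfun (fun w=> g (b w)) -> (forall v, enorm v <= beta -> 0 <= g v <= B) ->
 EE P (fun w=> g (b (t x w))) = EE P (fun w=> g (b (t 0 w))).
Proof.
move=> mg hg; have [t0 [_ [_ [hP [_ [_ [_ [_ [hb _]]]]]]]]] := hE.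
have ms y: mfun (fun w=> g (b (t y w))).
 by move=> _ C mC; rewrite setTI; have := shift_measurable y (mg measurableT C mC); rewrite setTI; exact.
apply: (EE_same (B := B))=> // [w|w|s]; try by apply: hg.
have mS: measurable [set w | s <= g (b w)] by exact: ge_measurable.
rewrite -[LHS]/(P (t x @^-1` [set w | s <= g (b w)])) hP //.
by congr (P _); apply/seteqP; split=> w /=; rewrite t0.
Qed.
End EnvCoefs.

(** * Measurability of the resolvent functional *)

Section BoxMeas.
Context (dT : measure_display) (T : measurableType dT) (R : realType).

(* A level set is a countable union of boxes on which finitely many coordinates are pinned down up to [1 / n]. *)
Lemma box_measurable (Phi : T -> R) (c : R) (J : nat -> finType) (v : forall n, J n -> T -> R) :
 (forall n j, mfun (v n j)) ->
 (forall w, Phi w < c -> exists n, forall w', (forall j, `|v n j w' - v n j w| <= 2/n.+1%:R) -> Phi w' < c) ->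
 measurable [set w | Phi w < c].
Proof.
move=> mv h.
pose box n (s : {ffun J n -> int}) : set T := [set w | forall j, `|v n j w - (s j)%:~R/n.+1%:R| <= n.+1%:R^-1].
pose cell n (s : {ffun J n -> int}) : set T := [set w | box n s w /\ forall w', box n s w' -> Phi w' < c].
have mbox n s: measurable (box n s).
 have -> : box n s = ~` \bigcup_j [set w | n.+1%:R^-1 < `|v n j w - (s j)%:~R/n.+1%:R|].
  apply/seteqP; split=> w /= hw.
   by move=> [j _ /=]; rewrite ltNge hw.
  by move=> j; rewrite leNgt; apply/negP=> hj; apply: hw; exists j.
 apply: measurableC; apply: countable_bigcupT_measurable; first exact: countableP.
 move=> j; have m1: mfun (fun w=> `|v n j w - (s j)%:~R/n.+1%:R|).
  apply: measurableT_comp; first exact: normr_measurable.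
  by apply: measurable_funB=> //; exact: measurable_cst.
 have := measurable_fun_ltr (@measurable_cst _ _ _ _ setT (n.+1%:R^-1 : R)) m1.
 by move=> /(_ measurableT [set true] I); rewrite setTI; congr measurable; apply/seteqP; split.
have -> : [set w | Phi w < c] = \bigcup_n \bigcup_s cell n s.
 apply/seteqP; split=> w /=.
  move=> hw; have [n hn] := h w hw; exists n=> //.
  exists [ffun j=> Num.floor (v n j w*n.+1%:R)]=> //=.
  have nR: 0 < n.+1%:R :> R by rewrite ltr0n.
  have bw: box n [ffun j=> Num.floor (v n j w*n.+1%:R)] w.
   move=> j; rewrite ffunE; have /andP[h1 h2] := floor_itv (v n j w*n.+1%:R).
   rewrite -[X in `|X - _|](mulfK (lt0r_neq0 nR)) -mulrBl normrM [`|_^-1|]gtr0_norm ?invr_gt0 //.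
   rewrite -[X in _ <= X]mul1r ler_pM2r ?invr_gt0 // ger0_norm ?subr_ge0 //.
   by move: h2; rewrite intrD; lra.
  split=> // w' bw'; apply: hn=> j; have := bw j; have := bw' j; rewrite !ffunE; set z := _%:~R/_.
  by set y := n.+1%:R^-1; clear; rewrite !ler_norml; lra.
 by move=> [n _ [s _ [h1 h2]]]; exact: h2.
apply: bigcupT_measurable=> n; apply: countable_bigcupT_measurable; first exact: countableP.
move=> s; have [hg|hg] := pselect (forall w', box n s w' -> Phi w' < c).
 by rewrite (_ : cell n s = box n s) //; apply/seteqP; split=> w=> [[]|].
by rewrite (_ : cell n s = set0) //; apply/seteqP; split=> w=> [[]|].
Qed.
Lemma lt_measurable_fun (f : T -> R) : (forall c, measurable [set w | f w < c]) -> mfun f.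
Proof.
move=> h; apply: (measurability _ (RGenInftyO.measurableE R))=> _ [_ [x ->] <-].
by rewrite setTI; have := h x; congr measurable; apply/seteqP; split=> w /=; rewrite in_itv.
Qed.
End BoxMeas.

Section MeasU.
Context (R : realType) (d : nat) (dT : measure_display) (T : measurableType dT).
Local Notation V := 'rV[R]_d.
Lemma LL_diff (a a' : V -> 'M[R]_d) (b b' : V -> V) (G : V -> V) (H : V -> 'M[R]_d) (x : V) (B e : R) :
 (forall i, `|G x 0 i| <= B) -> (forall i j, `|H x i j| <= B) -> (forall i j, `|a x i j - a' x i j| <= e) ->
 (forall i, `|b x 0 i - b' x 0 i| <= e) -> `|LL a b G H x - LL a' b' G H x| <= (d%:R*d%:R + d%:R)*(e*B).
Proof.
move=> hG hH ha hb.
have -> : LL a b G H x - LL a' b' G H x = 2^-1*(\sum_i \sum_j (a x i j - a' x i j)*H x j i) + \sum_i (b x 0 i - b' x 0 i)*G x 0 i.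
 rewrite /LL.
 have -> : \sum_i \sum_j (a x i j - a' x i j)*H x j i = \sum_i \sum_j a x i j*H x j i - \sum_i \sum_j a' x i j*H x j i.
  by rewrite -sumrB; apply: eq_bigr=> i _; rewrite -sumrB; apply: eq_bigr=> j _; rewrite mulrBl.
 have -> : \sum_i (b x 0 i - b' x 0 i)*G x 0 i = \sum_i b x 0 i*G x 0 i - \sum_i b' x 0 i*G x 0 i.
  by rewrite -sumrB; apply: eq_bigr=> i _; rewrite mulrBl.
 by ring.
apply: normDt; rewrite mulrDl; apply: lerD.
 rewrite normrM ger0_norm ?invr_ge0 // -[X in _ <= X]mul1r; apply: ler_pM; rewrite ?invr_ge0 //; first lra.
 rewrite -mulrA; apply: sumd_abs=> i; apply: sumd_abs=> j.
 by rewrite normrM ler_pM.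
by apply: sumd_abs=> i; rewrite normrM ler_pM.
Qed.

Variables (A : T -> V -> 'M[R]_d) (B : T -> V -> V) (nu be K : R).
Hypothesis hc : forall w, coefs nu be K (A w) (B w).
Hypothesis mA : forall x i j, mfun (fun w=> A w x i j).
Hypothesis mB : forall x i, mfun (fun w=> B w x 0 i).
(** A competitor certifying [UU < c] still does so when the coefficients move slightly at the nodes
    of a fine grid: it has compact support and bounded derivatives, and the coefficients share a
    Lipschitz constant. *)
Lemma U_measurable (kap : R) (f : V -> R) : 0 < kap -> bdd f -> mfun (fun w=> UU (A w) (B w) kap f).
Proof.
move=> k0 bf; apply: lt_measurable_fun=> c.
pose I n := {ffun 'I_d -> 'I_(2*n.+1*n.+1).+1}.
pose pt n (k : I n) : V := gpt n.+1 n.+1%:R k.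
pose v n (j : (I n*('I_d * 'I_d) + I n * 'I_d)%type) (w : T) : R :=
 match j with inl (k, (i, j))=> A w (pt n k) i j | inr (k, i)=> B w (pt n k) 0 i end.
apply: (@box_measurable _ _ _ _ _ (fun n=> (I n*('I_d * 'I_d) + I n * 'I_d)%type : finType) v).
 by move=> n [[k [i j]]|[k i]] /=; [exact: mA|exact: mB].
move=> w hw.
have s0: 0 < (c - UU (A w) (B w) kap f)/2 by lra.
have [phi [G [H [e [hp sp e0 hf hU]]]]] := U_near (hc w) k0 bf s0.
set sg := (c - UU (A w) (B w) kap f)/2 in s0 hU.
have [Bd Bd0 hBd] := C2_bdd hp sp.
have [M hM] := sp.
pose D : R := (d%:R*d%:R + d%:R)*((2*(K*d%:R) + 2)*Bd).
have K0 := c_K (hc w).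
have D0: 0 <= D by rewrite /D; pos.
have [n1 n10 hn1] := nat_ge M.
have [n2 n20 hn2] := nat_ge (2*D/(kap*sg)).
have ks: 0 < kap*sg by exact: mulr_gt0.
exists (n1 + n2)%N=> w' hw'; set n := (n1 + n2)%N in hw'.
have nR: 0 < n.+1%:R :> R by rewrite ltr0n.
have nM: M <= n.+1%:R by apply: (le_trans hn1); rewrite ler_nat leqW // leq_addr.
have nD: D/n.+1%:R <= kap*sg/2.
 have : 2*D/(kap*sg) <= n.+1%:R by apply: (le_trans hn2); rewrite ler_nat leqW // leq_addl.
 by rewrite !ler_pdivrMr //; lra.
have key x: `|gen (A w') (B w') kap phi G H x - gen (A w) (B w) kap phi G H x| <= D/n.+1%:R.
 have [hx|hx] := leP (enorm x) M; last first.
  by rewrite !(gen_supp _ _ _ hp hM hx) subrr normr0 divr_ge0 // ltW.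
 have -> : gen (A w') (B w') kap phi G H x - gen (A w) (B w) kap phi G H x = - (LL (A w') (B w') G H x - LL (A w) (B w) G H x).
  by rewrite /gen; ring.
 rewrite normrN.
 have [k hk] : exists k : I n, enorm (x - pt n k) <= d%:R*n.+1%:R^-1.
  apply: contrapT=> hno.
  have h1 := @pou_eq1 R d n.+1 n.+1 x isT (le_trans hx nM).
  have : (0 : R) = 1 by rewrite -h1 big1 // => k _; apply: tent_supp; rewrite ?invr_gt0 // ltNge; apply/negP=> hk; apply: hno; exists k.
  by move/eqP; rewrite eq_sym oner_eq0.
 have [_ b1 b2] := hBd x.
 have Ke (u : V) : K*enorm (x - pt n k) <= K*(d%:R*n.+1%:R^-1) by apply: ler_wpM2l.
 have -> : D/n.+1%:R = (d%:R*d%:R + d%:R)*(((2*(K*d%:R) + 2)/n.+1%:R)*Bd) by rewrite /D; ring.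
 apply: LL_diff=> // [i j|i].
  have h1 := hw' (inl (k, (i, j))); rewrite /= in h1.
  have h2 := c_aL (hc w') x (pt n k) i j; have h3 := c_aL (hc w) x (pt n k) i j.
  have := Ke x; move: h1 h2 h3; rewrite !ler_norml; clear; rewrite (_ : (2*(K*d%:R) + 2)/n.+1%:R = 2*(K*(d%:R*n.+1%:R^-1)) + 2/n.+1%:R); last by ring.
  by set y := n.+1%:R^-1; set q := K*(_*y); set p := K*enorm _; lra.
 have h1 := hw' (inr (k, i)); rewrite /= in h1.
 have h2 := c_bL (hc w') x (pt n k) i; have h3 := c_bL (hc w) x (pt n k) i.
 have := Ke x; move: h1 h2 h3; rewrite !ler_norml; clear; rewrite (_ : (2*(K*d%:R) + 2)/n.+1%:R = 2*(K*(d%:R*n.+1%:R^-1)) + 2/n.+1%:R); last by ring.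
 by set y := n.+1%:R^-1; set q := K*(_*y); set p := K*enorm _; lra.
have e'0: 0 <= e + D/n.+1%:R by apply: addr_ge0=> //; rewrite divr_ge0 // ltW.
have h1 := U_le (hc w') k0 bf e'0 hp sp.
apply: (le_lt_trans (h1 _)).
 by move=> x; have := hf x; have := key x; rewrite ler_norml; set z := D/_; clear; lra.
have h2: D/n.+1%:R/kap <= sg/2 by rewrite ler_pdivrMr //; move: nD; set z := D/_; clear; lra.
by rewrite mulrDl; move: hU h2 s0; rewrite /sg; set z := D/_/_; clear; lra.
Qed.
End MeasU.

(** * Decoupling the drift from the resolvent *)

Section EnvU.
Variables (R : realType) (d : nat).
Local Notation V := 'rV[R]_d.
Context (dO : measure_display) (Omega : measurableType dO).
Variables (P : probability Omega R) (t : V -> Omega -> Omega) (a : Omega -> 'M[R]_d) (b : Omega -> V).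
Variables (nu beta K Rr : R).
Hypothesis hE : env_assumptions P t a b nu beta K Rr.
Hypotheses (nu1 : 1 <= nu) (be0 : 0 <= beta) (K0 : 0 <= K).
Definition gens (F : set V) : set (set Omega) :=
 [set C | exists x, F x /\
    ((exists (i j : 'I_d) (B : set R), measurable B /\
      C = (fun w=> a (t x w) i j) @^-1` B) \/
     (exists (i : 'I_d) (B : set R), measurable B /\
      C = (fun w=> b (t x w) 0 i) @^-1` B))].
Lemma gens_a F x i j : F x -> measurable_fun (setT : set (g_sigma_algebraType (gens F))) (fun w=> a (t x w) i j).
Proof.
by move=> hF _ B mB; rewrite setTI; apply: sub_gen_smallest; exists x; split=> //; left; exists i, j, B.
Qed.
Lemma gens_b F x i : F x -> measurable_fun (setT : set (g_sigma_algebraType (gens F))) (fun w=> b (t x w) 0 i).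
Proof.
by move=> hF _ B mB; rewrite setTI; apply: sub_gen_smallest; exists x; split=> //; right; exists i, B.
Qed.
Definition Um kap (c : V) (rb : R) (f : V -> R) (w : Omega) : R :=
 UU (moda (chib c rb) (fun y=> a (t y w))) (modb (chib c rb) (fun y=> b (t y w))) kap f.
Definition Ue kap (f : V -> R) (w : Omega) : R := UU (fun y=> a (t y w)) (fun y=> b (t y w)) kap f.
Definition cls (w : Omega) := env_coefs hE w nu1 be0 K0.
Definition cls' (c : V) rb (w : Omega) := coefs_mod c rb (cls w).
Lemma Ue_measurable kap f : 0 < kap -> bdd f -> mfun (Ue kap f).
Proof.
move=> k0 bf; apply: (U_measurable cls)=> // [x i j|x i]; [exact: (a_measurable hE)|exact: (b_measurable hE)].
Qed.
Lemma Ue_bm kap f : 0 < kap -> bdd f -> bm (Ue kap f).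
Proof.
move=> k0 bf; split; first exact: Ue_measurable.
have [B hB] := bf; exists (B/kap)=> w; apply: (U_abs (cls w) k0 _ hB); exact: le_trans (normr_ge0 _) (hB 0).
Qed.
(** Within [rb - 1] of [c] the modified coefficients are constants, so only sites farther away
    enter. *)
Lemma Um_gens kap c rb f : 0 < kap -> bdd f ->
 measurable_fun (setT : set (g_sigma_algebraType (gens [set y | rb - 1 < enorm (y - c)]))) (Um kap c rb f).
Proof.
move=> k0 bf; apply: (@U_measurable _ _ _ (g_sigma_algebraType (gens [set y | rb - 1 < enorm (y - c)])) _ _ _ _ _ (cls' c rb))=> // [x i j|x i].
 have [h|h] := leP (enorm (x - c)) (rb - 1).
  rewrite (_ : (fun w=> _) = fun=> (1 - chib c rb x)*0 + chib c rb x *+ (i == j)); first exact: measurable_cst.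
  by apply/funext=> w; rewrite !mxE chib_in // subrr !mul0r.
 rewrite (_ : (fun w=> _) = fun w=> (1 - chib c rb x)*a (t x w) i j + chib c rb x *+ (i == j)); last by apply/funext=> w; rewrite !mxE.
 apply: measurable_funD; last exact: measurable_cst.
 by apply: measurable_funM; [exact: measurable_cst|exact: gens_a].
have [h|h] := leP (enorm (x - c)) (rb - 1).
 rewrite (_ : (fun w=> _) = fun=> 0); first exact: measurable_cst.
 by apply/funext=> w; rewrite !mxE chib_in // subrr !mul0r.
rewrite (_ : (fun w=> _) = fun w=> (1 - chib c rb x)*b (t x w) 0 i); last by apply/funext=> w; rewrite !mxE.
by apply: measurable_funM; [exact: measurable_cst|exact: gens_b].
Qed.
Lemma Um_measurable kap c rb f : 0 < kap -> bdd f -> mfun (Um kap c rb f).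
Proof.
move=> k0 bf; apply: (U_measurable (cls' c rb))=> // [x i j|x i].
 rewrite (_ : (fun w=> _) = fun w=> (1 - chib c rb x)*a (t x w) i j + chib c rb x *+ (i == j)); last by apply/funext=> w; rewrite !mxE.
 apply: measurable_funD; last exact: measurable_cst.
 by apply: measurable_funM; [exact: measurable_cst|exact: (a_measurable hE)].
rewrite (_ : (fun w=> _) = fun w=> (1 - chib c rb x)*b (t x w) 0 i); last by apply/funext=> w; rewrite !mxE.
by apply: measurable_funM; [exact: measurable_cst|exact: (b_measurable hE)].
Qed.
Lemma max_dot_measurable (d' : measure_display) (T : measurableType d') (s : R) (l : V) (v : T -> V) :
 (forall i, mfun (fun w=> v w 0 i)) -> mfun (fun w=> max (s*dotv (v w) l) 0).
Proof.
move=> h; apply: measurable_maxr; last exact: measurable_cst.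
apply: measurable_funM; first exact: measurable_cst.
by apply: measurable_sum=> i; apply: measurable_funM=> //; exact: measurable_cst.
Qed.
(** The condition on [rb] separates [x0] by more than [Rr] from all sites that the modified
    functional sees. Finite range dependence gives the product, and stationarity moves the drift
    factor to the origin. *)
Lemma EE_decouple (s : R) (l : V) kap c rb f x0 B : 0 < kap -> `|s| <= 1 -> enorm l = 1 -> (forall x, 0 <= f x <= 1) ->
 beta <= B -> kap^-1 <= B -> Rr + enorm (x0 - c) < rb - 1 ->
 EE P (fun w=> max (s*dotv (b (t x0 w)) l) 0*Um kap c rb f w) =
 EE P (fun w=> max (s*dotv (b (t 0 w)) l) 0)*EE P (Um kap c rb f).
Proof.
move=> k0 s1 l1 f01 hB1 hB2 hrb.
have bf: bdd f by exists 1=> x; have /andP[h1 h2] := f01 x; rewrite ger0_norm.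
have [_ [_ [_ [_ [_ [hb0 [_ [_ [hb [_ hind]]]]]]]]]] := hE.
have gB v: enorm v <= beta -> 0 <= max (s*dotv v l) 0 <= B.
 move=> hv; rewrite le_max lexx orbT /= ge_max; apply/andP; split; last exact: le_trans hB1.
 apply: normt; apply: le_trans hB1; rewrite normrM -[X in _ <= X]mul1r; apply: ler_pM=> //.
 by apply: (le_trans (dotv_abs _ _)); rewrite l1 mulr1.
have UB w: 0 <= Um kap c rb f w <= B.
 apply/andP; split; first by apply: (U_ge0 (cls' c rb w) k0)=> // x; have /andP[] := f01 x.
 apply: normt; apply: le_trans hB2; rewrite -[kap^-1]mul1r; apply: (U_abs (cls' c rb w) k0 ler01)=> x.
 by have /andP[h1 h2] := f01 x; rewrite ger0_norm.
have st := @stationary _ _ _ _ _ _ _ _ _ _ _ _ hE (fun v=> max (s*dotv v l) 0) B x0 (max_dot_measurable s l hb0) gB.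
rewrite -st.
apply: (EE_indep (B := B))=> // [|||u v].
- by apply: max_dot_measurable=> i; exact: (b_measurable hE).
- exact: Um_measurable.
- by move=> w; apply: gB.
apply: (hind [set x0] [set y | rb - 1 < enorm (y - c)]).
- exists (rb - 1 - enorm (x0 - c)); split=> [|x y -> /=]; first by lra.
 by move=> hy; have := enorm_tri y x0 c; rewrite (enormB y x0); lra.
- have := @ge_measurable _ (g_sigma_algebraType (gens [set x0])) R (fun w=> max (s*dotv (b (t x0 w)) l) 0) u.
 by apply; apply: max_dot_measurable=> i; exact: gens_b.
- have := @ge_measurable _ (g_sigma_algebraType (gens [set y | rb - 1 < enorm (y - c)])) R (Um kap c rb f) v.
 by apply; exact: Um_gens.
Qed.
End EnvU.

(** * Riemann sums and limits of measurable functions *)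

Section Riemann.
Variable R : realType.
Lemma heine (g : R -> R) (u v : R) : continuous g -> forall e, 0 < e ->
 exists2 dl : R, 0 < dl & forall x y, u <= x <= v -> `|y - x| < dl -> `|g y - g x| <= e.
Proof.
move=> cg e e0.
pose P (dl : R) (x : R) := forall y, `|y - x| < dl -> `|g y - g x| <= e.
have /compact_near_coveringP hcov := @segment_compact R u v.
have : \forall dl \near (0 : R)^'+, [set` `[u, v]] `<=` P dl.
 apply: hcov=> x _.
 have := cg x; move/(@cvgrPdist_lt R R)=> /(_ (e/2) ltac:(lra)) /nbhs_ballP[dl /= dl0 hd].
 have d2: 0 < dl/2 by lra.
 exists ([set x' : R | `|x - x'| < dl/2], [set t : R | t < dl/2])=> /=.
  by split; [apply/nbhs_ballP; exists (dl/2)|exact: nbhs_right_lt].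
 move=> [x' t] [/= h1 h2] y hy.
 have a1: `|g x - g x'| < e/2 by apply: hd; rewrite /ball /=; lra.
 have a2: `|g x - g y| < e/2.
  apply: hd; rewrite /ball /=; have -> : x - y = (x - x') - (y - x') by ring.
  by apply: (le_lt_trans (ler_normB _ _)); lra.
 have -> : g y - g x' = (g x - g x') - (g x - g y) by ring.
 by apply: normBt; lra.
move=> hnear.
have [dl [dl0 hdl]] : exists dl : R, 0 < dl /\ [set` `[u, v]] `<=` P dl.
 by near (0 : R)^'+ => t; exists t; split; near: t=> //; exact: nbhs_right_gt.
by exists dl=> // x y hx; apply: hdl; rewrite /= in_itv.
Unshelve. all: by end_near. Qed.
Definition rsum (g : R -> R) (u v : R) (n : nat) : R := \sum_(i < n) (v - u)/n%:R*g (u + i%:R*((v - u)/n%:R)).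
(** Exhibits a time integral along a path as a limit of finite sums, which yields its measurability
    in [Dr_bm]. *)
Lemma riemann_lim (g G : R -> R) (u v : R) : u <= v -> continuous g -> (forall x, u <= x <= v -> is_derive x 1 G (g x)) ->
 forall e, 0 < e -> exists n0 : nat, forall n, (n0 < n)%N -> `|(G v - G u) - rsum g u v n| <= e.
Proof.
move=> uv cg hG e e0.
pose e' := e/(v - u + 1).
have e'0: 0 < e' by apply: divr_gt0=> //; lra.
have [dl dl0 hd] := @heine g u v cg e' e'0.
have [n0 n00 hn0] := nat_ge ((v - u)/dl).
exists n0=> n hn; have nR: 0 < n%:R :> R by rewrite ltr0n (leq_ltn_trans _ hn).
pose tau := (v - u)/n%:R; pose x_ i := u + i%:R*tau.
have tau0: 0 <= tau by apply: divr_ge0; [lra|exact: ltW].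
have tnd: tau < dl.
 rewrite /tau ltr_pdivrMr //; rewrite ler_pdivrMr // in hn0; apply: (le_lt_trans hn0).
 by rewrite mulrC ltr_pM2l // ltr_nat.
have xn: x_ n = v by rewrite /x_ /tau mulrC divfK ?gt_eqF //; ring.
have x0: x_ 0%N = u by rewrite /x_ mul0r addr0.
have xS i: x_ i.+1 = x_ i + tau by rewrite /x_ -natr1; ring.
have xb (i : nat) : (i <= n)%N -> u <= x_ i <= v.
 move=> hi; rewrite /x_ lerDl mulr_ge0 //= -xn lerD2l; apply: ler_wpM2r=> //; by rewrite ler_nat.
have -> : G v - G u = \sum_(i < n) (G (x_ i.+1) - G (x_ i)).
 by rewrite -xn -x0 -(telescope_sumr (fun i=> G (x_ i)) (leq0n n)) big_mkord.
rewrite /rsum -/tau -sumrB; apply: normst.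
apply: (le_via (\sum_(i < n) e'*tau)); last first.
 rewrite sumr_const card_ord -mulr_natr -mulrA /tau divfK ?gt_eqF // /e' -mulrA ler_piMr ?(ltW e0) //.
 by rewrite mulrC ler_pdivrMr; lra.
apply: ler_sum=> i _; have /andP[h1 h2] := xb i (ltnW (ltn_ord i)); have /andP[h3 h4] := xb i.+1 (ltn_ord i).
have le1: x_ i <= x_ i.+1 by rewrite xS lerDl.
have := @derive_lip _ (fun z=> G z - g (x_ i)*z) (fun z=> g z - g (x_ i)) (x_ i) (x_ i.+1) e'.
rewrite min_l // max_r // => /(_ _ _).
have -> : G (x_ i.+1) - g (x_ i)*x_ i.+1 - (G (x_ i) - g (x_ i)*x_ i) = G (x_ i.+1) - G (x_ i) - tau*g (x_ i) by rewrite xS; ring.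
have -> : `|x_ i.+1 - x_ i| = tau by rewrite xS addrAC subrr add0r ger0_norm.
apply.
 move=> z /andP[z1 z2]; have := isd_add (hG z _) (isd_opp (isd_scale (g (x_ i)) (isd_id z))).
 by rewrite mulr1; apply; apply/andP; split; lra.
move=> z /andP[z1 z2]; apply: hd; first by apply/andP.
by rewrite ger0_norm; [rewrite xS in z2; lra|lra].
Qed.
End Riemann.

Section MeasLim.
Context (dT : measure_display) (T : measurableType dT) (R : realType).
Lemma unif_meas (F : T -> R) : (forall e : R, 0 < e -> exists2 G : T -> R, mfun G & forall w, `|F w - G w| <= e) ->
 mfun F.
Proof.
move=> h.
have [G hG] := choice (fun n : nat=> let: ex_intro2 G mG hG := h n.+1%:R^-1 ltac:(by rewrite invr_gt0 ltr0n) in ex_intro _ G (conj mG hG)).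
apply: (@measurable_fun_cvg _ _ _ _ G); first by move=> n; have [] := hG n.
move=> w _; apply/(@cvgrPdist_le R R)=> e e0.
have [n0 _ hn0] := nat_ge e^-1.
exists n0=> // n /= hn; have [_ hw] := hG n; apply: (le_trans (hw w)).
rewrite -[e]invrK lef_pV2 ?posrE ?invr_gt0 ?ltr0n //.
by apply: (le_trans hn0); rewrite ler_nat leqW.
Qed.
Lemma cvg_meas (G : nat -> T -> R) (F : T -> R) : (forall n, mfun (G n)) ->
 (forall w (e : R), 0 < e -> exists n0, forall n, (n0 < n)%N -> `|F w - G n w| <= e) -> mfun F.
Proof.
move=> mG h; apply: (measurable_fun_cvg mG)=> w _; apply/(@cvgrPdist_le R R)=> e e0.
by have [n0 hn0] := h w e e0; exists n0.+1.
Qed.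

Variable (P : probability T R).
Lemma EE_der (f g : R -> T -> R) (u v B t : R) : u < t < v -> (forall t, u < t < v -> bm (f t)) ->
 (forall t w, u < t < v -> is_derive t 1 (fun t=> f t w) (g t w)) -> (forall t w, u < t < v -> `|g t w| <= B) ->
 is_derive t 1 (fun t=> EE P (f t)) (EE P (g t)).
Proof.
move=> ht bf hd hB.
have B0: 0 <= `|B| by [].
have it: `]u, v[%classic t by rewrite /= in_itv.
have i1 x: `]u, v[%classic x -> P.-integrable setT (EFin \o f x) by rewrite /= in_itv /= => hx; apply: bm_int; exact: bf.
have i2 x y: `]u, v[%classic x -> [set: T] y -> derivable (f^~ y) x 1 by rewrite /= in_itv /= => hx _; have [] := hd x y hx.
have pE x y: u < x < v -> partial1of2 f x y = g x y by move=> hx; rewrite /partial1of2 derive1E; have [_ ->] := hd x y hx.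
have i3 x y: `]u, v[%classic x -> [set: T] y -> `|partial1of2 f x y| <= `|B|.
 by rewrite /= in_itv /= => hx _; rewrite pE //; apply: le_trans (ler_norm B); exact: hB.
have i4: P.-integrable setT (EFin \o (fun=> `|B|)) by apply: bm_int; exact: bm_cst.
split; first exact: (derivable_under_integral measurableT it i1 i2 (fun=> B0) i4 i3).
rewrite -derive1E (differentiation_under_integral measurableT it i1 i2 (fun=> B0) i4 i3).
by apply: eq_Rintegral=> w _; rewrite pE.
Qed.
End MeasLim.

(** * The martingale problem as a differential inequality *)

Section Paths.
Context (R : realType) (d : nat) (dW : measure_display) (W : measurableType dW).
Local Notation V := 'rV[R]_d.
Variable X : W -> R -> V.
Hypothesis mX : forall s (i : 'I_d), mfun (fun w=> X w s 0 i).
Hypothesis cX : forall w, {within [set s | 0 <= s], continuous (X w)}.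
(** The path is held at its starting point for negative times; it becomes continuous on the whole
    line, and two-sided derivatives make sense at time 0. *)
Definition Yp (w : W) (s : R) : V := X w (max s 0).
Lemma Yp_cont (f : V -> R) (w : W) : cont f -> continuous (fun s=> f (Yp w s)).
Proof.
move=> cf s.
have c1: Yp w @ s --> Yp w s.
 have /subspace_continuousP h : {within [set s | 0 <= s], continuous (X w)} by exact: cX.
 have s0: 0 <= max s 0 by rewrite le_max lexx orbT.
 have h1 := h _ s0.
 apply: (@cvg_comp _ _ _ (fun z : R=> max z 0) (X w) (nbhs s) (within [set z | 0 <= z] (nbhs (max s 0))) (nbhs (Yp w s)) _ h1)=> B hB.
 have cm: continuous (fun z : R=> max z 0) by apply: cts_max; [exact: cts_id|exact: cts_cst].
 have hB': nbhs (max s 0) [set z | 0 <= z -> B z] := hB.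
 have h2: nbhs s [set z | 0 <= max z 0 -> B (max z 0)] := cm s _ hB'.
 have h4: nbhs s [set z | B (max z 0)] by apply: filterS h2=> z /= h3; apply: h3; rewrite le_max lexx orbT.
 exact: h4.
have cf': {for Yp w s, continuous f} by exact: cont_continuous.
exact: (@continuous_comp _ _ _ (Yp w) f s c1 cf').
Qed.
Lemma comp_meas (d' : measure_display) (T : measurableType d') (v : T -> V) (f : V -> R) :
 (forall i, mfun (fun w=> v w 0 i)) -> cont f -> bsupp f -> mfun (fun w=> f (v w)).
Proof.
move=> mv cf [M hM]; apply: unif_meas=> e e0.
have [p p0 hp] := approx_grid cf hM e0.
have [c _ hcM] := nat_ge M.
exists (fun w=> \sum_k f (@gpt R d p (2*c * p).+1 c%:R k)*tent (p%:R^-1) (gpt p c%:R k) (v w)); last first.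
 by move=> w; exact: hp.
apply: measurable_sum=> k; apply: measurable_funM; first exact: measurable_cst.
apply: measurable_prod=> i _; apply: measurable_maxr; last exact: measurable_cst.
apply: measurable_funB; first exact: measurable_cst.
apply: measurable_funM; last exact: measurable_cst.
apply: measurableT_comp; first exact: normr_measurable.
by apply: measurable_funB=> //; exact: measurable_cst.
Qed.
Lemma bm_Yp (f : V -> R) (s : R) : cont f -> bsupp f -> bm (fun w=> f (Yp w s)).
Proof.
move=> cf sf; split; first by apply: comp_meas=> // i; exact: mX.
by have [B _ hB] := cont_bsupp_bdd cf sf; exists B=> w.
Qed.
(** The base point [-2] here and [-1] in [Dr] leave room on the left of the times that matter. *)
Definition Pr (f : V -> R) (w : W) (s : R) : R := \int[lebesgue_measure]_(r in `[(-2)%R, s]) f (Yp w r).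
Lemma Pr_der (f : V -> R) (w : W) (s : R) : cont f -> -2 < s -> is_derive s 1 (Pr f w) (f (Yp w s)).
Proof. by move=> cf s2; apply: (@int_der R _ (-2) s) s2; exact: Yp_cont. Qed.
Definition Dr f s w := Pr f w s - Pr f w (-1).
Lemma Dr_bm (f : V -> R) (s : R) : cont f -> bsupp f -> -1 < s -> bm (Dr f s).
Proof.
move=> cf sf s1; have [B B0 hB] := cont_bsupp_bdd cf sf; split; last first.
 exists (B * `|s - -1|)=> w; apply: (@derive_lip _ _ (fun r=> f (Yp w r)))=> x.
  rewrite min_l ?(ltW s1) // => /andP[h _]; apply: Pr_der=> //; lra.
 by move=> _; exact: hB.
apply: (@cvg_meas _ _ _ (fun n w=> rsum (fun r=> f (Yp w r)) (-1) s n)).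
 move=> n; apply: measurable_sum=> i; apply: measurable_funM; first exact: measurable_cst.
 by have [] := bm_Yp (-1 + i%:R*((s - -1)/n%:R)) cf sf.
move=> w e e0; apply: riemann_lim=> //; first exact: ltW.
 exact: Yp_cont.
by move=> x /andP[h1 _]; apply: Pr_der=> //; lra.
Qed.
Lemma Pr_int (f : V -> R) (w : W) (s : R) : cont f -> 0 <= s ->
 \int[lebesgue_measure]_(r in [set r | 0 <= r <= s]) f (X w r) = Pr f w s - Pr f w 0.
Proof.
move=> cf s0; have cg := @Yp_cont f w cf.
have -> : [set r : R | 0 <= r <= s] = `[0, s]%classic by apply/seteqP; split=> r /=; rewrite in_itv.
have -> : \int[lebesgue_measure]_(r in `[0, s]) f (X w r) = \int[lebesgue_measure]_(r in `[0, s]) f (Yp w r).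
 by apply: eq_Rintegral=> r; rewrite inE /= in_itv /= => /andP[h1 h2]; rewrite /Yp max_l.
have ig x y: lebesgue_measure.-integrable `[x, y] (EFin \o (fun r=> f (Yp w r))).
 apply: continuous_compact_integrable; first exact: segment_compact.
 exact: continuous_subspaceT.
rewrite /Pr Rintegral_itvB //; last by rewrite bnd_simp; lra.
rewrite Rintegral_itv_obnd_cbnd //.
apply: integrableS (ig 0 s)=> //; apply: subset_itv_oc_cc.
Qed.
Definition ind (A : set W) (w : W) : R := (w \in A)%:R.
Lemma ind01 A w : 0 <= ind A w <= 1. Proof. by rewrite /ind; case: (_ \in _); rewrite ?lexx ler01. Qed.
Lemma bm_indA A : measurable A -> bm (ind A).
Proof. by move=> mA; apply: bm_ind; rewrite (_ : [set w | _] = A) //; apply/seteqP; split=> w /=; rewrite inE. Qed.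
Lemma Ffilt_meas s A : Ffilt X s A -> measurable A.
Proof.
apply: smallest_sub; first exact: sigma_algebra_measurable.
by move=> _ [u [i [B [_ [mB ->]]]]]; have := mX u i measurableT mB; rewrite setTI.
Qed.

Variables (a : V -> 'M[R]_d) (b : V -> V) (nu be K : R).
Hypothesis hc : coefs nu be K a b.
Variable Q : probability W R.
Hypothesis hQ : solves_MP X a b 0 Q.
Local Notation E := (EE Q).
Lemma LL_cont G H (phi : V -> R) : C2 phi G H -> cont (fun x=> LL a b G H x).
Proof.
move=> hp; have [h1 _ _] := hp.
have := cont_add (cont_mul (@cont_cst R d (-1)) (gen_cont hc 0 hp)) (cont_mul (@cont_cst R d 0) (D1_cont h1)).
by congr cont; apply/funext=> x; rewrite /gen; ring.
Qed.
Lemma LL_bsupp G H (phi : V -> R) : C2 phi G H -> bsupp phi -> bsupp (fun x=> LL a b G H x).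
Proof.
move=> hp [M hM]; exists M=> x hx; have := gen_supp a b 0 hp hM hx.
by rewrite /gen mul0r sub0r=> /eqP; rewrite oppr_eq0=> /eqP.
Qed.
(** The martingale identity with its time integral differentiated under the expectation. [Psi]
    extends the function to [t > -1], since the identity itself is known only from [s] on. *)
Lemma MP_der (s : R) A (phi : V -> R) G H : 0 <= s -> Ffilt X s A -> C2 phi G H -> bsupp phi -> exists Psi : R -> R,
 (forall t : R, -1 < t -> is_derive t 1 Psi (E (fun w=> ind A w*LL a b G H (Yp w t)))) /\
 forall t : R, s <= t -> E (fun w=> ind A w * phi (Yp w t)) = Psi t.
Proof.
move=> s0 hA hp sp; have mA := Ffilt_meas hA; have bA := bm_indA mA.
have cL := LL_cont hp; have sL := LL_bsupp hp sp.
have [hp1 _ _] := hp; have cphi := D1_cont hp1.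
pose LA x := LL a b G H x.
pose Ps t := E (fun w=> ind A w * phi (Yp w s)) + (E (fun w=> ind A w*Dr LA t w) - E (fun w=> ind A w*Dr LA s w)).
exists Ps; split=> [t t1|t st].
 have [B B0 hB] := cont_bsupp_bdd cL sL.
 have := @EE_der _ W R Q (fun t w=> ind A w*Dr LA t w) (fun t w=> ind A w*LL a b G H (Yp w t)) (-1) (t + 1) B t.
 move=> h; have {}h := h ltac:(lra) _ _ _.
 have h1: is_derive t 1 (fun t=> E (fun w=> ind A w*Dr LA t w)) (E (fun w=> ind A w*LL a b G H (Yp w t))).
  apply: h.
  - by move=> z /andP[z1 z2]; apply: bm_mul=> //; exact: Dr_bm.
  - move=> z w /andP[z1 z2]; apply: isd_scale.
   have := isd_add (@Pr_der LA w z cL ltac:(lra)) (isd_cst (- Pr LA w (-1)) z).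
   by rewrite addr0.
  - move=> z w _; rewrite normrM -[X in _ <= X]mul1r; apply: ler_pM=> //.
   by have /andP[i0 i1] := ind01 A w; rewrite ger0_norm.
 have := isd_add (isd_cst (E (fun w=> ind A w * phi (Yp w s))) t) (isd_add h1 (isd_cst (- E (fun w=> ind A w*Dr LA s w)) t)).
 by rewrite add0r addr0.
have t0: 0 <= t by lra.
have [_ hM] := hQ.
have := hM phi (C2_C2c hp sp) s t ltac:(by apply/andP) A hA.
have MfE z w: 0 <= z -> Mf X a b phi z w = phi (Yp w z) - phi (X w 0) - (Pr LA w z - Pr LA w 0).
 move=> z0; rewrite /Mf /Yp max_l // -Pr_int //; congr (_ - _); apply: eq_Rintegral=> r _; exact: C2_Lgen.
have bD: bm (fun w=> ind A w*(phi (Yp w t) - phi (Yp w s) - (Dr LA t w - Dr LA s w))).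
 by apply: bm_mul=> //; apply: bm_sub; apply: bm_sub; first [exact: bm_Yp|apply: Dr_bm=> //; lra].
rewrite integral_mkcond (_ : (_ \_ A) = fun w=> (ind A w*(phi (Yp w t) - phi (Yp w s) - (Dr LA t w - Dr LA s w)))%:E); last first.
 apply/funext=> w; rewrite patchE /ind; case: ifP=> _; last by rewrite mul0r.
 by rewrite mul1r; congr EFin; rewrite !MfE // /Dr; ring.
rewrite EE_integral // => -[].
rewrite (@EE_eq _ _ _ Q _ (fun w=> ind A w * phi (Yp w t) - ind A w * phi (Yp w s) - (ind A w*Dr LA t w - ind A w*Dr LA s w))); last by move=> w; ring.
have b1 z: bm (fun w=> ind A w * phi (Yp w z)) by apply: bm_mul=> //; exact: bm_Yp.
have b2 z: -1 < z -> bm (fun w=> ind A w*Dr LA z w) by move=> hz; apply: bm_mul=> //; exact: Dr_bm.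
have bt: bm (fun w=> ind A w*Dr LA t w) by apply: b2; lra.
have bs: bm (fun w=> ind A w*Dr LA s w) by apply: b2; lra.
rewrite EE_sub; [|exact: bm_sub|exact: bm_sub].
rewrite EE_sub // EE_sub // /Ps=> h.
by apply/eqP; rewrite -subr_eq0 opprD addrA; apply/eqP.
Qed.
(** The function [- exp (- kap t) (Psi t - p/kap)] is nondecreasing: its derivative is
    [exp (- kap t)] times the expectation of [gen] on [A] minus [p]. *)
Lemma MP_super (kap s u p : R) A (phi : V -> R) G H : 0 < kap -> 0 <= s -> s <= u -> Ffilt X s A -> C2 phi G H -> bsupp phi ->
 (forall t, s <= t <= u -> p <= E (fun w=> ind A w*gen a b kap phi G H (Yp w t))) ->
 expR (- kap*u)*E (fun w=> ind A w * phi (Yp w u)) + p/kap*(expR (- kap*s) - expR (- kap*u)) <=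
 expR (- kap*s)*E (fun w=> ind A w * phi (Yp w s)).
Proof.
move=> k0 s0 su hA hp sp hp'; have mA := Ffilt_meas hA; have bA := bm_indA mA.
have [Psi [hd hPsi]] := MP_der s0 hA hp sp.
rewrite !hPsi //.
have cL := LL_cont hp; have sL := LL_bsupp hp sp.
have [hp1 _ _] := hp; have cphi := D1_cont hp1.
pose z t := - expR (- kap*t)*(Psi t - p/kap).
pose z1 t := expR (- kap*t)*(kap*Psi t - p - E (fun w=> ind A w*LL a b G H (Yp w t))).
have dz (t : R) : -1 < t -> is_derive t 1 z (z1 t).
 move=> t1; have d1 := isd_opp (isd_exp (isd_scale (- kap) (isd_id t))).
 have d2 := isd_add (hd t t1) (isd_cst (- (p/kap)) t).
 have h := isd_mul d1 d2; apply: isd_ext h _ _=> // ; rewrite /z1; field; exact: lt0r_neq0.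
have : z s <= z u.
 apply: (@derive_mono _ z z1 s u su)=> t /andP[t1 t2]; first by apply: dz; apply: lt_le_trans t1; apply: lt_le_trans s0; rewrite ltrN10.
 apply: mulr_ge0; first exact: expR_ge0.
 have := hp' t ltac:(by apply/andP).
 rewrite (@EE_eq _ _ _ Q _ (fun w=> kap*(ind A w * phi (Yp w t)) - ind A w*LL a b G H (Yp w t))); last by move=> w; rewrite /gen; ring.
 have b1: bm (fun w=> ind A w * phi (Yp w t)) by apply: bm_mul=> //; exact: bm_Yp.
 rewrite EE_sub; [|exact: bm_scale|apply: bm_mul=> //; exact: (bm_Yp t cL sL)].
 by rewrite EE_scale // hPsi //; lra.
rewrite /z; lra.
Qed.
Lemma E_start (f : V -> R) : cont f -> bsupp f -> E (fun w=> f (Yp w 0)) = f 0.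
Proof.
move=> cf sf; have [h0 _] := hQ; have [B B0 hB] := cont_bsupp_bdd cf sf.
have mS: measurable [set w | X w 0 = 0].
 have -> : [set w | X w 0 = 0] = ~` \bigcup_i [set w | X w 0 0 i != 0].
  apply/seteqP; split=> w /=; first by move=> e [i _ /=]; rewrite e mxE eqxx.
  move=> h; apply/rowP=> i; rewrite mxE; apply/eqP; apply: contrapT=> /negP hi; apply: h; exists i=> //.
 apply: measurableC; apply: countable_bigcupT_measurable; first exact: countableP.
 move=> i; have := measurable_fun_eqr (mX 0 i) (@measurable_cst _ _ _ _ setT (0 : R)).
 by move=> /(_ measurableT [set false] I); rewrite setTI; congr measurable; apply/seteqP; split=> w /=; case: eqP.
have bf := bm_Yp 0 cf sf.
have bC: bm (ind (~` [set w | X w 0 = 0])) by apply: bm_indA; exact: measurableC.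
have z: E (ind (~` [set w | X w 0 = 0])) = 0.
 rewrite /ind EE_ind; last by rewrite (_ : [set w | _] = ~` [set w | X w 0 = 0]); [exact: measurableC|apply/seteqP; split=> w /=; rewrite inE].
 rewrite (_ : [set w | _] = ~` [set w | X w 0 = 0]); last by apply/seteqP; split=> w /=; rewrite inE.
 by rewrite probability_setC // h0 subee.
apply/eqP; rewrite -subr_eq0 -normr_le0.
have -> : E (fun w=> f (Yp w 0)) - f 0 = E (fun w=> f (Yp w 0) - f 0) by rewrite EE_sub ?EE_cst //; exact: bm_cst.
have b1: bm (fun w=> f (Yp w 0) - f 0) by apply: bm_sub=> //; exact: bm_cst.
have key w: `|f (Yp w 0) - f 0| <= (2*B)*ind (~` [set w | X w 0 = 0]) w.
 rewrite /ind /Yp max_l //; case: (boolP (_ \in _))=> [_|].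
  by rewrite mulr1; apply: normBt; have := hB (X w 0); have := hB 0; lra.
 by rewrite notin_setE /= => /contrapT ->; rewrite subrr normr0 mulr0.
have e2: E (fun w=> (2*B)*ind (~` [set w | X w 0 = 0]) w) = 0 by rewrite EE_scale // z mulr0.
rewrite ler_norml; apply/andP; split.
 have h1 := EE_le Q (bm_scale (-1) (bm_scale (2*B) bC)) b1.
 rewrite EE_scale ?e2 ?mulr0 in h1; last exact: bm_scale.
 rewrite oppr0; apply: h1=> w; have := key w; rewrite ler_norml=> /andP[+ _]; lra.
have h1 := EE_le Q b1 (bm_scale (2*B) bC); rewrite e2 in h1; apply: h1.
by move=> w; have := key w; rewrite ler_norml=> /andP[_].
Qed.
End Paths.

(** * Probabilities of reaching a level and of staying in a slab *)

Section Hitting.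
Context (R : realType) (d : nat) (dW : measure_display) (W : measurableType dW).
Local Notation V := 'rV[R]_d.
Variable X : W -> R -> V.
Hypothesis mX : forall s (i : 'I_d), mfun (fun w=> X w s 0 i).
Hypothesis cX : forall w, {within [set s | 0 <= s], continuous (X w)}.
(** A window of half-width 1 about the level [- q], truncated to a ball. The width absorbs the
    motion between two observation times. *)
Definition Db (l : V) (q M : R) (x : V) : bool := (`|dotv x l + q| <= 1) && (dotv x x <= M).
Variables (l : V) (q M : R).

(** The window is met at one of the times [0, tau, ..., i tau]. Discrete observation replaces
    stopping times, so the martingale property is used between fixed times only. *)
Fixpoint Hb (tau : R) (i : nat) (w : W) : bool :=
 (if i is j.+1 then Hb tau j w else false) || Db l q M (X w (i%:R*tau)).
Lemma Hb_ex tau n i w : (i <= n)%N -> Db l q M (X w (i%:R*tau)) -> Hb tau n w.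
Proof.
elim: n=> [|n IH]; first by rewrite leqn0=> /eqP -> /= ->.
rewrite leq_eqVlt=> /orP[/eqP -> /= -> |hi hD /=]; first by rewrite orbT.
by rewrite IH.
Qed.
Lemma le_measurable (d' : measure_display) (T : measurableType d') (Z : T -> R) (s : R) : mfun Z -> measurable [set w | Z w <= s].
Proof.
move=> mZ; have := measurable_fun_ler mZ (@measurable_cst _ _ _ _ setT (s : R)).
by move=> /(_ measurableT [set true] I); rewrite setTI; congr measurable; apply/seteqP; split.
Qed.
Lemma dot_meas (d' : measure_display) (T : measurableType d') (v u : T -> V) : (forall i, mfun (fun w=> v w 0 i)) ->
 (forall i, mfun (fun w=> u w 0 i)) -> mfun (fun w=> dotv (v w) (u w)).
Proof. by move=> mv mu; apply: measurable_sum=> i; exact: measurable_funM. Qed.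
Lemma Db_meas (d' : measure_display) (T : measurableType d') (v : T -> V) : (forall i, mfun (fun w=> v w 0 i)) ->
 measurable [set w | Db l q M (v w)].
Proof.
move=> mv.
have ml: mfun (fun w=> dotv (v w) l) by apply: (@dot_meas _ _ v (fun=> l))=> // i; exact: measurable_cst.
rewrite (_ : [set w | _] = [set w | `|dotv (v w) l + q| <= 1] `&` [set w | dotv (v w) (v w) <= M]); last first.
 by apply/seteqP; split=> w /= => [/andP[]|[h1 h2]]; [|apply/andP].
apply: measurableI; apply: le_measurable; last exact: dot_meas.
apply: measurableT_comp; first exact: normr_measurable.
by apply: measurable_funD=> //; exact: measurable_cst.
Qed.
Definition fgen (s : R) : set (set W) := [set C | exists u (i : 'I_d) (B : set R), 0 <= u <= s /\ measurable B /\
         C = (fun w=> X w u 0 i) @^-1` B].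
Lemma Hb_filt (s tau : R) i : 0 <= tau -> i%:R*tau <= s -> Ffilt X s [set w | Hb tau i w].
Proof.
move=> t0 hs; pose T := g_sigma_algebraType (fgen s).
have mT u j: 0 <= u <= s -> measurable_fun (setT : set T) (fun w=> X w u 0 j).
 by move=> hu _ B mB; rewrite setTI; apply: sub_gen_smallest; exists u, j, B.
suff : measurable ([set w | Hb tau i w] : set T) by [].
elim: i hs=> [|i IH] hs.
 have -> : ([set w | Hb tau 0 w] : set T) = [set w | Db l q M (X w (0%:R*tau))] by apply/seteqP; split.
 by apply: (@Db_meas _ T)=> j; apply: mT; rewrite hs mul0r lexx.
have le1: i%:R*tau <= i.+1%:R*tau by apply: ler_wpM2r=> //; rewrite ler_nat.
have -> : ([set w | Hb tau i.+1 w] : set T) = [set w | Hb tau i w] `|` [set w | Db l q M (X w (i.+1%:R*tau))].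
 by apply/seteqP; split=> w /= /orP.
apply: measurableU; first by apply: IH; exact: le_trans hs.
by apply: (@Db_meas _ T)=> j; apply: mT; rewrite hs mulr_ge0.
Qed.
Lemma Hb_measurable (tau : R) i : 0 <= tau -> measurable [set w | Hb tau i w].
Proof. by move=> t0; apply: (Ffilt_meas mX (s := i%:R*tau)); exact: Hb_filt. Qed.
Lemma nHb_filt (s tau : R) i : 0 <= tau -> i%:R*tau <= s -> Ffilt X s [set w | ~~ Hb tau i w].
Proof.
move=> t0 hs; have h := Hb_filt t0 hs.
have -> : [set w | ~~ Hb tau i w] = setT `\` [set w | Hb tau i w] by apply/seteqP; split=> w /= => [/negP h'|[_ /negP]].
by apply: sigma_algebraCD h; exact: smallest_sigma_algebra.
Qed.
Lemma indE (p : W -> bool) w : ind R [set w | p w] w = (p w)%:R.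
Proof. by rewrite /ind; congr (_%:R); rewrite (_ : (w \in _) = p w) //; apply/idP/idP; rewrite inE. Qed.

Variables (a : V -> 'M[R]_d) (b : V -> V) (nu be K : R).
Hypothesis hc : coefs nu be K a b.
Variable Q : probability W R.
Hypothesis hQ : solves_MP X a b 0 Q.
Local Notation E := (EE Q).
Local Notation Cb := (d%:R * (d%:R * (nu * 30)) + d%:R * (be * 6)).
Lemma Cb_ge0 : 0 <= Cb.
Proof. by have n1 := c_nu hc; have b0 := c_be hc; have n0: 0 <= nu := le_trans ler01 n1; pos. Qed.
(** Comparison with the bump at [x]: [(kap - L)] of it is at most [1 + Cb] inside the unit ball,
    where [f >= 1], and nonpositive outside, where the bump has its minimum. *)
Lemma u_lower kap (f u : V -> R) G H (eps : R) x : 0 < kap -> kap <= 1 -> 0 < eps -> C2 u G H -> bsupp u ->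
 (forall y, `|gen a b kap u G H y - f y| <= eps) -> (forall y, 0 <= f y) -> (forall y, enorm (y - x) <= 1 -> 1 <= f y) ->
 (1 + Cb)^-1 - eps/kap <= u x.
Proof.
move=> k0 k1 e0 hu su hg f0 f1; have Cb0 := Cb_ge0.
have C1: 0 < 1 + Cb by rewrite ltr_wpDr.
have [ch [Gc [Hc [hch ch01 chx chout chb]]]] := bump_ex x.
pose m := - (1 + Cb)^-1.
have sch: bsupp ch by exists (enorm x + 1)=> y hy; apply: chout; have := enorm_tri0 y x; lra.
have := gen_ge hc k0 (ltW e0) (C2_add hu (C2_scale m hch)) (bsupp_lin m su sch) _ x.
rewrite chx mulr1 /m=> h; suff : - (eps/kap) <= u x - (1 + Cb)^-1 by lra.
apply: h=> y; rewrite gen_lin.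
have := hg y; rewrite ler_norml=> /andP[g1 _].
have c0: 0 < (1 + Cb)^-1 by rewrite invr_gt0.
have [hy|hy] := leP 1 (enorm (y - x)).
 have z: ch y = 0 by exact: chout.
 have LLc: 0 <= LL a b Gc Hc y by apply: (LL_min_ge0 hc hch)=> z'; rewrite z; have /andP[] := ch01 z'.
 rewrite {2}/gen z mulr0 sub0r mulrNN; have := mulr_ge0 (ltW c0) LLc; have := f0 y; lra.
have [b1 b2] := chb y; have bL := LL_bound hc b1 b2; rewrite ler_norml in bL.
have /andP[c1 c2] := ch01 y.
have t1: gen a b kap ch Gc Hc y <= 1 + Cb.
 rewrite /gen; have := ler_wpM2l (ltW k0) c2; case/andP: bL=> *; lra.
have t2 := ler_wpM2l (ltW c0) t1; rewrite mulVf ?gt_eqF // in t2.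
have := f1 y (ltW hy); lra.
Qed.
(** Optional stopping by hand: mass that enters the window is removed at each observation and has
    used up at least [c'] of the supermartingale value, since [u >= c'] in the window. *)
Lemma hit_bound kap (f : V -> R) tau n N : 0 < kap -> kap <= 1 -> 0 <= tau -> n%:R*tau <= N -> lips f -> bsupp f ->
 (forall x, 0 <= f x) -> (forall x, Db l q M x -> forall y, enorm (y - x) <= 1 -> 1 <= f y) ->
 E (fun w=> (Hb tau n w)%:R) <= expR (kap*N)*(1 + Cb)*UU a b kap f.
Proof.
move=> k0 k1 t0 hn lf sf f0 f1; have Cb0 := Cb_ge0.
have C1: 0 < 1 + Cb by rewrite ltr_wpDr.
set h_ := fun i=> E (fun w=> (Hb tau i w)%:R).
have bH i: bm (fun w=> (Hb tau i w)%:R : R) by apply: bm_ind; exact: Hb_measurable.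
have bnH i: bm (fun w=> (~~ Hb tau i w)%:R : R).
 by apply: bm_ind; apply: (Ffilt_meas mX (s := i%:R*tau)); exact: nHb_filt.
have hm i: h_ i <= h_ i.+1 by apply: EE_le=> // w /=; case: (Hb tau i w)=> //=; case: Db.
have af := lips_appr hc k0 lf sf.
suff key : expR (- kap*N)*(1 + Cb)^-1*h_ n <= UU a b kap f.
 have := ler_wpM2l (ltW (mulr_gt0 (expR_gt0 (kap*N)) C1)) key.
 rewrite (_ : expR (kap*N)*(1 + Cb)*(expR (- kap*N)*(1 + Cb)^-1*h_ n) = (expR (kap*N)*expR (- kap*N))*h_ n*((1 + Cb)*(1 + Cb)^-1)); last by ring.
 by rewrite divff ?gt_eqF // mulr1 -expRD mulNr subrr expR0 mul1r.
apply/ler_addgt0Pr=> sg sg0.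
pose eps := min (kap*(1 + Cb)^-1) (kap*sg/4).
have ci0: 0 < (1 + Cb)^-1 by rewrite invr_gt0.
have e0: 0 < eps by rewrite lt_min !mulr_gt0 //= divr_gt0 // mulr_gt0.
have ek1: eps/kap <= (1 + Cb)^-1 by rewrite ler_pdivrMr // mulrC ge_min lexx.
have ek2: eps/kap <= sg/4.
 rewrite ler_pdivrMr //; have -> : sg/4*kap = kap*sg/4 by ring.
 by rewrite ge_min lexx orbT.
have ek0: 0 < eps/kap by rewrite divr_gt0.
have [u [G [H [hu su hg]]]] := af eps e0.
have Un := appr_near hc k0 af e0 hu su hg.
have gge y: - eps <= gen a b kap u G H y by have := hg y; rewrite ler_norml=> /andP[h _]; have := f0 y; lra.
have ulow := gen_ge hc k0 (ltW e0) hu su gge.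
pose c' := (1 + Cb)^-1 - eps/kap.
have c'0: 0 <= c' by rewrite subr_ge0.
have uD x: Db l q M x -> c' <= u x by move=> hD; apply: (u_lower k0 k1 e0 hu su hg f0); exact: f1.
have [hu1 _ _] := hu; have cu := D1_cont hu1.
have bu t := bm_Yp mX t cu su.
have cg := gen_cont hc kap hu.
have sg': bsupp (gen a b kap u G H) by have [M' hM'] := su; exists M'=> y; exact: gen_supp hu hM' y.
have eN i: i%:R*tau <= N -> expR (- kap*N) <= expR (- kap*(i%:R*tau)).
 by move=> hi; rewrite ler_expR !mulNr lerN2 ler_pM2l.
(* Discounted [u] on the surviving paths, plus the removed mass weighted by [c'] and the smallest
   discount [exp (- kap N)], does not exceed [u 0] beyond the accumulated defect. *)
have claim i: i%:R*tau <= N ->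
 expR (- kap*(i%:R*tau))*E (fun w=> (~~ Hb tau i w)%:R*u (Yp X w (i%:R*tau))) + expR (- kap*N)*c'*h_ i <=
 u 0 + eps/kap*(1 - expR (- kap*(i%:R*tau))).
 elim: i=> [|i IH] hi.
  rewrite mul0r mulr0 expR0 mul1r subrr mulr0 addr0 -(E_start mX hQ cu su).
  have eN1: expR (- kap*N) <= 1 by have := eN 0%N hi; rewrite mul0r mulr0 expR0.
  apply: (le_via (E (fun w=> (~~ Hb tau 0 w)%:R*u (Yp X w 0) + c'*(Hb tau 0 w)%:R))).
   rewrite EE_add; [|by apply: bm_mul|exact: bm_scale].
   rewrite lerD2l EE_scale //; apply: ler_wpM2r; first by apply: EE_ge0.
   by rewrite -[X in _ <= X]mul1r; apply: ler_wpM2r.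
  apply: EE_le=> //; first by apply: bm_add; [exact: bm_mul|exact: bm_scale].
  move=> w; case hH : (Hb tau 0 w)=> /=; last by rewrite mul1r mulr0 addr0.
  rewrite mul0r add0r mulr1 /Yp max_l //; apply: uD; by move: hH; rewrite /= mul0r.
 have le1: i%:R*tau <= i.+1%:R*tau by apply: ler_wpM2r=> //; rewrite ler_nat.
 have {}IH := IH (le_trans le1 hi).
 have it0: 0 <= i%:R*tau by rewrite mulr_ge0.
 have hsup := @MP_super _ _ _ _ X mX cX _ _ _ _ _ hc Q hQ kap (i%:R*tau) (i.+1%:R*tau) (- eps) _ u G H k0 it0 le1 (nHb_filt t0 (lexx _)) hu su.
 have EiE t (v : V -> R) : E (fun w=> ind R [set w | ~~ Hb tau i w] w*v (Yp X w t)) = E (fun w=> (~~ Hb tau i w)%:R*v (Yp X w t)).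
  by apply: EE_eq=> w; rewrite indE.
 rewrite !EiE in hsup.
 have {}hsup := hsup _.
 have hs2: expR (- kap*(i.+1%:R*tau))*E (fun w=> (~~ Hb tau i w)%:R*u (Yp X w (i.+1%:R*tau))) +
   - eps/kap*(expR (- kap*(i%:R*tau)) - expR (- kap*(i.+1%:R*tau))) <=
   expR (- kap*(i%:R*tau))*E (fun w=> (~~ Hb tau i w)%:R*u (Yp X w (i%:R*tau))).
  apply: hsup=> t _; rewrite EiE -[X in X <= _](EE_cst Q); apply: EE_le=> [||w]; first exact: bm_cst.
   by apply: bm_mul=> //; exact: (bm_Yp mX t cg sg').
  case: (~~ Hb tau i w); rewrite ?mul1r ?mul0r; last by rewrite oppr_le0 ltW.
  exact: gge.
 have hs3: E (fun w=> (~~ Hb tau i.+1 w)%:R*u (Yp X w (i.+1%:R*tau))) + c'*(h_ i.+1 - h_ i) <=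
   E (fun w=> (~~ Hb tau i w)%:R*u (Yp X w (i.+1%:R*tau))).
  rewrite /h_ -EE_sub // -EE_scale; last exact: bm_sub.
  rewrite -EE_add; [|exact: bm_mul|by apply: bm_scale; exact: bm_sub].
  apply: EE_le; [by apply: bm_add; [exact: bm_mul|apply: bm_scale; exact: bm_sub]|exact: bm_mul|].
  move=> w /=; case: (Hb tau i w)=> /=; first by rewrite !mul0r subrr mulr0 addr0.
  rewrite subr0; case hD : (Db _ _ _ _)=> /=; rewrite ?mul0r ?mul1r ?add0r ?mulr1 ?mulr0 ?addr0 //.
  by rewrite /Yp max_l ?mulr_ge0 //; exact: uD.
 have hs4 := ler_wpM2l (expR_ge0 (- kap*(i.+1%:R*tau))) hs3.
 have hs5: expR (- kap*N)*(c'*(h_ i.+1 - h_ i)) <= expR (- kap*(i.+1%:R*tau))*(c'*(h_ i.+1 - h_ i)).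
  by apply: ler_wpM2r; [rewrite mulr_ge0 // subr_ge0|exact: eN].
 move: IH hs2 hs4 hs5; clear.
 set e1 := expR (- kap*(i%:R*tau)); set e2 := expR (- kap*(i.+1%:R*tau)); set eN := expR _.
 set A1 := E _; set A2 := E _; set A3 := E _; set ek := eps/kap; rewrite mulNr -/ek; set hi := h_ i; set hi1 := h_ i.+1.
 lra.
have fin := claim n hn.
have low: - (eps/kap) <= expR (- kap*(n%:R*tau))*E (fun w=> (~~ Hb tau n w)%:R*u (Yp X w (n%:R*tau))).
 have h1: - (eps/kap) <= E (fun w=> (~~ Hb tau n w)%:R*u (Yp X w (n%:R*tau))).
  rewrite -[X in X <= _](EE_cst Q); apply: EE_le=> [||w]; [exact: bm_cst|exact: bm_mul|].
  by case: (~~ _); rewrite ?mul1r ?mul0r // oppr_le0 ltW.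
 have e1: expR (- kap*(n%:R*tau)) <= 1 by rewrite -expR0 ler_expR mulNr oppr_le0 !mulr_ge0 // ltW.
 have := ler_wpM2l (expR_ge0 (- kap*(n%:R*tau))) h1.
 have := ler_wpM2r (ltW ek0) e1; lra.
have h1: h_ n <= 1.
 by rewrite -[X in _ <= X](EE_cst Q); apply: EE_le=> //; [exact: bm_cst|move=> w; case: Hb].
have h0: 0 <= h_ n by apply: EE_ge0.
have x1: expR (- kap*N) <= 1 by have := eN 0%N; rewrite mul0r mulr0 expR0; apply; apply: le_trans hn; rewrite mulr_ge0.
have x0 := expR_ge0 (- kap*N).
have z0 := expR_ge0 (- kap*(n%:R*tau)).
have y1: expR (- kap*N)*(eps/kap)*h_ n <= eps/kap.
 have xh: expR (- kap*N)*h_ n <= 1 by rewrite -[X in _ <= X]mul1r; apply: ler_pM.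
 by have := ler_wpM2r (ltW ek0) xh; lra.
have y2: eps/kap*(1 - expR (- kap*(n%:R*tau))) <= eps/kap by rewrite ler_piMr ?(ltW ek0) // lerBlDr lerDl.
move: fin low y1 y2 ek2 Un; rewrite /c' ler_norml; clear.
set A1 := _*E _; set ek := eps/kap; set e2 := ek*_; set x := expR _; set hn := h_ n; set ci := _^-1; set U := UU _ _ _ _.
have -> : x*(ci - ek)*hn = x*ci*hn - x*ek*hn by ring.
set p1 := x*ci*hn; set p2 := x*ek*hn; lra.
Qed.
(** On [A] the function [f] is at least 1 along the path up to time [N], so the discounted
    occupation is at least [(1 - exp (- kap N))/kap]. *)
Lemma stay_bound kap (f : V -> R) N (A : set W) : 0 < kap -> 0 <= N -> measurable A -> lips f -> bsupp f -> (forall x, 0 <= f x) ->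
 (forall w t, A w -> 0 <= t <= N -> 1 <= f (X w t)) ->
 (1 - expR (- kap*N))*E (ind R A) <= kap*UU a b kap f.
Proof.
move=> k0 N0 mA lf sf f0 f1.
have af := lips_appr hc k0 lf sf.
apply/ler_addgt0Pr=> sg sg0.
have e0: 0 < sg/4 by lra.
have [u [G [H [hu su hg]]]] := af _ e0; set eps := sg/4 in e0 hg.
have Un := appr_near hc k0 af e0 hu su hg.
have gge y: - eps <= gen a b kap u G H y by have := hg y; rewrite ler_norml=> /andP[h _]; have := f0 y; lra.
have ulow := gen_ge hc k0 (ltW e0) hu su gge.
have [hu1 _ _] := hu; have cu := D1_cont hu1.
have bu t := bm_Yp mX t cu su.
have cg := gen_cont hc kap hu.
have sg': bsupp (gen a b kap u G H) by have [M' hM'] := su; exists M'=> y; exact: gen_supp hu hM' y.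
have hT: Ffilt X 0 setT by have [h1 h2 _] := smallest_sigma_algebra setT (fgen 0); rewrite -[setT]setD0; apply: h2.
have hsup := @MP_super _ _ _ _ X mX cX _ _ _ _ _ hc Q hQ kap 0 N (E (ind R A) - eps) _ u G H k0 (lexx _) N0 hT hu su.
have EiE t (v : V -> R) : E (fun w=> ind R setT w*v (Yp X w t)) = E (fun w=> v (Yp X w t)).
 by apply: EE_eq=> w; rewrite /ind in_setT mul1r.
rewrite !EiE mulr0 expR0 mul1r (E_start mX hQ cu su) in hsup.
have bA := bm_indA R mA.
have {}hsup : expR (- kap*N)*E (fun w=> u (Yp X w N)) + (E (ind R A) - eps)/kap*(1 - expR (- kap*N)) <= u 0.
 apply: hsup=> t /andP[t0 tN]; rewrite EiE.
 have bg := bm_Yp mX t cg sg'.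
 have -> : E (ind R A) - eps = E (fun w=> ind R A w - eps) by rewrite EE_sub ?EE_cst //; exact: bm_cst.
 apply: EE_le=> //; first by apply: bm_sub=> //; exact: bm_cst.
 move=> w; rewrite {1}/ind; case: (boolP (w \in A))=> hw; last by rewrite sub0r.
 have := f1 w t (set_mem hw) ltac:(by apply/andP); have := hg (Yp X w t); rewrite ler_norml=> /andP[h1 _].
 have e: Yp X w t = X w t by rewrite /Yp max_l.
 by rewrite e in h1 *; rewrite -[true%:R]/(1 : R)=> h3; lra.
have h1: - (eps/kap) <= E (fun w=> u (Yp X w N)).
 by rewrite -[X in X <= _](EE_cst Q); apply: EE_le=> [|//|w]; [exact: bm_cst|exact: ulow].
have e1: expR (- kap*N) <= 1 by rewrite -expR0 ler_expR mulNr oppr_le0 mulr_ge0 // ltW.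
have x0 := expR_ge0 (- kap*N).
have h2 := ler_wpM2l x0 h1.
have h3 := ler_wpM2l (ltW k0) hsup.
have h4 := ler_wpM2l (ltW k0) h2.
have kU: kap*u 0 <= kap*UU a b kap f + eps.
 have : u 0 <= UU a b kap f + eps/kap by move: Un; rewrite ler_norml; lra.
 by move=> /(ler_wpM2l (ltW k0)); rewrite mulrDr mulrCA divff ?gt_eqF // mulr1.
set EA := E (ind R A) in h3 *; set x := expR _ in e1 x0 h2 h3 h4 *; set Eu := E (fun w=> u (Yp X w N)) in h1 h2 h3 h4.
have z1: kap*(x*Eu + (EA - eps)/kap*(1 - x)) = kap*(x*Eu) + (EA - eps)*(1 - x) by field; exact: lt0r_neq0.
have z2: kap*(x * - (eps/kap)) = - (x*eps) by field; exact: lt0r_neq0.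
rewrite z1 in h3; rewrite z2 in h4.
have z3: x*eps <= eps by rewrite ler_piMl // ltW.
have z4: 0 <= x*eps by rewrite mulr_ge0 // ltW.
have -> : sg = 4*eps by rewrite /eps; field.
by move: h3 h4 kU z3 z4 e0; clear; lra.
Qed.
End Hitting.

(** * The exit event: measurability and covering by discrete events *)

Section RealLine.
Variable R : realType.
Lemma cts_bound (g : R -> R) (u e : R) : continuous g -> 0 < e -> exists2 dl : R, 0 < dl & forall z, `|z - u| < dl -> `|g z - g u| < e.
Proof.
move=> cg e0; have := cg u; move/(@cvgrPdist_lt R R)=> /(_ e e0) /nbhs_ballP[dl /= dl0 hd].
by exists dl=> // z hz; rewrite distrC; apply: hd; rewrite /ball /= distrC.
Qed.
Lemma rat_near (g : R -> R) (u q c : R) : continuous g -> 0 <= u <= q -> c < g u ->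
 exists r : rat, 0 <= (ratr r : R) <= q /\ c < g (ratr r).
Proof.
move=> cg /andP[u0 uq] hu.
have [q0|q0] := leP q 0.
 have -> : q = 0 by lra.
 have u00: u = 0 by lra.
 by exists 0; rewrite rmorph0 lexx; split=> //; rewrite -u00.
have e0: 0 < g u - c by lra.
have [dl dl0 hd] := cts_bound u cg e0.
have hlt: max 0 (u - dl) < min q (u + dl) by rewrite gt_max !lt_min; apply/andP; split; apply/andP; split; lra.
have [r] := rat_in_itvoo hlt; rewrite in_itv /= gt_max lt_min=> /andP[/andP[r1 r2] /andP[r3 r4]].
exists r; split; first by rewrite !ltW.
by have := hd (ratr r); rewrite ltr_norml=> /(_ ltac:(by apply/andP; split; lra)); rewrite ltr_norml; lra.
Qed.
Lemma nat_near (x : R) (n : nat) : 0 <= x <= n%:R -> exists2 i : nat, (i <= n)%N & `|x - i%:R| <= 1.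
Proof.
elim: n=> [|n IH] /andP[x0 xn].
 by exists 0%N=> //; rewrite subr0 ger0_norm //; apply: (le_trans xn).
have [h|h] := leP x n%:R; first by have [i hi h1] := IH ltac:(by apply/andP); exists i=> //; exact: leqW.
by exists n.+1=> //; rewrite -natr1 in xn *; rewrite ler_norml; lra.
Qed.
End RealLine.

Section Exit.
Context (R : realType) (d : nat) (dW : measure_display) (W : measurableType dW).
Local Notation V := 'rV[R]_d.
Variable X : W -> R -> V.
Hypothesis mX : forall s (i : 'I_d), mfun (fun w=> X w s 0 i).
Hypothesis cX : forall w, {within [set s | 0 <= s], continuous (X w)}.
Variables (l : V) (bb L : R).
Hypotheses (bL : 0 < bb*L) (L0 : 0 < L).
Definition sl (w : W) (s : R) : R := dotv (Yp X w s) l.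
Lemma cont_dot : cont (fun x : V=> dotv x l).
Proof.
apply: (@cont_lip R d _ (enorm l))=> x y; rewrite -[X in _ - X]mul1r -mulNr mulN1r -dotvNl -dotvDl.
by rewrite mulrC; exact: dotv_abs.
Qed.
Lemma cont_sq : cont (fun x : V=> dotv x x).
Proof.
apply: cont_sum=> i; have h: cont (fun x : V=> x 0 i).
 by apply: (@cont_lip R d _ 1)=> x y; rewrite mul1r; have := coord_le (x - y) i; rewrite !mxE.
exact: cont_mul.
Qed.
Lemma sl_cts w : continuous (sl w).
Proof. exact: (Yp_cont cX cont_dot). Qed.
Lemma slE w s : 0 <= s -> sl w s = dotv (X w s) l.
Proof. by move=> h; rewrite /sl /Yp max_l. Qed.
Definition S0 w : set R := [set s | 0 <= s /\ ~ slab l bb L (X w s)].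
Lemma S0_inf w : S0 w !=set0 -> S0 w (inf (S0 w)) /\ forall u, 0 <= u -> u < inf (S0 w) -> slab l bb L (X w u).
Proof.
move=> ne; have lb: has_lbound (S0 w) by exists 0=> s [].
have hi: has_inf (S0 w) by split.
have T0: 0 <= inf (S0 w) by apply: lb_le_inf=> // s [].
split; last first.
 by move=> u u0 uT; apply: contrapT=> hu; have := ge_inf lb (conj u0 hu); rewrite leNgt uT.
split=> //; rewrite /slab /= -slE // => /andP[h1 h2].
have e0: 0 < min (sl w (inf (S0 w)) + bb*L) (L - sl w (inf (S0 w))) by rewrite lt_min; apply/andP; split; lra.
have [dl dl0 hd] := cts_bound (inf (S0 w)) (@sl_cts w) e0.
have [s hS sT] := inf_adherent dl0 hi; have [s0 hs] := hS.
have Ts := ge_inf lb hS.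
apply: hs; rewrite /slab /= -slE //.
have := hd s ltac:(by rewrite ger0_norm; lra); rewrite lt_min !ltr_norml=> /andP[/andP[a1 a2] /andP[a3 a4]].
by apply/andP; split; lra.
Qed.
(** Removes the infimum: the exit occurs on the negative side exactly when [- b L] is reached at
    some time before which, and at which, the path is below [L]. *)
Lemma exit_iff w : exit_neg X l bb L w <-> exists t, 0 <= t /\ sl w t <= - (bb*L) /\ forall u, 0 <= u <= t -> sl w u < L.
Proof.
have hL0 := L0; have hbL := bL; rewrite /exit_neg /=; split.
 move=> [ne hneg]; have [[T0 hT] hlt] := S0_inf ne.
 rewrite -/(S0 w) -slE // in hneg.
 exists (inf (S0 w)); split=> //; split.
  rewrite leNgt; apply/negP=> h; apply: hT; rewrite /slab /= -slE //; apply/andP; split=> //; lra.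
 move=> u /andP[u0]; rewrite le_eqVlt=> /orP[/eqP ->|uT]; first by lra.
 by have := hlt u u0 uT; rewrite /slab /= -slE // => /andP[].
move=> [t [t0 [ht hu]]].
have hS: S0 w t by split=> //; rewrite /slab /= -slE // => /andP[h _]; lra.
have lb: has_lbound (S0 w) by exists 0=> s [].
have [[T0 hT] _] := S0_inf (ex_intro _ t hS : S0 w !=set0).
split; first by exists t.
rewrite -/(S0 w) -slE //.
have Tt := ge_inf lb hS.
have h1 := hu (inf (S0 w)) ltac:(apply/andP; split; [exact: T0|exact: Tt]).
rewrite ltNge; apply/negP=> h2; apply: hT; rewrite /slab /= -slE //; apply/andP; split=> //; lra.
Qed.
Lemma sl_meas (s : R) : mfun (fun w=> sl w s).
Proof.
by apply: (@dot_meas _ _ _ _ (fun w=> Yp X w s) (fun=> l))=> i; [exact: mX|exact: measurable_cst].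
Qed.
Lemma rat_measurable (p : rat -> bool) (F : rat -> set W) : (forall r, measurable (F r)) -> measurable [set w | forall r, p r -> F r w].
Proof.
move=> mF; rewrite (_ : [set w | _] = ~` \bigcup_r (if p r then ~` F r else set0)); last first.
 apply/seteqP; split=> w /=.
  by move=> h [r _]; case: ifP=> // pr; apply; exact: h.
 by move=> h r pr; apply: contrapT=> hF; apply: h; exists r=> //; rewrite pr.
apply: measurableC; apply: bigcupT_measurable_rat=> r; case: ifP=> _ //; exact: measurableC.
Qed.
(** Rational approximation of the exit: at time [q] the path is within [1/(j + 1)] of the level
    [- b L] or below it, and so far it has kept the margin [1/(k + 1)] from [L]. *)
Definition Gk (k T0 j : nat) (q : rat) : set W := [set w | sl w (ratr q) < - (bb*L) + j.+1%:R^-1] `&`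
 [set w | forall r : rat, (0 <= (ratr r : R) <= (ratr q : R)) -> [set w | sl w (ratr r) <= L - k.+1%:R^-1] w].
Lemma Gk_measurable k T0 j q : measurable (Gk k T0 j q).
Proof.
apply: measurableI.
 have := measurable_fun_ltr (sl_meas (ratr q)) (@measurable_cst _ _ _ _ setT (- (bb*L) + j.+1%:R^-1)).
 by move=> /(_ measurableT [set true] I); rewrite setTI; congr measurable; apply/seteqP; split.
by apply: rat_measurable=> r; apply: le_measurable; exact: sl_meas.
Qed.
(** Compactness of the time interval supplies a margin [k] and a horizon [T0] that serve all [j] at
    once, so countable operations suffice. *)
Lemma exitE : exit_neg X l bb L = \bigcup_k \bigcup_T0 \bigcap_j \bigcup_q (if 0 <= (ratr q : R) <= (T0%:R : R) then Gk k T0 j q else set0).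
Proof.
have hL0 := L0; have hbL := bL; apply/seteqP; split=> w.
 move/exit_iff=> [t [t0 [ht hu]]].
 have [c + hc] := @EVT_max R (sl w) 0 t t0 (continuous_subspaceT (@sl_cts w)).
 rewrite in_itv /= => /hu hcL.
 have [k _ hk] := nat_ge ((L - sl w c)^-1); have Lc: 0 < L - sl w c by lra.
 have hk': k.+1%:R^-1 <= L - sl w c.
  by rewrite -[L - _]invrK lef_pV2 ?posrE ?invr_gt0 ?ltr0n //; apply: (le_trans hk); rewrite ler_nat.
 have [T0 _ hT0] := nat_ge t.
 exists k=> //; exists T0=> // j _.
 have j0: 0 < j.+1%:R^-1 :> R by rewrite invr_gt0 ltr0n.
 have hneg: continuous (fun s=> - sl w s) by apply: cts_opp; exact: sl_cts.
 have ht': bb*L - j.+1%:R^-1 < - sl w t by move: ht j0; set y := _^-1; lra.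
 have tt: 0 <= t <= t by rewrite t0 lexx.
 have [q [/andP[q0 qt] hq]] := @rat_near R (fun s=> - sl w s) t t (bb*L - j.+1%:R^-1) hneg tt ht'.
 exists q=> //; rewrite q0 (le_trans qt hT0) /=; split=> /=; first by move: hq; set y := _^-1; lra.
 move=> r /andP[r0 rq]; have := hc (ratr r); rewrite in_itv /= r0 (le_trans rq qt)=> /(_ isT); move: hk'; set y := _^-1; lra.
move=> [k _ [T0 _ hj]]; apply/exit_iff.
set c := L - k.+1%:R^-1.
have cL: c < L by rewrite /c ltrBlDr ltrDl invr_gt0 ltr0n.
have hq j: exists q : R, [/\ 0 <= q, q <= T0%:R, sl w q < - (bb*L) + j.+1%:R^-1 & forall u, 0 <= u <= q -> sl w u <= c].
 have [q _] := hj j I; case: ifP=> // /andP[q0 qT] [h1 h2]; exists (ratr q); split=> // u hu.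
 rewrite leNgt; apply/negP=> hlt.
 have [r [r1 r2]] := rat_near (@sl_cts w) hu hlt.
 by have := h2 r r1; rewrite /= leNgt r2.
(* Times in the horizon up to which the path stays below [c]. The supremum [t1] inherits the
   property by continuity, and the minimum over [[0, t1]] lies below every [- b L + 1/(j + 1)]. *)
pose G : set R := [set t | 0 <= t <= T0%:R /\ forall u, 0 <= u <= t -> sl w u <= c].
have [q0 [q00 q0T _ q0u]] := hq 0%N.
have neG: G !=set0 by exists q0; split=> //; apply/andP.
have ubG: has_ubound G by exists T0%:R=> t [/andP[]].
have hs: has_sup G by split.
set t1 := sup G.
have t10: 0 <= t1 by apply: (le_trans q00); apply: ub_le_sup=> //; split=> //; apply/andP.
have below u: 0 <= u -> u < t1 -> sl w u <= c.
 move=> u0 ut; have [g [_ hg] gt] := sup_adherent (ltac:(lra) : 0 < t1 - u) hs.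
 by apply: hg; rewrite u0 /=; rewrite -/t1 in gt; lra.
have at1 u: 0 <= u <= t1 -> sl w u <= c.
 move=> /andP[u0]; rewrite le_eqVlt=> /orP[/eqP ->|]; last exact: below.
 have [tz|tp] := leP t1 0.
  have -> : t1 = 0 by lra.
  by apply: q0u; rewrite lexx.
 rewrite leNgt; apply/negP=> hlt; have e0: 0 < sl w t1 - c by lra.
 have [dl dl0 hd] := cts_bound t1 (@sl_cts w) e0.
 pose z := max 0 (t1 - dl/2).
 have z0: 0 <= z by rewrite le_max lexx.
 have zt: z < t1 by rewrite gt_max; apply/andP; split; lra.
 have zd: t1 - dl/2 <= z by rewrite le_max lexx orbT.
 have := hd z ltac:(by rewrite ltr_norml; apply/andP; split; lra).
 by have := below z z0 zt; rewrite ltr_norml; lra.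
have [m + hm] := @EVT_min R (sl w) 0 t1 t10 (continuous_subspaceT (@sl_cts w)).
rewrite in_itv /= => /andP[m0 mt].
exists m; split=> //; split; last first.
 by move=> u /andP[u0 um]; apply: (le_lt_trans _ cL); apply: at1; rewrite u0 (le_trans um mt).
apply/ler_addgt0Pr=> e e0; have [j _ hje] := nat_ge e^-1.
have [q [qq0 qT h1 h2]] := hq j.
have qt1: q <= t1 by apply: ub_le_sup=> //; split=> //; apply/andP.
have := hm q; rewrite in_itv /= qq0 qt1=> /(_ isT) h3.
have h4: j.+1%:R^-1 <= e.
 by rewrite -[e]invrK lef_pV2 ?posrE ?invr_gt0 ?ltr0n //; apply: (le_trans hje); rewrite ler_nat.
by apply: (le_trans h3); apply: ltW; apply: (lt_le_trans h1); rewrite lerD2l.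
Qed.
Lemma exit_measurable : measurable (exit_neg X l bb L).
Proof.
rewrite exitE; apply: bigcupT_measurable=> k; apply: bigcupT_measurable=> T0; apply: bigcapT_measurable=> j.
by apply: bigcupT_measurable_rat=> q; case: ifP=> _ //; exact: Gk_measurable.
Qed.

Variable N : R.
Hypothesis N0 : 0 < N.
Definition Stay (m : nat) : set W := [set w | forall r : rat, (0 <= (ratr r : R) <= N) ->
 [set w | (- (bb*L) <= sl w (ratr r) <= L) && (dotv (Yp X w (ratr r)) (Yp X w (ratr r)) <= m%:R)] w].
Lemma Stay_measurable m : measurable (Stay m).
Proof.
apply: rat_measurable=> r.
rewrite (_ : [set w | _] = ([set w | - (bb*L) <= sl w (ratr r)] `&` [set w | sl w (ratr r) <= L]) `&` [set w | dotv (Yp X w (ratr r)) (Yp X w (ratr r)) <= m%:R]); last first.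
 by apply/seteqP; split=> w /= => [/andP[/andP[]]|[[-> ->] ->]].
apply: measurableI; first by apply: measurableI; [apply: ge_measurable|apply: le_measurable]; exact: sl_meas.
by apply: le_measurable; apply: dot_meas=> i; exact: mX.
Qed.
Lemma Stay_in m w t : Stay m w -> 0 <= t <= N -> - (bb*L) <= dotv (X w t) l <= L /\ dotv (X w t) (X w t) <= m%:R.
Proof.
move=> hS ht; have /andP[t0 _] := ht; rewrite -slE //.
have csq: continuous (fun s=> dotv (Yp X w s) (Yp X w s)) by apply: (Yp_cont cX (f := fun x=> dotv x x)); exact: cont_sq.
have hneg: continuous (fun s=> - sl w s) by apply: cts_opp; exact: sl_cts.
split; first (apply/andP; split).
- rewrite leNgt; apply/negP=> h.
 have h': bb*L < - sl w t by lra.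
 have [r [r1 r2]] := @rat_near R (fun s=> - sl w s) t N (bb*L) hneg ht h'.
 by have := hS r r1=> /= /andP[/andP[h1 _] _]; lra.
- rewrite leNgt; apply/negP=> h.
 have [r [r1 r2]] := rat_near (@sl_cts w) ht h.
 by have := hS r r1=> /= /andP[/andP[_ h1] _]; lra.
have <- : Yp X w t = X w t by rewrite /Yp max_l.
rewrite leNgt; apply/negP=> h.
have [r [r1 r2]] := rat_near csq ht h.
by have := hS r r1=> /= /andP[_ h1]; lra.
Qed.
(** By time [N] either [- b L] has been reached, and a fine mesh sees the path in the window by
    continuity, or the path is still in the slab, in a bounded region. The index [m] refines the
    mesh and enlarges the ball simultaneously. *)
Lemma exit_cover w : X w 0 = 0 -> exit_neg X l bb L w ->
 exists m0 : nat, forall m, (m0 <= m)%N -> Stay m w \/ Hb X l (bb*L) m%:R (N/m.+1%:R) m.+1 w.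
Proof.
have hL0 := L0; have hbL := bL; have hN0 := N0.
move=> X0 /exit_iff[t [t0 [ht hu]]].
have csq: continuous (fun s=> dotv (Yp X w s) (Yp X w s)) by apply: (Yp_cont cX (f := fun x=> dotv x x)); exact: cont_sq.
have s00: sl w 0 = 0 by rewrite slE // X0 dot0v.
have [[t2 [h1 h2]]|hno] := pselect (exists t2, 0 <= t2 <= N /\ sl w t2 <= - (bb*L)).
 have /andP[t20 t2N] := h1.
 have [t3 + ht3] : exists2 c, c \in `[0, t2] & sl w c = - (bb*L).
  apply: IVT=> //; first exact: continuous_subspaceT (@sl_cts w).
  by rewrite s00 ge_min le_max; apply/andP; split; apply/orP; [right|left]; lra.
 rewrite in_itv /= => /andP[t30 t32].
 have [d1 d10 hd1] := cts_bound t3 (@sl_cts w) ltr01.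
 have [d2 d20 hd2] := cts_bound t3 csq ltr01.
 pose dl := min d1 d2.
 have dl0: 0 < dl by rewrite lt_min d10.
 have [m1 _ hm1] := nat_ge (N/dl); rewrite ler_pdivrMr // in hm1.
 have [m2 _ hm2] := nat_ge (dotv (Yp X w t3) (Yp X w t3) + 1).
 exists (m1 + m2)%N=> m hm; right.
 have mR: 0 < m.+1%:R :> R by rewrite ltr0n.
 pose tau := N/m.+1%:R.
 have tau0: 0 < tau by rewrite divr_gt0.
 have taud: tau < dl.
  rewrite /tau ltr_pdivrMr //; apply: (le_lt_trans hm1); rewrite mulrC ltr_pM2l // ltr_nat ltnS.
  by apply: leq_trans hm; exact: leq_addr.
 have [i hi hx] : exists2 i : nat, (i <= m.+1)%N & `|t3/tau - i%:R| <= 1.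
  apply: nat_near; rewrite divr_ge0 ?(ltW tau0) //= ler_pdivrMr // /tau mulrC divfK ?gt_eqF //.
  exact: le_trans t32 t2N.
 have hnear: `|i%:R*tau - t3| < dl.
  apply: le_lt_trans taud; rewrite distrC.
  have -> : t3 - i%:R*tau = (t3/tau - i%:R)*tau by rewrite mulrBl divfK ?gt_eqF.
  by rewrite normrM [`|tau|]gtr0_norm // -[X in _ <= X]mul1r; apply: ler_wpM2r; first exact: ltW.
 have it0: 0 <= i%:R*tau by rewrite mulr_ge0 // ltW.
 suff hDb : Db l (bb*L) m%:R (X w (i%:R*tau)) by exact: (Hb_ex hi hDb).
 rewrite /Db -slE //.
 have n1: `|i%:R*tau - t3| < d1 by apply: (lt_le_trans hnear); rewrite ge_min lexx.
 have n2: `|i%:R*tau - t3| < d2 by apply: (lt_le_trans hnear); rewrite ge_min lexx orbT.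
 apply/andP; split; first by have := hd1 _ n1; rewrite ht3 opprK=> /ltW.
 have eY: Yp X w (i%:R*tau) = X w (i%:R*tau) by rewrite /Yp max_l.
 have := hd2 _ n2; rewrite ltr_norml eY=> /andP[_ h3].
 have : m2%:R <= m%:R :> R by rewrite ler_nat; apply: leq_trans hm; exact: leq_addl.
 lra.
have hno' u: 0 <= u <= N -> - (bb*L) < sl w u.
 by move=> hu'; rewrite ltNge; apply/negP=> h; apply: hno; exists u.
have tN: N < t by rewrite ltNge; apply/negP=> h; have := hno' t ltac:(by rewrite t0 h); lra.
have [c + hc] := @EVT_max R _ 0 N (ltW N0) (continuous_subspaceT csq).
rewrite in_itv /= => hcN.
have [m0 _ hm0] := nat_ge (dotv (Yp X w c) (Yp X w c)).
exists m0=> m hm; left=> r hr; have /andP[r0 rN] := hr.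
apply/andP; split; first (apply/andP; split).
- exact: ltW (hno' _ hr).
- by apply: ltW; apply: hu; rewrite r0 /=; lra.
apply: (le_trans (hc (ratr r) _)); first by rewrite in_itv.
by apply: (le_trans hm0); rewrite ler_nat.
Qed.
End Exit.

(** * The logistic test function *)

Section Logistic.
Variable R : realType.
Lemma lips_of_derive (f f1 : R -> R) (B : R) : (forall t : R, is_derive t 1 f (f1 t)) -> (forall t, `|f1 t| <= B) ->
 forall s t, `|f s - f t| <= B * `|s - t|.
Proof. by move=> hf hB s t; apply: (@derive_lip _ f f1 t s B)=> x _; exact: hB. Qed.

Variables (th S : R).
Hypotheses (th0 : 0 < th).
Definition lv (s : R) : R := expR (- th*s).
Definition lE0 : R := expR (- th*S).
(** Behaves like [exp (- th s)/th] to the right of [- S] and saturates at [exp (th S)/th] on the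
    left; boundedness is what permits a spatial cutoff. Its derivative is [- lg]. *)
Definition lF (s : R) : R := th^-1*(lv s*(1 + lE0 * lv s)^-1).
Definition lg (s : R) : R := lv s*((1 + lE0 * lv s)^+2)^-1.
Definition lg1 (s : R) : R := - th*(lv s*(1 - lE0 * lv s)*((1 + lE0 * lv s)^+3)^-1).
Lemma lv_gt0 s : 0 < lv s. Proof. exact: expR_gt0. Qed.
Lemma lE0_gt0 : 0 < lE0. Proof. exact: expR_gt0. Qed.
Lemma lden_gt1 s : 1 < 1 + lE0 * lv s. Proof. by rewrite ltrDl mulr_gt0 ?lE0_gt0 ?lv_gt0. Qed.
Lemma lden_gt0 s : 0 < 1 + lE0 * lv s. Proof. exact: lt_trans ltr01 (lden_gt1 s). Qed.
Lemma lv_der (s : R) : is_derive s 1 lv (- th * lv s).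
Proof. by have h := isd_exp (isd_scale (- th) (isd_id s)); apply: isd_ext h _ _=> //; rewrite /lv; ring. Qed.
Lemma lden_der (s : R) : is_derive s 1 (fun s=> 1 + lE0 * lv s) (- th*(lE0 * lv s)).
Proof. by have h := isd_add (isd_cst 1 s) (isd_scale lE0 (lv_der s)); apply: isd_ext h _ _=> //; ring. Qed.
Lemma linv_der (s : R) : is_derive s 1 (fun s=> (1 + lE0 * lv s)^-1) (- ((1 + lE0 * lv s)^+2)^-1*(- th*(lE0 * lv s))).
Proof. exact: (@isd_comp R (fun z=> z^-1) (fun s=> 1 + lE0 * lv s) s _ _ (isd_inv (lt0r_neq0 (lden_gt0 s))) (lden_der s)). Qed.
Lemma lF_der (s : R) : is_derive s 1 lF (- lg s).
Proof.
have h := isd_scale th^-1 (isd_mul (lv_der s) (linv_der s)).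
have d0 := lden_gt0 s; apply: isd_ext h _ _=> //; rewrite /lg.
by move: d0; set z := lE0 * lv s=> d0; set v := lv s; fieldp.
Qed.
Lemma lg_der (s : R) : is_derive s 1 lg (lg1 s).
Proof.
have h := isd_mul (isd_mul (lv_der s) (linv_der s)) (linv_der s).
have d0 := lden_gt0 s; apply: isd_ext h _ _=> [z|].
 by rewrite /lg -mulrA -expr2 exprVn.
by rewrite /lg1; move: d0; set z := lE0 * lv s=> d0; set v := lv s; fieldp.
Qed.
Lemma lg1_cont : continuous lg1.
Proof.
have cv: continuous lv by move=> s; exact: is_derive_cont (lv_der s).
have ci: continuous (fun s=> (1 + lE0 * lv s)^-1) by move=> s; exact: is_derive_cont (linv_der s).
rewrite (_ : lg1 = fun s=> - th*(lv s*(1 + - lE0 * lv s)*((1 + lE0 * lv s)^-1*(1 + lE0 * lv s)^-1*(1 + lE0 * lv s)^-1))); last first.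
 by apply/funext=> s; have := lden_gt0 s; rewrite /lg1; set v := lv s; set e := lE0=> d0; fieldp.
apply: cts_mul; first exact: cts_cst.
apply: cts_mul; last by do 2 apply: cts_mul=> //.
apply: cts_mul=> //; apply: cts_add; first exact: cts_cst.
by apply: cts_mul=> //; exact: cts_cst.
Qed.
Lemma lg_gt0 s : 0 < lg s.
Proof. by rewrite mulr_gt0 ?lv_gt0 // invr_gt0 exprn_gt0 ?lden_gt0. Qed.
Lemma lg1_le s : `|lg1 s| <= th * lg s.
Proof.
rewrite /lg1 normrM normrN [`|th|]gtr0_norm // ler_pM2l // !normrM [`|lv s|]gtr0_norm ?lv_gt0 //.
rewrite /lg -mulrA ler_pM2l ?lv_gt0 //.
have d0 := lden_gt0 s; have p0: 0 < lE0 * lv s by rewrite mulr_gt0 ?lE0_gt0 ?lv_gt0.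
rewrite [`|_^-1|]gtr0_norm ?invr_gt0 ?exprn_gt0 //.
have -> : ((1 + lE0 * lv s)^+2)^-1 = (1 + lE0 * lv s)*((1 + lE0 * lv s)^+3)^-1 by fieldp.
apply: ler_wpM2r; first by rewrite invr_ge0 exprn_ge0 // ltW.
by rewrite ler_norml; apply/andP; split; lra.
Qed.
Lemma lg_le_lv s : lg s <= lv s.
Proof.
rewrite /lg ler_pdivrMr ?exprn_gt0 ?lden_gt0 // ler_peMr ?(ltW (lv_gt0 s)) //.
by apply: exprn_ege1; exact: ltW (lden_gt1 s).
Qed.
Lemma lg_le s : lg s <= lE0^-1.
Proof.
rewrite /lg ler_pdivrMr ?exprn_gt0 ?lden_gt0 // mulrC ler_pdivlMr ?lE0_gt0 // mulrC.
have p0: 0 < lE0 * lv s by rewrite mulr_gt0 ?lE0_gt0 ?lv_gt0.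
rewrite expr2; nra.
Qed.
Lemma lF_ge0 s : 0 <= lF s.
Proof. by rewrite /lF !mulr_ge0 ?invr_ge0 ?(ltW th0) ?(ltW (lv_gt0 s)) ?(ltW (lden_gt0 s)). Qed.
Lemma lF_le s : lF s <= th^-1 * lE0^-1.
Proof.
rewrite /lF ler_pM2l ?invr_gt0 // ler_pdivrMr ?lden_gt0 // mulrC ler_pdivlMr ?lE0_gt0 // mulrC; lra.
Qed.
Lemma lF_le0 : lF 0 <= th^-1.
Proof.
rewrite /lF -[X in _ <= X]mulr1 ler_pM2l ?invr_gt0 // ler_pdivrMr ?lden_gt0 // mul1r.
by have := lden_gt1 0; rewrite /lv mulr0 expR0; lra.
Qed.
Lemma lg_ge s : - S <= s -> lv s/4 <= lg s.
Proof.
move=> h; rewrite /lg ler_pM2l ?lv_gt0 // lef_pV2 ?posrE ?exprn_gt0 ?lden_gt0 //.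
have p0: 0 < lE0 * lv s by rewrite mulr_gt0 ?lE0_gt0 ?lv_gt0.
have p1: lE0 * lv s <= 1.
 rewrite /lE0 /lv -expRD -expR0 ler_expR !mulNr -opprD oppr_le0 -mulrDr; apply: mulr_ge0; [exact: ltW|lra].
have -> : 4 = 2^+2 :> R by ring.
by rewrite lerXn2r ?nnegrE //; lra.
Qed.
(** Since [|lg1| <= th lg], the product [lg s exp (th s)] is nondecreasing and [lg s exp (- th s)]
    nonincreasing. *)
Lemma lg_comp s t : lg s <= expR (th * `|s - t|) * lg t.
Proof.
have key1 x y: x <= y -> lg x <= expR (th*(y - x)) * lg y.
 move=> xy.
 have := @derive_mono _ (fun s=> lg s*expR (th*s)) (fun s=> (lg1 s + th * lg s)*expR (th*s)) x y xy.
 move=> /(_ _ _) h.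
 have {}h : lg x*expR (th*x) <= lg y*expR (th*y).
  apply: h=> z _.
   have h' := isd_mul (lg_der z) (isd_exp (isd_scale th (isd_id z))); apply: isd_ext h' _ _=> //; ring.
  by apply: mulr_ge0; [have := lg1_le z; rewrite ler_norml; lra|exact: expR_ge0].
 rewrite -ler_pdivlMr ?expR_gt0 // in h; apply: (le_trans h); apply: eqle.
 by rewrite mulrBr expRD expRN; ring.
have key2 x y: x <= y -> lg y <= expR (th*(y - x)) * lg x.
 move=> xy.
 have := @derive_mono _ (fun s=> - lg s*expR (- th*s)) (fun s=> (th * lg s - lg1 s)*expR (- th*s)) x y xy.
 move=> /(_ _ _) h.
 have {}h : - lg x*expR (- th*x) <= - lg y*expR (- th*y).
  apply: h=> z _.
   have h' := isd_mul (isd_opp (lg_der z)) (isd_exp (isd_scale (- th) (isd_id z))); apply: isd_ext h' _ _=> //; ring.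
  by apply: mulr_ge0; [have := lg1_le z; rewrite ler_norml; lra|exact: expR_ge0].
 rewrite !mulNr lerN2 -ler_pdivlMr ?expR_gt0 // in h; apply: (le_trans h); apply: eqle.
 by rewrite -expRN opprK mulrBr expRD mulrAC -mulrA mulrC -mulrA; congr (_*_); rewrite mulrC.
have [h|/ltW h] := leP s t.
 by rewrite distrC ger0_norm ?subr_ge0 //; exact: key1.
by rewrite ger0_norm ?subr_ge0 //; exact: key2.
Qed.
Lemma lg_diff s t r : `|s - t| <= r -> `|lg s - lg t| <= (expR (th*r) - 1) * lg t.
Proof.
move=> hr; have t0 := lg_gt0 t.
have e1: expR (th * `|s - t|) <= expR (th*r) by rewrite ler_expR ler_pM2l.
have h1: lg s <= expR (th*r) * lg t by apply: (le_trans (lg_comp s t)); apply: ler_wpM2r=> //; exact: ltW.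
have h2: lg t <= expR (th*r) * lg s.
 by apply: (le_trans (lg_comp t s)); rewrite distrC; apply: ler_wpM2r=> //; exact: ltW (lg_gt0 s).
have e0: 1 <= expR (th*r) by rewrite -expR0 ler_expR mulr_ge0 ?(ltW th0) //; apply: le_trans hr.
have p: 0 <= (expR (th*r) - 1)*(lg t - lg s) \/ lg t <= lg s.
 by have [h|h] := leP (lg t) (lg s); [right|left; apply: mulr_ge0; lra].
rewrite ler_norml; apply/andP; split; last by lra.
by case: p=> p; [|have := mulr_ge0 (ltac:(lra) : 0 <= expR (th*r) - 1) (ltW t0)]; lra.
Qed.
End Logistic.

(** * Quenched estimate for the drift, and counting nodes near the origin *)

Section DetEst.
Context (R : realType) (d : nat).
Local Notation V := 'rV[R]_d.
Lemma U_shift (nu be K : R) (a : V -> 'M[R]_d) (b : V -> V) (hc : coefs nu be K a b) kap (f g : V -> R) w : 0 < kap -> 0 <= w -> bdd f -> bdd g ->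
 (forall x, f x <= g x + w) -> UU a b kap f <= UU a b kap g + w/kap.
Proof.
move=> k0 w0 bf bg h.
have bw: bdd (fun _ : V=> w) by exists w=> x; rewrite ger0_norm.
apply: (le_trans (U_mono hc k0 bf (bdd_add bg bw) h)); apply: (le_trans (U_sub hc k0 bg bw)); rewrite lerD2l.
by apply: normt; apply: (U_abs hc k0 w0)=> x; rewrite ger0_norm.
Qed.
Lemma dot_entry (u l : V) (B : R) : enorm l = 1 -> (forall i, `|u 0 i| <= B) -> `|dotv u l| <= d%:R*B.
Proof. by move=> l1 h; apply: (le_trans (dotv_abs _ _)); rewrite l1 mulr1; exact: enorm_le_coord. Qed.
Lemma LL_lin (a : V -> 'M[R]_d) (b : V -> V) (l x : V) : LL a b (fun=> l) (fun=> 0) x = dotv (b x) l.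
Proof. by rewrite /LL big1 ?mulr0 ?add0r // => i _; rewrite big1 // => j _; rewrite mxE mulr0. Qed.

(* With [F] the logistic function, [kap F - L F = kap F + (b.l) g + g' (l.a l) / 2] where [g = - F'] and [|g'| <= th g]. *)
Lemma drift_upper (nu be K th S C : R) : 0 < th -> 1 <= nu -> 0 <= be -> 0 < C -> exists2 CE : R, 0 < CE & forall (M : R) (ch : V -> R) Gc Hc (l : V), 1 <= M ->
 C2 ch Gc Hc -> bsupp ch -> (forall x, 0 <= ch x <= 1) -> (forall x, (forall i, `|Gc x 0 i| <= C/M) /\ (forall i j, `|Hc x i j| <= C/M)) ->
 enorm l = 1 -> forall a b, coefs nu be K a b -> forall kap, 0 < kap ->
 bdd (fun x=> ch x * lg th S (dotv x l)*dotv (b x) l + - (th*nu/2)*(ch x * lg th S (dotv x l))) ->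
 UU a b kap (fun x=> ch x * lg th S (dotv x l)*dotv (b x) l + - (th*nu/2)*(ch x * lg th S (dotv x l))) <= th^-1 + CE/M/kap.
Proof.
move=> th0 nu1 be0 C0; have nu0: 0 <= nu by lra.
pose BF := th^-1*(lE0 th S)^-1; pose BG := (lE0 th S)^-1.
have BG0: 0 < BG by rewrite invr_gt0 lE0_gt0.
have BF0: 0 < BF by rewrite mulr_gt0 ?invr_gt0 ?lE0_gt0.
pose CE := BF*(d%:R*(d%:R*(nu*C)) + d%:R*(be*C)) + d%:R*(d%:R*(nu*(C*BG))) + 1.
have CE0: 0 < CE.
 have C0' := ltW C0; have B1 := ltW BF0; have B2 := ltW BG0.
 by apply: ltr_wpDl=> //; pos.
exists CE=> // M ch Gc Hc l M1 hch sch ch01 chb l1 a b hc kap k0 hbd.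
have Mp: 0 < M by lra.
have cg1: continuous (fun s=> - lg1 th S s) by apply: cts_opp; exact: lg1_cont.
have hF := @C2_comp _ _ (lF th S) (fun s=> - lg th S s) (fun s=> - lg1 th S s) (fun y=> dotv y l + 0) _ _
  (fun y=> lF_der S th0 _) (fun y=> isd_opp (lg_der th S _)) (fun y=> cg1 (dotv y l + 0)) (C2_affine l 0).
set GF := (fun y=> _ *: _) in hF; set HF := (fun y=> \matrix_(_, _) _) in hF.
have hphi := C2_mul hch hF.
have sphi: bsupp (fun y=> ch y * lF th S (dotv y l + 0)) by have [m hm] := sch; exists m=> y hy; rewrite hm // mul0r.
have gF: forall x i, `|GF x 0 i| <= BG.
 move=> x i; have hn: `|- lg th S (dotv x l + 0)| = lg th S (dotv x l + 0) by rewrite normrN gtr0_norm // lg_gt0.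
 rewrite mxE normrM hn -[X in _ <= X]mulr1; apply: ler_pM=> //; first exact: ltW (lg_gt0 _ _ _).
  exact: lg_le.
 by rewrite -l1; exact: coord_le.
have LLF x: LL a b GF HF x = - lg th S (dotv x l)*dotv (b x) l - lg1 th S (dotv x l)/2 * \sum_i \sum_j a x i j*(l 0 j * l 0 i).
 by rewrite (@LL_comp _ _ a b (- lg th S (dotv x l + 0)) (- lg1 th S (dotv x l + 0)) (fun=> l) (fun=> 0) x GF HF) // LL_lin addr0; ring.
have qa x: 0 <= \sum_i \sum_j a x i j*(l 0 j * l 0 i) <= nu.
 have -> : \sum_i \sum_j a x i j*(l 0 j * l 0 i) = quadf l (a x) by apply: eq_bigr=> i _; apply: eq_bigr=> j _; ring.
 have := c_ell hc x l; rewrite l1 expr1n !mulr1=> /andP[h1 h2]; rewrite h2 andbT; apply: le_trans h1; by rewrite invr_ge0.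
have CM0: 0 <= CE/M by rewrite divr_ge0 // ltW.
have := U_le hc k0 hbd CM0 hphi sphi.
rewrite dot0v add0r=> h; apply: (le_trans (h _)); last first.
 rewrite lerD2r; have /andP[c0 c1] := ch01 0; apply: le_trans (lF_le0 S th0).
 by rewrite ler_piMl // lF_ge0.
move=> x; rewrite /gen LL_mul LLF addr0.
have [b1 b2] := chb x; have e1 := LL_bound hc b1 b2; have e2 := cross_bound hc b1 (gF x).
have /andP[c0 c1] := ch01 x; have /andP[q0 q1] := qa x.
set q := \sum_i \sum_j _ in q0 q1 *; set cr := 2^-1*_ in e2 *.
set g := lg th S (dotv x l); set g1 := lg1 th S (dotv x l); set F := lF th S (dotv x l).
have g0: 0 < g by exact: lg_gt0.
have F0: 0 <= F by exact: lF_ge0.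
have FB: F <= BF by exact: lF_le.
have hg1: - (th*g) <= g1 by have := lg1_le S th0 (dotv x l); rewrite ler_norml=> /andP[].
have t1: - (th*nu/2*(ch x*g)) <= ch x*(g1/2*q).
 have s1: - (th*g*nu) <= g1*q.
  have s2 := ler_wpM2r q0 hg1; apply: le_trans s2; rewrite mulNr lerN2; apply: ler_wpM2l=> //.
  by rewrite mulr_ge0 // ltW.
 by have := ler_wpM2l c0 s1; lra.
have t2: 0 <= kap*(ch x*F) by apply: mulr_ge0; [exact: ltW|exact: mulr_ge0].
have t3: `|F*LL a b Gc Hc x| + `|cr| <= CE/M.
 have -> : CE/M = BF*(d%:R*(d%:R*(nu*(C/M))) + d%:R*(be*(C/M))) + d%:R*(d%:R*(nu*(C/M*BG))) + M^-1 by rewrite /CE; ring.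
 rewrite normrM ger0_norm //; have s1: F * `|LL a b Gc Hc x| <= BF*(d%:R*(d%:R*(nu*(C/M))) + d%:R*(be*(C/M))) by exact: ler_pM.
 have s2: 0 < M^-1 by rewrite invr_gt0.
 by move: s1 s2 e2; clear; lra.
have := ler_norm (F*LL a b Gc Hc x); have := ler_norm cr.
move: t1 t2 t3; set LLc := LL a b Gc Hc x; set bl := dotv (b x) l; clear; move=> t1 t2 t3 t4 t5.
have -> : ch x*(- g*bl - g1/2*q) = - (ch x*g*bl) - ch x*(g1/2*q) by ring.
move: t1 t2 t3 t4 t5; set A := ch x*(g1/2*q); set B := _*bl; set D := F*LLc; set G := th*nu/2*_; rewrite mulNr -/G; lra.
Qed.
End DetEst.

Local Transparent KK.
(** A node within distance 1 of the origin contributes at least [4^-d] to the sum of [KK] at time 1,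
    which [grid_sum] bounds. *)
Lemma count_near (R : realType) (d p c : nat) : (0 < p)%N ->
 \sum_(k : {ffun 'I_d -> 'I_(2*c * p).+1}) (enorm (gpt p c%:R k : 'rV[R]_d) < 1)%R%:R <= (32 * p%:R)^+d :> R.
Proof.
move=> p0; have pR: 0 < p%:R :> R by rewrite ltr0n.
have pi: p%:R^-1 <= sqrt 1 :> R by rewrite sqrtr1 invf_le1 // ler1n.
have h := @grid_sum R d p (2*c * p).+1 c%:R 1 0 p0 ltr01 pi.
have -> : (32 * p%:R)^+d = (4 * p%:R)^+d*8^+d :> R by rewrite -exprMn; congr (_^+d); ring.
apply: le_trans (ler_wpM2l _ h); last by rewrite exprn_ge0 // mulr_ge0 // ltW.
rewrite mulr_sumr; apply: ler_sum=> k _; rewrite mulrA -exprMn -mulrA divff ?gt_eqF // mulr1.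
have KK0: 0 <= KK 1 (0 - gpt p c%:R k : 'rV[R]_d) by exact: KK_ge0.
case: ltP=> hk; last by rewrite mulr_ge0 // exprn_ge0.
have -> : true%:R = \prod_(i < d) 1 :> R by rewrite big1.
rewrite /KK -[d in 4^+d]card_ord -prodr_const -big_split /=.
apply: ler_prod=> i _; rewrite ler01 /= sqrtr1 !invr1 mul1r mulr1.
have -> : (0 - gpt p c%:R k : 'rV[R]_d) 0 i = - (gpt p c%:R k : 'rV[R]_d) 0 i by rewrite sub0r [LHS]mxE.
rewrite normrN.
have h1 := coord_le (gpt p c%:R k : 'rV[R]_d) i.
set z := `|_| in h1 *; have z0: 0 <= z by exact: normr_ge0.
have zp: 0 < (1 + z)^+2 by rewrite exprn_gt0 // ltr_wpDr.
by rewrite ler_pdivlMr // mul1r expr2; nra.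
Qed.
Local Opaque KK.

(** * Annealed estimate for one small tent *)

Section Cell.
Context (R : realType) (d : nat).
Local Notation V := 'rV[R]_d.
Definition pl (dO : measure_display) (Omega : measurableType dO) (P : probability Omega R) (t : V -> Omega -> Omega) (b : Omega -> V) (s : R) (l : V) : R :=
 EE P (fun w=> max (s*dotv (b (t 0 w)) l) 0).
(** Both the mean of [U] of a tent and its mean weighted by the drift are expressed through one
    quantity [Mt], the mean of the decoupled functional. The constants do not depend on [kap <= k1],
    and [hi/lo] becomes the threshold of the theorem. *)
Definition cellP (nu beta K Rr lo hi C3 k1 rho0 : R) : Prop :=
 forall (dO : measure_display) (Omega : measurableType dO) (P : probability Omega R) (t : V -> Omega -> Omega)
  (a : Omega -> 'M[R]_d) (b : Omega -> V), env_assumptions P t a b nu beta K Rr ->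
 forall (l : V) (kap rho : R) (x0 : V), enorm l = 1 -> 0 < kap -> kap <= k1 -> 0 < rho -> rho <= rho0 ->
 exists Mt : R, [/\ 0 <= Mt,
  EE P (Ue t a b kap (tent rho x0)) <= hi*rho^+d*Mt + (if 1 <= enorm x0 then 0 else C3) &
  rho^+d*(lo * pl P t b 1 l - hi * pl P t b (-1) l)*Mt - beta*(if 1 <= enorm x0 then 0 else C3) <=
   EE P (fun w=> dotv (b (t x0 w)) l*Ue t a b kap (tent rho x0) w)].

(* The value [U (tent rho x0)] is compared with the same quantity for the environment modified near [x0],
   which is independent of the drift at [x0]. *)
Lemma cell_constants (nu beta K Rr : R) : (0 < d)%N -> 1 <= nu -> 0 < beta -> 0 < K -> 0 < Rr ->
 exists lo hi C3 k1 rho0 : R, [/\ 0 < lo, 0 < hi, 0 < C3, 0 < k1 & 0 < rho0] /\ [/\ k1 <= 1, d%:R*rho0 <= 1 & cellP nu beta K Rr lo hi C3 k1 rho0].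
Proof.
move=> d0 nu1 be0 K0 Rr0.
pose K' := K + nu + beta + 1.
have K'0: 0 <= K' by rewrite /K'; lra.
have KK': K <= K' by rewrite /K'; lra.
have [r [rho0 hh]] := harn_ex d0 nu1 (ltW be0) K'0.
have [r0 rd rh0 rhd hH] := hh.
have [c [C [c0 C0 hcC]]] := hH (Rr + 9).
have [C1 [ka [C10 ka0 ka1 hcmp1]]] := compare hh (ltac:(lra) : 1 <= Rr + 3).
(* [compare] accepts only balls centred at the origin or far from it: for [|x0| <= Rr + 9] a ball of
   radius [2 Rr + 12] about 0 is erased, otherwise one of radius [Rr + 3] about [x0]. *)
have [C2 [kb [C20 kb0 kb1 hcmp2]]] := compare hh (ltac:(lra) : 1 <= 2*Rr + 12).
pose Cm := C1 + C2.
have Cm0: 0 < Cm by rewrite addr_gt0.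
exists (c/Cm), (C*Cm), C, (min ka kb), rho0; split; first by split=> //; [exact: divr_gt0|exact: mulr_gt0|rewrite lt_min ka0].
split=> //; first by rewrite ge_min ka1.
move=> dO Omega P t a b hE l kap rho x0 l1 k0 hk rho0' hrho.
have hka: kap <= ka by apply: (le_trans hk); rewrite ge_min lexx.
have hkb: kap <= kb by apply: (le_trans hk); rewrite ge_min lexx orbT.
have kap1: kap <= 1 by exact: le_trans ka1.
have hcl w := coefs_weak KK' (cls hE nu1 (ltW be0) (ltW K0) w).
have hcl' cc rb w: coefs nu beta K' _ _ := cls' hE nu1 (ltW be0) (ltW K0) cc rb w.
have [cc [rb [hcc hdec hcmp]]] : exists cc rb, [/\ enorm (x0 - cc) <= Rr + 9, Rr + enorm (x0 - cc) < rb - 1 &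
 forall w, Um t a b kap cc rb (tent r cc) w <= Cm*Ue t a b kap (tent r cc) w /\ Ue t a b kap (tent r cc) w <= Cm*Um t a b kap cc rb (tent r cc) w].
 have U0 w := U_tent_ge0 (hcl w); have Um0 cc rb w := U_tent_ge0 (hcl' cc rb w).
 have [hx|hx] := leP (enorm x0) (Rr + 9).
  exists 0, (2*Rr + 12); rewrite subr0; split=> //; first by lra.
  move=> w; split.
   apply: (le_via (C2*Ue t a b kap (tent r 0) w)); last by apply: ler_wpM2r; [exact: U0|rewrite /Cm lerDr ltW].
   apply: (hcmp2 _ _ _ _ (hcl' _ _ w) (hcl w))=> //; first by left.
   by move=> x hx'; have [-> ->] := mod_out (fun y=> a (t y w)) (fun y=> b (t y w)) hx'.
  apply: (le_via (C2*Um t a b kap 0 (2*Rr + 12) (tent r 0) w)); last by apply: ler_wpM2r; [exact: Um0|rewrite /Cm lerDr ltW].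
  by apply: (hcmp2 _ _ _ _ (hcl w) (hcl' _ _ w))=> //; [left|move=> x hx'; exact: mod_out].
 exists x0, (Rr + 3); rewrite subrr enorm0; split; [lra|lra|].
 have far: Rr + 3 + 6 < enorm x0 by lra.
 move=> w; split.
  apply: (le_via (C1*Ue t a b kap (tent r x0) w)); last by apply: ler_wpM2r; [exact: U0|rewrite /Cm lerDl ltW].
  apply: (hcmp1 _ _ _ _ (hcl' _ _ w) (hcl w))=> //; first by right.
  by move=> x hx'; have [-> ->] := mod_out (fun y=> a (t y w)) (fun y=> b (t y w)) hx'.
 apply: (le_via (C1*Um t a b kap x0 (Rr + 3) (tent r x0) w)); last by apply: ler_wpM2r; [exact: Um0|rewrite /Cm lerDl ltW].
 by apply: (hcmp1 _ _ _ _ (hcl w) (hcl' _ _ w))=> //; [right|move=> x hx'; exact: mod_out].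
pose m w := Um t a b kap cc rb (tent r cc) w; pose u w := Ue t a b kap (tent rho x0) w.
set ct := (if 1 <= enorm x0 then 0 else C).
have ct0: 0 <= ct by rewrite /ct; case: ifP=> // _; exact: ltW.
pose rr := rho^+d; have rr0: 0 < rr by exact: exprn_gt0.
have m0 w: 0 <= m w := U_tent_ge0 (hcl' cc rb w) cc k0 r0.
have u0 w: 0 <= u w := U_tent_ge0 (hcl w) x0 k0 rho0'.
have tb s x: 0 < s -> forall y : V, 0 <= tent s x y <= 1 by move=> s0 y; rewrite tent_ge0 tent_le1.
have lo_u w: c/Cm*rr * m w <= u w.
 have [h1 _] := hcC _ _ (hcl w) kap k0 kap1 rho rho0' hrho x0 cc hcc.
 have [h2 _] := hcmp w.
 apply: le_trans h1; rewrite -/rr.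
 have h3 := ler_wpM2l (ltac:(rewrite !mulr_ge0 ?invr_ge0 ?(ltW c0) ?(ltW Cm0) ?(ltW rr0) //) : 0 <= c/Cm*rr) h2.
 by apply: (le_trans h3); apply: eqle; rewrite /Ue; fieldp.
have u_hi w: u w <= C*Cm*rr * m w + ct.
 have [_ h1] := hcC _ _ (hcl w) kap k0 kap1 rho rho0' hrho x0 cc hcc.
 have [_ h2] := hcmp w.
 apply: (le_trans h1); rewrite -/ct lerD2r -/rr.
 have h3 := ler_wpM2l (ltac:(rewrite mulr_ge0 ?(ltW C0) ?(ltW rr0) //) : 0 <= C*rr) h2.
 by apply: (le_trans h3); apply: eqle; rewrite /m; ring.
have bdt s x: 0 < s -> bdd (tent s x : V -> R) by move=> s0; exact: tent_bdd.
have bmu: bm u by apply: (Ue_bm hE nu1 (ltW be0) (ltW K0) k0); exact: bdt.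
have bmm: bm m.
 split; first by apply: (Um_measurable hE nu1 (ltW be0) (ltW K0) _ _ k0); exact: bdt.
 exists (1/kap)=> w; apply: (U_abs (hcl' cc rb w) k0 ler01)=> y; have /andP[h1 h2] := tb r cc r0 y; by rewrite ger0_norm.
have [_ [_ [_ [_ [_ [_ [_ [_ [hb _]]]]]]]]] := hE.
have blb w: `|dotv (b (t x0 w)) l| <= beta by apply: (le_trans (dotv_abs _ _)); rewrite l1 mulr1.
pose bp s w := max (s*dotv (b (t x0 w)) l) 0.
have bp0 s w: 0 <= bp s w by rewrite le_max lexx orbT.
have bpb s w: `|s| = 1 -> bp s w <= beta.
 move=> s1; rewrite ge_max (ltW be0) andbT; apply: normt; by rewrite normrM s1 mul1r.
have mb s: mfun (bp s) by apply: max_dot_measurable=> i; exact: (b_measurable hE).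
have bbp s: `|s| = 1 -> bm (bp s) by move=> s1; split=> //; exists beta=> w; rewrite ger0_norm // bpb.
have bE w: dotv (b (t x0 w)) l = bp 1 w - bp (-1) w.
 rewrite /bp mul1r mulN1r; have [h|h] := leP 0 (dotv (b (t x0 w)) l).
  by rewrite max_r ?subr0 // oppr_le0.
 by rewrite max_l ?sub0r ?opprK // oppr_ge0 ltW.
have dec s: `|s| = 1 -> EE P (fun w=> bp s w * m w) = pl P t b s l*EE P m.
 move=> s1; apply: (EE_decouple hE nu1 (ltW be0) (ltW K0) (B := beta + kap^-1) k0)=> //; first by rewrite s1.
 - by move=> x; apply: tb.
 - by rewrite lerDl invr_ge0 ltW.
 - by rewrite lerDr ltW.
have n1: `|1 : R| = 1 by rewrite normr1.
have nN1: `|-1 : R| = 1 by rewrite normrN normr1.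
exists (EE P m); split; first by apply: EE_ge0.
 have h := EE_le P bmu (bm_add (bm_scale (C*Cm*rr) bmm) (bm_cst Omega ct)) u_hi.
 by rewrite EE_add ?EE_scale ?EE_cst // in h; [exact: bm_scale|exact: bm_cst].
have b1 := bm_mul (bbp 1 n1) bmm; have b2 := bm_mul (bbp (-1) nN1) bmm.
have h := @EE_le _ _ _ P (fun w=> (c/Cm*rr)*(bp 1 w * m w) + (- (C*Cm*rr)*(bp (-1) w * m w) + - (beta*ct)))
 (fun w=> dotv (b (t x0 w)) l*u w) _ _ _.
have {}h : EE P (fun w=> (c/Cm*rr)*(bp 1 w * m w) + (- (C*Cm*rr)*(bp (-1) w * m w) + - (beta*ct))) <= EE P (fun w=> dotv (b (t x0 w)) l*u w).
 apply: h.
 - by apply: bm_add; [exact: bm_scale|apply: bm_add; [exact: bm_scale|exact: bm_cst]].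
 - apply: bm_mul=> //; rewrite (_ : (fun w=> _) = fun w=> bp 1 w - bp (-1) w); first by apply: bm_sub; exact: bbp.
  by apply/funext.
 move=> w; rewrite bE.
 have s1 := ler_wpM2l (bp0 1 w) (lo_u w); have s2 := ler_wpM2l (bp0 (-1) w) (u_hi w).
 have s3 := ler_wpM2r ct0 (bpb (-1) w nN1).
 move: s1 s2 s3; set x := bp 1 w; set y := bp (-1) w; set mm := m w; set uu := u w; set q1 := c/Cm*rr; set q2 := C*Cm*rr.
 have -> : x*(q1 * mm) = q1*(x * mm) by ring.
 have -> : y*(q2 * mm + ct) = q2*(y * mm) + y*ct by ring.
 rewrite mulrBl mulNr; move: (q1*(x * mm)) (q2*(y * mm)) (y*ct) (x*uu) (y*uu) (beta*ct); clear=> *; lra.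
apply: le_trans h.
rewrite EE_add; [|exact: bm_scale|by apply: bm_add; [exact: bm_scale|exact: bm_cst]].
rewrite EE_add; [|exact: bm_scale|exact: bm_cst].
rewrite EE_cst (EE_scale _ _ b1) (EE_scale _ _ b2) (dec 1 n1) (dec (-1) nN1) -/rr.
set p1 := pl _ _ _ 1 l; set p2 := pl _ _ _ (-1) l; set Em := EE P m; apply: eqle; ring.
Qed.
End Cell.

(** * Summation over the grid and the uniform bound *)

Section GridEst.
Context (R : realType) (d : nat).
Local Notation V := 'rV[R]_d.
Lemma exp_sub1_le (x r : R) : 0 <= x -> x <= r -> x <= 1 -> expR x - 1 <= r*expR 1.
Proof.
move=> x0 xr x1; have h1 := expR_ge1Dx (- x).
have h2 := ler_wpM2l (expR_ge0 x) h1; rewrite -expRD subrr expR0 in h2.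
have h3: expR x <= expR 1 by rewrite ler_expR.
have h4: x*expR x <= r*expR 1 by apply: ler_pM=> //; exact: expR_ge0.
lra.
Qed.
(** Passes from functions to sums over nodes in [drift_upper]. On the support of one tent [lg]
    varies by a factor close to 1 and the drift by [K] times the radius; both losses are linear in
    the mesh and join the second order loss of order [th]. *)
Lemma grid_est (nu be K th S C : R) (p : nat) : 0 < th -> th <= 1 -> 1 <= nu -> 0 <= be -> 0 <= K -> 0 < C -> (0 < p)%N -> d%:R * p%:R^-1 <= 1 :> R ->
 exists2 CE : R, 0 < CE & forall (M : R) (ch : V -> R) Gc Hc (l : V) (c : nat), 1 <= M ->
 C2 ch Gc Hc -> (forall x, 2*M <= enorm x -> ch x = 0) -> (forall x, 0 <= ch x <= 1) -> (forall x, (forall i, `|Gc x 0 i| <= C/M) /\ (forall i j, `|Hc x i j| <= C/M)) ->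
 enorm l = 1 -> 2*M <= c%:R -> forall a b, coefs nu be K a b -> forall kap, 0 < kap ->
 \sum_(k : {ffun 'I_d -> 'I_(2*c * p).+1}) ch (gpt p c%:R k) * lg th S (dotv (gpt p c%:R k) l) *
   (dotv (b (gpt p c%:R k)) l - ((d%:R*be*expR 1 + d%:R*K)*(d%:R * p%:R^-1) + th*nu/2*(1 + expR 1)))*UU a b kap (tent p%:R^-1 (gpt p c%:R k))
  <= th^-1 + CE/M/kap /\
 UU a b kap (fun x=> ch x * lg th S (dotv x l)) <=
  (1 + expR 1)*(\sum_(k : {ffun 'I_d -> 'I_(2*c * p).+1}) ch (gpt p c%:R k) * lg th S (dotv (gpt p c%:R k) l)*UU a b kap (tent p%:R^-1 (gpt p c%:R k))) + CE/M/kap.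
Proof.
move=> th0 th1 nu1 be0 K0 C0 p0 hr1.
have [CE1 CE10 hdr] := @drift_upper R d nu be K th S C th0 nu1 be0 C0.
pose Bg := (lE0 th S)^-1.
have Bg0: 0 < Bg by rewrite invr_gt0 lE0_gt0.
pose W1 := d%:R*C*Bg.
have W10: 0 <= W1 by rewrite !mulr_ge0 // ltW.
have q0: 0 <= th*nu/2 by rewrite divr_ge0 // mulr_ge0 ?(ltW th0) //; lra.
have db0: 0 <= d%:R*be by rewrite mulr_ge0.
pose w0 := (d%:R*be + th*nu/2)*W1.
have w00: 0 <= w0 by rewrite mulr_ge0 // addr_ge0.
exists (CE1 + w0 + W1); first by rewrite -addrA ltr_pwDl // addr_ge0.
move=> M ch Gc Hc l c M1 hch chout ch01 chb l1 hcM a b hc kap k0.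
have M0: 0 < M by lra.
have pR: 0 < p%:R :> R by rewrite ltr0n.
have pi: 0 < p%:R^-1 :> R by rewrite invr_gt0.
set r := d%:R * p%:R^-1 in hr1 *.
have r0: 0 <= r by rewrite mulr_ge0 // ltW.
have e0 := expR_gt0 (1 : R).
pose h x := ch x * lg th S (dotv x l).
pose eta := r*expR 1.
have eta0: 0 <= eta by rewrite mulr_ge0 // ltW.
have eta1: eta <= expR 1 by rewrite /eta ler_piMl // ltW.
have h0 x: 0 <= h x by rewrite mulr_ge0 ?(ltW (lg_gt0 _ _ _)) //; have /andP[] := ch01 x.
have hB x: h x <= Bg.
 have /andP[c0 c1] := ch01 x; rewrite -[Bg]mul1r; apply: ler_pM=> //; first exact: ltW (lg_gt0 _ _ _).
 exact: lg_le.
have bh: bdd h by exists Bg=> x; rewrite ger0_norm.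
have blb x: `|dotv (b x) l| <= d%:R*be by apply: dot_entry=> // i; exact: (c_b hc).
have bH: bdd (fun x=> h x*dotv (b x) l + - (th*nu/2)*h x).
 apply: bdd_add; last exact: bdd_scale.
 by exists (Bg*(d%:R*be))=> x; rewrite normrM ler_pM // ger0_norm.
have sch: bsupp ch by exists (2*M)=> x hx; apply: chout; exact: ltW.
have hd := hdr M ch Gc Hc l M1 hch sch ch01 chb l1 a b hc kap k0 bH.
have [hch1 _ _] := hch.
have chlip x y: `|ch x - ch y| <= d%:R*(C/M)*enorm (x - y) by apply: (D1_lip hch1)=> z i; have [] := chb z.
have omE: W1/M = d%:R*(C/M)*Bg by rewrite /W1; ring.
have om0: 0 <= W1/M by rewrite divr_ge0 // ltW.
have near x y: enorm (x - y) <= r -> `|h x - h y| <= eta*h y + W1/M.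
 move=> hxy.
 have hs: `|dotv x l - dotv y l| <= r.
  by rewrite -[- dotv y l]dotvNl -dotvDl; apply: (le_trans (dotv_abs _ _)); rewrite l1 mulr1.
 have -> : h x - h y = ch y*(lg th S (dotv x l) - lg th S (dotv y l)) + (ch x - ch y) * lg th S (dotv x l) by rewrite /h; ring.
 apply: normDt; apply: lerD.
  have /andP[c0 c1] := ch01 y; rewrite normrM ger0_norm //.
  rewrite /h mulrCA; apply: ler_wpM2l=> //; apply: (le_trans (lg_diff S th0 hs)).
  apply: ler_wpM2r; first exact: ltW (lg_gt0 _ _ _).
  have tr: th*r <= r by rewrite ler_piMl.
  by apply: exp_sub1_le=> //; [rewrite mulr_ge0 // ltW|lra].
 rewrite normrM omE; apply: ler_pM=> //.
  apply: (le_trans (chlip x y)); rewrite -[X in _ <= X]mulr1; apply: ler_wpM2l; last exact: le_trans hr1.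
  by rewrite mulr_ge0 // divr_ge0 // ltW.
 by rewrite gtr0_norm ?lg_gt0 //; exact: lg_le.
set dl := _ + th*nu/2*(1 + expR 1).
have key x y: enorm (x - y) <= r -> h y*(dotv (b y) l - dl) <= h x*dotv (b x) l + - (th*nu/2)*h x + w0/M.
 move=> hxy; have n1 := near x y hxy.
 have bb: `|dotv (b y) l - dotv (b x) l| <= d%:R*K*r.
  rewrite -[- dotv (b x) l]dotvNl -dotvDl -mulrA; apply: dot_entry=> // i; rewrite !mxE distrC.
  by apply: (le_trans (c_bL hc x y i)); apply: ler_wpM2l.
 have s1: (h y - h x)*dotv (b x) l <= (eta*h y + W1/M)*(d%:R*be).
  by apply: normt; rewrite normrM; apply: ler_pM=> //; rewrite distrC.
 have s2: h y*(dotv (b y) l - dotv (b x) l) <= h y*(d%:R*K*r).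
  by apply: ler_wpM2l=> //; exact: le_trans (ler_norm _) bb.
 have s3: h x <= h y + eta*h y + W1/M by move: n1; rewrite ler_norml; lra.
 have s4 := ler_wpM2l q0 s3.
 have s5: th*nu/2*(eta*h y) <= th*nu/2*(expR 1*h y) by apply: ler_wpM2l=> //; apply: ler_wpM2r.
 have -> : w0/M = d%:R*be*(W1/M) + th*nu/2*(W1/M) by rewrite /w0; ring.
 have dlE: h y*dl = (eta*h y)*(d%:R*be) + h y*(d%:R*K*r) + th*nu/2*h y + th*nu/2*(expR 1*h y).
  by rewrite /dl /eta; ring.
 rewrite mulrBr dlE; move: s1 s2 s4 s5; rewrite !mulrBl !mulrBr !mulrDl !mulrDr mulNr.
 set z1 := h y*dotv (b x) l; set z2 := h x*dotv (b x) l; set z3 := h y*dotv (b y) l; set z4 := eta*h y*_; set z5 := W1/M*_.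
 set z6 := h y*(d%:R*K*r); set z7 := th*nu/2*h x; set z8 := th*nu/2*h y; set z9 := th*nu/2*(eta*h y).
 set za := th*nu/2*(W1/M); set zb := th*nu/2*(expR 1*h y).
 have -> : d%:R*be*(W1/M) = z5 by rewrite /z5; ring.
 clear=> *; lra.
pose I := {ffun 'I_d -> 'I_(2*c * p).+1}.
pose x_ (k : I) : V := gpt p c%:R k.
have tT (k : I) x : 0 <= tent p%:R^-1 (x_ k) x by exact: tent_ge0.
have sT x: \sum_(k : I) tent p%:R^-1 (x_ k) x <= 1 by exact: pou_le1.
have sT0 x: 0 <= \sum_(k : I) tent p%:R^-1 (x_ k) x by apply: sumr_ge0=> k _.
have sT1 x: (\sum_(k : I) tent p%:R^-1 (x_ k) x)*h x = h x.
 have [hx|hx] := leP (enorm x) c%:R; first by rewrite /x_ pou_eq1 // mul1r.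
 by rewrite /h chout ?mul0r ?mulr0 //; apply: (le_trans hcM); exact: ltW.
have nearT (k : I) x : tent p%:R^-1 (x_ k) x != 0 -> enorm (x - x_ k) <= r by exact: tent_near.
have ap (k : I) := tent_appr hc (x_ k) k0 pi.
split.
 pose ck (k : I) := h (x_ k)*(dotv (b (x_ k)) l - dl).
 have [apE UE] := appr_sum hc k0 (index_enum I) ck ap.
 rewrite -[X in X <= _]/(\sum_k ck k*UU a b kap (tent p%:R^-1 (x_ k))) -UE.
 have w0M: 0 <= w0/M by rewrite divr_ge0 // ltW.
 have := U_shift hc k0 w0M (appr_bdd hc k0 apE) bH.
 move=> h1; apply: (le_trans (h1 _)); last first.
  have -> : th^-1 + (CE1 + w0 + W1)/M/kap = th^-1 + CE1/M/kap + (w0/M/kap + W1/M/kap) by ring.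
  by apply: lerD; [exact: hd|rewrite lerDl divr_ge0 ?(ltW k0) // divr_ge0 // ltW].
 move=> x; set Hx := h x*dotv (b x) l + - (th*nu/2)*h x.
 have HxE: (\sum_(k : I) tent p%:R^-1 (x_ k) x)*Hx = Hx.
  have -> : Hx = (dotv (b x) l + - (th*nu/2))*h x by rewrite /Hx; ring.
  by rewrite mulrCA sT1.
 apply: (le_via (\sum_(k : I) (Hx + w0/M)*tent p%:R^-1 (x_ k) x)).
  apply: ler_sum=> k _; have [->|hne] := eqVneq (tent p%:R^-1 (x_ k) x) 0; first by rewrite !mulr0.
  by apply: ler_wpM2r=> //; apply: key; exact: nearT.
 rewrite -mulr_sumr mulrDl mulrC HxE lerD2l; exact: ler_piMr.
have [apE UE] := appr_sum hc k0 (index_enum I) (fun k=> h (x_ k)) ap.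
have [apE2 UE2] := appr_sum hc k0 [:: tt] (fun=> 1 + expR 1) (fun=> apE).
rewrite -[X in _ <= _*X + _]/(\sum_k h (x_ k)*UU a b kap (tent p%:R^-1 (x_ k))) -UE -(U_scale hc k0 (1 + expR 1) apE).
have bS: bdd (fun x=> (1 + expR 1) * \sum_k h (x_ k)*tent p%:R^-1 (x_ k) x) by apply: bdd_scale; exact: (appr_bdd hc k0 apE).
have h1 := U_shift hc k0 om0 bh bS.
apply: (le_trans (h1 _)); last first.
 rewrite lerD2l; apply: ler_wpM2r; first by rewrite invr_ge0 ltW.
 by apply: ler_wpM2r; [rewrite invr_ge0 ltW|rewrite lerDr addr_ge0 // ltW].
move=> x; rewrite -[X in X <= _]sT1 mulr_suml mulr_sumr.
apply: (le_via (\sum_(k : I) ((1 + expR 1)*(h (x_ k)*tent p%:R^-1 (x_ k) x) + W1/M*tent p%:R^-1 (x_ k) x))).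
 apply: ler_sum=> k _; have [->|hne] := eqVneq (tent p%:R^-1 (x_ k) x) 0; first by rewrite mul0r !mulr0 addr0.
 have -> : (1 + expR 1)*(h (x_ k)*tent p%:R^-1 (x_ k) x) + W1/M*tent p%:R^-1 (x_ k) x = tent p%:R^-1 (x_ k) x*(h (x_ k) + expR 1*h (x_ k) + W1/M) by ring.
 apply: ler_wpM2l=> //; have := near x (x_ k) (nearT k x hne); rewrite ler_norml=> /andP[_ s1].
 have := ler_wpM2r (h0 (x_ k)) eta1; lra.
rewrite big_split /= lerD2l -mulr_sumr; exact: ler_piMr.
Qed.
(** The decay rate [th] and the bound [C'] are fixed by the size of the drift gap alone, before the
    saturation level [S], the parameter [kap] and the radius [M0]. *)
Lemma main_est (nu beta K Rr lo hi C3 k1 rho0 eps0 : R) : (0 < d)%N -> 1 <= nu -> 0 < beta -> 0 < K -> 0 < lo -> 0 < hi -> 0 < C3 -> 0 < rho0 -> d%:R*rho0 <= 1 ->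
 @cellP R d nu beta K Rr lo hi C3 k1 rho0 -> 0 < eps0 ->
 exists th C' : R, [/\ 0 < th, 0 < C' &
 forall (dO : measure_display) (Omega : measurableType dO) (P : probability Omega R) (t : V -> Omega -> Omega)
  (a : Omega -> 'M[R]_d) (b : Omega -> V), env_assumptions P t a b nu beta K Rr ->
 forall l : V, enorm l = 1 -> 2*eps0*hi <= lo * pl P t b 1 l - hi * pl P t b (-1) l ->
 forall S kap M0 : R, 0 < kap -> kap <= k1 -> exists h : V -> R,
 [/\ lips h, bsupp h, (forall x, 0 <= h x), (forall x, enorm x <= M0 -> - S <= dotv x l -> expR (- th*dotv x l)/4 <= h x) &
   EE P (Ue t a b kap h) <= C']].
Proof.
move=> d0 nu1 be0 K0 lo0 hi0 C30 rh0 rhd hcell e0.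
have e10 := expR_gt0 (1 : R).
have dR: 0 < d%:R :> R by rewrite ltr0n.
have [C C0 hcut] := cutoff_ex R d.
(* Makes the loss due to the second order term at most [eps0/2]. *)
pose th := min 1 (eps0/(nu*(1 + expR 1))).
have ne0: 0 < nu*(1 + expR 1) by rewrite mulr_gt0 ?addr_gt0 //; lra.
have th0: 0 < th by rewrite lt_min ltr01 divr_gt0.
have th1: th <= 1 by rewrite ge_min lexx.
have thb: th*nu/2*(1 + expR 1) <= eps0/2.
 have : th <= eps0/(nu*(1 + expR 1)) by rewrite ge_min lexx orbT.
 rewrite ler_pdivlMr // => h; have -> : th*nu/2*(1 + expR 1) = (th*(nu*(1 + expR 1)))/2 by ring.
 by move: h; set z := th*_; clear; lra.
pose A0 := d%:R*beta*expR 1 + d%:R*K.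
have A00: 0 < A0 by rewrite addr_gt0 // !mulr_gt0.
have [p1 p10 hp1] := nat_ge (rho0^-1).
have [p2 p20 hp2] := nat_ge (2*A0*d%:R/eps0).
(* [p1] brings the mesh below [rho0], and [p2] makes the oscillation loss at most [eps0/2]. *)
pose p := (p1 + p2)%N.
have pp: (0 < p)%N by rewrite addn_gt0 p10.
have pR: 0 < p%:R :> R by rewrite ltr0n.
have pi: 0 < p%:R^-1 :> R by rewrite invr_gt0.
have pr: p%:R^-1 <= rho0.
 by rewrite -[rho0]invrK lef_pV2 ?posrE ?invr_gt0 //; apply: (le_trans hp1); rewrite ler_nat leq_addr.
have hr1: d%:R * p%:R^-1 <= 1 :> R by apply: le_trans rhd; apply: ler_wpM2l.
pose dl := A0*(d%:R * p%:R^-1) + th*nu/2*(1 + expR 1).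
have dle: dl <= eps0.
 have : A0*(d%:R * p%:R^-1) <= eps0/2.
  rewrite mulrA ler_pdivrMr // -ler_pdivrMl ?divr_gt0 //.
  have : 2*A0*d%:R/eps0 <= p%:R by apply: (le_trans hp2); rewrite ler_nat leq_addl.
  by apply: le_trans; apply: eqle; fieldp.
 by rewrite /dl; move: thb; set z := th*nu/2*_; set y := A0*_; clear; lra.
pose cnt : R := (32 * p%:R)^+d.
have cnt0: 0 <= cnt by rewrite exprn_ge0 // mulr_ge0 // ltW.
(* The value of the logistic function at the origin, the truncation error, and the additive
   constants of the nodes within distance 1 of the origin, where [h] is at most [exp 1]. *)
pose Z := th^-1 + 1 + (2*eps0 + beta)*(C3*expR 1*cnt).
have eb0: 0 < 2*eps0 + beta by rewrite addr_gt0 // mulr_gt0.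
have Z0: 0 < Z.
 rewrite /Z ltr_pwDl ?addr_gt0 ?invr_gt0 //; apply: mulr_ge0; first exact: ltW.
 by rewrite mulr_ge0 // mulr_ge0 // ltW.
exists th, ((1 + expR 1)*(Z/eps0) + 1); split=> //.
 by apply: ltr_wpDl=> //; apply: mulr_ge0; [rewrite addr_ge0 // ltW|rewrite divr_ge0 // ltW].
move=> dO Omega P t a b hE l l1 hpm S kap M0 k0 hk.
have [CE CE0 hgrid] := @grid_est nu beta K th S C p th0 th1 nu1 (ltW be0) (ltW K0) C0 pp hr1.
(* The cutoff radius exceeds [CE/kap], so truncation costs at most 1 in spite of the factor
   [1/kap]. *)
pose M := max (max 1 M0) (CE/kap).
have M1: 1 <= M by rewrite !le_max lexx.
have MM0: M0 <= M by rewrite !le_max lexx orbT.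
have MC: CE/kap <= M by rewrite le_max lexx orbT.
have Mp: 0 < M by exact: lt_le_trans M1.
have err: CE/M/kap <= 1 by rewrite mulrAC ler_pdivrMr // mul1r.
have [ch [Gc [Hc [hch ch01 chin chout chb]]]] := hcut M M1.
have [c _ hcM] := nat_ge (2*M).
have hcl w := cls hE nu1 (ltW be0) (ltW K0) w.
have sch: bsupp ch by exists (2*M)=> x hx; apply: chout; exact: ltW.
pose h (x : V) := ch x * lg th S (dotv x l).
have h0 x: 0 <= h x by rewrite mulr_ge0 ?(ltW (lg_gt0 _ _ _)) //; have /andP[] := ch01 x.
have hlv x: h x <= expR (- th*dotv x l).
 have /andP[c0 c1] := ch01 x; rewrite -[X in _ <= X]mul1r; apply: ler_pM=> //; first exact: ltW (lg_gt0 _ _ _).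
 exact: lg_le_lv.
have Bg0: 0 < (lE0 th S)^-1 by rewrite invr_gt0 lE0_gt0.
have hB x: h x <= (lE0 th S)^-1.
 have /andP[c0 c1] := ch01 x; rewrite -[X in _ <= X]mul1r; apply: ler_pM=> //; first exact: ltW (lg_gt0 _ _ _).
 exact: lg_le.
have sh: bsupp h by have [m hm] := sch; exists m=> y hy; rewrite /h hm // mul0r.
have lh: lips h.
 apply: lips_mul; first exact: (C2_lips hch sch).
 - exists (th*(lE0 th S)^-1)=> x y.
  have hb z: `|lg1 th S z| <= th*(lE0 th S)^-1.
   by apply: (le_trans (lg1_le S th0 z)); apply: ler_wpM2l; [exact: ltW|exact: lg_le].
  apply: (le_trans (lips_of_derive (lg_der th S) hb _ _)); apply: ler_wpM2l; first by rewrite mulr_ge0 // ltW.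
  by rewrite -[- dotv y l]dotvNl -dotvDl; apply: (le_trans (dotv_abs _ _)); rewrite l1 mulr1.
 - by exists 1=> x; have /andP[c0 c1] := ch01 x; rewrite ger0_norm.
 - by exists (lE0 th S)^-1=> x; rewrite gtr0_norm ?lg_gt0 //; exact: lg_le.
have bh: bdd h by exists (lE0 th S)^-1=> x; rewrite ger0_norm.
exists h; split=> //.
 move=> x hx hs; rewrite /h chin ?mul1r; last exact: le_trans MM0.
 exact: lg_ge.
pose I := {ffun 'I_d -> 'I_(2*c * p).+1}.
pose x_ (k : I) : V := gpt p c%:R k.
pose u_ (k : I) (w : Omega) := Ue t a b kap (tent p%:R^-1 (x_ k)) w.
pose bl (k : I) (w : Omega) := dotv (b (t (x_ k) w)) l.
have bmU f: bdd f -> bm (Ue t a b kap f) := Ue_bm hE nu1 (ltW be0) (ltW K0) k0.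
have bu k: bm (u_ k) by apply: bmU; exact: tent_bdd.
have [_ [_ [_ [_ [_ [_ [_ [_ [hb _]]]]]]]]] := hE.
have bbl k: bm (bl k).
 split; first by apply: (@dot_meas _ _ _ _ (fun w=> b (t (x_ k) w)) (fun=> l))=> i; [exact: (b_measurable hE)|exact: measurable_cst].
 by exists beta=> w; apply: (le_trans (dotv_abs _ _)); rewrite l1 mulr1.
have G1 w: \sum_k h (x_ k)*(bl k w - dl)*u_ k w <= th^-1 + 1.
 have [h1 _] := hgrid M ch Gc Hc l c M1 hch chout ch01 chb l1 hcM _ _ (hcl w) kap k0.
 by apply: (le_trans h1); rewrite lerD2l.
have G2 w: Ue t a b kap h w <= (1 + expR 1)*(\sum_k h (x_ k)*u_ k w) + 1.
 have [_ h1] := hgrid M ch Gc Hc l c M1 hch chout ch01 chb l1 hcM _ _ (hcl w) kap k0.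
 by apply: (le_trans h1); rewrite lerD2l.
pose m_ k := EE P (u_ k).
have E2: EE P (Ue t a b kap h) <= (1 + expR 1)*(\sum_k h (x_ k) * m_ k) + 1.
 have bs: bm (fun w=> \sum_(k : I) h (x_ k)*u_ k w) by apply: bm_sum=> k; exact: bm_scale.
 have h1 := EE_le P (bmU h bh) (bm_add (bm_scale (1 + expR 1) bs) (bm_cst Omega 1)) G2.
 rewrite EE_add in h1; [|exact: bm_scale|exact: bm_cst].
 rewrite EE_cst EE_scale // EE_sum in h1; last by move=> k; exact: bm_scale.
 apply: (le_trans h1); apply: eqle; congr (_*_ + _); apply: eq_bigr=> k _; exact: EE_scale.
apply: (le_trans E2); rewrite lerD2r; apply: ler_wpM2l; first by rewrite addr_ge0 // ltW.
rewrite ler_pdivlMr //.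
have E1: \sum_k (h (x_ k)*EE P (fun w=> bl k w*u_ k w) - h (x_ k)*dl * m_ k) <= th^-1 + 1.
 have bk k: bm (fun w=> h (x_ k)*(bl k w*u_ k w) + - (h (x_ k)*dl)*u_ k w).
  by apply: bm_add; apply: bm_scale=> //; exact: bm_mul.
 have h1: EE P (fun w=> \sum_(k : I) (h (x_ k)*(bl k w*u_ k w) + - (h (x_ k)*dl)*u_ k w)) <= EE P (fun=> th^-1 + 1).
  apply: EE_le; [exact: bm_sum|exact: bm_cst|move=> w; apply: le_trans (G1 w)].
  by apply: eqle; apply: eq_bigr=> k _; ring.
 rewrite EE_cst EE_sum // in h1; apply: le_trans h1; apply: eqle; apply: eq_bigr=> k _.
 rewrite EE_add; [|by apply: bm_scale; exact: bm_mul|exact: bm_scale].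
 by rewrite !EE_scale //; [rewrite mulNr|exact: bm_mul].
pose ct k := if 1 <= enorm (x_ k) then 0 else C3.
have ct0 k: 0 <= ct k by rewrite /ct; case: ifP=> // _; exact: ltW.
(* The two estimates of [cellP] share [Mt]: the upper one for the mean is inserted into the lower
   one for the drift, which turns the gap into [2 eps0] times the mean. *)
have lowk k: 2*eps0 * m_ k - (2*eps0 + beta)*ct k <= EE P (fun w=> bl k w*u_ k w).
 have [Mt [Mt0 h1 h2]] := hcell dO Omega P t a b hE l kap p%:R^-1 (x_ k) l1 k0 hk pi pr.
 apply: le_trans h2; rewrite -/(ct k) in h1 *.
 have rd0: 0 <= p%:R^-1^+d*Mt by rewrite mulr_ge0 // exprn_ge0 // ltW.
 have s1 := ler_wpM2l rd0 hpm.
 have e20: 0 <= 2*eps0 by rewrite mulr_ge0 // ltW.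
 have s2 := ler_wpM2l e20 h1.
 rewrite -/(u_ k) -/(m_ k) in s2.
 have z1: p%:R^-1^+d*Mt*(2*eps0*hi) = 2*eps0*(hi * p%:R^-1^+d*Mt) by ring.
 rewrite z1 in s1; rewrite mulrDr in s2.
 have z3: (2*eps0 + beta)*ct k = 2*eps0*ct k + beta*ct k by ring.
 rewrite z3.
 have z2: p%:R^-1^+d*(lo * pl P t b 1 l - hi * pl P t b (-1) l)*Mt = p%:R^-1^+d*Mt*(lo * pl P t b 1 l - hi * pl P t b (-1) l) by ring.
 rewrite z2; move: s1 s2; set y1 := 2*eps0*(hi*_*_); set y2 := _*(lo*_ - _); set y3 := 2*eps0 * m_ k; set y4 := 2*eps0*ct k; set y5 := beta*_.
 by clear=> *; lra.
have m0 k: 0 <= m_ k.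
 by apply: EE_ge0=> w; exact: (U_tent_ge0 (hcl w)).
have sumk: \sum_k (eps0*(h (x_ k) * m_ k) - (2*eps0 + beta)*(h (x_ k)*ct k)) <= th^-1 + 1.
 apply: le_trans E1; apply: ler_sum=> k _.
 have s1 := ler_wpM2l (h0 (x_ k)) (lowk k).
 have hm0: 0 <= h (x_ k) * m_ k by rewrite mulr_ge0.
 have s2 := ler_wpM2r hm0 dle.
 have z1: h (x_ k)*(2*eps0 * m_ k - (2*eps0 + beta)*ct k) = 2*(eps0*(h (x_ k) * m_ k)) - (2*eps0 + beta)*(h (x_ k)*ct k) by ring.
 have z2: h (x_ k)*dl * m_ k = dl*(h (x_ k) * m_ k) by ring.
 rewrite z1 in s1; rewrite z2; move: s1 s2; set y1 := eps0*(h _ * m_ k); set y2 := _*(h _*ct k); set y3 := dl*_; set y4 := h _*EE P _.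
 by clear=> *; lra.
have cb: \sum_k h (x_ k)*ct k <= C3*expR 1*cnt.
 apply: (le_via (\sum_(k : I) (C3*expR 1)*(enorm (x_ k) < 1)%R%:R)); last first.
  by rewrite -mulr_sumr; apply: ler_wpM2l; [rewrite mulr_ge0 // ltW|exact: count_near].
 apply: ler_sum=> k _; rewrite /ct ltNge; case: (leP 1 (enorm (x_ k)))=> hk'; rewrite ?mulr0 // mulr1 mulrC.
 rewrite ler_pM2l //; apply: (le_trans (hlv _)); rewrite ler_expR mulNr -mulrN.
 have : - dotv (x_ k) l <= 1.
  by rewrite -dotvNl; apply: (le_trans (dotv_le _ _)); rewrite l1 mulr1 enormN ltW.
 move=> h1; have := ler_wpM2l (ltW th0) h1; lra.
rewrite sumrB -!mulr_sumr in sumk.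
have hcb := ler_wpM2l (ltW eb0) cb.
rewrite mulrC /Z; move: sumk hcb; set y1 := eps0*_; set y2 := (2*eps0 + beta) * \sum_k _; set y3 := _*(C3*_*_).
by clear=> *; lra.
Qed.
End GridEst.

(** * From the resolvent bound to the exit probability *)

Section Final.
Context (R : realType) (d : nat).
Local Notation V := 'rV[R]_d.
(** For each [m] the observation event has annealed probability bounded independently of [m]. The
    exit event lies, up to a null set, in the lower limit of these events, so the bound passes to
    it. *)
Lemma exit_bound (nu beta K Rr th C' : R) (dO : measure_display) (Omega : measurableType dO) (P : probability Omega R)
 (t : V -> Omega -> Omega) (a : Omega -> 'M[R]_d) (b : Omega -> V)
  (dW : measure_display) (W : measurableType dW) (X : W -> R -> V) (Q : V -> Omega -> probability W R) (l : V) (bb L kap : R) :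
 1 <= nu -> 0 < beta -> 0 < K -> 0 < th -> env_assumptions P t a b nu beta K Rr -> diffusion_assumptions X t a b Q ->
 enorm l = 1 -> 0 < bb -> 0 < L -> 0 < kap -> kap <= 1 ->
 (forall M0 : R, exists h : V -> R, [/\ lips h, bsupp h, (forall x, 0 <= h x),
   (forall x, enorm x <= M0 -> - (bb*L + 2) <= dotv x l -> expR (- th*dotv x l)/4 <= h x) & EE P (Ue t a b kap h) <= C']) ->
 (Pann P Q (exit_neg X l bb L) <= ((expR 1*(1 + (d%:R*(d%:R*(nu*30)) + d%:R*(beta*6)))*(4*expR (- th*(bb*L - 2))) +
   kap/(1 - expR (-1))*(4*expR (th*L)))*C')%:E)%E.
Proof.
move=> nu1 be0 K0 th0 hE [mX [cX [mQ hQ]]] l1 bb0 L0 k0 k1 hh.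
set Cb := d%:R*_ + _.
have nu0: 0 <= nu by lra.
have be0' := ltW be0.
have Cb0: 0 <= Cb by rewrite /Cb; pos.
have bL: 0 < bb*L by exact: mulr_gt0.
(* With this horizon [exp (kap N)] and [1 - exp (- kap N)] are absolute constants. *)
pose N := kap^-1.
have N0: 0 < N by rewrite invr_gt0.
have kN: kap*N = 1 by rewrite /N divff ?gt_eqF.
have kN': - kap*N = -1 by rewrite mulNr kN.
have x1: 0 < 1 - expR (-1) :> R by rewrite subr_gt0 -[X in _ < X]expR0 ltr_expR ltrN10.
(* Multiples that make [h] at least 1 on the unit neighbourhood of the window about [- b L],
   respectively on the slab; the 2 accounts for the window and the neighbourhood. *)
pose c1 := 4*expR (- th*(bb*L - 2)); pose c2 := 4*expR (th*L).
have c10: 0 < c1 by rewrite mulr_gt0 // expR_gt0.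
have c20: 0 < c2 by rewrite mulr_gt0 // expR_gt0.
pose A := expR 1*(1 + Cb)*c1 + kap/(1 - expR (-1))*c2.
have A0: 0 <= A.
 apply: addr_ge0; apply: mulr_ge0; rewrite ?(ltW c10) ?(ltW c20) //.
  by rewrite mulr_ge0 ?expR_ge0 // addr_ge0.
 by rewrite divr_ge0 // ltW.
rewrite -/A.
have hcl w := cls hE nu1 (ltW be0) (ltW K0) w.
pose G (m : nat) : set W := Stay X l bb L N m `|` [set w | Hb X l (bb*L) m%:R (N/m.+1%:R) m.+1 w].
have tau0 (m : nat) : 0 <= N/m.+1%:R by rewrite divr_ge0 // ltW.
have mS m: measurable (Stay X l bb L N m) by exact: Stay_measurable.
have mH m: measurable [set w | Hb X l (bb*L) m%:R (N/m.+1%:R) m.+1 w] by exact: Hb_measurable.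
have mG m: measurable (G m) by exact: measurableU.
have bound m: (\int[P]_(w in setT) Q 0%R w (G m) <= (A*C')%:E)%E.
 have [h [lh sh h0 hlow hE']] := hh (m%:R + 2).
 have hb: bdd h := lips_bdd lh sh.
 have bmU: bm (Ue t a b kap h) := Ue_bm hE nu1 (ltW be0) (ltW K0) k0 hb.
 have nm (x : V) : dotv x x <= m%:R -> enorm x <= m%:R + 1.
  move=> hx; rewrite leNgt; apply/negP=> hlt; have := enorm_sqr x; have m0: 0 <= m%:R :> R by [].
  by rewrite expr2=> e; move: hx; rewrite -e; nra.
 have pt w: (Q 0%R w (G m) <= (A*Ue t a b kap h w)%:E)%E.
  have ah := lips_appr (hcl w) k0 lh sh.
  have hit: EE (Q 0%R w) (fun y=> (Hb X l (bb*L) m%:R (N/m.+1%:R) m.+1 y)%:R) <= expR 1*(1 + Cb)*c1*Ue t a b kap h w.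
   have lf := lips_scale c1 lh; have sf: bsupp (fun x=> c1*h x) by exact: bsupp_mulr.
   have hn: m.+1%:R*(N/m.+1%:R) <= N by rewrite mulrC divfK // pnatr_eq0.
   have := @hit_bound R d dW W X mX cX l (bb*L) m%:R _ _ nu beta K (hcl w) (Q 0%R w) (hQ 0 w) kap (fun x=> c1*h x) (N/m.+1%:R) m.+1 N k0 k1 (tau0 m) hn lf sf.
   rewrite (U_scale (hcl w) k0 c1 ah) kN -/Cb=> hb1.
   rewrite -mulrA; apply: hb1.
    by move=> x; rewrite mulr_ge0 // ltW.
   move=> x /andP[x_1 x_2] y hy.
   have dy: `|dotv (y - x) l| <= 1 by apply: (le_trans (dotv_abs _ _)); rewrite l1 mulr1.
   have dE: dotv y l = dotv x l + dotv (y - x) l by rewrite dotvDl dotvNl addrC subrK.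
   have s1: dotv y l <= - (bb*L) + 2 by rewrite dE; move: x_1 dy; rewrite !ler_norml; clear; lra.
   have s2: - (bb*L + 2) <= dotv y l by rewrite dE; move: x_1 dy; rewrite !ler_norml; clear; lra.
   have ny: enorm y <= m%:R + 2.
    by have := nm x x_2; have := enorm_tri0 y x; move: hy; clear; lra.
   have := ler_wpM2l (ltW c10) (hlow y ny s2); apply: le_trans.
   have -> : c1*(expR (- th*dotv y l)/4) = expR (- th*(bb*L - 2))*expR (- th*dotv y l) by rewrite /c1; field.
   rewrite -expRD -[X in X <= _]expR0 ler_expR -mulrDr mulNr -mulrN; apply: mulr_ge0; [exact: ltW|lra].
  have stay: EE (Q 0%R w) (ind R (Stay X l bb L N m)) <= kap/(1 - expR (-1))*c2*Ue t a b kap h w.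
   have lf := lips_scale c2 lh; have sf: bsupp (fun x=> c2*h x) by exact: bsupp_mulr.
   have := @stay_bound R d dW W X mX cX _ _ nu beta K (hcl w) (Q 0%R w) (hQ 0 w) kap (fun x=> c2*h x) N _ k0 (ltW N0) (mS m) lf sf.
   rewrite (U_scale (hcl w) k0 c2 ah) kN'=> hb1.
   have -> : kap/(1 - expR (-1))*c2*Ue t a b kap h w = kap*(c2*Ue t a b kap h w)/(1 - expR (-1)) by ring.
   rewrite ler_pdivlMr // mulrC; apply: hb1.
    by move=> x; rewrite mulr_ge0 // ltW.
   move=> y s hS hs; have [/andP[s1 s2] s3] := Stay_in cX hS hs.
   have ny: enorm (X y s) <= m%:R + 2 by have := nm _ s3; lra.
   have s4: - (bb*L + 2) <= dotv (X y s) l by lra.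
   have := ler_wpM2l (ltW c20) (hlow _ ny s4); apply: le_trans.
   have -> : c2*(expR (- th*dotv (X y s) l)/4) = expR (th*L)*expR (- th*dotv (X y s) l) by rewrite /c2; field.
   rewrite -expRD -[X in X <= _]expR0 ler_expR mulNr -mulrBr; apply: mulr_ge0; [exact: ltW|lra].
  apply: (le_trans (measureU2 _ (mS m) (mH m))).
  have e1: Q 0%R w (Stay X l bb L N m) = (EE (Q 0%R w) (ind R (Stay X l bb L N m)))%:E.
   rewrite /ind EE_ind; last by rewrite (_ : [set y | _] = Stay X l bb L N m) //; apply/seteqP; split=> y /=; rewrite inE.
   rewrite fineK ?fin_num_measure //; first by congr (Q 0%R w _); apply/seteqP; split=> y /=; rewrite inE.
   by rewrite (_ : [set y | _] = Stay X l bb L N m) //; apply/seteqP; split=> y /=; rewrite inE.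
  have e2: Q 0%R w [set y | Hb X l (bb*L) m%:R (N/m.+1%:R) m.+1 y] = (EE (Q 0%R w) (fun y=> (Hb X l (bb*L) m%:R (N/m.+1%:R) m.+1 y)%:R))%:E.
   by rewrite EE_ind // fineK ?fin_num_measure.
  by rewrite [X in (X + _)%E]e1 [X in (_ + X)%E]e2 -EFinD lee_fin /A mulrDl addrC; apply: lerD.
 apply: (le_via (\int[P]_(w in setT) (A*Ue t a b kap h w)%:E)%E).
  apply: ge0_le_integral=> //; first exact: mQ.
  by apply/measurable_EFinP; have [] := bm_scale A bmU.
 rewrite EE_integral; last exact: bm_scale.
 by rewrite lee_fin EE_scale //; apply: ler_wpM2l.
(* Increasing in [k]; by [exit_cover] every path that starts at 0 and exits on the negative side
   belongs to some [G' k]. *)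
pose G' (k : nat) : set W := \bigcap_(m in [set m | (k <= m)%N]) G m.
have mG' k: measurable (G' k) by apply: bigcap_measurable=> //; exists k=> /=.
have nd: {homo G' : n m/(n <= m)%N >-> (n <= m)%O}.
 move=> n m nm; apply/subsetPset=> w hw i /= hi; apply: hw; exact: leq_trans hi.
have mU: measurable (\bigcup_k G' k) by exact: bigcupT_measurable.
have mE: measurable (exit_neg X l bb L) by exact: exit_measurable.
have cover w: (Q 0%R w (exit_neg X l bb L) <= limn (fun k=> Q 0%R w (G' k)))%E.
 have -> : limn (fun k=> Q 0%R w (G' k)) = Q 0%R w (\bigcup_k G' k).
  by apply: cvg_lim=> //; exact: (nondecreasing_cvg_mu mG' mU nd).
 have [h0 _] := hQ 0 w.
 have mZ: measurable [set y | X y 0 = 0].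
  have -> : [set y | X y 0 = 0] = ~` \bigcup_i [set y | X y 0 0 i != 0].
   apply/seteqP; split=> y /=; first by move=> e [i _ /=]; rewrite e mxE eqxx.
   move=> h; apply/rowP=> i; rewrite mxE; apply/eqP; apply: contrapT=> /negP hi; apply: h; exists i=> //.
  apply: measurableC; apply: countable_bigcupT_measurable; first exact: countableP.
  move=> i; have := measurable_fun_eqr (mX 0 i) (@measurable_cst _ _ _ _ setT (0 : R)).
  by move=> /(_ measurableT [set false] I); rewrite setTI; congr measurable; apply/seteqP; split=> y /=; case: eqP.
 have mZC := measurableC mZ.
 have sub: exit_neg X l bb L `<=` \bigcup_k G' k `|` ~` [set y | X y 0 = 0].
  move=> y hy; have [h1|h1] := pselect (X y 0 = 0); last by right.
  left; have [m0 hm0] := exit_cover cX bL L0 N0 h1 hy.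
  by exists m0=> // m /= hm; exact: hm0.
 have h1: (Q 0%R w (exit_neg X l bb L) <= Q 0%R w (\bigcup_k G' k `|` ~` [set y | X y 0%R = 0%R]))%E.
  by apply: le_measure=> //; rewrite inE //; exact: measurableU.
 apply: (le_trans h1); apply: (le_trans (measureU2 _ mU mZC)).
 have z: Q 0%R w (~` [set y | X y 0%R = 0%R]) = 0%E by rewrite probability_setC // h0 subee.
 by rewrite [X in (_ + X <= _)%E]z adde0.
rewrite /Pann.
apply: (le_via (\int[P]_(w in setT) limn (fun k=> Q 0%R w (G' k)))%E).
 apply: ge0_le_integral=> //; first exact: mQ.
 apply: (emeasurable_fun_cvg (fun k w=> Q 0%R w (G' k)))=> [k|w _]; first exact: mQ.
 have -> : limn (fun k=> Q 0%R w (G' k)) = Q 0%R w (\bigcup_k G' k).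
  by apply: cvg_lim=> //; exact: (nondecreasing_cvg_mu mG' mU nd).
 exact: (nondecreasing_cvg_mu mG' mU nd).
have mono w: [set: Omega] w -> {homo (fun k=> Q 0%R w (G' k)) : n m/(n <= m)%N >-> (n <= m)%E}.
 by move=> _ n m nm; apply: le_measure; rewrite ?inE //; apply/subsetPset; exact: nd.
have mQ' k: mfun (fun w=> Q 0%R w (G' k)) by exact: mQ.
have mc := @monotone_convergence _ _ _ P setT measurableT (fun k w=> Q 0%R w (G' k)) mQ' (fun k w _=> measure_ge0 _ _) mono.
rewrite [X in (X <= _)%E]mc.
apply: lime_le.
 apply: ereal_nondecreasing_is_cvgn=> n m nm; apply: ge0_le_integral=> // w _.
 exact: mono.
apply: nearW=> k; apply: le_trans (bound k); apply: ge0_le_integral=> //; first exact: mQ.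
by move=> w _; apply: le_measure; rewrite ?inE // => y hy; apply: hy=> /=.
Qed.
Context (nu beta K Rr : R) (dO : measure_display) (Omega : measurableType dO) (P : probability Omega R)
 (t : V -> Omega -> Omega) (a : Omega -> 'M[R]_d) (b : Omega -> V) (hE : env_assumptions P t a b nu beta K Rr).
Lemma bm_drift (s : R) (z : V) :
 `|s| = 1 -> bm (fun w=> max (s*dotv (b (t 0 w)) z) 0).
Proof.
move=> s1; have [_ [_ [_ [_ [_ [_ [_ [_ [hb _]]]]]]]]] := hE.
split; first by apply: max_dot_measurable=> i; exact: (b_measurable hE).
exists (beta*enorm z)=> w; rewrite ger0_norm ?le_max ?lexx ?orbT // ge_max; apply/andP; split.
 apply: normt; rewrite normrM s1 mul1r; apply: (le_trans (dotv_abs _ _)).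
 by apply: ler_wpM2r; first exact: enorm_ge0.
by rewrite mulr_ge0 ?enorm_ge0 //; apply: le_trans (hb 0 w); exact: enorm_ge0.
Qed.
(** Makes the drift condition open in the direction, as required by the neighbourhood of [l] in
    [condT]. *)
Lemma pl_near (s : R) (l l' : V) :
 `|s| = 1 -> `|pl P t b s l - pl P t b s l'| <= beta*enorm (l - l').
Proof.
move=> s1; have [_ [_ [_ [_ [_ [_ [_ [_ [hb _]]]]]]]]] := hE.
have bmx z := bm_drift z s1.
apply: EE_close=> // w; apply: (le_trans (maxr_lip _ _)); rewrite -mulrBr normrM s1 mul1r -dotvNr -dotvDr.
apply: (le_trans (dotv_abs _ _)); apply: ler_wpM2r; first exact: enorm_ge0.
exact: hb.
Qed.
End Final.

Theorem theorem2p1 (R : realType) (d : nat) (nu beta K Rr : R) :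
  (0 < d)%N -> 1 <= nu -> 0 < beta -> 0 < K -> 0 < Rr ->
  exists c1 : R, 1 < c1 /\
  forall (dO : measure_display) (Omega : measurableType dO)
    (P : probability Omega R) (t : 'rV[R]_d -> Omega -> Omega)
    (a : Omega -> 'M[R]_d) (b : Omega -> 'rV[R]_d)
    (dW : measure_display) (W : measurableType dW) (X : W -> R -> 'rV[R]_d)
    (Q : 'rV[R]_d -> Omega -> probability W R),
  env_assumptions P t a b nu beta K Rr ->
  diffusion_assumptions X t a b Q ->
  forall l : 'rV[R]_d, enorm l = 1 ->
  (\int[P]_(w in setT) (Num.max (dotv (b (t 0 w)) l) 0)%:E
     > c1%:E * \int[P]_(w in setT) (Num.max (- dotv (b (t 0 w)) l) 0)%:E)%E ->
  condT X P Q l.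
Proof.
move=> d0 nu1 be0 K0 Rr0.
have [lo [hi [C3 [k1 [rho0 [[lo0 hi0 C30 k10 rh0] [k11 rhd hcell]]]]]]] := @cell_constants R d nu beta K Rr d0 nu1 be0 K0 Rr0.
have hl0: 0 < hi/lo by exact: divr_gt0.
(* Any value above [max 1 (hi/lo)] would do. *)
exists (hi/lo + 1); split; first by rewrite ltrDr.
move=> dO Omega P t a b dW W X Q hE hD l l1 hint.
set p := pl P t b 1 l; set m := pl P t b (-1) l.
have [_ [_ [_ [_ [_ [_ [_ [_ [hb _]]]]]]]]] := hE.
have bmx := bm_drift hE.
have n1: `|1 : R| = 1 by rewrite normr1.
have nN1: `|-1 : R| = 1 by rewrite normrN normr1.
have ip: (\int[P]_(w in setT) (max (dotv (b (t 0%R w)) l) 0)%:E = p%:E)%E.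
 by rewrite /p /pl -EE_integral; [apply: eq_integral=> w _; rewrite mul1r|exact: bmx].
have im: (\int[P]_(w in setT) (max (- dotv (b (t 0%R w)) l) 0)%:E = m%:E)%E.
 by rewrite /m /pl -EE_integral; [apply: eq_integral=> w _; rewrite mulN1r|exact: bmx].
rewrite ip im -EFinM lte_fin in hint.
have m0: 0 <= m by apply: EE_ge0=> w; rewrite le_max lexx orbT.
have gap: 0 < lo * p - hi * m.
 have h1: hi/lo * m <= (hi/lo + 1) * m by apply: ler_wpM2r=> //; rewrite lerDl.
 have h2: hi/lo * m < p by exact: le_lt_trans hint.
 have e: lo*(hi/lo * m) = hi * m by fieldp.
 by rewrite subr_gt0 -e ltr_pM2l.
(* Uses half of the gap; the other half is left for the change of direction from [l] to [l']. *)
pose eps0 := (lo * p - hi * m)/(4*hi).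
have eps00: 0 < eps0 by rewrite divr_gt0 // mulr_gt0.
have epsE: 2*eps0*hi = (lo * p - hi * m)/2 by rewrite /eps0; fieldp.
have [th [C' [th0 C'0 hmain]]] := main_est d0 nu1 be0 K0 lo0 hi0 C30 rh0 rhd hcell eps00.
(* Within this distance both drift means change by at most [beta de], which costs at most half of
   the gap. *)
pose de := (lo * p - hi * m)/(2*((lo + hi)*beta)).
have lhb: 0 < (lo + hi)*beta by rewrite mulr_gt0 // addr_gt0.
have de0: 0 < de by rewrite divr_gt0 // mulr_gt0.
exists de; split=> // l' l'1 hl' bb bb0.
have hpm: 2*eps0*hi <= lo * pl P t b 1 l' - hi * pl P t b (-1) l'.
 have h1 := pl_near hE l l' n1; have h2 := pl_near hE l l' nN1.
 have bd: beta*enorm (l - l') <= beta*de by rewrite ler_pM2l // enormB ltW.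
 have dE: (lo + hi)*(beta*de) = (lo * p - hi * m)/2 by rewrite /de; field; rewrite !gt_eqF // addr_gt0.
 have p1: p - beta*de <= pl P t b 1 l' by move: h1; rewrite ler_norml -/p=> /andP[_ h]; lra.
 have p2: pl P t b (-1) l' <= m + beta*de by move: h2; rewrite ler_norml -/m=> /andP[h _]; lra.
 have q1 := ler_wpM2l (ltW lo0) p1; have q2 := ler_wpM2l (ltW hi0) p2.
 rewrite epsE; move: q1 q2 dE; rewrite mulrBr mulrDr mulrDl.
 set z1 := lo*(beta*de); set z2 := hi*(beta*de); set z3 := lo * p; set z4 := hi * m; set z5 := lo*_; set z6 := hi*_.
 by clear; lra.
(* The smaller of the two rates: [th b] for reaching [- b L], and [th] for staying in the slab. *)
pose c0 := th * min bb 1.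
have mb0: 0 < min bb 1 by rewrite lt_min bb0 ltr01.
have c00: 0 < c0 by exact: mulr_gt0.
exists (c0/2); split; first by rewrite divr_gt0.
pose K1 := expR 1*(1 + (d%:R*(d%:R*(nu*30)) + d%:R*(beta*6)))*(4*expR (th*2)).
pose K2 := 4/(1 - expR (-1)) : R.
have x1: 0 < 1 - expR (-1) :> R by rewrite subr_gt0 -[X in _ < X]expR0 ltr_expR ltrN10.
have nu0: 0 <= nu by lra.
have be0' := ltW be0.
have K10: 0 <= K1.
 rewrite /K1; apply: mulr_ge0; last by rewrite mulr_ge0 // expR_ge0.
 by apply: mulr_ge0; [exact: expR_ge0|apply: addr_ge0=> //; pos].
have K20: 0 <= K2 by rewrite divr_ge0 // ltW.
have K12: 0 <= (K1 + K2)*C' by rewrite mulr_ge0 ?addr_ge0 // ltW.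
(* Beyond [L1] half of the rate [c0] absorbs the prefactor; beyond [L2] the chosen [kap] is at most
   [k1]. *)
pose L1 := 2/c0*((K1 + K2)*C'); pose L2 := k1^-1/(2*th).
exists (max 0 (max L1 L2)); split; first exact: num_real.
move=> L; rewrite !gt_max=> /andP[L0 /andP[hL1 hL2]].
(* The staying term is of order [kap exp (th L)], which this choice turns into [exp (- th L)]. *)
pose kap := expR (- (2*th*L)).
have kap0: 0 < kap by exact: expR_gt0.
have hk: kap <= k1.
 rewrite /kap expRN -[k1]invrK lef_pV2 ?posrE ?invr_gt0 ?expR_gt0 //.
 have h1: k1^-1 <= 2*th*L by rewrite mulrC -ler_pdivrMr ?mulr_gt0 // ltW.
 apply: (le_trans h1); have := expR_ge1Dx (2*th*L); lra.
have kap1: kap <= 1 by exact: le_trans k11.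
have hh := fun M0=> hmain dO Omega P t a b hE l' l'1 hpm (bb*L + 2) kap M0 kap0 hk.
apply: (le_trans (exit_bound nu1 be0 K0 th0 hE hD l'1 bb0 L0 kap0 kap1 hh)).
rewrite lee_fin.
have e1: expR (- th*(bb*L - 2)) <= expR (th*2)*expR (- (c0*L)).
 rewrite -expRD ler_expR.
 have : c0*L <= th*(bb*L).
  rewrite /c0 -mulrA ler_pM2l // ler_pM2r //; by rewrite ge_min lexx.
 by rewrite mulrBr !mulNr; lra.
have e2: kap*expR (th*L) <= expR (- (c0*L)).
 rewrite /kap -expRD ler_expR.
 have : c0*L <= th*L by rewrite ler_pM2r // /c0 ler_piMr ?(ltW th0) // ge_min lexx orbT.
 lra.
have s1: (expR 1*(1 + (d%:R*(d%:R*(nu*30)) + d%:R*(beta*6)))*(4*expR (- th*(bb*L - 2))) +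
   kap/(1 - expR (-1))*(4*expR (th*L))) <= (K1 + K2)*expR (- (c0*L)).
 rewrite [X in _ <= X]mulrDl; apply: lerD.
  rewrite /K1 -[X in _ <= X]mulrA; apply: ler_wpM2l; last by rewrite -mulrA ler_pM2l.
  by apply: mulr_ge0; [exact: expR_ge0|apply: addr_ge0=> //; pos].
 have -> : kap/(1 - expR (-1))*(4*expR (th*L)) = K2*(kap*expR (th*L)) by rewrite /K2; ring.
 exact: ler_wpM2l.
apply: (le_trans (ler_wpM2r (ltW C'0) s1)).
have -> : (K1 + K2)*expR (- (c0*L))*C' = (K1 + K2)*C'*expR (- (c0*L)) by ring.
have -> : expR (- (c0/2*L)) = expR (c0/2*L)*expR (- (c0*L)).
 by rewrite -expRD; congr expR; field.
apply: ler_wpM2r; first exact: expR_ge0.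
have h1: (K1 + K2)*C' <= c0/2*L.
 have := ltW hL1; rewrite /L1=> h; have c2: 0 <= c0/2 by rewrite divr_ge0 // ltW.
 have := ler_wpM2l c2 h.
 by rewrite mulrA (_ : c0/2*(2/c0) = 1) ?mul1r //; fieldp.
apply: (le_trans h1); have := expR_ge1Dx (c0/2*L); lra.
Qed.
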